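(* Let $k\ge 1$, $l_0,l_1,\dots,l_k$ and $m_1,\dots,m_k$ be non-negative integers with $l_0>0$, $l_i\ge m_i$ for all $1\le i\le k$, and $l'>m'>0$, where $l'=\sum_{i=1}^k l_i$ and $m'=\sum_{i=1}^k m_i$. For a meromorphic function $f$ put $$P[f]=f^{l_0}(f^{l_1})^{(m_1)}(f^{l_2})^{(m_2)}\cdots (f^{l_k})^{(m_k)}.$$ Let $D\subseteq\mathbb{C}$ be a domain and let $\mathcal{F}$ be a family of non-constant meromorphic functions on $D$ such that each $f\in\mathcal{F}$ has poles, if any, only of multiplicity at least $l_0$. Let $h\not\equiv 0$ be a holomorphic function on $D$ all of whose zeros have multiplicity at most $l_0-1$. If for each pair $f,g\in\mathcal{F}$ the functions $P[f]$ and $P[g]$ share $h$ IM on $D$, then $\mathcal{F}$ is normal in $D$.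
   Context: A family of meromorphic functions on $D$ is normal if every sequence in it has a subsequence converging uniformly on compact subsets of $D$ with respect to the spherical metric. Two meromorphic functions $\phi,\psi$ on $D$ share a holomorphic function $h$ IM on $D$ if $\{z\in D:\phi(z)=h(z)\}=\{z\in D:\psi(z)=h(z)\}$ (zero sets of $\phi-h$ and $\psi-h$, ignoring multiplicities). *)

(* Defs.v *)
From Stdlib Require Import Reals List.
From Coquelicot Require Import Coquelicot.
Import ListNotations.
Open Scope R_scope.

Definition disc (z0 : C) (r : R) : C -> Prop := fun z => Cmod (z - z0)%C < r.

Definition open_set (D : C -> Prop) : Prop :=
  forall z, D z -> exists r, 0 < r /\ forall w, disc z r w -> D w.

Definition connected_set (D : C -> Prop) : Prop :=
  forall U V : C -> Prop, open_set U -> open_set V ->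
    (forall z, D z -> U z \/ V z) ->
    (exists z, D z /\ U z) -> (exists z, D z /\ V z) ->
    exists z, D z /\ U z /\ V z.

Definition is_domain (D : C -> Prop) : Prop :=
  open_set D /\ connected_set D /\ exists z, D z.

Definition Cdiff (g : C -> C) (z : C) : Prop :=
  exists l : C, @is_derive C_AbsRing C_NormedModule g z l.

Definition holomorphic_on (U : C -> Prop) (g : C -> C) : Prop :=
  forall z, U z -> Cdiff g z.

Definition deriv_tower (U : C -> Prop) (g : C -> C) (d : nat -> C -> C) : Prop :=
  (forall z, U z -> d O z = g z) /\
  (forall n z, U z -> @is_derive C_AbsRing C_NormedModule (d n) z (d (S n) z)).

(* functions into the Riemann sphere: None = infinity *)
Definition sphere_fun := C -> option C.

Definition meromorphic_on (D : C -> Prop) (f : sphere_fun) : Prop :=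
  forall z0, D z0 -> exists r, 0 < r /\
    ( (exists g : C -> C, holomorphic_on (disc z0 r) g /\
         forall z, disc z0 r z -> f z = Some (g z))
    \/ (f z0 = None /\
        exists u : C -> C, holomorphic_on (disc z0 r) u /\
          forall z, disc z0 r z ->
            match f z with
            | None => u z = 0%C
            | Some w => w <> 0%C /\ (u z * w)%C = 1%C
            end)).

Definition nonconstant_on (D : C -> Prop) (f : sphere_fun) : Prop :=
  exists z1 z2, D z1 /\ D z2 /\ f z1 <> f z2.

Definition pole_mult_ge (f : sphere_fun) (z0 : C) (n : nat) : Prop :=
  exists (p : nat) (r : R) (u : C -> C),
    (n <= p)%nat /\ 0 < r /\ holomorphic_on (disc z0 r) u /\ u z0 <> 0%C /\
    forall z, disc z0 r z -> z <> z0 -> f z = Some (u z / (z - z0) ^ p)%C.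

Definition zero_mult_le (h : C -> C) (z0 : C) (n : nat) : Prop :=
  exists (q : nat) (r : R) (v : C -> C),
    (q <= n)%nat /\ 0 < r /\ holomorphic_on (disc z0 r) v /\ v z0 <> 0%C /\
    forall z, disc z0 r z -> h z = ((z - z0) ^ q * v z)%C.

Definition sum1 (k : nat) (a : nat -> nat) : nat :=
  fold_right Nat.add O (map a (seq 1 k)).

Definition Cprod1 (k : nat) (a : nat -> C) : C :=
  fold_right Cmult 1%C (map a (seq 1 k)).

(* P[f](z) = w, at a point z where f is finite (holomorphic near z):
   P[f] = f^l0 (f^{l_1})^{(m_1)} ... (f^{l_k})^{(m_k)}.
   At poles of f, P[f] = infinity, so it equals no finite value. *)
Definition P_value (l0 k : nat) (l m : nat -> nat) (f : sphere_fun) (z w : C) : Prop :=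
  exists (r : R) (g : C -> C) (d : nat -> nat -> C -> C),
    0 < r /\ holomorphic_on (disc z r) g /\
    (forall y, disc z r y -> f y = Some (g y)) /\
    (forall i, deriv_tower (disc z r) (fun y => (g y) ^ (l i))%C (d i)) /\
    w = ((g z) ^ l0 * Cprod1 k (fun i => d i (m i) z))%C.

Definition share_IM_P (l0 k : nat) (l m : nat -> nat) (D : C -> Prop)
    (f g : sphere_fun) (h : C -> C) : Prop :=
  forall z, D z -> (P_value l0 k l m f z (h z) <-> P_value l0 k l m g z (h z)).

Definition chordal (a b : option C) : R :=
  match a, b with
  | Some x, Some y =>
      Cmod (x - y)%C / (sqrt (1 + Cmod x ^ 2) * sqrt (1 + Cmod y ^ 2))
  | Some x, None | None, Some x => 1 / sqrt (1 + Cmod x ^ 2)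
  | None, None => 0
  end.

Definition compact_subset (D K : C -> Prop) : Prop :=
  (forall z, K z -> D z) /\
  (exists M, forall z, K z -> Cmod z <= M) /\
  (forall z, (forall eps, 0 < eps -> exists w, K w /\ Cmod (w - z)%C < eps) -> K z).

Definition normal_family (D : C -> Prop) (Fam : sphere_fun -> Prop) : Prop :=
  forall fs : nat -> sphere_fun, (forall n, Fam (fs n)) ->
    exists (phi : nat -> nat) (F : sphere_fun),
      (forall n, (phi n < phi (S n))%nat) /\
      forall K, compact_subset D K ->
        forall eps, 0 < eps -> exists N, forall n z, (N <= n)%nat -> K z ->
          chordal (fs (phi n) z) (F z) < eps.

(* Main.v *)
From Stdlib Require Import Reals List Lra Lia ZArith Cantor ClassicalEpsilon.
From Stdlib Require Import ssreflect ssrbool ssrfun.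
From Coquelicot Require Import Coquelicot.
Require Import Defs.
Open Scope R_scope.

(** Marty's criterion reduces normality to a bound on the spherical derivative near each point z0, uniform over the family.
    Sharing h gives, for c = 1 or c = 2, that no P[f] takes the value c h on a common punctured disc around z0, where
    h = (z - z0)^q v with q < l0. If the spherical derivatives blew up at z0, Zalcman rescaling with the exponents that turn
    c h into a (b + z)^q would produce a nonconstant F, meromorphic on C with bounded spherical derivative, such that P[F] omits
    a z^q off 0, unless the zooms run away from z0; rescaling about z0 then reduces that case to a nonzero constant a.

    For a constant a, put H = 1 / (P[F] - a) and W = - H' / (F H), both entire. Where |F| is moderate H and W are bounded by
    compactness of the translates of F; elsewhere, on a disc of radius comparable to the distance d to the moderate points,
    u = 1/F satisfies A H = u^N with A bounded, so log |H| = O(1 + d) by removing the zeros with Blaschke factors and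
    Harnack's inequality, and W is bounded by Harnack again. Hence W is constant, then H, then P[F], and F is constant: it
    could only be c exp(eta z), whose P is not constant. For a z^q with q > 0, the function U = - (z H' + q H) / (F H) tends to
    zero along large circles, so U = 0 and P[F] is a multiple of z^q, which again forces F to be constant. *)

(** * Complex derivatives and paths *)

(** The exponents come from homogeneity: P[c F(w + s y)] is c^L s^m' times P[F] at w + s y, where L
    = l0 + l'. Taking c = t^-(m' + q) and s = t^L multiplies P[F] by s^-q, which is what turns (z -
    z0)^q into ((w - z0) / s + y)^q. Zalcman's lemma needs m' + q < L, and this is where l' > m' and
    q < l0 enter.

    Dividing by F makes W entire: P[F] = F^e Q with e = l0 + l' - m' >= 2, so P[F]' / F is
    holomorphic at the zeros of F, while at a pole the simple pole of H' / H meets a zero of 1 / F.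
    The obstacle is that F may be close to infinity on large regions, where limits of translates are
    identically infinite and say nothing. There A may vanish, hence the Blaschke factors; log |H|
    then grows linearly in d, which is exactly compensated by the factor 1 / d that Harnack gives
    for a logarithmic derivative on a disc of radius comparable to d. A nonzero constant W is not
    absurd at once: it forces H to be bounded, because where H is large both 1 / F and its
    derivative are small and W would be small too. *)

Definition near (z : C) (P : C -> Prop) : Prop :=
  exists r, 0 < r /\ forall y, disc z r y -> P y.

(* CD, RD: complex derivative of a function of a complex, resp. real, variable; Cc, pc: continuity, and jc: joint continuity. *)
Definition CD (g : C -> C) (z l : C) : Prop :=
  @is_derive C_AbsRing C_NormedModule g z l.

Lemma Cmod_sym (a b : C) : Cmod (a - b) = Cmod (b - a).
Proof. by rewrite -Cmod_opp; congr Cmod; ring. Qed.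

Lemma Cmod_tri (a b c : C) : Cmod (a - c) <= Cmod (a - b) + Cmod (b - c).
Proof. replace (a - c)%C with ((a - b) + (b - c))%C by ring. exact: Cmod_triangle. Qed.

Lemma Cmod_le_add (a b : C) : Cmod a <= Cmod b + Cmod (a - b).
Proof. replace a with (b + (a - b))%C at 1 by ring. exact: Cmod_triangle. Qed.

Lemma Cmod_sub_self (a : C) : Cmod (a - a) = 0.
Proof. replace (a - a)%C with (RtoC 0) by ring. exact: Cmod_0. Qed.

Lemma Csub_neq0 (a b : C) : a <> b -> (a - b)%C <> 0.
Proof. move=> ab e; apply: ab. replace a with (a - b + b)%C by ring. rewrite e; ring. Qed.

Lemma Cmod_sub_pos (a b : C) : a <> b -> 0 < Cmod (a - b).
Proof. by move/Csub_neq0 /Cmod_gt_0. Qed.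

Lemma Cmul_neq0 (a b : C) : a <> 0 -> b <> 0 -> (a * b)%C <> 0.
Proof. exact: Cmult_neq_0. Qed.

Lemma Cmul_eq0 (a b : C) : (a * b)%C = 0 -> a = 0 \/ b = 0.
Proof.
move=> e; case: (excluded_middle_informative (a = 0)) => [|a0]; first by left.
case: (excluded_middle_informative (b = 0)) => [|b0]; first by right.
by case: (Cmul_neq0 _ _ a0 b0).
Qed.

Lemma disc_center z r : 0 < r -> disc z r z.
Proof. by rewrite /disc Cmod_sub_self. Qed.

Lemma disc_sub z r y s w : disc y s w -> Cmod (y - z) + s <= r -> disc z r w.
Proof. rewrite /disc => h1 h2. have := Cmod_tri w y z. lra. Qed.

Lemma near_disc z r : 0 < r -> near z (disc z r).
Proof. by exists r. Qed.

Lemma near_open z r y : disc z r y -> near y (disc z r).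
Proof.
move=> h; exists (r - Cmod (y - z)); split; first by rewrite /disc in h; lra.
move=> w hw; apply: disc_sub hw _; lra.
Qed.

Lemma near_self z P : near z P -> P z.
Proof. case=> r [r0]; apply; exact: disc_center. Qed.

Lemma near_mono z (P Q : C -> Prop) : (forall y, P y -> Q y) -> near z P -> near z Q.
Proof. move=> h [r [r0 hr]]; exists r; split=> // y /hr; exact: h. Qed.

Lemma near_and z P Q : near z P -> near z Q -> near z (fun y => P y /\ Q y).
Proof.
move=> [r [r0 h]] [s [s0 k]]; exists (Rmin r s); split; first exact: Rmin_pos.
move=> y; rewrite /disc => hy; have := Rmin_l r s; have := Rmin_r r s.
by split; [apply: h|apply: k]; rewrite /disc; lra.
Qed.

Lemma near2 z (P Q S : C -> Prop) :
  (forall y, P y -> Q y -> S y) -> near z P -> near z Q -> near z S.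
Proof. move=> h hp hq; apply: near_mono (near_and _ _ _ hp hq) => y []; exact: h. Qed.

Lemma near_near z P : near z P -> near z (fun y => near y P).
Proof.
move=> [r [r0 h]]; exists r; split=> // y /near_open; exact: near_mono.
Qed.

Lemma near_all z (P : C -> Prop) : (forall y, P y) -> near z P.
Proof. by move=> h; exists 1; split=> [|y _]; [lra|exact: h]. Qed.

Lemma CD_eps g z l : CD g z l <->
  forall eps, 0 < eps -> near z (fun y => Cmod (g y - g z - l * (y - z)) <= eps * Cmod (y - z)).
Proof.
split.
- case=> _ /(_ z (fun P H => H)) h eps e0.
  case: (h (mkposreal eps e0)) => d hd; exists d; split; first exact: cond_pos.
  move=> y hy; move: (hd y hy) => /=.
  by rewrite /norm /= /abs /= /minus /plus /opp /scal /= /mult /= (Cmult_comm l).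
- move=> h; split; first exact: is_linear_scal_l.
  move=> x hx; rewrite -(is_filter_lim_locally_unique _ _ hx) => eps.
  case: (h eps (cond_pos eps)) => d [d0 hd]; exists (mkposreal d d0) => y hy.
  move: (hd y hy); by rewrite /norm /= /abs /= /minus /plus /opp /scal /= /mult /= (Cmult_comm l).
Qed.

(** The derivative of the statement lives in [C_NormedModule], the product and chain rules in
    [AbsRing_NormedModule C_AbsRing]; both unfold to the same epsilon estimate. *)
Lemma CD_abs g z l :
  CD g z l <-> @is_derive C_AbsRing (AbsRing_NormedModule C_AbsRing) g z l.
Proof.
split.
- move/CD_eps => h; split; first exact: is_linear_scal_l.
  move=> x hx; rewrite -(is_filter_lim_locally_unique _ _ hx) => eps.
  case: (h eps (cond_pos eps)) => d [d0 hd]; exists (mkposreal d d0) => y hy.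
  move: (hd y hy); by rewrite /norm /= /abs /= /minus /plus /opp /scal /= /mult /= (Cmult_comm l).
- case=> _ /(_ z (fun P H => H)) h; apply/CD_eps => eps e0.
  case: (h (mkposreal eps e0)) => d hd; exists d; split; first exact: cond_pos.
  move=> y hy; move: (hd y hy) => /=.
  by rewrite /norm /= /abs /= /minus /plus /opp /scal /= /mult /= (Cmult_comm l).
Qed.

Lemma CD_unique g z l : CD g z l -> C_derive g z = l.
Proof. exact: is_C_derive_unique. Qed.

Lemma CD_cder g z : Cdiff g z -> CD g z (C_derive g z).
Proof. case=> l h; by rewrite (CD_unique _ _ _ h). Qed.

Lemma CD_Cdiff g z l : CD g z l -> Cdiff g z.
Proof. by exists l. Qed.

Lemma CD_ext g h z l : near z (fun y => g y = h y) -> CD g z l -> CD h z l.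
Proof.
move=> [r [r0 e]]; apply: is_derive_ext_loc; exists (mkposreal r r0) => y hy; exact: e.
Qed.

Lemma CD_const c z : CD (fun _ => c) z 0.
Proof. exact: (@is_derive_const C_AbsRing C_NormedModule). Qed.

Lemma CD_id z : CD (fun y => y) z 1.
Proof. apply/CD_abs; exact: (@is_derive_id C_AbsRing). Qed.

Lemma CD_plus g h z a b : CD g z a -> CD h z b -> CD (fun y => g y + h y)%C z (a + b).
Proof. exact: (@is_derive_plus C_AbsRing C_NormedModule). Qed.

Lemma CD_minus g h z a b : CD g z a -> CD h z b -> CD (fun y => g y - h y)%C z (a - b).
Proof. exact: (@is_derive_minus C_AbsRing C_NormedModule). Qed.

Lemma CD_opp g z a : CD g z a -> CD (fun y => - g y)%C z (- a).
Proof. exact: (@is_derive_opp C_AbsRing C_NormedModule). Qed.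

Lemma CD_mult g h z a b : CD g z a -> CD h z b ->
  CD (fun y => g y * h y)%C z (a * h z + g z * b).
Proof.
move=> /CD_abs ha /CD_abs hb; apply/CD_abs.
by apply: (@is_derive_mult C_AbsRing _ _ _ _ _ ha hb) => n m; exact: Cmult_comm.
Qed.

Lemma CD_scal c g z a : CD g z a -> CD (fun y => c * g y)%C z (c * a).
Proof.
move=> h; move: (CD_mult _ _ _ _ _ (CD_const c z) h); by rewrite Cmult_0_l Cplus_0_l.
Qed.

Lemma CD_comp g h z a b : CD h (g z) b -> CD g z a -> CD (fun y => h (g y)) z (a * b).
Proof. move=> hb /CD_abs ha; exact: (@is_derive_comp C_AbsRing C_NormedModule h g z b a hb ha). Qed.

Lemma CD_eq g z a b : CD g z a -> a = b -> CD g z b.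
Proof. by move=> h <-. Qed.

Definition Cc (g : C -> C) (z : C) : Prop :=
  forall eps, 0 < eps -> near z (fun y => Cmod (g y - g z) < eps).

Lemma CD_Cc g z l : CD g z l -> Cc g z.
Proof.
move/CD_eps => h eps e0; have := h 1 Rlt_0_1 => {}h.
have k0 : 0 < eps / (2 + Cmod l) by apply: Rdiv_lt_0_compat => //; have := Cmod_ge_0 l; lra.
apply: near2 h (near_disc z _ k0) => y hy hd.
have := Cmod_le_add (g y - g z) (l * (y - z)); rewrite Cmod_mult => h2.
apply: Rle_lt_trans (_ : (1 + Cmod l) * Cmod (y - z) < eps); first by lra.
have hl := Cmod_ge_0 l; have hyz := Cmod_ge_0 (y - z).
apply: Rle_lt_trans (_ : (2 + Cmod l) * Cmod (y - z) < _); first by nra.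
rewrite /disc in hd; apply/(Rmult_lt_reg_r (/ (2 + Cmod l))); first by apply: Rinv_0_lt_compat; lra.
by rewrite Rmult_comm -Rmult_assoc Rinv_l ?Rmult_1_l; [|lra].
Qed.

Lemma Cdiff_Cc g z : Cdiff g z -> Cc g z.
Proof. case=> l; exact: CD_Cc. Qed.

Lemma Cc_neq g z c : Cc g z -> g z <> c -> near z (fun y => g y <> c).
Proof.
move=> h n; have p := Cmod_sub_pos _ _ n.
apply: near_mono (h _ p) => y hy e; rewrite e Cmod_sym in hy; lra.
Qed.

Lemma CD_inv (z : C) : z <> 0 -> CD (fun y => / y)%C z (- / (z * z)).
Proof.
move=> z0; apply/CD_eps => eps e0; have m0 := proj1 (Cmod_gt_0 z) z0.
(* The remainder is (y - z)^2 / (y z^2), at most 2 |y - z|^2 / |z|^3 once |y| >= |z| / 2. *)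
have k0 : 0 < Rmin (Cmod z / 2) (eps * (Cmod z)^3 / 2).
  apply: Rmin_pos; [lra|have := pow_lt _ 3 m0; nra].
apply: near_mono (near_disc z _ k0) => y; rewrite /disc => hy.
have h1 := Rmin_l (Cmod z / 2) (eps * (Cmod z)^3 / 2); have h2 := Rmin_r (Cmod z / 2) (eps * (Cmod z)^3 / 2).
have hm : Cmod z / 2 <= Cmod y by have := Cmod_le_add z y; rewrite Cmod_sym; lra.
have y0 : y <> 0 by apply/Cmod_gt_0; lra.
have -> : (/ y - / z - - / (z * z) * (y - z))%C = ((y - z) * (y - z) / (y * (z * z)))%C by field.
rewrite Cmod_div; last by do 2 apply: Cmul_neq0 => //.
rewrite !Cmod_mult; have d0 := Cmod_ge_0 (y - z).
apply/Rle_div_l; first by apply: Rmult_lt_0_compat; nra.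
apply: Rle_trans (_ : Cmod (y - z) * (eps * (Cmod z)^3 / 2) <= _); first by apply: Rmult_le_compat_l => //; lra.
have : 0 <= Cmod (y - z) * eps * (Cmod z * Cmod z) by repeat apply: Rmult_le_pos; lra.
nra.
Qed.

Lemma CD_invf g z a : CD g z a -> g z <> 0 -> CD (fun y => / g y)%C z (- a / (g z * g z)).
Proof.
move=> h n; apply: CD_eq (CD_comp _ _ _ _ _ (CD_inv _ n) h) _; by field.
Qed.

Lemma CD_div g h z a b : CD g z a -> CD h z b -> h z <> 0 ->
  CD (fun y => g y / h y)%C z ((a * h z - g z * b) / (h z * h z)).
Proof.
move=> ha hb n; apply: CD_eq (CD_mult _ _ _ _ _ ha (CD_invf _ _ _ hb n)) _; by field.
Qed.

Lemma CD_pow g z a n : CD g z a -> CD (fun y => g y ^ n)%C z (RtoC (INR n) * a * g z ^ (Nat.pred n))%C.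
Proof.
move=> h; elim: n => [|n IH]; first by apply: CD_eq (CD_const 1 z) _; rewrite /=; ring.
apply: (CD_ext (fun y => g y * g y ^ n)%C); first exact: near_all.
apply: CD_eq (CD_mult _ _ _ _ _ h IH) _; rewrite S_INR RtoC_plus; case: n {IH} => [|n] /=; ring.
Qed.

Lemma CD_affine g a b z l : CD g (a + b * z) l -> CD (fun y => g (a + b * y))%C z (b * l).
Proof.
move=> h; apply: (CD_comp (fun y => a + b * y)%C) => //.
apply: CD_eq (CD_plus _ _ _ _ _ (CD_const a z) (CD_scal b _ _ _ (CD_id z))) _; ring.
Qed.

Lemma Cdiff_const c z : Cdiff (fun _ => c) z.
Proof. exists (RtoC 0); exact: CD_const. Qed.
Lemma Cdiff_id z : Cdiff (fun y => y) z.
Proof. exists (RtoC 1); exact: CD_id. Qed.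
Lemma Cdiff_plus g h z : Cdiff g z -> Cdiff h z -> Cdiff (fun y => g y + h y)%C z.
Proof. move=> [a ha] [b hb]; exists (a + b)%C; exact: CD_plus. Qed.
Lemma Cdiff_minus g h z : Cdiff g z -> Cdiff h z -> Cdiff (fun y => g y - h y)%C z.
Proof. move=> [a ha] [b hb]; exists (a - b)%C; exact: CD_minus. Qed.
Lemma Cdiff_opp g z : Cdiff g z -> Cdiff (fun y => - g y)%C z.
Proof. move=> [a ha]; exists (- a)%C; exact: CD_opp. Qed.
Lemma Cdiff_mult g h z : Cdiff g z -> Cdiff h z -> Cdiff (fun y => g y * h y)%C z.
Proof. move=> [a ha] [b hb]; eexists; exact: (CD_mult _ _ _ _ _ ha hb). Qed.
Lemma Cdiff_inv g z : Cdiff g z -> g z <> 0 -> Cdiff (fun y => / g y)%C z.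
Proof. move=> [a ha] n; eexists; exact: (CD_invf _ _ _ ha n). Qed.
Lemma Cdiff_div g h z : Cdiff g z -> Cdiff h z -> h z <> 0 -> Cdiff (fun y => g y / h y)%C z.
Proof. by move=> hg hh n; apply: Cdiff_mult => //; apply: Cdiff_inv. Qed.
Lemma Cdiff_pow g z n : Cdiff g z -> Cdiff (fun y => g y ^ n)%C z.
Proof. move=> [a ha]; eexists; exact: (CD_pow _ _ _ n ha). Qed.
Lemma Cdiff_ext g h z : near z (fun y => g y = h y) -> Cdiff g z -> Cdiff h z.
Proof. move=> e [l hl]; exists l; exact: CD_ext e hl. Qed.

Lemma cder_ext g h z : near z (fun y => g y = h y) -> Cdiff g z -> C_derive h z = C_derive g z.
Proof. move=> e /CD_cder d; apply: CD_unique; exact: CD_ext e d. Qed.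

Ltac hol := repeat first
  [ eassumption | apply: Cdiff_const | apply: Cdiff_id | apply: Cdiff_plus | apply: Cdiff_minus
  | apply: Cdiff_opp | apply: Cdiff_mult | apply: Cdiff_div | apply: Cdiff_inv | apply: Cdiff_pow ].

(** * Derivatives along real paths and the mean value inequality *)

Definition RD (p : R -> C) (t : R) (l : C) : Prop :=
  forall eps, 0 < eps -> exists d, 0 < d /\ forall s, Rabs (s - t) < d ->
    Cmod (p s - p t - RtoC (s - t) * l) <= eps * Rabs (s - t).

Definition pc (p : R -> C) (t : R) : Prop :=
  forall eps, 0 < eps -> exists d, 0 < d /\ forall s, Rabs (s - t) < d -> Cmod (p s - p t) < eps.

Lemma RD_pc p t l : RD p t l -> pc p t.
Proof.
move=> h eps e0; case: (h 1 Rlt_0_1) => d [d0 hd].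
have hl := Cmod_ge_0 l.
have k0 : 0 < eps / (2 + Cmod l) by apply: Rdiv_lt_0_compat => //; lra.
exists (Rmin d (eps / (2 + Cmod l))); split; first exact: Rmin_pos.
move=> s hs; have h1 := Rmin_l d (eps / (2 + Cmod l)); have h2 := Rmin_r d (eps / (2 + Cmod l)).
have {}hd := hd s (Rlt_le_trans _ _ _ hs h1).
have h3 : Rabs (s - t) < eps / (2 + Cmod l) by lra.
have := Cmod_le_add (p s - p t) (RtoC (s - t) * l); rewrite Cmod_mult Cmod_R => h4.
have a0 := Rabs_pos (s - t).
have : (2 + Cmod l) * Rabs (s - t) < eps.
  apply/(Rmult_lt_reg_r (/ (2 + Cmod l))); first by apply: Rinv_0_lt_compat; lra.
  by rewrite Rmult_comm -Rmult_assoc Rinv_l ?Rmult_1_l; [|lra].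
nra.
Qed.

Lemma Cmod_pair_le (x y : R) : Cmod (x, y) <= Rabs x + Rabs y.
Proof.
rewrite /Cmod /=; apply: Rsqr_incr_0_var; last by have := Rabs_pos x; have := Rabs_pos y; lra.
rewrite Rsqr_sqrt; last by nra.
rewrite /Rsqr; have := Rabs_pos x; have := Rabs_pos y.
have -> : x * (x * 1) = Rabs x * Rabs x by rewrite -Rabs_mult Rabs_pos_eq; nra.
have -> : y * (y * 1) = Rabs y * Rabs y by rewrite -Rabs_mult Rabs_pos_eq; nra.
nra.
Qed.

Lemma RD_pair x y t a b : is_derive x t a -> is_derive y t b -> RD (fun s => (x s, y s)) t (a, b).
Proof.
move=> [_ /(_ t (fun P H => H)) hx] [_ /(_ t (fun P H => H)) hy] eps e0.
have h0 : 0 < eps / 2 by lra.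
case: (hx (mkposreal _ h0)) => dx ux; case: (hy (mkposreal _ h0)) => dy uy.
exists (Rmin dx dy); split; first by apply: Rmin_pos; exact: cond_pos.
move=> s hs; have m1 := Rmin_l dx dy; have m2 := Rmin_r dx dy.
have {}ux := ux s (Rlt_le_trans _ _ _ hs m1); have {}uy := uy s (Rlt_le_trans _ _ _ hs m2).
move: ux uy; rewrite /norm /= /abs /= /minus /plus /opp /scal /= /mult /= => ux uy.
have -> : ((x s, y s) - (x t, y t) - RtoC (s - t) * (a, b))%C =
   (x s + - x t + - ((s + - t) * a), y s + - y t + - ((s + - t) * b)).
  rewrite /Cminus /Cplus /Copp /Cmult /RtoC /=; congr pair; ring.
apply: Rle_trans (Cmod_pair_le _ _) _; rewrite /Rminus; lra.
Qed.

Lemma RD_re p t l : RD p t l -> is_derive (fun s => Re (p s)) t (Re l).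
Proof.
move=> h; split; first exact: is_linear_scal_l.
move=> x hx; rewrite -(is_filter_lim_locally_unique _ _ hx) => eps.
case: (h eps (cond_pos eps)) => d [d0 hd]; exists (mkposreal d d0) => s hs.
have {}hd := hd s hs; rewrite /norm /= /abs /= /minus /plus /opp /scal /= /mult /=.
apply: Rle_trans hd; apply: Rle_trans (re_le_Cmod _); right; congr Rabs.
rewrite /Re /=; ring.
Qed.

Lemma RD_comp g p t v l : CD g (p t) l -> RD p t v -> RD (fun s => g (p s)) t (v * l).
Proof.
move=> /CD_eps hg hp eps e0.
have hv := Cmod_ge_0 v; have hl := Cmod_ge_0 l.
have e1 : 0 < eps / (2 * (1 + Cmod v)) by apply: Rdiv_lt_0_compat; lra.
have e2 : 0 < Rmin 1 (eps / (2 * (1 + Cmod l))) by apply: Rmin_pos; [lra|apply: Rdiv_lt_0_compat; lra].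
case: (hg _ e1) => r [r0 hr]; case: (RD_pc _ _ _ hp r r0) => d1 [d10 hd1].
case: (hp _ e2) => d2 [d20 hd2]; exists (Rmin d1 d2); split; first exact: Rmin_pos.
move=> s hs; have m1 := Rmin_l d1 d2; have m2 := Rmin_r d1 d2.
have a1 := hd1 s (Rlt_le_trans _ _ _ hs m1); have a2 := hd2 s (Rlt_le_trans _ _ _ hs m2).
have a3 := hr _ a1; have p0 := Rabs_pos (s - t).
have m3 := Rmin_l 1 (eps / (2 * (1 + Cmod l))); have m4 := Rmin_r 1 (eps / (2 * (1 + Cmod l))).
have a4 : Cmod (p s - p t) <= (1 + Cmod v) * Rabs (s - t).
  have := Cmod_le_add (p s - p t) (RtoC (s - t) * v); rewrite Cmod_mult Cmod_R; nra.
have -> : (g (p s) - g (p t) - RtoC (s - t) * (v * l) =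
   (g (p s) - g (p t) - l * (p s - p t)) + l * (p s - p t - RtoC (s - t) * v))%C by ring.
apply: Rle_trans (Cmod_triangle _ _) _; rewrite Cmod_mult.
have b1 : eps / (2 * (1 + Cmod v)) * ((1 + Cmod v) * Rabs (s - t)) = eps / 2 * Rabs (s - t) by field; lra.
have b2 : (1 + Cmod l) * (eps / (2 * (1 + Cmod l)) * Rabs (s - t)) = eps / 2 * Rabs (s - t) by field; lra.
have c1 := Rmult_le_compat_l _ _ _ (Rlt_le _ _ e1) a4.
have q0 : 0 < eps / (2 * (1 + Cmod l)) by apply: Rdiv_lt_0_compat; lra.
have c3 : Cmod (p s - p t - RtoC (s - t) * v) <= eps / (2 * (1 + Cmod l)) * Rabs (s - t).
  by apply: Rle_trans a2 _; apply: Rmult_le_compat_r.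
have c2 : Cmod l * Cmod (p s - p t - RtoC (s - t) * v) <= eps / 2 * Rabs (s - t).
  rewrite -b2; apply: Rmult_le_compat => //; [exact: Cmod_ge_0|lra].
lra.
Qed.

Definition seg (a b : C) (t : R) : C := (a + RtoC t * (b - a))%C.

Lemma seg0 a b : seg a b 0 = a.
Proof. rewrite /seg; ring. Qed.
Lemma seg1 a b : seg a b 1 = b.
Proof. rewrite /seg; ring. Qed.

Lemma RD_seg a b t : RD (seg a b) t (b - a).
Proof.
move=> eps e0; exists 1; split; first lra.
move=> s _; rewrite /seg.
have -> : (a + s * (b - a) - (a + t * (b - a)) - RtoC (s - t) * (b - a) = 0)%C by rewrite RtoC_minus; ring.
rewrite Cmod_0; have := Rabs_pos (s - t); nra.
Qed.

Lemma seg_disc z r a b t : 0 <= t <= 1 -> disc z r a -> disc z r b -> disc z r (seg a b t).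
Proof.
rewrite /disc /seg => ht ha hb.
have -> : (a + t * (b - a) - z = RtoC (1 - t) * (a - z) + RtoC t * (b - z))%C by rewrite RtoC_minus; ring.
apply: Rle_lt_trans (Cmod_triangle _ _) _; rewrite !Cmod_mult !Cmod_R !Rabs_pos_eq; try lra.
case: (Req_dec t 0) => [->|t0]; first lra. nra.
Qed.

(** The mean value theorem is only real, so it is applied to the projection of g along the segment
    onto the direction of g b - g a, which loses nothing of the increment. *)
Lemma mean_value_ineq g g' a b M :
  (forall t, 0 <= t <= 1 -> CD g (seg a b t) (g' (seg a b t)) /\ Cmod (g' (seg a b t)) <= M) ->
  Cmod (g b - g a) <= M * Cmod (b - a).
Proof.
move=> h; set c := Cconj (g b - g a).
have hd t : 0 <= t <= 1 ->
    is_derive (fun s => Re (c * g (seg a b s))) t (Re ((b - a) * (c * g' (seg a b t)))).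
  move=> ht; apply: (RD_re (fun s => (c * g (seg a b s))%C)).
  apply: (RD_comp (fun w => (c * g w)%C)); last exact: RD_seg.
  by apply: CD_scal; case: (h t ht).
case: (MVT_gen (fun s => Re (c * g (seg a b s))) 0 1 (fun t => Re ((b - a) * (c * g' (seg a b t))))).
- rewrite Rmin_left ?Rmax_right; try lra. move=> t ht; apply: hd; lra.
- rewrite Rmin_left ?Rmax_right; try lra. move=> t ht.
  apply: derivable_continuous_pt; exists (Re ((b - a) * (c * g' (seg a b t)))).
  by apply/is_derive_Reals; apply: hd.
move=> t; rewrite Rmin_left ?Rmax_right; try lra; move=> [ht e].
rewrite seg0 seg1 in e.
have e1 : Re (c * g b) - Re (c * g a) = Cmod (g b - g a) ^ 2.
  rewrite /c Cmod2_alt /Re /Im /=; ring.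
have h1 := re_le_Cmod ((b - a) * (c * g' (seg a b t))).
rewrite !Cmod_mult {2}/c Cmod_conj in h1.
have h2 : Cmod (g b - g a) ^ 2 <= Cmod (b - a) * (Cmod (g b - g a) * M).
  rewrite -e1 e; apply: Rle_trans (Rle_abs _) _; rewrite Rminus_0_r Rmult_1_r.
  apply: Rle_trans h1 _; apply: Rmult_le_compat_l; first exact: Cmod_ge_0.
  apply: Rmult_le_compat_l; first exact: Cmod_ge_0. by case: (h t ht).
case: (Cmod_ge_0 (g b - g a)) => [p|<-].
  apply: (Rmult_le_reg_l (Cmod (g b - g a))) => //; lra.
case: (h 0); first lra. move=> _ hM; have := Cmod_ge_0 (g' (seg a b 0)); have := Cmod_ge_0 (b - a); nra.
Qed.

(** * Complex integrals *)

Definition CI (p : R -> C) (a b : R) : C := RInt (V := C_R_CompleteNormedModule) p a b.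
Definition isCI (p : R -> C) (a b : R) (l : C) : Prop :=
  is_RInt (V := C_R_NormedModule) p a b l.

Lemma CI_isCI p a b : a <= b -> (forall t, a <= t <= b -> pc p t) -> isCI p a b (CI p a b).
Proof.
move=> ab h; apply: (RInt_correct (V := C_R_CompleteNormedModule)); apply: ex_RInt_continuous.
rewrite Rmin_left ?Rmax_right // => t ht P [eps hP].
case: (h t ht eps (cond_pos eps)) => d [d0 hd]; exists (mkposreal d d0) => s hs; apply: hP.
apply: C_NormedModule_mixin_compat1; exact: hd.
Qed.

Lemma isCI_unique p a b l : isCI p a b l -> CI p a b = l.
Proof. exact: (is_RInt_unique (V := C_R_CompleteNormedModule)). Qed.

Lemma isCI_scal c p a b l : isCI p a b l -> isCI (fun t => c * p t)%C a b (c * l).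
Proof.
case: c => x y h.
have h1 := is_RInt_fct_extend_fst (U := R_NormedModule) (V := R_NormedModule) _ _ _ _ h.
have h2 := is_RInt_fct_extend_snd (U := R_NormedModule) (V := R_NormedModule) _ _ _ _ h.
apply: (is_RInt_fct_extend_pair (U := R_NormedModule) (V := R_NormedModule)).
- exact: (is_RInt_minus _ _ _ _ _ _ (is_RInt_scal _ _ _ x _ h1) (is_RInt_scal _ _ _ y _ h2)).
- exact: (is_RInt_plus _ _ _ _ _ _ (is_RInt_scal _ _ _ x _ h2) (is_RInt_scal _ _ _ y _ h1)).
Qed.

Lemma isCI_minus p q a b l m : isCI p a b l -> isCI q a b m -> isCI (fun t => p t - q t)%C a b (l - m).
Proof. exact: (is_RInt_minus (V := C_R_NormedModule)). Qed.

Lemma isCI_ext p q a b l : a <= b -> (forall t, a <= t <= b -> p t = q t) -> isCI p a b l -> isCI q a b l.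
Proof.
move=> ab e; apply: is_RInt_ext; rewrite Rmin_left ?Rmax_right // => t ht; apply: e; lra.
Qed.

Lemma isCI_bound p a b l M : a <= b -> (forall t, a <= t <= b -> Cmod (p t) <= M) ->
  isCI p a b l -> Cmod l <= (b - a) * M.
Proof.
move=> ab h hi; rewrite Cmod_norm; apply: (norm_RInt_le_const (V := C_R_NormedModule)) hi => // t ht.
by have := h t ht; rewrite Cmod_norm.
Qed.

Lemma isCI_FTC p q a b : a <= b -> (forall t, a <= t <= b -> RD p t (q t)) ->
  (forall t, a <= t <= b -> pc q t) -> isCI q a b (p b - p a).
Proof.
move=> ab hp hq; apply: (is_RInt_derive (V := C_R_CompleteNormedModule)).
- rewrite Rmin_left ?Rmax_right // => t ht; split; first exact: is_linear_scal_l.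
  move=> x hx; rewrite -(is_filter_lim_locally_unique _ _ hx) => eps.
  case: (hp t ht eps (cond_pos eps)) => d [d0 hd]; exists (mkposreal d d0) => s hs.
  have {}hd := hd s hs; rewrite Cmod_norm in hd.
  have e : (p s - p t - RtoC (s - t) * q t)%C = 
     (minus (minus (p s) (p t)) (scal (minus s t) (q t : C_R_NormedModule))) :> C_R_NormedModule.
    rewrite /minus /plus /opp /scal /= /prod_plus /prod_opp /prod_scal /= /scal /= /mult /plus /opp /=.
    rewrite /Cminus /Cplus /Copp /Cmult /RtoC /=; congr pair; ring.
  by rewrite e in hd.
- rewrite Rmin_left ?Rmax_right // => t ht P [eps hP].
  case: (hq t ht eps (cond_pos eps)) => d [d0 hd]; exists (mkposreal d d0) => s hs; apply: hP.
  apply: C_NormedModule_mixin_compat1; exact: hd.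
Qed.

(** Subtracting 2 c / 2^j makes the sequence increasing, adding it makes it decreasing, so the
    supremum of the first lies below every term of the second. *)
Lemma geometric_limit_R (x : nat -> R) c : 0 <= c ->
  (forall j, Rabs (x (S j) - x j) <= c / 2 ^ j) -> exists l, forall j, Rabs (l - x j) <= 2 * c / 2 ^ j.
Proof.
move=> c0 h.
have h2 j : c / 2 ^ j = 2 * c / 2 ^ j - 2 * c / 2 ^ (S j) by rewrite /=; field; apply: pow_nonzero; lra.
have p j : 0 <= 2 * c / 2 ^ j by apply: Rdiv_le_0_compat; [lra|apply: pow_lt; lra].
have ha j k : x j - 2 * c / 2 ^ j <= x (j + k)%nat - 2 * c / 2 ^ (j + k).
  elim: k => [|k IH]; first by rewrite Nat.add_0_r; lra.
  rewrite Nat.add_succ_r; have := h (j + k)%nat; rewrite h2 => /Rabs_le_between; lra.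
have hb j k : x (j + k)%nat + 2 * c / 2 ^ (j + k) <= x j + 2 * c / 2 ^ j.
  elim: k => [|k IH]; first by rewrite Nat.add_0_r; lra.
  rewrite Nat.add_succ_r; have := h (j + k)%nat; rewrite h2 => /Rabs_le_between; lra.
have hab j k : x j - 2 * c / 2 ^ j <= x k + 2 * c / 2 ^ k.
  have := ha j k; have := hb k j; rewrite (Nat.add_comm k j); have := p (j + k)%nat; lra.
case: (completeness (fun y => exists j, y = x j - 2 * c / 2 ^ j)).
- exists (x O + 2 * c / 2 ^ O) => y [j ->]; exact: hab.
- by exists (x O - 2 * c / 2 ^ O), O.
move=> l [l1 l2]; exists l => j; apply/Rabs_le_between; split.
- have := l1 _ (ex_intro _ j erefl); lra.
- have : l <= x j + 2 * c / 2 ^ j by apply: l2 => y [k ->]; exact: hab.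
  lra.
Qed.

(** Common core of the two arguments by infinite descent: triangle bisection in [goursat] and
    repeated recentring in [zoom_point]. Each failure at stage j produces a failure of stage j + 1
    close by, and the failures converge. *)
Lemma nested_limit (Bad : nat -> C -> Prop) c w0 : 0 <= c ->
  (forall j w, Bad j w -> exists w', Cmod (w' - w) <= c / 2 ^ j /\ Bad (S j) w') ->
  Bad O w0 -> exists l, Cmod (l - w0) <= 4 * c /\
    forall j, exists w, Bad j w /\ Cmod (l - w) <= 4 * c / 2 ^ j.
Proof.
move=> c0 h h0.
have ch jw : exists w', Bad (fst jw) (snd jw) -> Cmod (w' - snd jw) <= c / 2 ^ (fst jw) /\ Bad (S (fst jw)) w'.
  case: (excluded_middle_informative (Bad (fst jw) (snd jw))) => [/h [w' hw]|n]; first by exists w'.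
  by exists (RtoC 0) => /n.
pose nxt jw := proj1_sig (constructive_indefinite_description _ (ch jw)).
pose w : nat -> C := nat_rect (fun _ => C) w0 (fun j w => nxt (j, w)).
have hn j : Bad j (w j) -> Cmod (w (S j) - w j) <= c / 2 ^ j /\ Bad (S j) (w (S j)).
  by move=> hb; rewrite /= /nxt; case: constructive_indefinite_description => w' /=; apply.
have hw j : Bad j (w j) by elim: j => [//|j /hn []].
have hs j : Cmod (w (S j) - w j) <= c / 2 ^ j by case: (hn j (hw j)).
case: (geometric_limit_R (fun j => fst (w j)) c c0) => [j|x hx].
  apply: Rle_trans (hs j); exact: (re_le_Cmod (w (S j) - w j)).
case: (geometric_limit_R (fun j => snd (w j)) c c0) => [j|y hy].
  apply: Rle_trans (hs j); apply: (Rle_trans _ _ _ (Rmax_r _ _) (Rmax_Cmod (w (S j) - w j)%C)).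
have hl j : Cmod ((x, y) - w j) <= 4 * c / 2 ^ j.
  have -> : ((x, y) - w j)%C = (x - fst (w j), y - snd (w j)) by rewrite /Cminus /Cplus /Copp /=; congr pair; ring.
  apply: Rle_trans (Cmod_pair_le _ _) _; have := hx j; have := hy j; lra.
exists (x, y); split=> [|j]; last by exists (w j).
have := hl O; rewrite /=; lra.
Qed.

(** * Integrals depending on a parameter *)

Definition jc (K : R -> C -> C) (t : R) (z : C) : Prop :=
  forall eps, 0 < eps -> exists d, 0 < d /\ forall s y, Rabs (s - t) < d -> disc z d y ->
    Cmod (K s y - K t z) < eps.

Lemma jc_fst p t z : pc p t -> jc (fun s _ => p s) t z.
Proof. by move=> h eps /h [d [d0 hd]]; exists d; split=> // s y hs _; apply: hd. Qed.

Lemma jc_snd t z : jc (fun _ y => y) t z.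
Proof. by move=> eps e0; exists eps. Qed.

Lemma jc_pc K t z : jc K t z -> pc (fun s => K s z) t.
Proof.
by move=> h eps /h [d [d0 hd]]; exists d; split=> // s hs; apply: hd => //; apply: disc_center.
Qed.

Lemma jc_plus K G t z : jc K t z -> jc G t z -> jc (fun s y => K s y + G s y)%C t z.
Proof.
move=> hk hg eps e0; have e2 : 0 < eps / 2 by lra.
case: (hk _ e2) => d [d0 hd]; case: (hg _ e2) => d' [d0' hd'].
exists (Rmin d d'); split; first exact: Rmin_pos.
move=> s y; rewrite /disc => hs hy; have m1 := Rmin_l d d'; have m2 := Rmin_r d d'.
have a1 : Cmod (K s y - K t z) < eps / 2 by apply: hd; rewrite /disc; lra.
have a2 : Cmod (G s y - G t z) < eps / 2 by apply: hd'; rewrite /disc; lra.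
have -> : (K s y + G s y - (K t z + G t z) = (K s y - K t z) + (G s y - G t z))%C by ring.
have := Cmod_triangle (K s y - K t z) (G s y - G t z); lra.
Qed.

Lemma jc_comp k K t z : Cc k (K t z) -> jc K t z -> jc (fun s y => k (K s y)) t z.
Proof.
move=> hk hK eps /hk [r [r0 hr]]; case: (hK r r0) => d [d0 hd].
by exists d; split=> // s y hs hy; apply: hr; apply: hd.
Qed.

Lemma jc_mult K G t z : jc K t z -> jc G t z -> jc (fun s y => K s y * G s y)%C t z.
Proof.
move=> hk hg eps e0; set a := Cmod (K t z); set b := Cmod (G t z).
have a0 : 0 <= a by exact: Cmod_ge_0. have b0 : 0 <= b by exact: Cmod_ge_0.
have ea : 0 < eps / (2 * (b + 1)) by apply: Rdiv_lt_0_compat; lra.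
have eb : 0 < Rmin 1 (eps / (2 * (a + 1))) by apply: Rmin_pos; [lra|apply: Rdiv_lt_0_compat; lra].
case: (hk _ ea) => d [d0 hd]; case: (hg _ eb) => d' [d0' hd'].
exists (Rmin d d'); split; first exact: Rmin_pos.
move=> s y; rewrite /disc => hs hy; have m1 := Rmin_l d d'; have m2 := Rmin_r d d'.
have a1 : Cmod (K s y - K t z) < eps / (2 * (b + 1)) by apply: hd; rewrite /disc; lra.
have a2 : Cmod (G s y - G t z) < Rmin 1 (eps / (2 * (a + 1))) by apply: hd'; rewrite /disc; lra.
have m3 := Rmin_l 1 (eps / (2 * (a + 1))); have m4 := Rmin_r 1 (eps / (2 * (a + 1))).
have -> : (K s y * G s y - K t z * G t z = (K s y - K t z) * G s y + K t z * (G s y - G t z))%C by ring.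
apply: Rle_lt_trans (Cmod_triangle _ _) _; rewrite !Cmod_mult -/a.
have hG : Cmod (G s y) <= b + 1 by have := Cmod_le_add (G s y) (G t z); rewrite -/b; lra.
have c1 : Cmod (K s y - K t z) * Cmod (G s y) <= eps / (2 * (b + 1)) * (b + 1).
  apply: Rmult_le_compat => //; try exact: Cmod_ge_0; lra.
have c2 : a * Cmod (G s y - G t z) <= a * (eps / (2 * (a + 1))) by apply: Rmult_le_compat_l => //; lra.
have c3 : eps / (2 * (b + 1)) * (b + 1) = eps / 2 by field; lra.
have c4 : (a + 1) * (eps / (2 * (a + 1))) = eps / 2 by field; lra.
have : 0 < eps / (2 * (a + 1)) by apply: Rdiv_lt_0_compat; lra.
lra.
Qed.

Lemma compact_interval (a b : R) (d : R -> R) : (forall t, a <= t <= b -> 0 < d t) ->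
  exists e, 0 < e /\ forall t, a <= t <= b -> exists s, a <= s <= b /\ Rabs (t - s) < d s /\ e <= d s.
Proof.
(* The compactness theorem wants a radius that is positive everywhere; off the interval it is set to
   1. *)
move=> h; have p t : 0 < (if excluded_middle_informative (a <= t <= b) then d t else 1).
  destruct (excluded_middle_informative (a <= t <= b)) as [ht|nt]; [exact: h|exact: Rlt_0_1].
case: (compactness_value_1d a b (fun t => mkposreal _ (p t))) => e he.
exists e; split; first exact: cond_pos.
move=> t ht; apply: Classical_Prop.NNPP => n; apply: (he t ht) => -[s [hs /= [h1 h2]]]; apply: n.
exists s; move: h1 h2; destruct (excluded_middle_informative (a <= s <= b)) as [hs'|n'] => h1 h2; first by [].
exact: (False_ind _ (n' hs)).
Qed.

Lemma unif_param K a b z eps : (forall t, a <= t <= b -> jc K t z) -> 0 < eps ->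
  exists d, 0 < d /\ forall t y, a <= t <= b -> disc z d y -> Cmod (K t y - K t z) < eps.
Proof.
move=> h e0; have e2 : 0 < eps / 2 by lra.
have ch t : exists d, a <= t <= b -> 0 < d /\ forall s y, Rabs (s - t) < d -> disc z d y ->
    Cmod (K s y - K t z) < eps / 2.
  case: (excluded_middle_informative (a <= t <= b)) => [/h /(_ _ e2) [d hd]|n]; first by exists d.
  by exists 1 => /n.
pose d t := proj1_sig (constructive_indefinite_description _ (ch t)).
have hd t : a <= t <= b -> 0 < d t /\ forall s y, Rabs (s - t) < d t -> disc z (d t) y ->
    Cmod (K s y - K t z) < eps / 2.
  by rewrite /d; case: constructive_indefinite_description.
case: (compact_interval a b d) => [t /hd []//|e [e00 he]].
exists e; split=> // t y ht hy; case: (he t ht) => s [/hd [ds0 hs] [h1 h2]].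
have a1 : Cmod (K t y - K s z) < eps / 2 by apply: hs => //; rewrite /disc in hy *; lra.
have a2 : Cmod (K t z - K s z) < eps / 2 by apply: hs => //; exact: disc_center.
have := Cmod_tri (K t y) (K s z) (K t z); rewrite (Cmod_sym (K s z)); lra.
Qed.

Lemma CI_param_Cc K a b z : a <= b -> near z (fun y => forall t, a <= t <= b -> jc K t y) ->
  Cc (fun y => CI (fun t => K t y) a b) z.
Proof.
move=> ab h eps e0; have h0 := near_self _ _ h.
have e1 : 0 < eps / (b - a + 1) by apply: Rdiv_lt_0_compat; lra.
case: (unif_param _ _ _ _ _ h0 e1) => d [d0 hd].
apply: near2 h (near_disc z d d0) => y hy hyd.
have i1 := CI_isCI _ _ _ ab (fun t ht => jc_pc _ _ _ (hy t ht)).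
have i0 := CI_isCI _ _ _ ab (fun t ht => jc_pc _ _ _ (h0 t ht)).
apply: Rle_lt_trans (isCI_bound _ _ _ _ _ ab (fun t ht => Rlt_le _ _ (hd t y ht hyd)) (isCI_minus _ _ _ _ _ _ i1 i0)) _.
have : (b - a + 1) * (eps / (b - a + 1)) = eps by field; lra.
nra.
Qed.

(** The remainder of K t at z is the increment of K t x - (x - z) K' t z, whose derivative is small
    uniformly in t by joint continuity of K'; the mean value inequality bounds it before
    integrating. *)
Lemma CI_param_CD K K' a b z : a <= b ->
  near z (fun y => forall t, a <= t <= b -> jc K t y /\ CD (K t) y (K' t y)) ->
  (forall t, a <= t <= b -> jc K' t z) ->
  CD (fun y => CI (fun t => K t y) a b) z (CI (fun t => K' t z) a b).
Proof.
move=> ab h hj; have h0 := near_self _ _ h; apply/CD_eps => eps e0.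
have e1 : 0 < eps / (b - a + 1) by apply: Rdiv_lt_0_compat; lra.
case: (unif_param _ _ _ _ _ hj e1) => d [d0 hd].
case: h => r [r0 hr]; exists (Rmin r d); split; first exact: Rmin_pos.
move=> y hy; have m1 := Rmin_l r d; have m2 := Rmin_r r d.
have hyr : disc z r y by rewrite /disc in hy *; lra.
have hyd : disc z d y by rewrite /disc in hy *; lra.
have i1 := CI_isCI _ _ _ ab (fun t ht => jc_pc _ _ _ (proj1 (hr y hyr t ht))).
have i0 := CI_isCI _ _ _ ab (fun t ht => jc_pc _ _ _ (proj1 (h0 t ht))).
have i2 := isCI_scal (y - z) _ _ _ _ (CI_isCI _ _ _ ab (fun t ht => jc_pc _ _ _ (hj t ht))).
have i3 := isCI_minus _ _ _ _ _ _ (isCI_minus _ _ _ _ _ _ i1 i0) i2.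
rewrite (Cmult_comm (CI _ _ _)); apply: Rle_trans (isCI_bound _ _ _ _ (eps / (b - a + 1) * Cmod (y - z)) ab _ i3) _.
- move=> t ht; set g := fun x => (K t x - (x - z) * K' t z)%C.
  have -> : (K t y - K t z - (y - z) * K' t z = g y - g z)%C by rewrite /g; ring.
  apply: (mean_value_ineq g (fun x => K' t x - K' t z)%C) => s hs.
  have hsd : disc z (Rmin r d) (seg z y s) by apply: seg_disc => //; apply: disc_center; exact: Rmin_pos.
  split; last by apply: Rlt_le; apply: hd => //; rewrite /disc in hsd *; lra.
  have hsr : disc z r (seg z y s) by rewrite /disc in hsd *; lra.
  have [_ hc] := hr _ hsr t ht.
  apply: CD_eq (CD_minus _ _ _ _ _ hc (CD_mult _ _ _ _ _ (CD_minus _ _ _ _ _ (CD_id _) (CD_const z _)) (CD_const (K' t z) _))) _; ring.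
- have : (b - a + 1) * (eps / (b - a + 1)) = eps by field; lra.
  have := Cmod_ge_0 (y - z) => m0 e3.
  have : (b - a) * (eps / (b - a + 1)) <= eps by nra.
  nra.
Qed.

Lemma scal_RtoC (k : R) (z : C) : scal k (z : C_R_NormedModule) = (RtoC k * z)%C.
Proof.
case: z => x y; change ((k * x, k * y) = (k * x - 0 * y, k * y + 0 * x)); congr pair; ring.
Qed.

Lemma RtoC_m1 : RtoC (-1) = (- (1))%C.
Proof. by rewrite -RtoC_opp. Qed.

Lemma Ctwo_neq0 : RtoC 2 <> 0.
Proof. by move/RtoC_inj; lra. Qed.

Lemma RtoC_half : RtoC (/ 2) = (/ 2)%C.
Proof. by rewrite RtoC_inv. Qed.

(** * Segment integrals, Goursat's theorem and primitives *)

Definition segI (f : C -> C) (a b : C) : C := CI (fun t => f (seg a b t) * (b - a))%C 0 1.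

Lemma pc_seg_fun f a b t : Cc f (seg a b t) -> pc (fun t => f (seg a b t) * (b - a))%C t.
Proof.
move=> h; apply: (jc_pc (fun s _ => (f (seg a b s) * (b - a))%C) t 0).
apply: jc_mult.
- apply: (jc_comp f (fun s _ => seg a b s)) => //; apply: jc_fst; apply: RD_pc; exact: RD_seg.
- by move=> eps e0; exists 1; split=> [|s y _ _]; [lra|rewrite Cmod_sub_self].
Qed.

Lemma segI_isCI f a b : (forall t, 0 <= t <= 1 -> Cc f (seg a b t)) ->
  isCI (fun t => f (seg a b t) * (b - a))%C 0 1 (segI f a b).
Proof. move=> h; apply: CI_isCI => [|t /h]; [lra|exact: pc_seg_fun]. Qed.

Lemma segI_swap f a b : (forall t, 0 <= t <= 1 -> Cc f (seg a b t)) -> segI f b a = (- segI f a b)%C.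
Proof.
move=> h; apply: isCI_unique; have := is_RInt_swap (V := C_R_NormedModule) _ _ _ _ (segI_isCI f a b h).
have e : forall l : C_R_NormedModule, is_RInt (fun t => f (seg a b t) * (b - a))%C 1 0 l ->
    is_RInt (V := C_R_NormedModule) (fun t => f (seg a b t) * (b - a))%C (-1 * 0 + 1) (-1 * 1 + 1) l.
  by move=> l; rewrite !Rmult_0_r Rplus_0_l Rmult_1_r; have -> : -1 + 1 = 0 by lra.
move/e /(is_RInt_comp_lin (V := C_R_NormedModule)); apply: isCI_ext => [|t _]; first lra.
have -> : seg a b (-1 * t + 1) = seg b a t by rewrite /seg RtoC_plus RtoC_mult RtoC_m1; ring.
rewrite scal_RtoC RtoC_m1; ring.
Qed.

Lemma segI_split f a b : (forall t, 0 <= t <= 1 -> Cc f (seg a b t)) ->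
  (segI f a ((a + b) / 2) + segI f ((a + b) / 2) b = segI f a b)%C.
Proof.
move=> h; set p := fun t => (f (seg a b t) * (b - a))%C.
have i1 : isCI p 0 (1/2) (CI p 0 (1/2)) by apply: CI_isCI => [|t ht]; [lra|apply: pc_seg_fun; apply: h; lra].
have i2 : isCI p (1/2) 1 (CI p (1/2) 1) by apply: CI_isCI => [|t ht]; [lra|apply: pc_seg_fun; apply: h; lra].
have -> : segI f a b = (CI p 0 (1/2) + CI p (1/2) 1)%C.
  apply: isCI_unique; exact: (is_RInt_Chasles (V := C_R_NormedModule) _ _ _ _ _ _ i1 i2).
congr Cplus; apply: isCI_unique.
- have e : is_RInt (V := C_R_NormedModule) p (/2 * 0 + 0) (/2 * 1 + 0) (CI p 0 (1/2)).
    have -> : /2 * 0 + 0 = 0 by lra. by have -> : /2 * 1 + 0 = 1/2 by lra.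
  move/(is_RInt_comp_lin (V := C_R_NormedModule)): e; apply: isCI_ext => [|t _]; first lra.
  rewrite /p; have -> : seg a b (/2 * t + 0) = seg a ((a + b) / 2) t.
    rewrite /seg RtoC_plus RtoC_mult RtoC_half; field; exact: Ctwo_neq0.
  have -> : ((a + b) / 2 - a = RtoC (/ 2) * (b - a))%C by rewrite RtoC_half; field; exact: Ctwo_neq0.
  rewrite scal_RtoC; ring.
- have e : is_RInt (V := C_R_NormedModule) p (/2 * 0 + /2) (/2 * 1 + /2) (CI p (1/2) 1).
    have -> : /2 * 0 + /2 = 1/2 by lra. by have -> : /2 * 1 + /2 = 1 by lra.
  move/(is_RInt_comp_lin (V := C_R_NormedModule)): e; apply: isCI_ext => [|t _]; first lra.
  rewrite /p; have -> : seg a b (/2 * t + /2) = seg ((a + b) / 2) b t.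
    rewrite /seg RtoC_plus RtoC_mult RtoC_half; field; exact: Ctwo_neq0.
  have -> : (b - (a + b) / 2 = RtoC (/ 2) * (b - a))%C by rewrite RtoC_half; field; exact: Ctwo_neq0.
  rewrite scal_RtoC; ring.
Qed.

Lemma segI_FTC F f a b : (forall t, 0 <= t <= 1 -> CD F (seg a b t) (f (seg a b t)) /\ Cc f (seg a b t)) ->
  segI f a b = (F b - F a)%C.
Proof.
move=> h; apply: isCI_unique.
have := isCI_FTC (fun t => F (seg a b t)) (fun t => f (seg a b t) * (b - a))%C 0 1.
rewrite seg0 seg1; apply=> [|t /h [h1 h2]|t /h [h1 h2]]; first lra.
- rewrite Cmult_comm; apply: RD_comp => //; exact: RD_seg.
- exact: pc_seg_fun.
Qed.

Lemma segI_bound f a b M : (forall t, 0 <= t <= 1 -> Cc f (seg a b t)) ->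
  (forall t, 0 <= t <= 1 -> Cmod (f (seg a b t)) <= M) -> Cmod (segI f a b) <= M * Cmod (b - a).
Proof.
move=> h hM; have := isCI_bound _ _ _ _ (M * Cmod (b - a)) Rle_0_1 _ (segI_isCI f a b h).
rewrite Rminus_0_r Rmult_1_l; apply=> t ht; rewrite Cmod_mult.
by apply: Rmult_le_compat_r; [exact: Cmod_ge_0|exact: hM].
Qed.

Lemma pow_half_small X d : 0 < d -> exists j, X / 2 ^ j < d.
Proof.
move=> d0; have h : Rabs (/ 2) < 1 by rewrite Rabs_pos_eq; lra.
have k0 : 0 < d / (Rabs X + 1) by apply: Rdiv_lt_0_compat => //; have := Rabs_pos X; lra.
case: (pow_lt_1_zero _ h _ k0) => j hj; exists j; have := hj j (Nat.le_refl _).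
have p : 0 < / 2 ^ j by apply: Rinv_0_lt_compat; apply: pow_lt; lra.
rewrite pow_inv Rabs_pos_eq; last lra. move=> h2.
have : (Rabs X + 1) * / 2 ^ j < d.
  have e : d = (Rabs X + 1) * (d / (Rabs X + 1)) by field; have := Rabs_pos X; lra.
  rewrite e; apply: Rmult_lt_compat_l => //; have := Rabs_pos X; lra.
have := Rle_abs X; rewrite /Rdiv; nra.
Qed.

Lemma hol_seg f z r a b : (forall y, disc z r y -> Cdiff f y) -> disc z r a -> disc z r b ->
  forall t, 0 <= t <= 1 -> Cc f (seg a b t).
Proof. by move=> h ha hb t ht; apply: Cdiff_Cc; apply: h; apply: seg_disc. Qed.

Definition triI f a b c : C := (segI f a b + segI f b c + segI f c a)%C.

Lemma disc_mid z r a b : disc z r a -> disc z r b -> disc z r ((a + b) / 2).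
Proof.
move=> ha hb; have -> : ((a + b) / 2)%C = seg a b (/ 2).
  rewrite /seg RtoC_half; field; exact: Ctwo_neq0.
apply: seg_disc => //; lra.
Qed.

Lemma triI_split f z r p q s : (forall y, disc z r y -> Cdiff f y) ->
  disc z r p -> disc z r q -> disc z r s ->
  let a := ((p + q) / 2)%C in let b := ((p + s) / 2)%C in let c := ((q + s) / 2)%C in
  triI f p q s = (triI f p a b + triI f a q c + triI f b c s + triI f c b a)%C.
Proof.
move=> h hp hq hs a b c.
have ha : disc z r a by exact: disc_mid. have hb : disc z r b by exact: disc_mid.
have hc : disc z r c by exact: disc_mid.
have e1 : (segI f p a + segI f a q)%C = segI f p q by apply: segI_split; exact: hol_seg h hp hq.
have e2 : (segI f q c + segI f c s)%C = segI f q s by apply: segI_split; exact: hol_seg h hq hs.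
have e3 : (segI f s b + segI f b p)%C = segI f s p.
  have -> : b = ((s + p) / 2)%C by rewrite /b Cplus_comm. apply: segI_split; exact: hol_seg h hs hp.
have s1 := segI_swap f a b (hol_seg _ _ _ _ _ h ha hb).
have s2 := segI_swap f b c (hol_seg _ _ _ _ _ h hb hc).
have s3 := segI_swap f a c (hol_seg _ _ _ _ _ h ha hc).
rewrite /triI -e1 -e2 -e3 s1 s2 s3; ring.
Qed.

Lemma Cmod_sum4 a b c d : Cmod (a + b + c + d) <= Cmod a + Cmod b + Cmod c + Cmod d.
Proof.
have := Cmod_triangle (a + b + c) d; have := Cmod_triangle (a + b) c; have := Cmod_triangle a b; lra.
Qed.

Lemma goursat f z r a b c : (forall y, disc z r y -> Cdiff f y) ->
  disc z r a -> disc z r b -> disc z r c -> triI f a b c = 0.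
Proof.
move=> h ha hb hc; apply: Cmod_eq_0; case: (Cmod_ge_0 (triI f a b c)) => [T0|//]; exfalso.
set u := (b - a)%C; set v := (c - a)%C; set K := Cmod u + Cmod v + 1.
have u0 := Cmod_ge_0 u; have v0 := Cmod_ge_0 v; have K0 : 0 < K by rewrite /K; lra.
have [rho [hr [ra [rb rc]]]] : exists rho, rho < r /\ disc z rho a /\ disc z rho b /\ disc z rho c.
  exists ((r + Rmax (Cmod (a - z)) (Rmax (Cmod (b - z)) (Cmod (c - z)))) / 2).
  have m1 := Rmax_l (Cmod (a - z)) (Rmax (Cmod (b - z)) (Cmod (c - z))).
  have m2 := Rmax_r (Cmod (a - z)) (Rmax (Cmod (b - z)) (Cmod (c - z))).
  have m3 := Rmax_l (Cmod (b - z)) (Cmod (c - z)); have m4 := Rmax_r (Cmod (b - z)) (Cmod (c - z)).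
  have : Rmax (Cmod (a - z)) (Rmax (Cmod (b - z)) (Cmod (c - z))) < r by do 2 apply: Rmax_lub_lt => //.
  rewrite /disc; repeat split; lra.
have hrho y : disc z rho y -> Cdiff f y by move=> hy; apply: h; rewrite /disc in hy *; lra.
(* Every triangle of the bisection is p, p + s u, p + s v with |s| = 2^-j; the half-turned central
   one is obtained by replacing s by - s / 2. *)
pose Bad j p := exists s, Cmod s = / 2 ^ j /\ disc z rho p /\ disc z rho (p + s * u) /\
  disc z rho (p + s * v) /\ Cmod (triI f a b c) / 4 ^ j <= Cmod (triI f p (p + s * u) (p + s * v)).
case: (nested_limit Bad K a (Rlt_le _ _ K0)).
- move=> j p [s [hs [h1 [h2 [h3 h4]]]]].
  have half x : Cmod (s * x / 2) = Cmod s * Cmod x / 2.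
    by rewrite Cmod_div ?Cmod_mult ?Cmod_R ?Rabs_pos_eq //; [lra|exact: Ctwo_neq0].
  have hs2 : Cmod (s / 2) = / 2 ^ (S j).
    by rewrite Cmod_div ?hs ?Cmod_R ?Rabs_pos_eq /=; [field; apply: pow_nonzero; lra|lra|exact: Ctwo_neq0].
  have p2 : 0 < / 2 ^ j by apply: Rinv_0_lt_compat; apply: pow_lt; lra.
  have e4 : Cmod (triI f a b c) / 4 ^ j = 4 * (Cmod (triI f a b c) / 4 ^ S j).
    by rewrite /=; field; apply: pow_nonzero; lra.
  have := triI_split f z rho _ _ _ hrho h1 h2 h3 => /=.
  set ma := ((p + (p + s * u)) / 2)%C; set mb := ((p + (p + s * v)) / 2)%C.
  set mc := ((p + s * u + (p + s * v)) / 2)%C => e.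
  have dma : disc z rho ma by exact: disc_mid. have dmb : disc z rho mb by exact: disc_mid.
  have dmc : disc z rho mc by exact: disc_mid.
  have n2 := Ctwo_neq0.
  have q1 : (p + s / 2 * u)%C = ma by rewrite /ma; field.
  have q2 : (p + s / 2 * v)%C = mb by rewrite /mb; field.
  have q3 : (ma + s / 2 * u)%C = (p + s * u)%C by rewrite /ma; field.
  have q4 : (ma + s / 2 * v)%C = mc by rewrite /ma /mc; field.
  have q5 : (mb + s / 2 * u)%C = mc by rewrite /mb /mc; field.
  have q6 : (mb + s / 2 * v)%C = (p + s * v)%C by rewrite /mb; field.
  have q7 : (mc + - (s / 2) * u)%C = mb by rewrite /mb /mc; field.
  have q8 : (mc + - (s / 2) * v)%C = ma by rewrite /ma /mc; field.
  have := Cmod_sum4 (triI f p ma mb) (triI f ma (p + s * u) mc) (triI f mb mc (p + s * v)) (triI f mc mb ma).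
  rewrite -e => hsum.
  have dist x : Cmod (s * x / 2) <= / 2 ^ j * Cmod x by rewrite half hs; have := Cmod_ge_0 x; nra.
  have du := dist u; have dv := dist v.
  have hK : / 2 ^ j * Cmod u + / 2 ^ j * Cmod v <= K / 2 ^ j by rewrite /K /Rdiv; nra.
  have pu : 0 <= / 2 ^ j * Cmod u by nra. have pv : 0 <= / 2 ^ j * Cmod v by nra.
  case: (Rle_lt_dec (Cmod (triI f a b c) / 4 ^ S j) (Cmod (triI f p ma mb))) => c1.
    exists p; split; first by rewrite Cmod_sub_self; lra.
    by exists (s / 2)%C; rewrite q1 q2.
  case: (Rle_lt_dec (Cmod (triI f a b c) / 4 ^ S j) (Cmod (triI f ma (p + s * u) mc))) => c2.
    exists ma; split; last by exists (s / 2)%C; rewrite q3 q4.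
    have -> : (ma - p = s * u / 2)%C by rewrite /ma; field. lra.
  case: (Rle_lt_dec (Cmod (triI f a b c) / 4 ^ S j) (Cmod (triI f mb mc (p + s * v)))) => c3.
    exists mb; split; last by exists (s / 2)%C; rewrite q5 q6.
    have -> : (mb - p = s * v / 2)%C by rewrite /mb; field. lra.
  exists mc; split.
    have -> : (mc - p = s * u / 2 + s * v / 2)%C by rewrite /mc; field.
    apply: Rle_trans (Cmod_triangle _ _) _; lra.
  exists (- (s / 2))%C; rewrite q7 q8 Cmod_opp; refine (conj hs2 (conj dmc (conj dmb (conj dma _)))); lra.
- exists (RtoC 1); rewrite Cmod_1 /= Rinv_1.
  have -> : (a + 1 * u = b)%C by rewrite /u; ring. have -> : (a + 1 * v = c)%C by rewrite /v; ring.
  do 4 split=> //; lra.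
move=> l [_ hl].
have dl : disc z r l.
  rewrite /disc; have d0 : 0 < r - rho by lra.
  case: (pow_half_small (4 * K) _ d0) => j hj; case: (hl j) => w [[s [_ [hw _]]] hlw].
  rewrite /disc in hw; have := Cmod_tri l w z; lra.
have [l' hl'] := h _ dl; move/CD_eps: (hl') => hl''.
set T := Cmod (triI f a b c) in T0 *.
(* Three edges of length at most 2 K / 2^j, in a disc of radius 6 K / 2^j about l, contribute 36/73
   of [T] / 4^j in total. *)
have e0 : 0 < T / (73 * K * K) by apply: Rdiv_lt_0_compat => //; nra.
case: (hl'' _ e0) => d [d0 hd]; case: (pow_half_small (6 * K) _ d0) => j hj.
case: (hl j) => w [[s [hs [h1 [h2 [h3 h4]]]]] hlw].
have p2 : 0 < / 2 ^ j by apply: Rinv_0_lt_compat; apply: pow_lt; lra.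
have nb x : Cmod x <= K / 2 ^ j -> disc l (6 * K / 2 ^ j) (w + x).
  move=> hx; rewrite /disc; have -> : (w + x - l = x + (w - l))%C by ring.
  have := Cmod_triangle x (w - l); rewrite (Cmod_sym w l); rewrite /Rdiv in hx hlw *; nra.
have su : Cmod (s * u) <= K / 2 ^ j by rewrite Cmod_mult hs /K /Rdiv; nra.
have sv : Cmod (s * v) <= K / 2 ^ j by rewrite Cmod_mult hs /K /Rdiv; nra.
have n0 : disc l (6 * K / 2 ^ j) w.
  have := nb 0; rewrite Cplus_0_r; apply; rewrite Cmod_0 /Rdiv; nra.
have n1 := nb _ su; have n2 := nb _ sv.
(* A primitive of the affine part of f at l: its increments cancel around the triangle, so only the
   remainder of f is integrated. *)
set G := fun y => (f l * y + l' * ((y - l) * (y - l)) / 2)%C.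
have est x y : disc l (6 * K / 2 ^ j) x -> disc l (6 * K / 2 ^ j) y -> disc z rho x -> disc z rho y ->
    Cmod (y - x) <= 2 * K / 2 ^ j ->
    Cmod (segI f x y - (G y - G x)) <= T / (73 * K * K) * (6 * K / 2 ^ j) * (2 * K / 2 ^ j).
  move=> nx ny dx dy hxy.
  have hG t : 0 <= t <= 1 -> CD G (seg x y t) (f l + l' * (seg x y t - l))%C /\
      Cc (fun w => f l + l' * (w - l))%C (seg x y t).
    move=> _; split; last by apply: (CD_Cc _ _ (0 + l' * (1 - 0))%C); apply: CD_plus; [exact: CD_const|apply: CD_scal; apply: CD_minus; [exact: CD_id|exact: CD_const]].
    apply: CD_eq; first by rewrite /G; apply: CD_plus; [apply: CD_scal; exact: CD_id|apply: CD_mult; [apply: CD_scal; apply: CD_mult; apply: CD_minus; [exact: CD_id|exact: CD_const|exact: CD_id|exact: CD_const]|exact: CD_const]].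
    by cbv beta; field; exact: Ctwo_neq0.
  have hcs t : 0 <= t <= 1 -> Cc f (seg x y t) by exact: hol_seg hrho dx dy t.
  have e : (segI f x y - (G y - G x) = segI (fun w => f w - (f l + l' * (w - l))) x y)%C.
    rewrite -(segI_FTC G _ x y hG); symmetry; apply: isCI_unique.
    apply: isCI_ext (isCI_minus _ _ _ _ _ _ (segI_isCI f x y hcs) (segI_isCI _ x y (fun t ht => proj2 (hG t ht)))) => [|t _]; [lra|ring].
  rewrite e; apply: Rle_trans (segI_bound _ _ _ (T / (73 * K * K) * (6 * K / 2 ^ j)) _ _) _.
  - move=> t ht; apply: (Cdiff_Cc (fun w => (f w - (f l + l' * (w - l)))%C)).
    by hol; apply: hrho; apply: seg_disc.
  - move=> t ht; have dt : disc l (6 * K / 2 ^ j) (seg x y t) by exact: seg_disc.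
    have -> : (f (seg x y t) - (f l + l' * (seg x y t - l)) = f (seg x y t) - f l - l' * (seg x y t - l))%C by ring.
    rewrite /disc in dt; apply: Rle_trans (hd _ _) _; first by rewrite /disc; lra.
    apply: Rmult_le_compat_l; lra.
  - apply: Rmult_le_compat_l => //; apply: Rmult_le_pos; first lra. rewrite /Rdiv; nra.
have pK : 0 < K / 2 ^ j by rewrite /Rdiv; nra.
have a1 := est w (w + s * u)%C n0 n1 h1 h2; have a2 := est _ _ n1 n2 h2 h3; have a3 := est _ _ n2 n0 h3 h1.
have b1 : Cmod (w + s * u - w) <= 2 * K / 2 ^ j.
  have -> : (w + s * u - w = s * u)%C by ring. rewrite /Rdiv in su pK *; lra.
have b3 : Cmod (w - (w + s * v)) <= 2 * K / 2 ^ j.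
  have -> : (w - (w + s * v) = - (s * v))%C by ring. rewrite Cmod_opp; rewrite /Rdiv in sv pK *; lra.
have b2 : Cmod (w + s * v - (w + s * u)) <= 2 * K / 2 ^ j.
  have -> : (w + s * v - (w + s * u) = s * v + - (s * u))%C by ring.
  have := Cmod_triangle (s * v) (- (s * u)); rewrite Cmod_opp; rewrite /Rdiv in su sv pK *; lra.
have {}a1 := a1 b1; have {}a2 := a2 b2; have {}a3 := a3 b3.
have e : triI f w (w + s * u) (w + s * v) = ((segI f w (w + s * u) - (G (w + s * u) - G w)) +
  (segI f (w + s * u) (w + s * v) - (G (w + s * v) - G (w + s * u))) +
  (segI f (w + s * v) w - (G w - G (w + s * v))) + 0)%C by rewrite /triI; ring.
have := Cmod_sum4 (segI f w (w + s * u) - (G (w + s * u) - G w))%C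
  (segI f (w + s * u) (w + s * v) - (G (w + s * v) - G (w + s * u)))%C
  (segI f (w + s * v) w - (G w - G (w + s * v)))%C 0.
rewrite -e Cmod_0.
have e4 : 4 ^ j = 2 ^ j * 2 ^ j by rewrite -Rpow_mult_distr; congr (_ ^ _); lra.
have q0 : 0 < / (2 ^ j * 2 ^ j) by apply: Rinv_0_lt_compat; apply: Rmult_lt_0_compat; apply: pow_lt; lra.
have e5 : T / (73 * K * K) * (6 * K / 2 ^ j) * (2 * K / 2 ^ j) = 12 / 73 * (T * / (2 ^ j * 2 ^ j)).
  field; split; [apply: pow_nonzero; lra|lra].
rewrite e5 in a1 a2 a3; rewrite e4 /Rdiv -/T in h4.
have qT : 0 < T * / (2 ^ j * 2 ^ j) by nra.
lra.
Qed.

Lemma primitive_exists f z r : 0 < r -> (forall y, disc z r y -> Cdiff f y) ->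
  exists F, forall y, disc z r y -> CD F y (f y).
Proof.
move=> r0 h; exists (segI f z) => y hy; have hz := disc_center z r r0.
apply/CD_eps => eps e0; case: (Cdiff_Cc _ _ (h y hy) _ e0) => d [d0 hd].
apply: near2 (near_disc y d d0) (near_open _ _ _ hy) => x hxd hx.
have hsw := segI_swap f z x (hol_seg _ _ _ _ _ h hz hx).
have hg := goursat f z r z y x h hz hy hx; rewrite /triI hsw in hg.
have hc := hol_seg _ _ _ _ _ h hy hx.
have e : (segI f z x - segI f z y - f y * (x - y) = segI (fun w => f w - f y) y x)%C.
  have -> : (segI f z x = segI f z y + segI f y x)%C.
    have -> : segI f z x = (segI f z x + (segI f z y + segI f y x + - segI f z x))%C by rewrite hg; ring.
    ring.
  have hk t : 0 <= t <= 1 -> CD (fun w => f y * w)%C (seg y x t) (f y) /\ Cc (fun _ => f y) (seg y x t).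
    move=> _; split; first by apply: CD_eq (CD_scal _ _ _ _ (CD_id _)) _; ring.
    exact: CD_Cc (CD_const _ _).
  have hk2 : (f y * (x - y) = segI (fun _ => f y) y x)%C by rewrite (segI_FTC _ _ _ _ hk); ring.
  have : (segI f y x - segI (fun _ => f y) y x)%C = segI (fun w => f w - f y)%C y x.
    symmetry; apply: isCI_unique.
    apply: isCI_ext (isCI_minus _ _ _ _ _ _ (segI_isCI f y x hc) (segI_isCI _ y x (fun t ht => proj2 (hk t ht)))) => [|t _]; [lra|ring].
  move=> <-; rewrite -hk2; ring.
rewrite e; apply: segI_bound => t ht.
- apply: (Cdiff_Cc (fun w => (f w - f y)%C)); hol; apply: h; exact: seg_disc.
- apply: Rlt_le; apply: hd; apply: seg_disc => //; exact: disc_center.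
Qed.

(** * Cauchy estimates and the maximum principle *)

Definition cis (t : R) : C := (cos t, sin t).

Lemma Cmod_cis t : Cmod (cis t) = 1.
Proof.
rewrite /Cmod /cis /=; have -> : cos t * (cos t * 1) + sin t * (sin t * 1) = 1.
  have := sin2_cos2 t; rewrite /Rsqr; lra.
exact: sqrt_1.
Qed.

Lemma cis_neq0 t : cis t <> 0.
Proof. by apply/Cmod_gt_0; rewrite Cmod_cis; lra. Qed.

Lemma RD_cis t : RD cis t (Ci * cis t).
Proof.
have -> : (Ci * cis t)%C = (- sin t, cos t) by rewrite /Ci /cis /Cmult /=; congr pair; ring.
by apply: RD_pair; [exact: is_derive_cos|exact: is_derive_sin].
Qed.

Lemma pc_cis t : pc cis t.
Proof. exact: RD_pc (RD_cis t). Qed.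

Lemma cis_2PI : cis (2 * PI) = cis 0.
Proof. by rewrite /cis cos_2PI sin_2PI cos_0 sin_0. Qed.

Lemma twoPI_pos : 0 <= 2 * PI.
Proof. have := PI_RGT_0; lra. Qed.

Lemma Cmod_RtoC_cis r t : 0 <= r -> Cmod (RtoC r * cis t) = r.
Proof. by move=> r0; rewrite Cmod_mult Cmod_R Cmod_cis Rmult_1_r Rabs_pos_eq. Qed.

Lemma jc_cst (c : C) t z : jc (fun _ _ => c) t z.
Proof. by move=> eps e0; exists 1; split=> [|s y _ _]; [lra|rewrite Cmod_sub_self]. Qed.

Lemma jc_inv K t z : jc K t z -> K t z <> 0 -> jc (fun s y => / K s y)%C t z.
Proof. move=> h n; apply: (jc_comp (fun w => / w)%C) => //; exact: CD_Cc (CD_inv _ n). Qed.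

Lemma jc_opp K t z : jc K t z -> jc (fun s y => - K s y)%C t z.
Proof. move=> h; apply: (jc_comp (fun w => - w)%C) => //; exact: CD_Cc (CD_opp _ _ _ (CD_id _)). Qed.

Ltac jct := repeat first
  [ apply: jc_cst | apply: jc_snd | apply: jc_plus | apply: jc_mult | apply: jc_opp
  | (apply: jc_fst; exact: pc_cis) | (apply: jc_inv; last by exact: cis_neq0) ].

Lemma isCI_cst (c : C) a b : isCI (fun _ => c) a b (RtoC (b - a) * c).
Proof. rewrite -scal_RtoC; exact: (is_RInt_const (V := C_R_NormedModule)). Qed.

(* With Psi(t) the integral of F (z + t e^{i x}) / e^{i x}, one has t Psi'(t) = Psi(t), so Psi is linear in t. *)
Lemma deriv_formula F f z R0 r :
  (forall y, disc z R0 y -> CD F y (f y) /\ Cc f y) -> 0 < r < R0 ->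
  CI (fun x => F (z + RtoC r * cis x) * / cis x)%C 0 (2 * PI) = (RtoC r * (RtoC (2 * PI) * f z))%C.
Proof.
move=> h hr; set Psi := fun t : C => CI (fun x => F (z + t * cis x) * / cis x)%C 0 (2 * PI).
set Phi := fun t : C => CI (fun x => f (z + t * cis x))%C 0 (2 * PI).
have dz (t : C) x : Cmod t < R0 -> disc z R0 (z + t * cis x).
  rewrite /disc; have -> : (z + t * cis x - z = t * cis x)%C by ring. by rewrite Cmod_mult Cmod_cis Rmult_1_r.
have jF (t : C) x : Cmod t < R0 -> jc (fun x (t : C) => F (z + t * cis x) * / cis x)%C x t.
  move=> ht; jct; apply: (jc_comp F (fun x t => (z + t * cis x)%C)); last by jct.
  exact: CD_Cc (proj1 (h _ (dz t x ht))).
have jf (t : C) x : Cmod t < R0 -> jc (fun x (t : C) => f (z + t * cis x))%C x t.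
  move=> ht; apply: (jc_comp f (fun x t => (z + t * cis x)%C)); last by jct.
  exact: (proj2 (h _ (dz t x ht))).
have hPsi (t : C) : Cmod t < R0 -> CD Psi t (Phi t).
  move=> ht; apply: (CI_param_CD (fun x t => F (z + t * cis x) * / cis x)%C (fun x t => f (z + t * cis x))%C).
  - exact: twoPI_pos.
  - have : disc 0 R0 t by rewrite /disc; have -> : (t - 0 = t)%C by ring.
    move/near_open; apply: near_mono => s; rewrite /disc; have -> : (s - 0 = s)%C by ring.
    move=> hs x _; split; first exact: jF.
    have [hd _] := h _ (dz s x hs).
    apply: CD_eq.
      apply: CD_mult; last exact: CD_const.
      apply: (CD_comp (fun t => z + t * cis x)%C F) hd _.
      by apply: CD_plus; [exact: CD_const|apply: CD_mult; [exact: CD_id|exact: CD_const]].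
    by cbv beta; field; exact: cis_neq0.
  - by move=> x _; exact: jf.
(* The x-derivative of F(z + t e^{ix}) / e^{ix} integrates to zero over a period; it equals i times
   the difference of the two integrands. *)
have key (t : C) : Cmod t < R0 -> (t * Phi t = Psi t)%C.
  move=> ht; set g := fun w : C => (F (z + t * w) * / w)%C.
  have i1 := CI_isCI _ _ _ twoPI_pos (fun x _ => jc_pc _ _ _ (jf t x ht)).
  have i2 := CI_isCI _ _ _ twoPI_pos (fun x _ => jc_pc _ _ _ (jF t x ht)).
  have i3 := isCI_scal Ci _ _ _ _ (isCI_minus _ _ _ _ _ _ (isCI_scal t _ _ _ _ i1) i2).
  have i4 : isCI (fun x => Ci * (t * f (z + t * cis x) - F (z + t * cis x) * / cis x))%C 0 (2 * PI)
     (g (cis (2 * PI)) - g (cis 0)).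
    apply: (isCI_FTC (fun x => g (cis x))) => [|x _|x _]; first exact: twoPI_pos.
    - have [hd _] := h _ (dz t x ht); have nx := cis_neq0 x.
      have hg : CD g (cis x) ((t * f (z + t * cis x) - F (z + t * cis x) * / cis x) / cis x)%C.
        apply: CD_eq (CD_mult _ _ _ _ _ (CD_affine F z t _ _ hd) (CD_inv _ nx)) _; by field.
      have -> : (Ci * (t * f (z + t * cis x) - F (z + t * cis x) * / cis x) =
         (Ci * cis x) * ((t * f (z + t * cis x) - F (z + t * cis x) * / cis x) / cis x))%C by field.
      apply: RD_comp hg (RD_cis x).
    - apply: (jc_pc (fun x (t : C) => Ci * (t * f (z + t * cis x) - F (z + t * cis x) * / cis x))%C _ t).
      apply: jc_mult; first exact: jc_cst.
      apply: jc_plus; last by apply: jc_opp; exact: jF.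
      apply: jc_mult; [exact: jc_snd|exact: jf].
  rewrite cis_2PI in i4; have e4 := isCI_unique _ _ _ _ i4; have e3 := isCI_unique _ _ _ _ i3.
  rewrite e3 in e4.
  have : (Ci * (t * Phi t - Psi t))%C = 0.
    by rewrite e4; ring.
  case/Cmul_eq0 => [e|e]; first by move/(f_equal snd): e => /=; lra.
  have -> : (t * Phi t = (t * Phi t - Psi t) + Psi t)%C by ring. rewrite e; ring.
have e0 : Psi 0 = 0 by rewrite -key ?Cmod_0; [ring|lra].
have eP0 : Phi 0 = (RtoC (2 * PI) * f z)%C.
  rewrite /Phi; apply: isCI_unique; have := isCI_cst (f z) 0 (2 * PI); rewrite Rminus_0_r.
  apply: isCI_ext => [|x _]; first exact: twoPI_pos. by congr f; ring.
rewrite -eP0 -/(Psi r).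
have hconst t : 0 < t <= r -> (Psi t / t = Psi r / r)%C.
  move=> ht; have := mean_value_ineq (fun w => Psi w / w)%C (fun _ => 0)%C r t 0.
  have hs s : 0 <= s <= 1 -> 0 < r + s * (t - r) <= r by nra.
  have es s : seg r t s = RtoC (r + s * (t - r)) by rewrite /seg RtoC_plus RtoC_mult RtoC_minus.
  move=> hm; have : Cmod (Psi t / t - Psi r / r) <= 0.
    rewrite -(Rmult_0_l (Cmod (t - r))); apply: hm => s /hs; rewrite es; set q := r + _ => hq.
    rewrite Cmod_0; split; last lra.
    have n0 : RtoC q <> 0 by move/RtoC_inj; lra.
    have hq2 : Cmod q < R0 by rewrite Cmod_R Rabs_pos_eq; lra.
    apply: CD_eq (CD_div _ _ _ _ _ (hPsi q hq2) (CD_id _) n0) _.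
    by rewrite -key //; field.
  move=> h1; have /Cmod_eq_0 h2 : Cmod (Psi t / t - Psi r / r) = 0 by apply: Rle_antisym => //; exact: Cmod_ge_0.
  have -> : (Psi t / t = (Psi t / t - Psi r / r) + Psi r / r)%C by ring. rewrite h2; ring.
have r0 : RtoC r <> 0 by move/RtoC_inj; lra.
(* The constant value of Psi t / t is identified by letting t tend to 0, where Psi vanishes with
   derivative Phi 0. *)
have : Cmod (Psi r / r - Phi 0) = 0.
  apply: Rle_antisym; last exact: Cmod_ge_0.
  apply: Rnot_lt_le => hp.
  have hz : Cmod 0 < R0 by rewrite Cmod_0; lra.
  have hp2 : 0 < Cmod (Psi r / r - Phi 0) / 2 by lra.
  have /CD_eps /(_ _ hp2) [d [d0 hd]] := hPsi 0 hz.
  set t := Rmin (d / 2) r; have m1 := Rmin_l (d / 2) r; have m2 := Rmin_r (d / 2) r.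
  have t0 : 0 < t by apply: Rmin_pos; lra.
  have tn : RtoC t <> 0 by move/RtoC_inj; lra.
  have := hd t; rewrite /disc; have -> : (t - 0 = t)%C by ring.
  rewrite e0 Cmod_R Rabs_pos_eq; last lra. move=> /(_ ltac:(rewrite /t in t0 *; lra)).
  have -> : (Psi t - 0 - Phi 0 * t = RtoC t * (Psi r / r - Phi 0))%C.
    rewrite -(hconst t); last by rewrite /t in t0 *; lra.
    by field.
  rewrite Cmod_mult Cmod_R Rabs_pos_eq; last lra. nra.
move/Cmod_eq_0 => e; have -> : (Psi r = RtoC r * (Psi r / r - Phi 0 + Phi 0))%C by field.
rewrite e; ring.
Qed.

Lemma disc_tri z0 R z y r : Cmod (z - z0) + r < R -> Cmod (y - z) <= r -> disc z0 R y.
Proof. rewrite /disc; have := Cmod_tri y z z0; lra. Qed.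

Lemma circ_disc y r R z0 x : 0 <= r -> Cmod (y - z0) + r < R -> disc z0 R (y + RtoC r * cis x).
Proof.
move=> r0 h; apply: disc_tri h _.
have -> : (y + r * cis x - y = r * cis x)%C by ring. rewrite Cmod_RtoC_cis //; lra.
Qed.

Lemma circ_mean_jc k z0 R y r x : (forall w, disc z0 R w -> Cc k w) -> 0 <= r -> Cmod (y - z0) + r < R ->
  jc (fun x y => k (y + RtoC r * cis x) * / cis x)%C x y.
Proof.
move=> h r0 hy; jct; apply: (jc_comp k (fun x y => (y + RtoC r * cis x)%C)); last by jct.
by apply: h; apply: circ_disc.
Qed.

Lemma near_room (z z0 : C) r R : Cmod (z - z0) + r < R -> near z (fun y => Cmod (y - z0) + r < R).
Proof.
move=> h; exists (R - r - Cmod (z - z0)); split; first lra.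
move=> y; rewrite /disc => hy; have := Cmod_tri y z z0; lra.
Qed.

Lemma circ_mean_CD k k' z0 R y r : (forall w, disc z0 R w -> CD k w (k' w) /\ Cc k' w) -> 0 <= r ->
  Cmod (y - z0) + r < R ->
  CD (fun y => CI (fun x => k (y + RtoC r * cis x) * / cis x)%C 0 (2 * PI)) y
     (CI (fun x => k' (y + RtoC r * cis x) * / cis x)%C 0 (2 * PI)).
Proof.
move=> h r0 hy.
apply: (CI_param_CD (fun x y => k (y + RtoC r * cis x) * / cis x)%C (fun x y => k' (y + RtoC r * cis x) * / cis x)%C).
- exact: twoPI_pos.
- apply: near_mono (near_room _ _ _ _ hy) => w hw x _; split.
    apply: (circ_mean_jc k z0 R) => // v /h [hv _]; exact: CD_Cc hv.
  have [hd _] := h _ (circ_disc w r R z0 x r0 hw).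
  apply: CD_eq.
    apply: CD_mult; last exact: CD_const.
    apply: (CD_comp (fun y => y + RtoC r * cis x)%C k) hd _.
    by apply: CD_plus; [exact: CD_id|exact: CD_const].
  by cbv beta; ring.
- move=> x _; apply: (circ_mean_jc k' z0 R) => // v /h [_ hv]; exact: hv.
Qed.

Lemma circ_mean_Cc k z0 R y r : (forall w, disc z0 R w -> Cc k w) -> 0 <= r -> Cmod (y - z0) + r < R ->
  Cc (fun y => CI (fun x => k (y + RtoC r * cis x) * / cis x)%C 0 (2 * PI)) y.
Proof.
move=> h r0 hy; apply: (CI_param_Cc (fun x y => k (y + RtoC r * cis x) * / cis x)%C); first exact: twoPI_pos.
apply: near_mono (near_room _ _ _ _ hy) => w hw x _; exact: circ_mean_jc h r0 hw.
Qed.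

Definition holD (z : C) (r : R) (g : C -> C) : Prop := forall y, disc z r y -> Cdiff g y.

Lemma circ_const_neq0 r : 0 < r -> (RtoC r * RtoC (2 * PI))%C <> 0.
Proof.
move=> r0; apply: Cmul_neq0; move/RtoC_inj; [lra|have := PI_RGT_0; lra].
Qed.

Lemma deriv_formula' F f z0 R y r : (forall w, disc z0 R w -> CD F w (f w) /\ Cc f w) -> 0 < r ->
  Cmod (y - z0) + r < R ->
  f y = (/ (RtoC r * RtoC (2 * PI)) * CI (fun x => F (y + RtoC r * cis x) * / cis x)%C 0 (2 * PI))%C.
Proof.
move=> h r0 hy; have hR : 0 < r < (R - Cmod (y - z0)) by lra.
rewrite (deriv_formula F f y _ r _ hR); first by field; split; move/RtoC_inj; [have := PI_RGT_0; lra|lra].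
move=> w hw; apply: h; rewrite /disc in hw *; have := Cmod_tri w y z0; lra.
Qed.

(** Apply the circle formula to f and a primitive F of it. Differentiating once under the integral
    writes f' as a circle mean of f, which is continuous. *)
Lemma cder_Cc f z0 R z : holD z0 R f -> disc z0 R z -> Cc (C_derive f) z.
Proof.
move=> h hz; have R0 : 0 < R by rewrite /disc in hz; have := Cmod_ge_0 (z - z0); lra.
case: (primitive_exists f z0 R R0 h) => F hF.
have hFf w : disc z0 R w -> CD F w (f w) /\ Cc f w by move=> hw; split; [exact: hF|apply: Cdiff_Cc; exact: h].
set r := (R - Cmod (z - z0)) / 2; have r0 : 0 < r by rewrite /r /disc in hz *; lra.
have hr : Cmod (z - z0) + r < R by rewrite /r /disc in hz *; lra.
have hn := near_room _ _ _ _ hr.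
set c := (/ (RtoC r * RtoC (2 * PI)))%C.
have e : near z (fun y => (c * CI (fun x => f (y + RtoC r * cis x) * / cis x) 0 (2 * PI))%C = C_derive f y).
  apply: near_mono (near_near _ _ hn) => y hy; symmetry; apply: CD_unique.
  apply: (CD_ext (fun y => c * CI (fun x => F (y + RtoC r * cis x) * / cis x)%C 0 (2 * PI))%C).
    by apply: near_mono hy => w hw; rewrite /c -(deriv_formula' F f z0 R w r hFf r0 hw).
  apply: CD_scal; apply: circ_mean_CD hFf (Rlt_le _ _ r0) (near_self _ _ hy).
have hc := circ_mean_Cc f z0 R z r (fun w hw => proj2 (hFf w hw)) (Rlt_le _ _ r0) hr.
move=> eps e0; have c0 : 0 < eps / (Cmod c + 1) by apply: Rdiv_lt_0_compat => //; have := Cmod_ge_0 c; lra.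
have ez := near_self _ _ e; apply: near2 (hc _ c0) e => y hy ey; rewrite -ey -ez => {ey}.
set A := CI _ _ _ in hy *; set B := CI _ _ _ in hy *.
have -> : (c * A - c * B = c * (A - B))%C by ring.
rewrite Cmod_mult; have p := Cmod_ge_0 c.
apply: Rle_lt_trans (_ : (Cmod c) * (eps / (Cmod c + 1)) < _); first by apply: Rmult_le_compat_l => //; lra.
have : (Cmod c + 1) * (eps / (Cmod c + 1)) = eps by field; lra.
nra.
Qed.

Lemma hol_C1 f z0 R w : holD z0 R f -> disc z0 R w -> CD f w (C_derive f w) /\ Cc (C_derive f) w.
Proof. by move=> h hw; split; [apply: CD_cder; apply: h|apply: cder_Cc h hw]. Qed.

(** Now that f' is continuous, the formula applies to the pair f, f' and exhibits f' as a circle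
    mean of f, hence differentiable under the integral. *)
Lemma cder_hol f z0 R : holD z0 R f -> holD z0 R (C_derive f).
Proof.
move=> h z hz; have hf w := hol_C1 f z0 R w h.
set r := (R - Cmod (z - z0)) / 2; have r0 : 0 < r by rewrite /r /disc in hz *; lra.
have hr : Cmod (z - z0) + r < R by rewrite /r /disc in hz *; lra.
eexists; apply: (CD_ext (fun y => / (RtoC r * RtoC (2 * PI)) * CI (fun x => f (y + RtoC r * cis x) * / cis x)%C 0 (2 * PI))%C).
  by apply: near_mono (near_room _ _ _ _ hr) => w hw; rewrite -(deriv_formula' f (C_derive f) z0 R w r hf r0 hw).
apply: CD_scal; apply: circ_mean_CD hf (Rlt_le _ _ r0) hr.
Qed.

Lemma cder_near g z : near z (Cdiff g) -> near z (Cdiff (C_derive g)).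
Proof. by move=> [r [r0 h]]; exists r; split=> //; exact: cder_hol. Qed.

Lemma cauchy_estimate f z R M : 0 < R -> holD z R f -> (forall y, disc z R y -> Cmod (f y) <= M) ->
  R * Cmod (C_derive f z) <= M.
Proof.
move=> R0 h hM; apply: Rnot_lt_le => hlt; have d0 := Cmod_ge_0 (C_derive f z).
have M0 : 0 <= M by apply: Rle_trans (Cmod_ge_0 (f z)) (hM z _); exact: disc_center.
have dp : 0 < Cmod (C_derive f z) by nra.
set r := (R + M / Cmod (C_derive f z)) / 2.
have hM2 : M / Cmod (C_derive f z) < R by apply/Rlt_div_l.
have hM3 : 0 <= M / Cmod (C_derive f z) by apply: Rdiv_le_0_compat.
have r0 : 0 < r by rewrite /r; lra.
have hz : Cmod (z - z) + r < R by rewrite Cmod_sub_self /r; lra.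
have e := deriv_formula' f (C_derive f) z R z r (fun w => hol_C1 f z R w h) r0 hz.
have hb : Cmod (CI (fun x => f (z + RtoC r * cis x) * / cis x)%C 0 (2 * PI)) <= (2 * PI - 0) * M.
  apply: (isCI_bound (fun x => f (z + RtoC r * cis x) * / cis x)%C _ _ _ _ twoPI_pos).
    move=> x _; rewrite Cmod_mult Cmod_inv; last exact: cis_neq0.
    by rewrite Cmod_cis Rinv_1 Rmult_1_r; apply: hM; apply: circ_disc => //; lra.
  apply: CI_isCI => [|x _]; first exact: twoPI_pos.
  apply: (jc_pc (fun x y => f (y + RtoC r * cis x) * / cis x)%C); apply: circ_mean_jc (Rlt_le _ _ r0) hz.
  move=> w hw; apply: Cdiff_Cc; exact: h.
have hP := PI_RGT_0.
move: e => /(f_equal Cmod); rewrite Cmod_mult Cmod_inv; last exact: circ_const_neq0.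
rewrite Cmod_mult !Cmod_R !Rabs_pos_eq; try lra. move=> e.
have : r * (2 * PI) * Cmod (C_derive f z) <= 2 * PI * M by rewrite e -Rmult_assoc Rinv_r; nra.
move=> h3; have h4 : r * Cmod (C_derive f z) <= M by nra.
have : M < r * Cmod (C_derive f z).
  have -> : M = M / Cmod (C_derive f z) * Cmod (C_derive f z) by field; lra.
  apply: Rmult_lt_compat_r => //; rewrite /r; lra.
lra.
Qed.

Lemma Re_inv_one_minus (s : C) : Cmod s < 1 -> / 2 <= Re (/ (1 - s)).
Proof.
case: s => x y hs; have : Cmod (x, y) ^ 2 < 1 by have := Cmod_ge_0 (x, y); nra.
rewrite Cmod2_alt /= => h1; rewrite /Re /Cinv /=.
have p : 0 < (1 + - x) * ((1 + - x) * 1) + (0 + - y) * ((0 + - y) * 1) by nra.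
apply/Rle_div_r => //; nra.
Qed.

(** Cauchy's formula up to the value of the kernel integral. The circle is shrunk linearly to z; the
    t-derivative of the integral has an integrand which is an exact x-derivative, so it vanishes
    over a period and the integral at t = 1 equals that at t = 0. *)
Lemma offcenter_formula F z0 R r z : holD z0 R F -> r < R -> disc z0 r z ->
  let w := fun x => (RtoC r * cis x * / (z0 + RtoC r * cis x - z))%C in
  (forall x, (z0 + RtoC r * cis x - z)%C <> 0) /\
  isCI (fun x => F (z0 + RtoC r * cis x) * w x)%C 0 (2 * PI) (F z * CI w 0 (2 * PI)).
Proof.
move=> h hr hz w; have r0 : 0 < r by rewrite /disc in hz; have := Cmod_ge_0 (z - z0); lra.
have nz x : (z0 + RtoC r * cis x - z)%C <> 0.
  move=> e; move: hz; rewrite /disc; have -> : (z - z0 = r * cis x)%C.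
    have -> : (r * cis x = (z0 + RtoC r * cis x - z) + (z - z0))%C by ring. rewrite e; ring.
  rewrite Cmod_RtoC_cis; lra.
split=> //.
set ga := fun x => (z0 + RtoC r * cis x)%C.
have hga x : Cmod (ga x - z0) <= r.
  have -> : (ga x - z0 = r * cis x)%C by rewrite /ga; ring. rewrite Cmod_RtoC_cis; lra.
have din t x : 0 <= t <= 1 -> disc z0 R (z + RtoC t * (ga x - z)).
  move=> ht; apply: seg_disc ht _ _; rewrite /disc; first by rewrite /disc in hz; lra.
  have := hga x; lra.
set f := C_derive F.
have hF t x := hol_C1 F z0 R _ h (din t x _).
have jga (t : C) x : jc (fun x t => z + t * (ga x - z))%C x t by rewrite /ga; jct.
have jF (t : C) x : disc z0 R (z + t * (ga x - z)) -> jc (fun x t => F (z + t * (ga x - z)) * w x)%C x t.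
  move=> ht; apply: jc_mult.
    apply: (jc_comp F (fun x t => z + t * (ga x - z))%C) => //; apply: Cdiff_Cc; exact: h.
  rewrite /w; apply: jc_mult; first by jct. by apply: jc_inv; [jct|exact: nz].
have jf (t : C) x : disc z0 R (z + t * (ga x - z)) -> jc (fun x t => f (z + t * (ga x - z)) * (RtoC r * cis x))%C x t.
  move=> ht; apply: jc_mult; last by jct.
  by apply: (jc_comp f (fun x t => z + t * (ga x - z))%C) => //; exact: cder_Cc h ht.
set I := fun t => CI (fun x => F (z + t * (ga x - z)) * w x)%C 0 (2 * PI).
have nearin t : 0 <= t <= 1 -> near (RtoC t) (fun s => forall x, disc z0 R (z + s * (ga x - z))).
  move=> ht; exists ((R - r) / (2 * r + 1)); split; first by apply: Rdiv_lt_0_compat; lra.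
  move=> s; rewrite /disc => hs x.
  have ht2 : Cmod (z + RtoC t * (ga x - z) - z0) <= r.
    have -> : (z + t * (ga x - z) - z0 = RtoC (1 - t) * (z - z0) + RtoC t * (ga x - z0))%C by rewrite RtoC_minus; ring.
    apply: Rle_trans (Cmod_triangle _ _) _; rewrite !Cmod_mult !Cmod_R !Rabs_pos_eq; try lra.
    have := hga x; rewrite /disc in hz; nra.
  have -> : (z + s * (ga x - z) - z0 = (s - t) * (ga x - z) + (z + RtoC t * (ga x - z) - z0))%C by ring.
  apply: Rle_lt_trans (Cmod_triangle _ _) _; rewrite Cmod_mult.
  have h2r : Cmod (ga x - z) <= 2 * r + 1 by have := Cmod_tri (ga x) z0 z; have := hga x; rewrite (Cmod_sym z0) /disc in hz *; lra.
  have e : (R - r) / (2 * r + 1) * (2 * r + 1) = R - r by field; lra.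
  have : Cmod (s - t) * Cmod (ga x - z) < R - r.
    rewrite -e; apply: Rle_lt_trans (_ : Cmod (s - t) * (2 * r + 1) < _).
      by apply: Rmult_le_compat_l => //; exact: Cmod_ge_0.
    apply: Rmult_lt_compat_r => //; lra.
  lra.
have hI t : 0 <= t <= 1 -> CD I t 0.
  move=> ht; have i0 : CI (fun x => f (z + RtoC t * (ga x - z)) * (RtoC r * cis x))%C 0 (2 * PI) = 0.
    have i1 := CI_isCI _ _ _ twoPI_pos (fun x _ => jc_pc _ _ _ (jf (RtoC t) x (din t x ht))).
    have pcf x : pc (fun x => Ci * (f (z + RtoC t * (ga x - z)) * (RtoC r * cis x)))%C x.
      apply: (jc_pc (fun x t => Ci * (f (z + t * (ga x - z)) * (RtoC r * cis x)))%C _ (RtoC t)).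
      by apply: jc_mult; [exact: jc_cst|apply: jf; exact: din].
    have Cin : Ci <> 0 by move/(f_equal snd) => /=; lra.
    have : (Ci * CI (fun x => f (z + RtoC t * (ga x - z)) * (RtoC r * cis x))%C 0 (2 * PI))%C = 0; last by case/Cmul_eq0.
    rewrite -(isCI_unique _ _ _ _ (isCI_scal Ci _ _ _ _ i1)).
    have RDc (c : C) x : RD (fun x => c * cis x)%C x (Ci * cis x * c).
      by apply: (RD_comp (fun v => c * v)%C); [apply: CD_eq (CD_scal _ _ _ _ (CD_id _)) _; ring|exact: RD_cis].
    case: (Req_dec t 0) => [e|nt].
    - have -> : (RtoC 0) = (f z * RtoC r * cis (2 * PI) - f z * RtoC r * cis 0)%C by rewrite cis_2PI; ring.
      apply: isCI_unique; apply: (isCI_FTC (fun x => f z * RtoC r * cis x)%C) => [|x _|x _ //]; first exact: twoPI_pos.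
      have := RDc (f z * RtoC r)%C x; rewrite e; have -> : (z + 0 * (ga x - z) = z)%C by ring.
      by have -> : (Ci * cis x * (f z * r) = Ci * (f z * (r * cis x)))%C by ring.
    - have tn : RtoC t <> 0 by move/RtoC_inj.
      have -> : (RtoC 0) = (/ RtoC t * F (z + RtoC t * (ga (2 * PI)%R - z)) - / RtoC t * F (z + RtoC t * (ga 0 - z)))%C by rewrite /ga cis_2PI; ring.
      apply: isCI_unique; apply: (isCI_FTC (fun x => / RtoC t * F (z + RtoC t * (ga x - z)))%C) => [|x _|x _ //]; first exact: twoPI_pos.
      set G := fun v => (/ RtoC t * F (z + RtoC t * (z0 + RtoC r * v - z)))%C.
      have hG : CD G (cis x) (RtoC r * f (z + RtoC t * (ga x - z)))%C.
        apply: CD_eq.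
          apply: CD_scal; apply: (CD_comp (fun v => z + RtoC t * (z0 + RtoC r * v - z))%C F); first exact: (CD_cder _ _ (h _ (din t x ht))).
          apply: CD_plus; first exact: CD_const. apply: CD_scal; apply: CD_minus; last exact: CD_const.
          apply: CD_plus; first exact: CD_const. apply: CD_scal; exact: CD_id.
        by cbv beta; rewrite /f /ga; field.
      have -> : (Ci * (f (z + t * (ga x - z)) * (r * cis x)) = Ci * cis x * (RtoC r * f (z + RtoC t * (ga x - z))))%C by ring.
      exact: RD_comp hG (RD_cis x).
  rewrite -i0; apply: (CI_param_CD (fun x t => F (z + t * (ga x - z)) * w x)%C (fun x t => f (z + t * (ga x - z)) * (RtoC r * cis x))%C).
  - exact: twoPI_pos.
  - apply: near_mono (nearin t ht) => s hs x _; split; first by apply: jF.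
    apply: CD_eq.
      apply: CD_mult; last exact: CD_const.
      apply: (CD_comp (fun t => z + t * (ga x - z))%C F); first exact: (CD_cder _ _ (h _ (hs x))).
      by apply: CD_plus; [exact: CD_const|apply: CD_mult; [exact: CD_id|exact: CD_const]].
    by cbv beta; rewrite /w /f /ga; field; exact: nz.
  - by move=> x _; apply: jf; exact: din.
have e1 : I 1 = I 0.
  have := mean_value_ineq I (fun _ => 0%C) 0 1 0.
  have es s : seg 0 1 s = RtoC s by rewrite /seg; ring.
  move=> hm; have : Cmod (I 1 - I 0) <= 0 * Cmod (1 - 0).
    by apply: hm => s hs; rewrite es Cmod_0; split; [exact: hI|lra].
  rewrite Rmult_0_l => h1; have /Cmod_eq_0 h2 : Cmod (I 1 - I 0) = 0 by apply: Rle_antisym => //; exact: Cmod_ge_0.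
  have -> : I 1 = (I 1 - I 0 + I 0)%C by ring. rewrite h2; ring.
have l01 : 0 <= 1 <= 1 by lra.
have l00 : 0 <= 0 <= 1 by lra.
have i1 := CI_isCI _ _ _ twoPI_pos (fun x _ => jc_pc _ _ _ (jF (RtoC 1) x (din 1 x l01))).
have ew : I 0 = (F z * CI w 0 (2 * PI))%C.
  have hw : isCI w 0 (2 * PI) (CI w 0 (2 * PI)).
    apply: CI_isCI => [|x _]; first exact: twoPI_pos.
    apply: (jc_pc (fun x _ => w x) _ 0); rewrite /w; apply: jc_mult; first by jct.
    by apply: jc_inv; [jct|exact: nz].
  apply: isCI_unique; apply: isCI_ext (isCI_scal (F z) _ _ _ _ hw) => [|x _]; first exact: twoPI_pos.
  by have -> : (z + 0 * (ga x - z) = z)%C by ring.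
rewrite -ew -e1; apply: isCI_ext i1 => [|x _]; first exact: twoPI_pos.
by have -> : (z + 1 * (ga x - z) = z0 + r * cis x)%C by rewrite /ga; ring.
Qed.

(** Landau's trick: the off-centre formula for F^n gives |F z|^n <= (2 r / d) M^n, using only crude
    bounds on the kernel, and the constant disappears as n grows. *)
Lemma max_principle F z0 R r M z : holD z0 R F -> r < R ->
  (forall x, 0 <= x <= 2 * PI -> Cmod (F (z0 + RtoC r * cis x)%C) <= M) -> disc z0 r z -> Cmod (F z) <= M.
Proof.
move=> h hr hM hz; have r0 : 0 < r by rewrite /disc in hz; have := Cmod_ge_0 (z - z0); lra.
have hP := PI_RGT_0.
have M0 : 0 <= M by apply: Rle_trans (Cmod_ge_0 _) (hM 0 _); lra.
set d := r - Cmod (z - z0); have d0 : 0 < d by rewrite /d /disc in hz *; lra.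
have main n : Cmod (F z) ^ n <= 2 * r / d * M ^ n.
  have hn : holD z0 R (fun y => F y ^ n)%C by move=> y /h hy; exact: Cdiff_pow.
  case: (offcenter_formula (fun y => F y ^ n)%C z0 R r z hn hr hz) => nz hI.
  set w := fun x => (RtoC r * cis x * / (z0 + RtoC r * cis x - z))%C in hI.
  have hb := isCI_bound _ _ _ _ (r / d * M ^ n) twoPI_pos _ hI.
  have hwI : isCI w 0 (2 * PI) (CI w 0 (2 * PI)).
    apply: CI_isCI => [|x _]; first exact: twoPI_pos.
    apply: (jc_pc (fun x _ => w x) _ 0); rewrite /w; apply: jc_mult; first by jct.
    by apply: jc_inv; [jct|exact: nz].
  have hre : PI <= Re (CI w 0 (2 * PI)).
    have i1 := is_RInt_fct_extend_fst (U := R_NormedModule) (V := R_NormedModule) _ _ _ _ hwI.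
    have i2 := is_RInt_const (V := R_NormedModule) 0 (2 * PI) (/ 2).
    have := is_RInt_le _ _ _ _ _ _ twoPI_pos i2 i1 _; rewrite /scal /= /mult /= => hh.
    have : (2 * PI - 0) * / 2 <= fst (CI w 0 (2 * PI)).
      apply: hh => x _; have ex : (/ (1 - (z - z0) / (RtoC r * cis x)))%C = w x.
        by rewrite /w; field; repeat split; try exact: cis_neq0; try exact: nz; move/RtoC_inj; lra.
      change (/ 2 <= Re (w x)); rewrite -ex; apply: Re_inv_one_minus; rewrite Cmod_div; last by apply: Cmul_neq0; [move/RtoC_inj; lra|exact: cis_neq0].
      rewrite Cmod_RtoC_cis; last lra. apply/Rlt_div_l => //; move: hz; rewrite /disc Rmult_1_l //.
    move=> h2; change (PI <= fst (CI w 0 (2 * PI))); have e2 : (2 * PI - 0) * / 2 = PI by field.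
    apply: Rle_trans h2; rewrite e2; exact: Rle_refl.
  have hk : PI <= Cmod (CI w 0 (2 * PI)).
    by apply: Rle_trans hre _; apply: Rle_trans (Rle_abs _) (re_le_Cmod _).
  rewrite Cmod_mult Cmod_pow in hb.
  have {}hb : Cmod (F z) ^ n * Cmod (CI w 0 (2 * PI)) <= (2 * PI - 0) * (r / d * M ^ n).
    apply: hb => x hx; rewrite Cmod_mult Cmod_pow Rmult_comm; apply: Rmult_le_compat.
    - exact: Cmod_ge_0.
    - by apply: pow_le; exact: Cmod_ge_0.
    - rewrite /w Cmod_mult Cmod_RtoC_cis; last lra. rewrite Cmod_inv //.
      apply: Rmult_le_compat_l; first lra. apply: Rinv_le_contravar => //.
      have := Cmod_tri (z0 + r * cis x) z z0.
      have -> : (z0 + r * cis x - z0 = r * cis x)%C by ring.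
      rewrite Cmod_RtoC_cis /d; lra.
    - by apply: pow_incr; split; [exact: Cmod_ge_0|exact: hM].
  have p0 : 0 <= Cmod (F z) ^ n by apply: pow_le; exact: Cmod_ge_0.
  have : Cmod (F z) ^ n * PI <= 2 * PI * (r / d * M ^ n) by nra.
  have -> : 2 * PI * (r / d * M ^ n) = (2 * r / d * M ^ n) * PI by field; lra.
  by move/Rmult_le_reg_r; apply.
apply: Rnot_lt_le => hlt.
case: M0 => [M0|M0].
- set q := Cmod (F z) / M; have q1 : 1 < q by apply/Rlt_div_r => //; lra.
  have q2 : Rabs q > 1 by rewrite Rabs_pos_eq; lra.
  case: (Pow_x_infinity q q2 (2 * r / d + 1)) => n /(_ n (Nat.le_refl _)).
  rewrite Rabs_pos_eq; last by apply: pow_le; lra.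
  have -> : q ^ n = Cmod (F z) ^ n / M ^ n by rewrite /q /Rdiv Rpow_mult_distr pow_inv.
  have pM := pow_lt _ n M0.
  move/Rge_le; move/(Rle_div_r _ _ _ pM) => h2; have := main n; nra.
- have := main 1%nat; rewrite -M0 /=; lra.
Qed.

(** Hadamard's quotient, the integral of f' (p + t (z - p)) over [0, 1], is holomorphic by
    differentiation under the integral. *)
Lemma factor_center f p R : 0 < R -> holD p R f -> exists f1, holD p R f1 /\
  forall z, disc p R z -> f z = (f p + (z - p) * f1 z)%C.
Proof.
move=> R0 h; set f1 := fun z => CI (fun t => C_derive f (seg p z t)) 0 1.
have hp := disc_center p R R0.
have jseg t z : jc (fun t z => seg p z t) t z.
  by rewrite /seg; jct; apply: jc_fst; move=> eps e0; exists eps; split=> // s; rewrite -RtoC_minus Cmod_R.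
have jd k z t : holD p R k -> disc p R z -> 0 <= t <= 1 -> jc (fun t z => k (seg p z t)) t z.
  move=> hk hz ht; apply: (jc_comp k (fun t z => seg p z t)) => //; apply: Cdiff_Cc; apply: hk; exact: seg_disc.
have h1 := cder_hol _ _ _ h; have h2 := cder_hol _ _ _ h1.
exists f1; split=> [z hz|z hz].
- exists (CI (fun t => RtoC t * C_derive (C_derive f) (seg p z t))%C 0 1).
  apply: (CI_param_CD (fun t z => C_derive f (seg p z t)) (fun t z => RtoC t * C_derive (C_derive f) (seg p z t))%C).
  + lra.
  + apply: near_mono (near_open _ _ _ hz) => w hw t ht; split; first exact: jd.
    apply: (CD_comp (fun z => seg p z t) (C_derive f)); first by apply: CD_cder; apply: h1; apply: seg_disc.
    apply: CD_eq; first by rewrite /seg; apply: CD_plus; [exact: CD_const|apply: CD_scal; apply: CD_minus; [exact: CD_id|exact: CD_const]].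
    ring.
  + move=> t ht; apply: jc_mult; last exact: jd.
    by apply: jc_fst; move=> eps e0; exists eps; split=> // s; rewrite -RtoC_minus Cmod_R.
- have e : segI (C_derive f) p z = (f z - f p)%C.
    apply: segI_FTC => t ht; apply: hol_C1 h _; exact: seg_disc.
  have i : isCI (fun t => C_derive f (seg p z t)) 0 1 (f1 z).
    by apply: CI_isCI => [|t ht]; [lra|apply: (jc_pc (fun t z => C_derive f (seg p z t))); exact: jd].
  have -> : ((z - p) * f1 z)%C = segI (C_derive f) p z.
    symmetry; apply: isCI_unique; apply: isCI_ext (isCI_scal (z - p) _ _ _ _ i) => [|t _]; [lra|ring].
  rewrite e; ring.
Qed.

(** * Zeros and removable singularities *)

(** A version of the quotient that is one total function, with f z = f p + (z - p) [dquot f p z] for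
    every z; zeros can thus be divided out repeatedly without tracking domains. *)
Definition dquot (f : C -> C) (p z : C) : C :=
  if excluded_middle_informative (z = p) then C_derive f p else ((f z - f p) / (z - p))%C.

Lemma dquot_eq f p z : f z = (f p + (z - p) * dquot f p z)%C.
Proof.
rewrite /dquot; destruct (excluded_middle_informative (z = p)) as [->|n] => /=; first by ring.
by field; exact: Csub_neq0.
Qed.

Lemma dquot_neq f p z : z <> p -> dquot f p z = ((f z - f p) / (z - p))%C.
Proof. by rewrite /dquot; destruct (excluded_middle_informative (z = p)). Qed.

Lemma dquot_self f p : dquot f p p = C_derive f p.
Proof. by rewrite /dquot; destruct (excluded_middle_informative (p = p)). Qed.

Lemma near_neq (z p : C) : z <> p -> near z (fun y => y <> p).
Proof. move=> n; exact: (Cc_neq (fun y => y) z p (CD_Cc _ _ _ (CD_id z)) n). Qed.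

Lemma dquot_hol f p : near p (Cdiff f) -> forall z, Cdiff f z -> Cdiff (dquot f p) z.
Proof.
move=> [r [r0 hr]] z hz; case: (excluded_middle_informative (z = p)) => [->|n].
- case: (factor_center f p r r0 hr) => f1 [h1 e1].
  apply: (Cdiff_ext f1); last by apply: h1; exact: disc_center.
  apply: near_mono (near_disc p r r0) => y hy; rewrite /dquot.
  destruct (excluded_middle_informative (y = p)) as [e|ny] => /=; last by rewrite (e1 y hy); field; exact: Csub_neq0.
  subst y; symmetry; apply: CD_unique; apply: (CD_ext (fun z => f p + (z - p) * f1 z)%C).
    by apply: near_mono (near_disc p r r0) => w hw; rewrite -e1.
  case: (h1 p hy) => l hl; apply: CD_eq.
    apply: CD_plus; first exact: CD_const. apply: CD_mult hl. apply: CD_minus; [exact: CD_id|exact: CD_const].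
  by cbv beta; ring.
- apply: (Cdiff_ext (fun z => (f z - f p) / (z - p))%C).
    by apply: near_mono (near_neq _ _ n) => y ny; rewrite dquot_neq.
  by hol; exact: Csub_neq0.
Qed.

Lemma holD_near_at z0 R f p : holD z0 R f -> disc z0 R p -> near p (Cdiff f).
Proof. move=> h hp; apply: near_mono (near_open _ _ _ hp); exact: h. Qed.

Lemma dquot_holD f z0 R p : holD z0 R f -> disc z0 R p -> holD z0 R (dquot f p).
Proof. move=> h hp z hz; apply: dquot_hol (h z hz); exact: holD_near_at h hp. Qed.

(** One number d is at once the radius, the reciprocal of the index threshold and the reciprocal of
    the bound, so a single minimum over a cover of the circle settles all three. *)
Lemma circle_uniform (E : nat -> C -> R) z0 r :
  (forall x, 0 <= x <= 2 * PI -> exists d, 0 < d /\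
     forall n y, / d <= INR n -> disc (z0 + RtoC r * cis x) d y -> E n y <= / d) ->
  exists M, forall n x, M <= INR n -> 0 <= x <= 2 * PI -> E n (z0 + RtoC r * cis x)%C <= M.
Proof.
move=> h; pose pt x := (z0 + RtoC r * cis x)%C.
have hpt x : pc pt x by apply: (jc_pc (fun x _ => pt x) _ 0); rewrite /pt; jct.
have ch x : exists d, 0 <= x <= 2 * PI -> 0 < d /\ forall n s, / d <= INR n -> Rabs (s - x) < d -> E n (pt s) <= / d.
  case: (excluded_middle_informative (0 <= x <= 2 * PI)) => [hx|n]; last by exists 1 => /n.
  case: (h x hx) => d [d0 hd]; case: (hpt x d d0) => e [e0 he]; exists (Rmin d e) => _.
  have m1 := Rmin_l d e; have m2 := Rmin_r d e; have m0 : 0 < Rmin d e by exact: Rmin_pos.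
  have mi : / d <= / Rmin d e by apply: Rinv_le_contravar.
  split=> // n s hn hs; apply: (Rle_trans _ _ _ _ mi); apply: hd; first lra.
  apply: he; lra.
pose d x := proj1_sig (constructive_indefinite_description _ (ch x)).
have hd x : 0 <= x <= 2 * PI -> 0 < d x /\ forall n s, / d x <= INR n -> Rabs (s - x) < d x -> E n (pt s) <= / d x.
  by rewrite /d; case: constructive_indefinite_description => d' /=; apply.
case: (compact_interval 0 (2 * PI) d) => [x /hd []//|e [e0 he]].
exists (/ e) => n x hn hx; case: (he x hx) => s [/hd [ds0 hs] [h1 h2]].
have mi : / d s <= / e by apply: Rinv_le_contravar.
by apply: (Rle_trans _ _ _ _ mi); apply: hs => //; lra.
Qed.

Lemma circle_bounded f z0 R r : holD z0 R f -> 0 <= r < R ->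
  exists M, forall x, 0 <= x <= 2 * PI -> Cmod (f (z0 + RtoC r * cis x)%C) <= M.
Proof.
move=> h hr; case: (circle_uniform (fun _ y => Cmod (f y)) z0 r) => [x hx|M hM].
- set p := (z0 + RtoC r * cis x)%C.
  have hp : disc z0 R p by apply: circ_disc; rewrite ?Cmod_sub_self; lra.
  case: (Cdiff_Cc _ _ (h p hp) 1 Rlt_0_1) => d [d0 hd].
  have c0 := Cmod_ge_0 (f p).
  have i0 : 0 < / (Cmod (f p) + 1) by apply: Rinv_0_lt_compat; lra.
  exists (Rmin d (/ (Cmod (f p) + 1))); split; first exact: Rmin_pos.
  move=> n y _ hy; have m1 := Rmin_l d (/ (Cmod (f p) + 1)); have m2 := Rmin_r d (/ (Cmod (f p) + 1)).
  have {}hd := hd y (Rlt_le_trans _ _ _ hy m1).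
  apply: Rle_trans (_ : Cmod (f p) + 1 <= _); first by have := Cmod_le_add (f y) (f p); lra.
  rewrite -{1}(Rinv_inv (Cmod (f p) + 1)); apply: Rinv_le_contravar => //; exact: Rmin_pos.
- case: (INR_unbounded M) => n hn; exists M => x hx; apply: (hM n x) => //; lra.
Qed.

Lemma Rle_lim_r (a c : R) R r0 : r0 < R -> (forall r, r0 < r < R -> r * a <= c) -> R * a <= c.
Proof.
move=> h0 h; apply: Rnot_lt_le => hlt.
have a0 : 0 < Rabs a + 1 by have := Rabs_pos a; lra.
set e := Rmin ((R - r0) / 2) ((R * a - c) / (2 * (Rabs a + 1))).
have e0 : 0 < e by apply: Rmin_pos; [lra|apply: Rdiv_lt_0_compat; lra].
have m1 : e <= (R - r0) / 2 by exact: Rmin_l. have m2 : e <= (R * a - c) / (2 * (Rabs a + 1)) by exact: Rmin_r.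
have hre : r0 < R - e < R by lra.
have h1 := h (R - e) hre.
have : e * a <= (R * a - c) / (2 * (Rabs a + 1)) * (Rabs a + 1).
  apply: Rle_trans (_ : e * (Rabs a + 1) <= _); first by have := Rle_abs a; nra.
  by apply: Rmult_le_compat_r; lra.
have -> : (R * a - c) / (2 * (Rabs a + 1)) * (Rabs a + 1) = (R * a - c) / 2 by field; lra.
lra.
Qed.

(** If the division by z - p never stops, f = (z - p)^n v_n for all n, and the maximum principle for
    v_n gives |f z| <= M (|z - p| / r)^n, which tends to 0. *)
Lemma order_dichotomy f p R : 0 < R -> holD p R f -> (forall z, disc p R z -> f z = 0) \/
  exists n v, holD p R v /\ v p <> 0 /\ forall z, f z = ((z - p) ^ n * v z)%C.
Proof.
move=> R0 h; case: (excluded_middle_informative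
  (exists n v, holD p R v /\ v p <> 0 /\ forall z, f z = ((z - p) ^ n * v z)%C)) => [|hn]; first by right.
left => z hz; have hp := disc_center p R R0.
have main n : exists v, holD p R v /\ forall z, f z = ((z - p) ^ n * v z)%C.
  elim: n => [|n [v [hv e]]]; first by exists f; split=> // w; rewrite /=; ring.
  exists (dquot v p); split; first exact: dquot_holD.
  move=> w; rewrite e {1}(dquot_eq v p w).
  have -> : v p = 0; last by rewrite /=; ring.
  apply: Classical_Prop.NNPP => n0; apply: hn; by exists n, v.
set r := (R + Cmod (z - p)) / 2; have z0 := Cmod_ge_0 (z - p).
have hr : Cmod (z - p) < r < R by rewrite /disc /r in hz *; lra.
case: (circle_bounded f p R r h) => [|M hM]; first lra.
apply: Cmod_eq_0; apply: Rle_antisym; last exact: Cmod_ge_0.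
apply: Rnot_lt_le => fz0.
have main2 n : Cmod (f z) <= M * (Cmod (z - p) / r) ^ n.
  case: (main n) => v [hv e]; rewrite e Cmod_mult Cmod_pow.
  have rn : 0 < r ^ n by apply: pow_lt; lra.
  have : Cmod (v z) <= M / r ^ n.
    apply: (max_principle v p R r) => //; [lra| |rewrite /disc; lra]; move=> x hx; apply/Rle_div_r => //.
    have := hM x hx; rewrite e Cmod_mult Cmod_pow.
    have -> : (p + r * cis x - p = r * cis x)%C by ring.
    rewrite Cmod_RtoC_cis; lra.
  rewrite /Rdiv Rpow_mult_distr pow_inv => hvz.
  have zn : 0 <= Cmod (z - p) ^ n by apply: pow_le.
  have := Rmult_le_compat_l _ _ _ zn hvz; rewrite /Rdiv; lra.
have q1 : Rabs (Cmod (z - p) / r) < 1.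
  rewrite Rabs_pos_eq; last by apply: Rdiv_le_0_compat; lra.
  by apply/Rlt_div_l; lra.
have k0 : 0 < Cmod (f z) / (Rabs M + 1) by apply: Rdiv_lt_0_compat => //; have := Rabs_pos M; lra.
case: (pow_lt_1_zero _ q1 _ k0) => n /(_ n (Nat.le_refl _)).
have qp : 0 <= (Cmod (z - p) / r) ^ n by apply: pow_le; apply: Rdiv_le_0_compat; lra.
rewrite Rabs_pos_eq // => h3; have h4 := main2 n.
have e : Cmod (f z) = (Rabs M + 1) * (Cmod (f z) / (Rabs M + 1)) by field; have := Rabs_pos M; lra.
have := Rle_abs M; have := Rabs_pos M; nra.
Qed.

Lemma exists_punct p r : 0 < r -> exists z, disc p r z /\ z <> p.
Proof.
move=> r0; exists (p + RtoC (r / 2))%C; split.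
  rewrite /disc; have -> : (p + RtoC (r / 2) - p = RtoC (r / 2))%C by ring. rewrite Cmod_R Rabs_pos_eq; lra.
move=> e; have : RtoC (r / 2) = 0.
  have -> : RtoC (r / 2) = (p + RtoC (r / 2) - p)%C by ring. rewrite e; ring.
by move/RtoC_inj; lra.
Qed.

Lemma near_dichotomy f p : near p (Cdiff f) ->
  near p (fun z => f z = 0) \/ exists n v, near p (Cdiff v) /\ v p <> 0 /\ forall z, f z = ((z - p) ^ n * v z)%C.
Proof.
move=> [r [r0 h]]; case: (order_dichotomy f p r r0 h) => [h0|[n [v [hv [v0 e]]]]].
- by left; exists r.
- by right; exists n, v; split=> //; exists r.
Qed.

Lemma near_punct_neq0 f p n v : near p (Cdiff v) -> v p <> 0 -> (forall z, f z = ((z - p) ^ n * v z)%C) ->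
  near p (fun z => z <> p -> f z <> 0).
Proof.
move=> /near_self /Cdiff_Cc hc v0 e; apply: near_mono (Cc_neq _ _ _ hc v0) => z vz nz; rewrite e.
apply: Cmul_neq0 => //; apply: Cpow_nz; exact: Csub_neq0.
Qed.

Lemma identity_disc f p R : 0 < R -> holD p R f -> near p (fun z => f z = 0) -> forall z, disc p R z -> f z = 0.
Proof.
move=> R0 h hn; case: (order_dichotomy f p R R0 h) => // [[n [v [hv [v0 e]]]]].
have hv' := holD_near_at _ _ _ _ hv (disc_center p R R0).
case: (near_and _ _ _ hn (near_punct_neq0 _ _ _ _ hv' v0 e)) => r [r0 hr].
by case: (exists_punct p r r0) => z [/hr [z0 nz] np]; case: (nz np).
Qed.

(** The function (z - p)^2 g is differentiable at p with value and derivative 0, because g is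
    bounded; dividing by z - p twice gives the extension. *)
Lemma removable g p R M : 0 < R -> (forall y, disc p R y -> y <> p -> Cdiff g y /\ Cmod (g y) <= M) ->
  exists g1, holD p R g1 /\ forall y, y <> p -> g1 y = g y.
Proof.
move=> R0 h; set k := fun z => ((z - p) * (z - p) * g z)%C.
have Mp : 0 <= M.
  case: (exists_punct p R R0) => z [h1 h2]; case: (h z h1 h2) => _; have := Cmod_ge_0 (g z); lra.
have ck : CD k p 0.
  apply/CD_eps => eps e0; have k0 : 0 < eps / (M + 1) by apply: Rdiv_lt_0_compat; lra.
  apply: near2 (near_disc p R R0) (near_disc p _ k0) => y hy hd.
  have -> : (k y - k p - 0 * (y - p) = (y - p) * (y - p) * g y)%C by rewrite /k; ring.
  case: (excluded_middle_informative (y = p)) => [->|n].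
    have -> : ((p - p) * (p - p) * g p = 0)%C by ring. rewrite Cmod_0 Cmod_sub_self; lra.
  case: (h y hy n) => _ hM; rewrite !Cmod_mult.
  have c0 := Cmod_ge_0 (y - p); rewrite /disc in hd.
  have : Cmod (y - p) * (M + 1) <= eps.
    have -> : eps = eps / (M + 1) * (M + 1) by field; lra. apply: Rmult_le_compat_r; lra.
  have := Cmod_ge_0 (g y); nra.
have hk : holD p R k.
  move=> y hy; case: (excluded_middle_informative (y = p)) => [->|n]; first exact: CD_Cdiff ck.
  by case: (h y hy n) => hg _; rewrite /k; hol.
have hp := disc_center p R R0.
have h1 := dquot_holD _ _ _ _ hk hp; have h2 := dquot_holD _ _ _ _ h1 hp.
have k0 : k p = 0 by rewrite /k; ring.
have d0 : dquot k p p = 0 by rewrite dquot_self; exact: CD_unique.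
exists (dquot (dquot k p) p); split=> // y n.
rewrite dquot_neq // d0 dquot_neq // k0 /k; field; exact: Csub_neq0.
Qed.

Lemma liouville f M : (forall z, Cdiff f z) -> (forall z, Cmod (f z) <= M) -> forall z w, f z = f w.
Proof.
move=> h hM; have d0 z : C_derive f z = 0.
  apply: Cmod_eq_0; apply: Rle_antisym; last exact: Cmod_ge_0.
  apply: Rnot_lt_le => hp; set R := (M + 1) / Cmod (C_derive f z).
  have M0 : 0 <= M by apply: Rle_trans (Cmod_ge_0 (f z)) (hM z).
  have R0 : 0 < R by apply: Rdiv_lt_0_compat; lra.
  have := cauchy_estimate f z R M R0 (fun y _ => h y) (fun y _ => hM y).
  have -> : R * Cmod (C_derive f z) = M + 1 by rewrite /R; field; lra. lra.
move=> z w; have := mean_value_ineq f (C_derive f) w z 0.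
move=> hm; have h1 : Cmod (f z - f w) <= 0 * Cmod (z - w).
  apply: hm => t _; rewrite d0 Cmod_0; split; [rewrite -(d0 (seg w z t)); exact: CD_cder|lra].
have /Cmod_eq_0 h2 : Cmod (f z - f w) = 0 by apply: Rle_antisym; [lra|exact: Cmod_ge_0].
have -> : f z = (f z - f w + f w)%C by ring. rewrite h2; ring.
Qed.

Lemma schwarz m p R : 0 < R -> holD p R m -> (forall z, disc p R z -> Cmod (m z) <= 1) -> m p = 0 ->
  (forall z, disc p R z -> R * Cmod (m z) <= Cmod (z - p)) /\ R * Cmod (C_derive m p) <= 1.
Proof.
move=> R0 h h1 m0; have hp := disc_center p R R0; have hd := dquot_holD _ _ _ _ h hp.
have hq z : disc p R z -> R * Cmod (dquot m p z) <= 1.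
  move=> hz; apply: (Rle_lim_r _ _ _ (Cmod (z - p))); first by [].
  move=> r hr; have r0 : 0 < r by have := Cmod_ge_0 (z - p); lra.
  rewrite Rmult_comm; apply/Rle_div_r => //.
  apply: (max_principle (dquot m p) p R r) => //; [lra| |rewrite /disc; lra]; move=> x hx; apply/Rle_div_r => //.
    have hx2 : disc p R (p + r * cis x) by apply: circ_disc; rewrite ?Cmod_sub_self; lra.
    have := h1 _ hx2; rewrite (dquot_eq m p) m0 Cplus_0_l Cmod_mult.
    have -> : (p + r * cis x - p = r * cis x)%C by ring. rewrite Cmod_RtoC_cis; lra.
split=> [z hz|]; last by rewrite -dquot_self; exact: hq.
rewrite (dquot_eq m p z) m0 Cplus_0_l Cmod_mult; have := hq z hz; have := Cmod_ge_0 (z - p); nra.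
Qed.

(** * Harnack's inequality and Blaschke factors *)

Lemma RD_ln_Cmod p t v : RD p t v -> p t <> 0 -> is_derive (fun s => ln (Cmod (p s))) t (Re (v / p t)).
Proof.
move=> h n; have hx := RD_re _ _ _ h.
have hy : is_derive (fun s => Im (p s)) t (Im v).
  have := RD_re _ _ _ (RD_comp (fun w => - Ci * w)%C _ _ _ _ (CD_scal _ _ _ _ (CD_id _)) h).
  have -> : Re (v * (- Ci * 1)) = Im v by rewrite /Re /Im /=; ring.
  apply: is_derive_ext => s; rewrite /Re /Im /=; ring.
have pos : 0 < Re (p t) * Re (p t) + Im (p t) * Im (p t).
  have := proj1 (Cmod_gt_0 _) n => h0; have := Cmod2_alt (p t); nra.
have e s : Re (p s) * Re (p s) + Im (p s) * Im (p s) = Cmod (p s) ^ 2 by rewrite Cmod2_alt; ring.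
have e2 : locally t (fun s => / 2 * ln (Re (p s) * Re (p s) + Im (p s) * Im (p s)) = ln (Cmod (p s))).
  have c0 := proj1 (Cmod_gt_0 _) n; case: (RD_pc _ _ _ h _ c0) => d [d0 hd]; exists (mkposreal d d0) => s hs.
  have ps : 0 < Cmod (p s) by have := hd s hs; have := Cmod_le_add (p t) (p s); rewrite Cmod_sym; lra.
  rewrite e /= Rmult_1_r ln_mult //; lra.
apply: is_derive_ext_loc e2 _.
have d1 := is_derive_plus _ _ _ _ _ (is_derive_mult _ _ _ _ _ hx hx Rmult_comm) (is_derive_mult _ _ _ _ _ hy hy Rmult_comm).
have d2 := is_derive_scal _ _ (/ 2) _ (is_derive_comp ln _ t _ _ (is_derive_ln _ pos) d1).
move: d2; rewrite /plus /mult /scal /= /mult /=; move: pos; case: (p t) => a b; case: v {h hx hy d1} => c d.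
rewrite /Re /Im /= => pos; set X := / 2 * _; set Y := _ + _ in |- *.
have -> : c * (a / Y) - d * (- b / Y) = X by rewrite /X /Y; field; nra.
by [].
Qed.

Lemma ln_pos x : 1 < x -> 0 < ln x.
Proof. by move=> h; rewrite -ln_1; apply: ln_increasing; lra. Qed.

(* The branch L of log T centred at z has positive real part; Schwarz is applied to (L - L z) / (L + L z). *)
Lemma harnack T z d : 0 < d -> holD z d T -> (forall y, disc z d y -> 1 < Cmod (T y)) ->
  (forall w, disc z d w -> ln (Cmod (T z)) * (d - Cmod (w - z)) <= (d + Cmod (w - z)) * ln (Cmod (T w))) /\
  d * Cmod (C_derive T z) <= 2 * ln (Cmod (T z)) * Cmod (T z).
Proof.
move=> d0 h h1; have hz := disc_center z d d0.
have n y : disc z d y -> T y <> 0 by move=> /h1 hy; apply/Cmod_gt_0; lra.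
set tau := fun y => (C_derive T y / T y)%C.
have htau : holD z d tau by move=> y hy; apply: Cdiff_div; [exact: cder_hol h y hy|exact: h|exact: n].
case: (primitive_exists tau z d d0 htau) => L0 hL0.
set lam := ln (Cmod (T z)); have lam0 : 0 < lam by apply: ln_pos; exact: h1.
set L := fun y => (L0 y - L0 z + RtoC lam)%C.
have hL y : disc z d y -> CD L y (tau y).
  move=> hy; apply: CD_eq; first by apply: CD_plus; [apply: CD_minus; [exact: hL0|exact: CD_const]|exact: CD_const].
  ring.
have Lz : L z = RtoC lam by rewrite /L; ring.
(* Both sides have the same derivative along the segment from z and agree at z, so L never has to be
   exponentiated. *)
have reL y : disc z d y -> Re (L y) = ln (Cmod (T y)).
  move=> hy; have hs t : 0 <= t <= 1 -> disc z d (seg z y t) by move=> ht; apply: seg_disc.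
  have hd t : 0 <= t <= 1 -> is_derive (fun t => Re (L (seg z y t)) - ln (Cmod (T (seg z y t)))) t 0.
    move=> ht; have d1 := RD_re _ _ _ (RD_comp _ _ _ _ _ (hL _ (hs t ht)) (RD_seg z y t)).
    have d2 := RD_ln_Cmod _ _ _ (RD_comp _ _ _ _ _ (CD_cder _ _ (h _ (hs t ht))) (RD_seg z y t)) (n _ (hs t ht)).
    have := is_derive_minus _ _ _ _ _ d1 d2.
    have -> : ((y - z) * C_derive T (seg z y t) / T (seg z y t) = (y - z) * tau (seg z y t))%C.
      by rewrite /tau; field; apply: n; exact: hs.
    by rewrite minus_eq_zero.
  case: (MVT_gen (fun t => Re (L (seg z y t)) - ln (Cmod (T (seg z y t)))) 0 1 (fun _ => 0)).
  - rewrite Rmin_left ?Rmax_right; try lra. move=> t ht; apply: hd; lra.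
  - rewrite Rmin_left ?Rmax_right; try lra. move=> t ht.
    apply: derivable_continuous_pt; exists 0; apply/is_derive_Reals; exact: hd.
  move=> t [_]; rewrite seg0 seg1 Lz -/lam; rewrite {2}/Re /=; lra.
have reLp y : disc z d y -> 0 < Re (L y) by move=> hy; rewrite reL //; apply: ln_pos; exact: h1.
have npl y : disc z d y -> (L y + RtoC lam)%C <> 0.
  move=> hy e; have := reLp y hy; have : Re (L y + RtoC lam) = 0 by rewrite e.
  rewrite /Re /=; lra.
set m := fun y => ((L y - RtoC lam) / (L y + RtoC lam))%C.
have hm : holD z d m.
  move=> y hy; have hLy := CD_Cdiff _ _ _ (hL y hy); rewrite /m; hol; exact: npl.
have hm1 y : disc z d y -> Cmod (m y) <= 1.
  move=> hy; rewrite /m Cmod_div; last exact: npl.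
  apply/Rle_div_l; first by apply/Cmod_gt_0; exact: npl.
  rewrite Rmult_1_l; apply: Rsqr_incr_0_var; last exact: Cmod_ge_0.
  rewrite /Rsqr; have e c : Cmod c * Cmod c = Cmod c ^ 2 by ring. rewrite !e !Cmod2_alt.
  have := reLp y hy; move: (L y) => -[a b]; rewrite /Re /Im /=; nra.
have m0 : m z = 0 by rewrite /m Lz /Cdiv /Cminus Cplus_opp_r Cmult_0_l.
case: (schwarz m z d d0 hm hm1 m0) => s1 s2; split.
- move=> w hw; have {}s1 := s1 w hw; rewrite -reL //.
  rewrite /m Cmod_div in s1; last exact: npl.
  have pp : 0 < Cmod (L w + RtoC lam) by apply/Cmod_gt_0; exact: npl.
  have s3 : d * Cmod (L w - RtoC lam) <= Cmod (w - z) * Cmod (L w + RtoC lam).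
    have := Rmult_le_compat_r _ _ _ (Rlt_le _ _ pp) s1.
    by have -> : d * (Cmod (L w - lam) / Cmod (L w + lam)) * Cmod (L w + lam) = d * Cmod (L w - lam) by field; lra.
  have a0 := Cmod_ge_0 (L w - RtoC lam); have r0 := Cmod_ge_0 (w - z).
  have s4 : d * d * (Cmod (L w - RtoC lam) ^ 2) <= Cmod (w - z) * Cmod (w - z) * Cmod (L w + RtoC lam) ^ 2.
    have := Rmult_le_compat _ _ _ _ (Rmult_le_pos _ _ (Rlt_le _ _ d0) a0) (Rmult_le_pos _ _ (Rlt_le _ _ d0) a0) s3 s3; nra.
  rewrite !Cmod2_alt in s4; have := reLp w hw; rewrite /disc in hw.
  move: (Cmod (w - z)) r0 hw s4 => r r0 hw; move: (L w) => -[a b]; rewrite /Re /Im /= => s4 ap.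
  rewrite -/lam; have hh : (d * (lam - a)) ^ 2 <= (r * (a + lam)) ^ 2.
    have : 0 <= (d * d - r * r) * (b * b) by apply: Rmult_le_pos; nra. nra.
  have : d * (lam - a) <= r * (a + lam).
    apply: Rsqr_incr_0_var; first by rewrite /Rsqr; nra. nra.
  lra.
- have e : C_derive m z = (tau z / (2 * RtoC lam))%C.
    apply: CD_unique; apply: CD_eq.
      apply: CD_div; [apply: CD_minus; [exact: hL|exact: CD_const]|apply: CD_plus; [exact: hL|exact: CD_const]|exact: npl].
    have ln0 : RtoC lam <> 0 by move/RtoC_inj; lra.
    have ll0 : (RtoC lam + RtoC lam)%C <> 0 by rewrite -RtoC_plus; move/RtoC_inj; lra.
    by cbv beta; rewrite Lz; field; repeat split; first [exact: ln0|exact: ll0|exact: Ctwo_neq0].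
  have Tp := proj1 (Cmod_gt_0 _) (n z hz).
  have l2 : (2 * RtoC lam)%C = RtoC (2 * lam) by rewrite RtoC_mult.
  rewrite e l2 Cmod_div in s2; last by move/RtoC_inj; lra.
  rewrite Cmod_R Rabs_pos_eq in s2; last lra.
  rewrite /tau Cmod_div in s2; last exact: n.
  have : d * Cmod (C_derive T z) = d * (Cmod (C_derive T z) / Cmod (T z) / (2 * lam)) * (2 * lam * Cmod (T z)) by field; lra.
  move=> ->; rewrite -/lam -{2}(Rmult_1_l (2 * lam * Cmod (T z))); apply: Rmult_le_compat_r => //; nra.
Qed.

Lemma Cc_eq_at f g p : Cc f p -> Cc g p -> near p (fun y => y <> p -> f y = g y) -> f p = g p.
Proof.
move=> hf hg e; apply: Classical_Prop.NNPP => n; have d0 := Cmod_sub_pos _ _ n.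
have d2 : 0 < Cmod (f p - g p) / 2 by lra.
case: (near_and _ _ _ e (near_and _ _ _ (hf _ d2) (hg _ d2))) => r [r0 hr].
case: (exists_punct p r r0) => y [/hr [ey [h1 h2]] ny]; rewrite (ey ny) in h1.
have := Cmod_tri (f p) (g y) (g p); rewrite (Cmod_sym (f p) (g y)); lra.
Qed.

(** On |y| = r the right side vanishes, so the Blaschke factor has modulus 1 there; inside, the
    identity measures how far it falls below 1. *)
Lemma blaschke_identity (r : R) (c y : C) :
  Cmod (RtoC (r * r) - Cconj c * y) ^ 2 - (r * Cmod (y - c)) ^ 2 =
  (r * r - Cmod y ^ 2) * (r * r - Cmod c ^ 2).
Proof.
rewrite Rpow_mult_distr !Cmod2_alt; case: c => a b; case: y => u v; rewrite /Re /Im /=; ring.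
Qed.

(** Times [dquot A p] this is A divided by the Blaschke factor r (x - p) / (r^2 - conj (p - z) (x -
    z)) of the disc of centre z and radius r. *)
Definition bfac (z : C) (r : R) (p x : C) : C := ((RtoC (r * r) - Cconj (p - z) * (x - z)) / RtoC r)%C.

Lemma bfac_remove A z R r p : holD z R A -> 0 < r < R -> disc z r p -> A p = 0 ->
  (forall x, 0 <= x <= 2 * PI -> Cmod (A (z + RtoC r * cis x)%C) <= 1) ->
  let A1 := fun x => (dquot A p x * bfac z r p x)%C in
  holD z R A1 /\ (forall x, 0 <= x <= 2 * PI -> Cmod (A1 (z + RtoC r * cis x)%C) <= 1).
Proof.
move=> h hr hp A0 h1 A1; have rn : RtoC r <> 0 by move/RtoC_inj; lra.
have hpR : disc z R p by rewrite /disc in hp *; lra.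
split.
- move=> x hx; apply: Cdiff_mult; first exact: (dquot_holD A z R p h hpR x hx).
  by rewrite /bfac; hol.
- move=> x hx; rewrite /A1; set y := (z + RtoC r * cis x)%C.
  have ey : (y - z = RtoC r * cis x)%C by rewrite /y; ring.
  have my : Cmod (y - z) = r by rewrite ey Cmod_RtoC_cis //; lra.
  have nyp : (y - p)%C <> 0.
    apply: Csub_neq0 => e; rewrite e in my; rewrite /disc in hp; lra.
  have := blaschke_identity r (p - z) (y - z); rewrite my.
  have -> : (y - z - (p - z) = y - p)%C by ring.
  rewrite (_ : r * r - r ^ 2 = 0); last ring. rewrite Rmult_0_l => e.
  have eb : Cmod (RtoC (r * r) - Cconj (p - z) * (y - z)) = r * Cmod (y - p).
    have c1 := Cmod_ge_0 (RtoC (r * r) - Cconj (p - z) * (y - z)); have c2 := Cmod_ge_0 (y - p).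
    have c3 : 0 <= r * Cmod (y - p) by apply: Rmult_le_pos; lra. nra.
  have := h1 x hx; rewrite -/y (dquot_eq A p y) A0 Cplus_0_l Cmod_mult => h2.
  rewrite Cmod_mult /bfac Cmod_div // eb Cmod_R Rabs_pos_eq; last lra.
  have -> : Cmod (dquot A p y) * (r * Cmod (y - p) / r) = Cmod (y - p) * Cmod (dquot A p y) by field; lra.
  exact: h2.
Qed.

Lemma max_principle_le1 A z R r y : holD z R A -> 0 < r < R ->
  (forall x, 0 <= x <= 2 * PI -> Cmod (A (z + RtoC r * cis x)%C) <= 1) -> disc z r y -> Cmod (A y) <= 1.
Proof. move=> h hr h1 hy; apply: (max_principle A z R r) => //; lra. Qed.

(* The common zeros of A and B = A H are divided out by Blaschke factors; each division increases |A w|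
   by a definite ratio, so only finitely many are needed before Harnack applies to 2 / A. *)
Lemma quotient_bound z R r r' w A B H : holD z R A -> holD z R B -> holD z R H ->
  (forall x, disc z R x -> B x = (A x * H x)%C) -> 0 < r' < r -> r < R -> disc z r' w ->
  (forall x, 0 <= x <= 2 * PI -> Cmod (A (z + RtoC r * cis x)%C) <= 1) ->
  (forall x, 0 <= x <= 2 * PI -> Cmod (B (z + RtoC r * cis x)%C) <= 1) -> A w <> 0 ->
  Cmod (H z) <= exp ((r' + Cmod (w - z)) / (r' - Cmod (w - z)) * ln (2 / Cmod (A w))).
Proof.
move=> hA hB hH e hr' hrR hw hA1 hB1 Aw.
have hrho : 0 <= Cmod (w - z) < r' by split; [exact: Cmod_ge_0|exact: hw].
(* By [blaschke_identity] every Blaschke factor with zero in the disc of radius r' satisfies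
   |factor|^2 <= 1 - [del] at w; the denominator comes from |r^2 - conj (p - z) (w - z)| <= 2
   r^2. *)
set del := (r * r - Cmod (w - z) ^ 2) * (r * r - r' ^ 2) / (4 * (r * r) * (r * r)).
have rr : 0 < r * r by nra.
have del0 : 0 < del by apply: Rdiv_lt_0_compat; [apply: Rmult_lt_0_compat; nra|nra].
have del1 : del < 1.
  apply/Rlt_div_l; first nra.
  have q1 : 0 <= r * r - Cmod (w - z) ^ 2 <= r * r by nra. have q2 : 0 <= r * r - r' ^ 2 <= r * r by nra. nra.
have hr0 : 0 < r < R by lra.
have hwr : disc z r w by rewrite /disc; lra.
have hwR : disc z R w by rewrite /disc; lra.
set kap := (r' + Cmod (w - z)) / (r' - Cmod (w - z)).
have kap0 : 0 < kap by apply: Rdiv_lt_0_compat; lra.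
have step p A' : holD z R A' -> (forall x, 0 <= x <= 2 * PI -> Cmod (A' (z + RtoC r * cis x)%C) <= 1) ->
    disc z r' p -> A' p = 0 -> Cmod (A' w) ^ 2 <= (1 - del) * Cmod (dquot A' p w * bfac z r p w) ^ 2.
  move=> hA' h1 hp Ap; have c0 := Cmod_ge_0 (p - z); rewrite /disc in hp.
  set bw := (RtoC (r * r) - Cconj (p - z) * (w - z))%C.
  have rn : RtoC r <> 0 by move/RtoC_inj; lra.
  have hb2 : Cmod bw <= 2 * (r * r).
    apply: Rle_trans (Cmod_triangle _ _) _; rewrite Cmod_opp Cmod_mult Cmod_conj Cmod_R Rabs_pos_eq; nra.
  have := blaschke_identity r (p - z) (w - z).
  have -> : (w - z - (p - z) = w - p)%C by ring.
  rewrite -/bw => hid.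
  have b0 := Cmod_ge_0 bw.
  have hdel : (1 - del) * Cmod bw ^ 2 >= (r * Cmod (w - p)) ^ 2.
    have : del * Cmod bw ^ 2 <= (r * r - Cmod (w - z) ^ 2) * (r * r - Cmod (p - z) ^ 2); last by lra.
    apply: Rle_trans (_ : del * (4 * (r * r) * (r * r)) <= _).
      apply: Rmult_le_compat_l; [lra|nra].
    rewrite /del; have -> : (r * r - Cmod (w - z) ^ 2) * (r * r - r' ^ 2) / (4 * (r * r) * (r * r)) * (4 * (r * r) * (r * r)) =
       (r * r - Cmod (w - z) ^ 2) * (r * r - r' ^ 2) by field; lra.
    apply: Rmult_le_compat_l; nra.
  rewrite (dquot_eq A' p w) Ap Cplus_0_l 2!Cmod_mult /bfac Cmod_div // -/bw Cmod_R Rabs_pos_eq; last lra.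
  have q0 := Cmod_ge_0 (dquot A' p w).
  have -> : (1 - del) * (Cmod (dquot A' p w) * (Cmod bw / r)) ^ 2 = (1 - del) * Cmod bw ^ 2 * (Cmod (dquot A' p w) ^ 2 / (r * r)) by field; lra.
  have -> : (Cmod (w - p) * Cmod (dquot A' p w)) ^ 2 = (r * Cmod (w - p)) ^ 2 * (Cmod (dquot A' p w) ^ 2 / (r * r)) by field; lra.
  apply: Rmult_le_compat_r; last lra. apply: Rdiv_le_0_compat; nra.
have fin A' B' : holD z R A' -> holD z R B' -> (forall x, disc z R x -> B' x = (A' x * H x)%C) ->
    (forall x, 0 <= x <= 2 * PI -> Cmod (A' (z + RtoC r * cis x)%C) <= 1) ->
    (forall x, 0 <= x <= 2 * PI -> Cmod (B' (z + RtoC r * cis x)%C) <= 1) ->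
    (forall p, disc z r' p -> A' p <> 0) -> Cmod (H z) <= exp (kap * ln (2 / Cmod (A' w))).
  (* The 2 makes |T| > 1 strict, as Harnack's inequality demands of a function with positive log
     modulus. *)
  move=> hA' hB' e' h1 h2 nz; set T := fun y => (2 / A' y)%C.
  have r'0 : 0 < r' by lra.
  have Tm y : disc z r' y -> Cmod (T y) = 2 / Cmod (A' y).
    by move=> /nz ny; rewrite /T Cmod_div // Cmod_R Rabs_pos_eq; lra.
  have hT : holD z r' T.
    move=> y hy; have hAy : Cdiff A' y by apply: hA'; rewrite /disc in hy *; lra. rewrite /T; hol; exact: nz.
  have a1 y : disc z r' y -> Cmod (A' y) <= 1.
    move=> hy; apply: (max_principle_le1 A' z R r) => //; rewrite /disc in hy *; lra.
  have T1 y : disc z r' y -> 1 < Cmod (T y).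
    move=> hy; rewrite Tm //; have := a1 y hy; have p := proj1 (Cmod_gt_0 _) (nz y hy) => hh.
    by apply/Rlt_div_r => //; lra.
  case: (harnack T z r' r'0 hT T1) => /(_ w hw) hk _.
  have hz := disc_center z r' r'0; have hzr : disc z r z by apply: disc_center; lra.
  have hzR : disc z R z by apply: disc_center; lra.
  have Az := nz z hz; have Azp := proj1 (Cmod_gt_0 _) Az.
  have Bz := max_principle_le1 _ _ _ _ _ hB' hr0 h2 hzr.
  have HT : Cmod (H z) <= Cmod (T z).
    rewrite Tm //; apply/Rle_div_r => //; rewrite e' // Cmod_mult in Bz; lra.
  apply: Rle_trans HT _; have := T1 z hz => T1z; rewrite -{1}(exp_ln (Cmod (T z))); last lra.
  have : ln (Cmod (T z)) <= kap * ln (2 / Cmod (A' w)).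
    rewrite -Tm // /kap; have -> : (r' + Cmod (w - z)) / (r' - Cmod (w - z)) * ln (Cmod (T w)) =
      ((r' + Cmod (w - z)) * ln (Cmod (T w))) / (r' - Cmod (w - z)) by field; lra.
    apply/Rle_div_r => //; lra.
  case=> [hl|->]; [left; exact: exp_increasing|exact: Rle_refl].
(* Bounds the number of divisions: after k of them |A w|^2 <= (1 - [del])^k |A_k w|^2, and |A_k w|
   <= 1 by the maximum principle. *)
have [j hj] : exists j, (1 - del) ^ j <= Cmod (A w) ^ 2.
  have Awp := proj1 (Cmod_gt_0 _) Aw.
  have a1 : Rabs (1 - del) < 1 by rewrite Rabs_pos_eq; lra.
  have a2 : 0 < Cmod (A w) ^ 2 by apply: pow_lt.
  case: (pow_lt_1_zero _ a1 _ a2) => j /(_ j (Nat.le_refl _)); rewrite Rabs_pos_eq; last by apply: pow_le; lra.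
  by move=> hj; exists j; lra.
elim: j A B hA hB e hA1 hB1 Aw hj => [|j IH] A B hA hB e hA1 hB1 Aw hj;
(case: (excluded_middle_informative (exists p, disc z r' p /\ A p = 0)) => [[p [hp Ap]]|nz];
  last by (apply: (fin A B) => // p hp Ap; apply: nz; exists p)).
all: have hpr : disc z r p by rewrite /disc in hp *; lra.
all: have Awp := proj1 (Cmod_gt_0 _) Aw; have hs := step p A hA hA1 hp Ap.
all: have [h1 h2] := bfac_remove A z R r p hA hr0 hpr Ap hA1.
- have := max_principle_le1 _ _ _ _ w h1 hr0 h2 hwr; cbv beta => h3.
  have h4 := Cmod_ge_0 (dquot A p w * bfac z r p w); rewrite /= in hj; nra.
- have hpR : disc z R p by rewrite /disc in hpr *; lra.
  have Bp : B p = 0 by rewrite e // Ap Cmult_0_l.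
  have [k1 k2] := bfac_remove B z R r p hB hr0 hpr Bp hB1.
  have nA1 : (dquot A p w * bfac z r p w)%C <> 0.
    by move=> e0; rewrite e0 Cmod_0 in hs; nra.
  have pj : 0 < (1 - del) ^ j by apply: pow_lt; lra.
  have := IH _ _ h1 k1 _ h2 k2 nA1 _ => hfin.
  apply: Rle_trans (hfin _ _) _.
  + move=> x hx; have -> : (dquot A p x * bfac z r p x * H x = (dquot A p x * H x) * bfac z r p x)%C by ring.
    congr Cmult; have cA := Cdiff_Cc _ _ (dquot_holD _ _ _ _ hA hpR x hx).
    case: (excluded_middle_informative (x = p)) => [ex|nx].
      rewrite {x hx cA}ex; apply: (Cc_eq_at (dquot B p) (fun x => dquot A p x * H x)%C).
      * exact: Cdiff_Cc (dquot_holD B z R p hB hpR p hpR).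
      * by apply: (Cdiff_Cc (fun x => dquot A p x * H x)%C); apply: Cdiff_mult; [exact: (dquot_holD A z R p hA hpR p hpR)|exact: hH].
      * apply: near_mono (near_open _ _ _ hpR) => y hy ny; rewrite !dquot_neq // e // Bp Ap; field; exact: Csub_neq0.
    rewrite !dquot_neq // e // Bp Ap; field; exact: Csub_neq0.
  + rewrite /= in hj; apply: (Rmult_le_reg_l (1 - del)); first lra. lra.
  + have q0 := proj1 (Cmod_gt_0 _) nA1.
    have hle : Cmod (A w) <= Cmod (dquot A p w * bfac z r p w).
      apply: Rsqr_incr_0_var; last lra. rewrite /Rsqr; nra.
    have : kap * ln (2 / Cmod (dquot A p w * bfac z r p w)) <= kap * ln (2 / Cmod (A w)).
      apply: Rmult_le_compat_l; first lra. apply: ln_le; first by apply: Rdiv_lt_0_compat; lra.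
      by apply: Rmult_le_compat_l; [lra|apply: Rinv_le_contravar].
    case=> [hl|->]; [left; exact: exp_increasing|exact: Rle_refl].
Qed.

(** * Locally uniform convergence *)

Definition incr (phi : nat -> nat) : Prop := forall n, (phi n < phi (S n))%nat.

Lemma incr_mono phi : incr phi -> forall n m, (n <= m)%nat -> (phi n <= phi m)%nat.
Proof.
move=> h n m; elim: m => [|m IH] hm; first by have -> : n = O by lia.
case: (Nat.eq_dec n (S m)) => [->//|ne]; have := h m; have := IH ltac:(lia); lia.
Qed.

Lemma incr_ge phi : incr phi -> forall n, (n <= phi n)%nat.
Proof. move=> h; elim=> [|n IH]; [lia|have := h n; lia]. Qed.

Lemma incr_comp phi psi : incr phi -> incr psi -> incr (fun n => phi (psi n)).
Proof.
move=> h k n; have := incr_mono _ h _ _ (k n : (S (psi n) <= psi (S n))%nat); have := h (psi n); lia.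
Qed.

Definition infinite_pred (A : nat -> Prop) : Prop := forall N, exists n, (N <= n)%nat /\ A n.

(** Let l be the supremum of the y such that x n >= y for infinitely many n in A: infinitely many x
    n lie within eps / 2 of l. *)
Lemma pigeonhole_interval (A : nat -> Prop) (x : nat -> R) eps : infinite_pred A ->
  (forall n, Rabs (x n) <= 1) -> 0 < eps ->
  exists A', infinite_pred A' /\ (forall n, A' n -> A n) /\ forall n m, A' n -> A' m -> Rabs (x n - x m) <= eps.
Proof.
move=> hA hx e0; pose S y := infinite_pred (fun n => A n /\ y <= x n).
case: (completeness S).
- exists 1 => y hy; case: (hy O) => n [_ [_ h]]; have := Rle_abs (x n); have := hx n; lra.
- by exists (-1) => N; case: (hA N) => n [h1 h2]; exists n; repeat split=> //; have := hx n => /Rabs_le_between; lra.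
move=> l [l1 l2]; have [y [hy hyl]] : exists y, S y /\ l - eps / 2 < y.
  apply: Classical_Prop.NNPP => hn; have : l <= l - eps / 2; last lra.
  apply: l2 => y hy; apply: Rnot_lt_le => hlt; apply: hn; by exists y.
have nS : ~ S (l + eps / 2) by move/l1; lra.
have [N hN] : exists N, forall n, (N <= n)%nat -> A n -> x n < l + eps / 2.
  apply: Classical_Prop.NNPP => hn; apply: nS => N; apply: Classical_Prop.NNPP => hn2; apply: hn.
  exists N => n h1 h2; apply: Rnot_le_lt => h3; apply: hn2; by exists n.
exists (fun n => (N <= n)%nat /\ A n /\ y <= x n); split; [|split].
- move=> M; case: (hy (Nat.max M N)) => n [h1 h2]; exists n; split; [lia|split; [lia|exact: h2]].
- by move=> n [_ []].
- move=> n m [h1 [h2 h3]] [k1 [k2 k3]]; have := hN n h1 h2; have := hN m k1 k2.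
  move=> *; apply/Rabs_le_between; lra.
Qed.

(** Stage s decodes to a pair (j, k) and thins the index set until coordinate j oscillates by at
    most 1 / (k + 1), so one decreasing sequence of index sets serves all coordinates and
    accuracies. *)
Lemma diagonal (e : nat -> nat -> R) : (forall n j, Rabs (e n j) <= 1) ->
  exists phi, incr phi /\ forall j eps, 0 < eps -> exists N, forall n m, (N <= n)%nat -> (N <= m)%nat ->
    Rabs (e (phi n) j - e (phi m) j) <= eps.
Proof.
move=> he; pose jj s := fst (Cantor.of_nat s); pose ee s := / (INR (snd (Cantor.of_nat s)) + 1).
have ee0 s : 0 < ee s by apply: Rinv_0_lt_compat; have := pos_INR (snd (Cantor.of_nat s)); lra.
have ch sA : exists A' : nat -> Prop, infinite_pred (snd sA) -> infinite_pred A' /\ (forall n, A' n -> snd sA n) /\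
    forall n m, A' n -> A' m -> Rabs (e n (jj (fst sA)) - e m (jj (fst sA))) <= ee (fst sA).
  case: (excluded_middle_informative (infinite_pred (snd sA))) => [h|n]; last by exists (snd sA) => /n.
  case: (pigeonhole_interval _ (fun n => e n (jj (fst sA))) _ h (fun n => he n _) (ee0 (fst sA))) => A' hA'.
  by exists A'.
pose nx sA := proj1_sig (constructive_indefinite_description _ (ch sA)).
pose A : nat -> nat -> Prop := nat_rect (fun _ => nat -> Prop) (fun _ => True) (fun s A => nx (s, A)).
have hnx s : infinite_pred (A s) -> infinite_pred (A (S s)) /\ (forall n, A (S s) n -> A s n) /\
    forall n m, A (S s) n -> A (S s) m -> Rabs (e n (jj s) - e m (jj s)) <= ee s.
  by move=> h; rewrite /= /nx; case: constructive_indefinite_description => A' /= /(_ h).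
have hinf s : infinite_pred (A s) by elim: s => [N|s IH]; [by exists N|case: (hnx s IH)].
have hdec s k n : A (s + k)%nat n -> A s n.
  elim: k => [|k IH]; first by rewrite Nat.add_0_r.
  rewrite Nat.add_succ_r => h; apply: IH; case: (hnx _ (hinf (s + k)%nat)) => _ [h2 _]; exact: h2.
have ch2 sN : exists n, (snd sN < n)%nat /\ A (S (fst sN)) n.
  by case: (hinf (S (fst sN)) (S (snd sN))) => n [h1 h2]; exists n.
pose nx2 sN := proj1_sig (constructive_indefinite_description _ (ch2 sN)).
have hnx2 s N : (N < nx2 (s, N))%nat /\ A (S s) (nx2 (s, N)).
  by rewrite /nx2; case: constructive_indefinite_description.
pose phi : nat -> nat := nat_rect (fun _ => nat) O (fun s N => nx2 (s, N)).
have hphi n : A n (phi n) by case: n => [//|n]; case: (hnx2 n (phi n)).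
exists phi; split=> [n|j eps e0]; first by case: (hnx2 n (phi n)).
case: (INR_unbounded (/ eps)) => k hk; set s := Cantor.to_nat (j, k).
have ej : jj s = j by rewrite /jj /s Cantor.cancel_of_to.
have es : ee s <= eps.
  rewrite /ee /s Cantor.cancel_of_to /= -(Rinv_inv eps); apply: Rinv_le_contravar; last lra.
  exact: Rinv_0_lt_compat.
exists (S s) => n m hn hm; apply: Rle_trans es.
case: (hnx s (hinf s)) => _ [_]; rewrite ej; apply.
- by apply: (hdec _ (n - S s)%nat); have -> : (S s + (n - S s))%nat = n by lia.
- by apply: (hdec _ (m - S s)%nat); have -> : (S s + (m - S s))%nat = m by lia.
Qed.

Definition Ccv (a : nat -> C) (l : C) : Prop :=
  forall eps, 0 < eps -> exists N, forall n, (N <= n)%nat -> Cmod (a n - l) <= eps.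

Lemma C_complete (a : nat -> C) : (forall eps, 0 < eps -> exists N, forall n m, (N <= n)%nat -> (N <= m)%nat ->
  Cmod (a n - a m) <= eps) -> exists l, Ccv a l.
Proof.
move=> h.
have hc (p : C -> R) : (forall x y, Rabs (p x - p y) <= Cmod (x - y)) -> exists l, Un_cv (fun n => p (a n)) l.
  move=> hp; have hC : Cauchy_crit (fun n => p (a n)).
    move=> eps e0; have e2 : 0 < eps / 2 by lra.
    case: (h _ e2) => N hN; exists N => n m hn hm; rewrite /R_dist; have := hp (a n) (a m).
    have := hN n m hn hm; lra.
  case: (Rcomplete.R_complete _ hC) => l hl; by exists l.
case: (hc fst) => [x y|l1 h1]; first exact: (re_le_Cmod (x - y)).
case: (hc snd) => [x y|l2 h2].
  exact: (Rle_trans _ _ _ (Rmax_r _ _) (Rmax_Cmod (x - y)%C)).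
exists (l1, l2) => eps e0; have e2 : 0 < eps / 2 by lra.
case: (h1 _ e2) => N1 k1; case: (h2 _ e2) => N2 k2; exists (Nat.max N1 N2) => n hn.
have -> : (a n - (l1, l2))%C = (fst (a n) - l1, snd (a n) - l2).
  by rewrite /Cminus /Cplus /Copp /=; congr pair.
apply: Rle_trans (Cmod_pair_le _ _) _.
have := k1 n ltac:(lia); have := k2 n ltac:(lia); rewrite /R_dist; lra.
Qed.

Lemma Ccv_Cmod a l M : Ccv a l -> (exists N, forall n, (N <= n)%nat -> Cmod (a n) <= M) -> Cmod l <= M.
Proof.
move=> h [N hN]; apply: Rnot_lt_le => hl; have e0 : 0 < (Cmod l - M) / 2 by lra.
case: (h _ e0) => N' hN'; have := hN (Nat.max N N') ltac:(lia); have := hN' (Nat.max N N') ltac:(lia).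
have := Cmod_le_add l (a (Nat.max N N')); rewrite Cmod_sym; lra.
Qed.

Lemma bolzano_weierstrass (a : nat -> C) M : (forall n, Cmod (a n) <= M) ->
  exists phi l, incr phi /\ Ccv (fun n => a (phi n)) l.
Proof.
move=> h; have M1 : 0 < Rabs M + 1 by have := Rabs_pos M; lra.
have hb (p : C -> R) n : (forall x, Rabs (p x) <= Cmod x) -> Rabs (p (a n) / (Rabs M + 1)) <= 1.
  move=> hp; rewrite /Rdiv Rabs_mult (Rabs_pos_eq (/ _)); last by left; apply: Rinv_0_lt_compat.
  apply/Rle_div_l => //; have := hp (a n); have := h n; have := Rle_abs M; lra.
have hf x : Rabs (fst x) <= Cmod x by exact: (re_le_Cmod x).
have hs x : Rabs (snd x) <= Cmod x by exact: (Rle_trans _ _ _ (Rmax_r _ _) (Rmax_Cmod x)).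
case: (diagonal (fun n j => match j with O => fst (a n) / (Rabs M + 1) | _ => snd (a n) / (Rabs M + 1) end)).
  by move=> n [|j]; [apply: (hb fst)|apply: (hb snd)].
move=> phi [hphi hc]; case: (C_complete (fun n => a (phi n))) => [eps e0|l hl]; last by exists phi, l.
have e2 : 0 < eps / (2 * (Rabs M + 1)) by apply: Rdiv_lt_0_compat; lra.
case: (hc O _ e2) => N1 h1; case: (hc 1%nat _ e2) => N2 h2; exists (Nat.max N1 N2) => n m hn hm.
have {}h1 := h1 n m ltac:(lia) ltac:(lia); have {}h2 := h2 n m ltac:(lia) ltac:(lia).
have cnv x y : Rabs (x / (Rabs M + 1) - y / (Rabs M + 1)) <= eps / (2 * (Rabs M + 1)) -> Rabs (x - y) <= eps / 2.
  have -> : x / (Rabs M + 1) - y / (Rabs M + 1) = (x - y) * / (Rabs M + 1) by field; lra.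
  rewrite Rabs_mult (Rabs_pos_eq (/ _)); last by left; apply: Rinv_0_lt_compat.
  move/(Rle_div_l _ _ _ M1); have -> : eps / (2 * (Rabs M + 1)) * (Rabs M + 1) = eps / 2 by field; lra. by [].
apply: Rle_trans (Cmod_pair_le _ _) _; have := cnv _ _ h1; have := cnv _ _ h2; rewrite /Rminus /=; lra.
Qed.

(** Nothing is asked of the limit: its holomorphy is Weierstrass's theorem, proved next. *)
Definition lcv (fn : nat -> C -> C) (f : C -> C) (z : C) : Prop :=
  exists r, 0 < r /\ (exists N, forall n, (N <= n)%nat -> holD z r (fn n)) /\
    forall eps, 0 < eps -> exists N, forall n y, (N <= n)%nat -> disc z r y -> Cmod (fn n y - f y) <= eps.

Lemma holD_sub z r y s g : holD z r g -> Cmod (y - z) + s <= r -> holD y s g.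
Proof. by move=> h hs w hw; apply: h; apply: disc_sub hw hs. Qed.

Lemma cder_minus f g z : Cdiff f z -> Cdiff g z -> C_derive (fun y => f y - g y)%C z = (C_derive f z - C_derive g z)%C.
Proof. by move=> /CD_cder hf /CD_cder hg; apply: CD_unique; apply: CD_minus. Qed.

(** Cauchy estimates for fn n - fn m make the derivatives uniformly Cauchy on the half disc. The
    mean value inequality for fn n - fn m, with m tending to infinity, then shows that their limit
    is the derivative of f. *)
Lemma lcv_cder_aux fn f z : lcv fn f z -> near z (Cdiff f) /\ lcv (fun n => C_derive (fn n)) (C_derive f) z.
Proof.
move=> [r [r0 [[N hN] hu]]]; set s := r / 2; have s0 : 0 < s by rewrite /s; lra.
have sub y : disc z s y -> Cmod (y - z) + s <= r by rewrite /disc /s; lra.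
have dsub y : disc z s y -> disc z r y by rewrite /disc /s; lra.
have hC eps : 0 < eps -> exists N', (N <= N')%nat /\ forall n m y, (N' <= n)%nat -> (N' <= m)%nat -> disc z s y ->
    Cmod (C_derive (fn n) y - C_derive (fn m) y) <= eps.
  move=> e0; have e1 : 0 < eps * s / 2 by nra.
  case: (hu _ e1) => N1 h1; exists (Nat.max N N1); split=> [|n m y hn hm hy]; first lia.
  have hh : holD y s (fun w => fn n w - fn m w)%C.
    move=> w hw; have hwr := disc_sub _ _ _ _ _ hw (sub y hy).
    by apply: Cdiff_minus; apply: hN => //; lia.
  have hNd k : (Nat.max N N1 <= k)%nat -> Cdiff (fn k) y by move=> hk; apply: hN (dsub _ hy); lia.
  rewrite -(cder_minus _ _ _ (hNd n hn) (hNd m hm)).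
  have := cauchy_estimate _ y s (eps * s) s0 hh _ => hce.
  apply: (Rmult_le_reg_l s) => //; rewrite (Rmult_comm s eps); apply: hce => w hw.
  have hwr := disc_sub _ _ _ _ _ hw (sub y hy).
  have -> : (fn n w - fn m w = (fn n w - f w) + - (fn m w - f w))%C by ring.
  apply: Rle_trans (Cmod_triangle _ _) _; rewrite Cmod_opp.
  have := h1 n w ltac:(lia) hwr; have := h1 m w ltac:(lia) hwr; lra.
have ch y : exists G, disc z s y -> Ccv (fun n => C_derive (fn n) y) G.
  case: (excluded_middle_informative (disc z s y)) => [hy|n]; last by exists (RtoC 0) => /n.
  case: (C_complete (fun n => C_derive (fn n) y)) => [eps /hC [N' [_ h]]|G hG]; last by exists G.
  by exists N' => n m hn hm; apply: h.
pose G y := proj1_sig (constructive_indefinite_description _ (ch y)).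
have hG y : disc z s y -> Ccv (fun n => C_derive (fn n) y) (G y) by rewrite /G; case: constructive_indefinite_description.
have hGu eps : 0 < eps -> exists N', (N <= N')%nat /\ forall n y, (N' <= n)%nat -> disc z s y ->
    Cmod (C_derive (fn n) y - G y) <= eps.
  move=> e0; have e2 : 0 < eps / 2 by lra.
  case: (hC _ e2) => N1 [h0 h1]; exists N1; split=> // n y hn hy; case: (hG y hy _ e2) => N2 h2.
  have := h2 (Nat.max N1 N2) ltac:(lia); have := h1 n (Nat.max N1 N2) y hn ltac:(lia) hy.
  have := Cmod_tri (C_derive (fn n) y) (C_derive (fn (Nat.max N1 N2)) y) (G y); lra.
have hCD y : disc z s y -> CD f y (G y).
  move=> hy; apply/CD_eps => eps e0; have e4 : 0 < eps / 4 by lra.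
  case: (hC _ e4) => N1 [h01 h1]; case: (hGu _ e4) => N2 [h02 h2]; set n := Nat.max N1 N2.
  have hn : Cdiff (fn n) y by apply: hN; [lia|exact: dsub].
  have /CD_eps /(_ _ e4) hd := CD_cder _ _ hn.
  apply: near2 hd (near_open _ _ _ hy) => x hx hxs.
  have lim : Cmod ((fn n x - f x) - (fn n y - f y)) <= eps / 4 * Cmod (x - y).
    apply: (Ccv_Cmod (fun m => (fn n x - fn m x) - (fn n y - fn m y))%C).
      move=> e e0'; have e02 : 0 < e / 2 by lra. case: (hu _ e02) => N3 h3; exists N3 => m hm.
      have -> : (fn n x - fn m x - (fn n y - fn m y) - (fn n x - f x - (fn n y - f y)) =
         - (fn m x - f x) + (fn m y - f y))%C by ring.
      apply: Rle_trans (Cmod_triangle _ _) _; rewrite Cmod_opp.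
      have := h3 m x hm (dsub _ hxs); have := h3 m y hm (dsub _ hy); lra.
    exists N1 => m hm; apply: (mean_value_ineq (fun w => fn n w - fn m w)%C (fun w => C_derive (fn n) w - C_derive (fn m) w)%C).
    move=> t ht; have hst : disc z s (seg y x t) by apply: seg_disc.
    split; last by apply: h1 => //; lia.
    by apply: CD_minus; apply: CD_cder; apply: hN; try exact: dsub; lia.
  have -> : (f x - f y - G y * (x - y) = - ((fn n x - f x) - (fn n y - f y)) + (fn n x - fn n y - C_derive (fn n) y * (x - y))
     + (C_derive (fn n) y - G y) * (x - y))%C by ring.
  apply: Rle_trans (Cmod_triangle _ _) _; rewrite Cmod_mult.
  have t1 := Cmod_triangle (- (fn n x - f x - (fn n y - f y))) (fn n x - fn n y - C_derive (fn n) y * (x - y)).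
  rewrite Cmod_opp in t1.
  have g2 := h2 n y ltac:(lia) hy; have p0 := Cmod_ge_0 (x - y).
  have pe := Rmult_le_pos _ _ (Rlt_le _ _ e0) p0; have := Rmult_le_compat_r _ _ _ p0 g2; lra.
split; first by exists s; split=> // y hy; exact: CD_Cdiff (hCD y hy).
exists s; split=> //; split.
  exists N => n hn; apply: cder_hol; apply: holD_sub (hN n hn) _; rewrite Cmod_sub_self /s; lra.
move=> eps /hGu [N' [_ h]]; exists N' => n y hn hy; rewrite (CD_unique _ _ _ (hCD y hy)); exact: h.
Qed.

Lemma lcv_hol fn f z : lcv fn f z -> near z (Cdiff f).
Proof. by case/lcv_cder_aux. Qed.

Lemma lcv_cder fn f z : lcv fn f z -> lcv (fun n => C_derive (fn n)) (C_derive f) z.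
Proof. by case/lcv_cder_aux. Qed.

Lemma lcv_cst f z : near z (Cdiff f) -> lcv (fun _ => f) f z.
Proof.
move=> [r [r0 h]]; exists r; split=> //; split; first by exists O.
move=> eps e0; exists O => n y _ _; rewrite Cmod_sub_self; lra.
Qed.

Lemma lcv_eval fn f z eps : lcv fn f z -> 0 < eps ->
  exists d N, 0 < d /\ forall n y, (N <= n)%nat -> disc z d y -> Cmod (fn n y - f z) <= eps.
Proof.
move=> h e0; have e2 : 0 < eps / 2 by lra.
case: (Cdiff_Cc _ _ (near_self _ _ (lcv_hol _ _ _ h)) _ e2) => d [d0 hd].
case: h => r [r0 [_ /(_ _ e2) [N hN]]]; exists (Rmin d r), N; split; first exact: Rmin_pos.
move=> n y hn; rewrite /disc => hy; have m1 := Rmin_l d r; have m2 := Rmin_r d r.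
have k1 : Cmod (fn n y - f y) <= eps / 2 by apply: hN => //; rewrite /disc; lra.
have k2 : Cmod (f y - f z) < eps / 2 by apply: hd; rewrite /disc; lra.
have := Cmod_tri (fn n y) (f y) (f z); lra.
Qed.

Lemma lcv_ext fn gn f g z : lcv fn f z ->
  (exists r N, 0 < r /\ forall n y, (N <= n)%nat -> disc z r y -> fn n y = gn n y) ->
  near z (fun y => f y = g y) -> lcv gn g z.
Proof.
move=> [r [r0 [[N hN] hu]]] [s [N1 [s0 e1]]] [s2 [s20 e2]].
set t := Rmin r (Rmin s s2); have t0 : 0 < t by do 2 apply: Rmin_pos => //.
have m1 : t <= r by exact: Rmin_l. have m2 := Rmin_r r (Rmin s s2).
have m3 := Rmin_l s s2; have m4 := Rmin_r s s2; rewrite -/t in m2.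
exists t; split=> //; split.
  exists (Nat.max N N1) => n hn y hy; apply: (Cdiff_ext (fn n)).
    by apply: near_mono (near_open _ _ _ hy) => w hw; apply: e1; [lia|rewrite /disc in hw *; lra].
  by apply: hN; [lia|rewrite /disc in hy *; lra].
move=> eps /hu [N' hN']; exists (Nat.max N' N1) => n y hn hy.
rewrite -e1; [|lia|rewrite /disc in hy *; lra]. rewrite -e2; last by rewrite /disc in hy *; lra.
by apply: hN'; [lia|rewrite /disc in hy *; lra].
Qed.

Lemma lcv_plus fn gn f g z : lcv fn f z -> lcv gn g z -> lcv (fun n y => fn n y + gn n y)%C (fun y => f y + g y)%C z.
Proof.
move=> [r [r0 [[N hN] hu]]] [s [s0 [[M hM] hv]]]; exists (Rmin r s); split; first exact: Rmin_pos.
have m1 := Rmin_l r s; have m2 := Rmin_r r s; split.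
  exists (Nat.max N M) => n hn y hy; apply: Cdiff_plus; [apply: hN; [lia|]|apply: hM; [lia|]]; rewrite /disc in hy *; lra.
move=> eps e0; have e2 : 0 < eps / 2 by lra.
case: (hu _ e2) => N1 h1; case: (hv _ e2) => N2 h2; exists (Nat.max N1 N2) => n y hn hy.
have -> : (fn n y + gn n y - (f y + g y) = (fn n y - f y) + (gn n y - g y))%C by ring.
have k1 : Cmod (fn n y - f y) <= eps / 2 by apply: h1; [lia|rewrite /disc in hy *; lra].
have k2 : Cmod (gn n y - g y) <= eps / 2 by apply: h2; [lia|rewrite /disc in hy *; lra].
have := Cmod_triangle (fn n y - f y) (gn n y - g y); lra.
Qed.

Lemma lcv_mult fn gn f g z : lcv fn f z -> lcv gn g z -> lcv (fun n y => fn n y * gn n y)%C (fun y => f y * g y)%C z.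
Proof.
move=> hf hg; case: (Cdiff_Cc _ _ (near_self _ _ (lcv_hol _ _ _ hf)) 1 Rlt_0_1) => a [a0 ha].
case: (Cdiff_Cc _ _ (near_self _ _ (lcv_hol _ _ _ hg)) 1 Rlt_0_1) => b [b0 hb].
case: hf => r [r0 [[N hN] hu]]; case: hg => s [s0 [[M hM] hv]].
set t := Rmin (Rmin r s) (Rmin a b).
have t0 : 0 < t by apply: Rmin_pos; apply: Rmin_pos.
have [m1 [m2 [m3 m4]]] : t <= r /\ t <= s /\ t <= a /\ t <= b.
  have := Rmin_l (Rmin r s) (Rmin a b); have := Rmin_r (Rmin r s) (Rmin a b); rewrite -/t.
  have := Rmin_l r s; have := Rmin_r r s; have := Rmin_l a b; have := Rmin_r a b; lra.
exists t; split=> //; split.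
  exists (Nat.max N M) => n hn y hy; apply: Cdiff_mult; [apply: hN; [lia|]|apply: hM; [lia|]]; rewrite /disc in hy *; lra.
move=> eps e0; set K := Cmod (f z) + Cmod (g z) + 3.
have K0 : 3 <= K by rewrite /K; have := Cmod_ge_0 (f z); have := Cmod_ge_0 (g z); lra.
have e2 : 0 < Rmin 1 (eps / (2 * K)) by apply: Rmin_pos; [lra|apply: Rdiv_lt_0_compat; lra].
have m5 := Rmin_l 1 (eps / (2 * K)); have m6 := Rmin_r 1 (eps / (2 * K)).
case: (hu _ e2) => N1 h1; case: (hv _ e2) => N2 h2; exists (Nat.max N1 N2) => n y hn hy.
have -> : (fn n y * gn n y - f y * g y = (fn n y - f y) * gn n y + f y * (gn n y - g y))%C by ring.
have k1 : Cmod (fn n y - f y) <= Rmin 1 (eps / (2 * K)) by apply: h1; [lia|rewrite /disc in hy *; lra].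
have k2 : Cmod (gn n y - g y) <= Rmin 1 (eps / (2 * K)) by apply: h2; [lia|rewrite /disc in hy *; lra].
have k3 : Cmod (f y - f z) < 1 by apply: ha; rewrite /disc in hy *; lra.
have k4 : Cmod (g y - g z) < 1 by apply: hb; rewrite /disc in hy *; lra.
have k5 := Cmod_le_add (f y) (f z); have k6 := Cmod_le_add (g y) (g z); have k7 := Cmod_le_add (gn n y) (g y).
apply: Rle_trans (Cmod_triangle _ _) _; rewrite !Cmod_mult.
have q1 := Cmod_ge_0 (f z); have q2 := Cmod_ge_0 (g z).
have l1 : Cmod (fn n y - f y) * Cmod (gn n y) <= eps / (2 * K) * K.
  apply: Rmult_le_compat; try exact: Cmod_ge_0; first lra. rewrite /K; lra.
have l2 : Cmod (f y) * Cmod (gn n y - g y) <= K * (eps / (2 * K)).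
  apply: Rmult_le_compat; try exact: Cmod_ge_0; last lra. rewrite /K; lra.
have e3 : eps / (2 * K) * K = eps / 2 by field; lra.
lra.
Qed.

Lemma lcv_scal c fn f z : lcv fn f z -> lcv (fun n y => c * fn n y)%C (fun y => c * f y)%C z.
Proof. apply: lcv_mult; apply: lcv_cst; apply: near_all => y; exact: Cdiff_const. Qed.

Lemma lcv_minus fn gn f g z : lcv fn f z -> lcv gn g z -> lcv (fun n y => fn n y - gn n y)%C (fun y => f y - g y)%C z.
Proof.
move=> hf hg; apply: lcv_ext (lcv_plus _ _ _ _ _ hf (lcv_scal (-1)%C _ _ _ hg)) _ _.
- by exists 1, O; split=> [|n y _ _]; [lra|rewrite RtoC_m1; ring].
- by apply: near_all => y; rewrite RtoC_m1; ring.
Qed.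

Lemma lcv_pow fn f z k : lcv fn f z -> lcv (fun n y => fn n y ^ k)%C (fun y => f y ^ k)%C z.
Proof.
move=> h; elim: k => [|k IH]; last exact: lcv_mult h IH.
by apply: (lcv_cst (fun _ => RtoC 1)); apply: near_all => y; exact: Cdiff_const.
Qed.

Lemma lcv_inv fn f z : lcv fn f z -> f z <> 0 -> lcv (fun n y => / fn n y)%C (fun y => / f y)%C z.
Proof.
move=> h n0; have p0 := proj1 (Cmod_gt_0 _) n0; have p4 : 0 < Cmod (f z) / 4 by lra.
case: (lcv_eval _ _ _ _ h p4) => d [N [d0 hd]].
case: (Cdiff_Cc _ _ (near_self _ _ (lcv_hol _ _ _ h)) _ p4) => a [a0 ha].
case: h => r [r0 [[M hM] hu]].
set t := Rmin r (Rmin d a); have t0 : 0 < t by apply: Rmin_pos => //; apply: Rmin_pos.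
have [m1 [m2 m3]] : t <= r /\ t <= d /\ t <= a.
  have := Rmin_l r (Rmin d a); have := Rmin_r r (Rmin d a); have := Rmin_l d a; have := Rmin_r d a; rewrite -/t; lra.
have low n y : (N <= n)%nat -> disc z t y -> Cmod (f z) / 2 <= Cmod (fn n y).
  move=> hn hy; have : Cmod (fn n y - f z) <= Cmod (f z) / 4 by apply: hd => //; rewrite /disc in hy *; lra.
  have := Cmod_le_add (f z) (fn n y); rewrite Cmod_sym; lra.
have lowf y : disc z t y -> Cmod (f z) / 2 <= Cmod (f y).
  move=> hy; have : Cmod (f y - f z) < Cmod (f z) / 4 by apply: ha; rewrite /disc in hy *; lra.
  have := Cmod_le_add (f z) (f y); rewrite Cmod_sym; lra.
exists t; split=> //; split.
  exists (Nat.max N M) => n hn y hy; apply: Cdiff_inv; first by apply: hM; [lia|rewrite /disc in hy *; lra].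
  by apply/Cmod_gt_0; have := low n y ltac:(lia) hy; lra.
move=> eps e0; have e1 : 0 < eps * (Cmod (f z) * Cmod (f z) / 4) by apply: Rmult_lt_0_compat => //; nra.
case: (hu _ e1) => N1 h1; exists (Nat.max N N1) => n y hn hy.
have l1 := low n y ltac:(lia) hy; have l2 := lowf y hy.
have n1 : fn n y <> 0 by apply/Cmod_gt_0; lra.
have n2 : f y <> 0 by apply/Cmod_gt_0; lra.
have -> : (/ fn n y - / f y = - (fn n y - f y) / (fn n y * f y))%C by field.
rewrite Cmod_div; last exact: Cmul_neq0. rewrite Cmod_opp Cmod_mult.
apply/Rle_div_l; first nra.
have k1 : Cmod (fn n y - f y) <= eps * (Cmod (f z) * Cmod (f z) / 4) by apply: h1; [lia|rewrite /disc in hy *; lra].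
apply: Rle_trans k1 _; apply: Rmult_le_compat_l; first lra. nra.
Qed.

(* Uniformly bounded near z for all large indices, both thresholds being read off a single radius. *)
Definition lbd (E : nat -> C -> R) (z : C) : Prop :=
  exists d, 0 < d /\ forall n y, / d <= INR n -> disc z d y -> E n y <= / d.

Lemma lbd_intro (E : nat -> C -> R) z d N M : 0 < d ->
  (forall n y, (N <= n)%nat -> disc z d y -> E n y <= M) -> lbd E z.
Proof.
move=> d0 h; set K := / d + INR N + Rabs M + 1.
have K0 : 0 < K by rewrite /K; have := Rinv_0_lt_compat _ d0; have := pos_INR N; have := Rabs_pos M; lra.
have K1 : / K <= d.
  rewrite -(Rinv_inv d); apply: Rinv_le_contravar; first exact: Rinv_0_lt_compat.
  rewrite /K; have := pos_INR N; have := Rabs_pos M; lra.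
exists (/ K); split; first exact: Rinv_0_lt_compat.
rewrite Rinv_inv => n y hn hy; apply: Rle_trans (h n y _ _) _.
- apply: INR_le; move: hn; rewrite /K; have := Rinv_0_lt_compat _ d0; have := Rabs_pos M; lra.
- by rewrite /disc in hy *; lra.
- rewrite /K; have := Rinv_0_lt_compat _ d0; have := pos_INR N; have := Rle_abs M; lra.
Qed.

Lemma lbd_elim E z : lbd E z -> exists d N M, 0 < d /\ forall n y, (N <= n)%nat -> disc z d y -> E n y <= M.
Proof.
move=> [d [d0 h]]; case: (INR_unbounded (/ d)) => N hN; exists d, N, (/ d); split=> // n y hn; apply: h.
have := le_INR _ _ hn; lra.
Qed.

Lemma lcv_lbd fn f z : lcv fn f z -> lbd (fun n y => Cmod (fn n y)) z.
Proof.
move=> h; case: (lcv_eval _ _ _ 1 h Rlt_0_1) => d [N [d0 hd]].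
apply: (lbd_intro _ _ d N (Cmod (f z) + 1)) => // n y hn hy.
have := hd n y hn hy; have := Cmod_le_add (fn n y) (f z); lra.
Qed.

(** Convergence arguments fail at isolated points; a bound on a small circle around such a point
    passes to its interior by the maximum principle. *)
Lemma lbd_fill (E : nat -> C -> C) z R N0 : 0 < R -> (forall n, (N0 <= n)%nat -> holD z R (E n)) ->
  near z (fun y => y <> z -> lbd (fun n y => Cmod (E n y)) y) -> lbd (fun n y => Cmod (E n y)) z.
Proof.
move=> R0 hE [d [d0 hd]]; set r := Rmin (R / 2) (d / 2).
have r0 : 0 < r by apply: Rmin_pos; lra.
have m1 : r <= R / 2 by exact: Rmin_l. have m2 : r <= d / 2 by exact: Rmin_r.
case: (circle_uniform (fun n y => Cmod (E n y)) z r) => [x hx|M hM].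
  apply: hd; first by apply: circ_disc; rewrite ?Cmod_sub_self; lra.
  move=> e; have := Cmod_RtoC_cis r x (Rlt_le _ _ r0).
  have -> : (r * cis x = z + r * cis x - z)%C by ring. rewrite e Cmod_sub_self; lra.
case: (INR_unbounded M) => N hN; apply: (lbd_intro _ _ r (Nat.max N N0) M) => // n y hn hy.
apply: (max_principle (E n) z R r) => //; [by apply: hE; lia|lra|move=> x hx; apply: hM => //].
have := le_INR N n ltac:(lia); lra.
Qed.

(** * Meromorphic functions and Marty's criterion *)

(** Replaces finite covers: points violating P N for every N would accumulate in K, against the
    local validity at the limit. *)
Lemma compact_uniform (K : C -> Prop) M (P : nat -> C -> Prop) : (forall y, K y -> Cmod y <= M) ->
  (forall y, (forall eps, 0 < eps -> exists w, K w /\ Cmod (w - y) < eps) -> K y) ->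
  (forall N N' y, (N <= N')%nat -> P N y -> P N' y) ->
  (forall y, K y -> exists N, near y (P N)) -> exists N, forall y, K y -> P N y.
Proof.
move=> hM hcl hmono hloc; apply: Classical_Prop.NNPP => hn.
have ch N : exists y, K y /\ ~ P N y.
  apply: Classical_Prop.NNPP => h; apply: hn; exists N => y hy; apply: Classical_Prop.NNPP => hp.
  by apply: h; exists y.
pose a N := proj1_sig (constructive_indefinite_description _ (ch N)).
have ha N : K (a N) /\ ~ P N (a N) by rewrite /a; case: constructive_indefinite_description.
case: (bolzano_weierstrass a M) => [n|phi [l [hphi hl]]]; first by apply: hM; case: (ha n).
have Kl : K l.
  apply: hcl => eps e0; have e2 : 0 < eps / 2 by lra. case: (hl _ e2) => N /(_ N (Nat.le_refl _)) h.
  exists (a (phi N)); split; [by case: (ha (phi N))|lra].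
case: (hloc l Kl) => N [r [r0 hr]]; have r2 : 0 < r / 2 by lra.
case: (hl _ r2) => N' /(_ (Nat.max N N') (Nat.le_max_r _ _)) h.
case: (ha (phi (Nat.max N N'))) => _; apply; apply: (hmono N).
  have := incr_ge _ hphi (Nat.max N N'); lia.
apply: hr; rewrite /disc; lra.
Qed.

Lemma cdisc_bounded z r y : Cmod (y - z) <= r -> Cmod y <= Cmod z + r.
Proof. move=> h; have := Cmod_le_add y z; lra. Qed.

Lemma cdisc_closed z r y :
  (forall eps, 0 < eps -> exists w, Cmod (w - z) <= r /\ Cmod (w - y) < eps) -> Cmod (y - z) <= r.
Proof.
move=> h; apply: Rnot_lt_le => hlt; have e0 : 0 < Cmod (y - z) - r by lra.
case: (h _ e0) => w [h1 h2]; have := Cmod_tri y w z; rewrite (Cmod_sym y w); lra.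
Qed.

(** * Values on the sphere and meromorphic germs *)

Definition fin (a : option C) : C := if a is Some w then w else RtoC 0.

Definition oinv (a : option C) : option C :=
  if a is Some w then (if excluded_middle_informative (w = 0) then None else Some (/ w)%C) else Some (RtoC 0).

(* Junk value 0 at the poles. *)
Definition fv (f : sphere_fun) (z : C) : C := fin (f z).
Definition sinv (f : sphere_fun) : sphere_fun := fun z => oinv (f z).

Lemma oinv0 : oinv (Some (RtoC 0)) = None.
Proof. by rewrite /oinv; destruct (excluded_middle_informative (RtoC 0 = 0)). Qed.

Lemma oinv_neq0 (w : C) : w <> 0 -> oinv (Some w) = Some (/ w)%C.
Proof. by move=> n; rewrite /oinv; destruct (excluded_middle_informative (w = 0)). Qed.

Lemma Cinv_neq0 (w : C) : w <> 0 -> (/ w)%C <> 0.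
Proof. by move=> n e; have := Cinv_r w n; rewrite e Cmult_0_r => /RtoC_inj; lra. Qed.

Lemma Cinv_inv (w : C) : w <> 0 -> (/ / w = w)%C.
Proof. by move=> n; field. Qed.

Lemma oinvK a : oinv (oinv a) = a.
Proof.
case: a => [w|]; last exact: oinv0.
case: (excluded_middle_informative (w = 0)) => [->|n]; first by rewrite oinv0.
by rewrite oinv_neq0 // oinv_neq0; [rewrite Cinv_inv|exact: Cinv_neq0].
Qed.

Lemma sinvK f : sinv (sinv f) = f.
Proof. by apply: FunctionalExtensionality.functional_extensionality => z; rewrite /sinv oinvK. Qed.

Definition reg (f : sphere_fun) (z : C) : Prop := near z (fun y => f y <> None /\ Cdiff (fv f) y).
(** The germ that is identically infinite qualifies, its inverse being 0; it has to, since limits of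
    meromorphic functions may be infinite. *)
Definition mero (f : sphere_fun) (z : C) : Prop := reg f z \/ reg (sinv f) z.

Lemma reg_near f z : reg f z -> near z (reg f).
Proof. exact: near_near. Qed.

Lemma mero_near f z : mero f z -> near z (mero f).
Proof. by case=> /reg_near; apply: near_mono => y; [left|right]. Qed.

Lemma mero_sinv f z : mero f z -> mero (sinv f) z.
Proof. by case=> h; [right; rewrite sinvK|left]. Qed.

Lemma some_fv f z : f z <> None -> f z = Some (fv f z).
Proof. by rewrite /fv; case: (f z). Qed.

Lemma sinv_zero f z : sinv f z <> None -> fv (sinv f) z = 0 <-> f z = None.
Proof.
rewrite /fv /sinv; case: (f z) => [w|] h; last by split.
case: (excluded_middle_informative (w = 0)) => [w0|n]; first by case: h; rewrite w0 oinv0.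
by rewrite oinv_neq0 //; split=> // /(Cinv_neq0 _ n).
Qed.

Lemma fv_sinv f z : f z <> None -> sinv f z <> None -> fv f z <> 0 /\ fv (sinv f) z = (/ fv f z)%C.
Proof.
rewrite /fv /sinv; case: (f z) => [w|] h h2; last by [].
case: (excluded_middle_informative (w = 0)) => [w0|n]; first by case: h2; rewrite w0 oinv0.
by rewrite oinv_neq0.
Qed.

Lemma sinv_some f z : f z <> None -> fv f z <> 0 -> sinv f z <> None.
Proof. by rewrite /fv /sinv; case: (f z) => [w|] h n //; rewrite oinv_neq0. Qed.

Lemma sinv_fin f z : sinv f z <> None -> fv (sinv f) z <> 0 -> f z <> None.
Proof. by move=> h n e; apply: n; apply/sinv_zero. Qed.

Lemma near_inv f z : reg f z -> fv f z <> 0 ->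
  near z (fun y => f y <> None /\ sinv f y <> None /\ fv f y <> 0 /\ fv (sinv f) y = (/ fv f y)%C).
Proof.
move=> h n; have [_ hd] := near_self _ _ h; have hc := Cc_neq _ _ _ (Cdiff_Cc _ _ hd) n.
apply: near2 h hc => y [h1 _] h2; have h3 := sinv_some _ _ h1 h2; by have [_ h4] := fv_sinv _ _ h1 h3.
Qed.

Lemma reg_sinv f z : reg f z -> fv f z <> 0 -> reg (sinv f) z.
Proof.
move=> h n; apply: near2 (near_near _ _ (near_inv _ _ h n)) h => y hy [h1 h2].
have [_ [h3 [h4 _]]] := near_self _ _ hy; split=> //.
apply: (Cdiff_ext (fun y => / fv f y)%C); last exact: Cdiff_inv.
by apply: near_mono hy => w [_ [_ [_ ->]]].
Qed.

Lemma mero_finite f z : mero f z -> f z <> None -> reg f z.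
Proof.
case=> // h n; rewrite -(sinvK f); apply: reg_sinv => // e; apply: n; apply/sinv_zero => //.
by case: (near_self _ _ h).
Qed.

Lemma mero_pole f z : mero f z -> f z = None -> reg (sinv f) z.
Proof. by case=> // /near_self [h _] /h. Qed.

Lemma reg_hol f z : reg f z -> near z (Cdiff (fv f)).
Proof. by apply: near_mono => y []. Qed.

Lemma meromorphic_mero D f : meromorphic_on D f -> forall z, D z -> mero f z.
Proof.
move=> h z /h [r [r0 [[g [hg e]]|[n0 [u [hu e]]]]]].
- left; apply: near_mono (near_near _ _ (near_disc z r r0)) => y hy; have hyd := near_self _ _ hy.
  rewrite e //; split=> //; apply: (Cdiff_ext g); last exact: hg.
  by apply: near_mono hy => w hw; rewrite /fv e.
- right; have es y : disc z r y -> sinv f y = Some (u y).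
    move=> hy; have := e y hy; rewrite /sinv; case: (f y) => [w [wn uw]|/= ->//].
    rewrite oinv_neq0 //; congr Some; have -> : (/ w = u y * w * / w)%C by rewrite uw; ring. by field.
  apply: near_mono (near_near _ _ (near_disc z r r0)) => y hy; have hyd := near_self _ _ hy.
  rewrite es //; split=> //; apply: (Cdiff_ext u); last exact: hu.
  by apply: near_mono hy => w hw; rewrite /fv es.
Qed.

(** The spherical derivative. At a pole it is computed for 1 / f, whose value there is 0, which
    makes it invariant under inversion ([sharp_sinv]). *)
Definition sharp (f : sphere_fun) (z : C) : R :=
  if f z is Some w then Cmod (C_derive (fv f) z) / (1 + Cmod w ^ 2) else Cmod (C_derive (fv (sinv f)) z).

Lemma sharp_fin f z : f z <> None -> sharp f z = Cmod (C_derive (fv f) z) / (1 + Cmod (fv f z) ^ 2).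
Proof. by rewrite /sharp /fv; case: (f z). Qed.

Lemma sharp_pole f z : f z = None -> sharp f z = Cmod (C_derive (fv (sinv f)) z).
Proof. by rewrite /sharp; case: (f z). Qed.

Lemma one_sq_pos x : 0 < 1 + x ^ 2.
Proof. have := pow2_ge_0 x; lra. Qed.

Lemma sharp_ge0 f z : 0 <= sharp f z.
Proof.
rewrite /sharp; case: (f z) => [w|]; last exact: Cmod_ge_0.
apply: Rdiv_le_0_compat; [exact: Cmod_ge_0|exact: one_sq_pos].
Qed.

Lemma sharp_sinv f z : mero f z -> sharp (sinv f) z = sharp f z.
Proof.
move=> hm; case: (excluded_middle_informative (f z = None)) => [e|n].
  have es : sinv f z = Some (RtoC 0) by rewrite /sinv e.
  rewrite (sharp_pole _ _ e) sharp_fin ?es // /fv es /= Cmod_0; field.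
have hr := mero_finite _ _ hm n.
case: (excluded_middle_informative (fv f z = 0)) => [e0|n0].
  have es : sinv f z = None by rewrite /sinv (some_fv _ _ n) e0 oinv0.
  rewrite (sharp_pole _ _ es) sinvK sharp_fin // e0 Cmod_0; field.
have hi := near_inv _ _ hr n0; have [_ [s1 [_ s2]]] := near_self _ _ hi.
have hd := proj2 (near_self _ _ hr).
have d : C_derive (fv (sinv f)) z = (- C_derive (fv f) z / (fv f z * fv f z))%C.
  apply: CD_unique; apply: (CD_ext (fun y => / fv f y)%C); last exact: CD_invf (CD_cder _ _ hd) n0.
  by apply: near_mono hi => y [_ [_ [_ ->]]].
rewrite !sharp_fin // d s2 Cmod_inv // Cmod_div; last exact: Cmul_neq0.
rewrite Cmod_opp Cmod_mult; have := proj1 (Cmod_gt_0 _) n0 => p; field; repeat split; nra.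
Qed.

(* Cartesian coordinates of the point a on the sphere of diameter 1 resting on the plane. *)
Definition sc (j : nat) (a : option C) : R :=
  match a with
  | None => 0
  | Some w => match j with O => / (1 + Cmod w ^ 2) | 1%nat => fst w / (1 + Cmod w ^ 2) | _ => snd w / (1 + Cmod w ^ 2) end
  end.

(** Inversion acts on the sphere as the half-turn sending coordinates (t, x, y) to (1 - t, x, - y);
    with the next two lemmas this transfers every estimate from finite values to poles. *)
Lemma sc_oinv0 a : sc 0 (oinv a) = 1 - sc 0 a.
Proof.
case: a => [w|]; last by rewrite /= Cmod_0; field.
case: (excluded_middle_informative (w = 0)) => [->|n]; first by rewrite oinv0 /= Cmod_0; field.
rewrite oinv_neq0 //= Cmod_inv //; have := proj1 (Cmod_gt_0 _) n => p; field; repeat split; nra.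
Qed.

Lemma Cinv_div (w : C) : w <> 0 -> (/ w)%C = (RtoC (/ Cmod w ^ 2) * Cconj w)%C.
Proof.
move=> n; have p := proj1 (Cmod_gt_0 _) n; have h := Cmod2_conj w.
have n2 : RtoC (Cmod w ^ 2) <> 0 by move/RtoC_inj; nra.
have nc : Cconj w <> 0 by move=> e; apply: n2; rewrite h e Cmult_0_r.
have -> : RtoC (/ Cmod w ^ 2) = (/ (w * Cconj w))%C .
  by rewrite -h RtoC_inv //; nra.
field; by split.
Qed.

Lemma sc_oinv1 a : sc 1 (oinv a) = sc 1 a.
Proof.
case: a => [w|]; last by rewrite /= Cmod_0; field.
case: (excluded_middle_informative (w = 0)) => [->|n]; first by rewrite oinv0 /= Cmod_0; field.
rewrite oinv_neq0 // /sc Cmod_inv // Cinv_div //; have := proj1 (Cmod_gt_0 _) n; move: (Cmod w) => c p.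
by case: w n => x y n /=; field; repeat split; nra.
Qed.

Lemma sc_oinv2 a : sc 2 (oinv a) = - sc 2 a.
Proof.
case: a => [w|]; last by rewrite /= Cmod_0; field.
case: (excluded_middle_informative (w = 0)) => [->|n]; first by rewrite oinv0 /= Cmod_0; field.
rewrite oinv_neq0 // /sc Cmod_inv // Cinv_div //; have := proj1 (Cmod_gt_0 _) n; move: (Cmod w) => c p.
by case: w n => x y n /=; field; repeat split; nra.
Qed.

Lemma sc_sphere a : sc 1 a ^ 2 + sc 2 a ^ 2 = sc 0 a - sc 0 a ^ 2.
Proof.
case: a => [w|] /=; last ring. have := Cmod2_alt w; rewrite /= => ->.
case: w => x y; rewrite /Re /Im /=; field; nra.
Qed.

Lemma sc_surj t x y : x ^ 2 + y ^ 2 = t - t ^ 2 -> exists a, sc 0 a = t /\ sc 1 a = x /\ sc 2 a = y.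
Proof.
move=> h; case: (Req_dec t 0) => [t0|t0].
  exists None; rewrite /= t0 in h *; have : x = 0 by nra. have : y = 0 by nra. by move=> -> ->.
exists (Some (x / t, y / t)); have e : 1 + Cmod (x / t, y / t) ^ 2 = / t.
  rewrite Cmod2_alt /Re /Im /=; have -> : 1 + (x / t * (x / t * 1) + y / t * (y / t * 1)) = (t ^ 2 + (x ^ 2 + y ^ 2)) / t ^ 2 by field.
  rewrite h; field. by [].
rewrite /sc e /=; repeat split; field => //.
Qed.

Lemma sc_bound j a : Rabs (sc j a) <= 1.
Proof.
have h := sc_sphere a; have b x : x ^ 2 <= / 4 -> -1 <= x <= 1 by move=> hx; split; nra.
have q : (sc 0 a - / 2) ^ 2 + sc 1 a ^ 2 + sc 2 a ^ 2 = / 4 by move: h; rewrite /=; lra.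
have q0 := pow2_ge_0 (sc 0 a - / 2); have q1 := pow2_ge_0 (sc 1 a); have q2 := pow2_ge_0 (sc 2 a).
have s : -1 <= sc 0 a <= 1 /\ -1 <= sc 1 a <= 1 /\ -1 <= sc 2 a <= 1.
  by split; [split; nra|split; apply: b; lra].
apply/Rabs_le_between; case: j => [|[|j]]; try tauto.
Qed.

Lemma RD_im p t l : RD p t l -> is_derive (fun s => Im (p s)) t (Im l).
Proof.
move=> h; have := RD_re _ _ _ (RD_comp (fun w => - Ci * w)%C _ _ _ _ (CD_scal _ _ _ _ (CD_id _)) h).
have -> : Re (l * (- Ci * 1)) = Im l by rewrite /Re /Im /=; ring.
apply: is_derive_ext => s; rewrite /Re /Im /=; ring.
Qed.

Lemma is_derive_div_sq (n x y : R -> R) t n' x' y' :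
  is_derive n t n' -> is_derive x t x' -> is_derive y t y' ->
  is_derive (fun s => n s / (1 + (x s * x s + y s * y s))) t
    (n' / (1 + (x t * x t + y t * y t)) - n t * (2 * (x t * x' + y t * y')) / (1 + (x t * x t + y t * y t)) ^ 2).
Proof.
move=> hn hx hy.
have d1 := is_derive_plus _ _ _ _ _ (is_derive_const 1 t) (is_derive_plus _ _ _ _ _
  (is_derive_mult _ _ _ _ _ hx hx Rmult_comm) (is_derive_mult _ _ _ _ _ hy hy Rmult_comm)).
have p : 1 + (x t * x t + y t * y t) <> 0 by nra.
have := is_derive_div _ _ _ _ _ hn d1 p; rewrite /plus /mult /zero /=.
set X := (_ / _) in |- *; set Y := (_ - _) in |- *; have -> : X = Y; last by [].
rewrite /X /Y; field; nra.
Qed.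

Lemma sc_derive_fin j p t v : RD p t v ->
  exists l, is_derive (fun s => sc j (Some (p s))) t l /\ Rabs l <= 3 * (Cmod v / (1 + Cmod (p t) ^ 2)).
Proof.
move=> h; have hx := RD_re _ _ _ h; have hy := RD_im _ _ _ h.
have e s : 1 + (Re (p s) * Re (p s) + Im (p s) * Im (p s)) = 1 + Cmod (p s) ^ 2 by rewrite Cmod2_alt; ring.
pose n s := match j with O => 1 | 1%nat => Re (p s) | _ => Im (p s) end.
have [n' [hn [hn1 hn2]]] : exists n', is_derive n t n' /\ Rabs n' <= Cmod v /\ Rabs (n t) <= 1 + Cmod (p t).
  have c0 := Cmod_ge_0 v; have p0 := Cmod_ge_0 (p t).
  have im w : Rabs (Im w) <= Cmod w by exact: (Rle_trans _ _ _ (Rmax_r _ _) (Rmax_Cmod w)).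
  rewrite /n; case: j {n} => [|[|j]].
  - exists 0; split; [exact: is_derive_const|split; rewrite ?Rabs_R0 ?Rabs_R1; lra].
  - exists (Re v); split=> //; split; [exact: re_le_Cmod|have := re_le_Cmod (p t); lra].
  - exists (Im v); split=> //; split; [exact: im|have := im (p t); lra].
have hn3 : Rabs (n t) * Cmod (p t) <= 1 + Cmod (p t) ^ 2.
  have c0 := Cmod_ge_0 (p t).
  have im w : Rabs (Im w) <= Cmod w by exact: (Rle_trans _ _ _ (Rmax_r _ _) (Rmax_Cmod w)).
  rewrite /n; case: j {n hn hn1 hn2} => [|[|j]].
  - rewrite Rabs_R1; nra.
  - have := re_le_Cmod (p t); have := Rabs_pos (Re (p t)); nra.
  - have := im (p t); have := Rabs_pos (Im (p t)); nra.
eexists; split.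
  have := is_derive_div_sq _ _ _ _ _ _ _ hn hx hy; apply: is_derive_ext => s; rewrite e.
  rewrite /n /sc; case: j {n hn hn1 hn2 hn3} => [|[|j]] //; by rewrite /Rdiv Rmult_1_l.
rewrite e; set D := 1 + Cmod (p t) ^ 2 in hn3 *; have D0 : 0 < D by exact: one_sq_pos.
have hip : Rabs (Re (p t) * Re v + Im (p t) * Im v) <= Cmod (p t) * Cmod v.
  have := re_le_Cmod (Cconj (p t) * v); rewrite Cmod_mult Cmod_conj; apply: Rle_trans; right; congr Rabs.
  rewrite /Re /Im /=; ring.
rewrite /Rminus; apply: Rle_trans (Rabs_triang _ _) _; rewrite Rabs_Ropp.
have i0 : 0 < / D by exact: Rinv_0_lt_compat.
have t1 : Rabs (n' / D) <= Cmod v / D.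
  rewrite /Rdiv Rabs_mult (Rabs_pos_eq (/ D)); last lra. apply: Rmult_le_compat_r; lra.
have t2 : Rabs (n t * (2 * (Re (p t) * Re v + Im (p t) * Im v)) / D ^ 2) <= 2 * (Cmod v / D).
  have -> : n t * (2 * (Re (p t) * Re v + Im (p t) * Im v)) / D ^ 2 =
     2 * (n t * (Re (p t) * Re v + Im (p t) * Im v)) * (/ D * / D) by field; lra.
  rewrite Rabs_mult (Rabs_pos_eq (/ D * / D)); last by apply: Rmult_le_pos; lra.
  rewrite !Rabs_mult (Rabs_pos_eq 2); last lra.
  have : Rabs (n t) * Rabs (Re (p t) * Re v + Im (p t) * Im v) <= D * Cmod v.
    apply: Rle_trans (_ : Rabs (n t) * (Cmod (p t) * Cmod v) <= _).
      by apply: Rmult_le_compat_l => //; exact: Rabs_pos.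
    rewrite -Rmult_assoc; apply: Rmult_le_compat_r => //; exact: Cmod_ge_0.
  move=> hh; have -> : 2 * (Cmod v / D) = 2 * (D * Cmod v) * (/ D * / D) by field; lra.
  apply: Rmult_le_compat_r; first by apply: Rmult_le_pos; lra. lra.
lra.
Qed.

Lemma sc_derive_reg j f a b t : reg f (seg a b t) ->
  exists l, is_derive (fun s => sc j (f (seg a b s))) t l /\ Rabs l <= 3 * (sharp f (seg a b t) * Cmod (b - a)).
Proof.
move=> hr; have [h1 h2] := near_self _ _ hr.
case: (sc_derive_fin j _ _ _ (RD_comp _ _ _ _ _ (CD_cder _ _ h2) (RD_seg a b t))) => l [hl bl].
exists l; split.
- apply: is_derive_ext_loc hl; case: hr => r [r0 hr]; case: (RD_pc _ _ _ (RD_seg a b t) r r0) => d [d0 hd].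
  exists (mkposreal d d0) => s hs; rewrite -some_fv //; by case: (hr _ (hd s hs)).
- move: bl; rewrite sharp_fin // Cmod_mult /Rdiv; lra.
Qed.

Ltac ringR := match goal with |- ?a = ?b => change (@eq R a b) end; ring.

Lemma sc_derive j f a b t : mero f (seg a b t) ->
  exists l, is_derive (fun s => sc j (f (seg a b s))) t l /\ Rabs l <= 3 * (sharp f (seg a b t) * Cmod (b - a)).
Proof.
case=> h; first exact: sc_derive_reg.
case: (sc_derive_reg j _ a b t h) => l; rewrite sharp_sinv; last by right.
move=> [hl bl]; case: j hl => [|[|j]] hl.
- exists (- l); rewrite Rabs_Ropp; split=> //.
  have := is_derive_minus _ _ _ _ _ (is_derive_const 1 t) hl; rewrite /minus /zero /plus /opp /= Rplus_0_l.
  by apply: is_derive_ext => s; rewrite /sinv sc_oinv0; ringR.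
- by exists l; split=> //; apply: is_derive_ext hl => s; rewrite /sinv sc_oinv1.
- exists (- l); rewrite Rabs_Ropp; split=> //; apply: is_derive_ext (is_derive_opp _ _ _ hl) => s.
  have e2 x : sc (S (S j)) x = sc 2 x by case: x.
  rewrite !e2 /sinv sc_oinv2 /opp /=; ringR.
Qed.

(** The way a bound on the spherical derivative is used throughout: it gives equicontinuity on the
    sphere, across poles as well. *)
Lemma sc_lipschitz j f a b M : (forall t, 0 <= t <= 1 -> mero f (seg a b t) /\ sharp f (seg a b t) <= M) ->
  Rabs (sc j (f b) - sc j (f a)) <= 3 * M * Cmod (b - a).
Proof.
move=> h; have ch t : exists l, 0 <= t <= 1 -> is_derive (fun s => sc j (f (seg a b s))) t l /\ Rabs l <= 3 * M * Cmod (b - a).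
  case: (excluded_middle_informative (0 <= t <= 1)) => [ht|n]; last by exists 0 => /n.
  case: (h t ht) => hm hs; case: (sc_derive j f a b t hm) => l [hl bl]; exists l => _; split=> //.
  apply: Rle_trans bl _; have := Rmult_le_compat_r _ _ _ (Cmod_ge_0 (b - a)) hs; lra.
pose l t := proj1_sig (constructive_indefinite_description _ (ch t)).
have hl t : 0 <= t <= 1 -> is_derive (fun s => sc j (f (seg a b s))) t (l t) /\ Rabs (l t) <= 3 * M * Cmod (b - a).
  by rewrite /l; case: constructive_indefinite_description.
case: (MVT_gen (fun s => sc j (f (seg a b s))) 0 1 l).
- rewrite Rmin_left ?Rmax_right; try lra. move=> t ht; apply: (proj1 (hl t _)); lra.
- rewrite Rmin_left ?Rmax_right; try lra. move=> t ht.
  apply: derivable_continuous_pt; exists (l t); apply/is_derive_Reals; exact: (proj1 (hl t ht)).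
move=> t; rewrite Rmin_left ?Rmax_right; try lra. rewrite seg0 seg1 => -[ht ->].
rewrite Rminus_0_r Rmult_1_r; exact: (proj2 (hl t ht)).
Qed.

(** * Locally uniform convergence on the sphere *)

Definition rcv (fs : nat -> sphere_fun) (F : sphere_fun) (z : C) : Prop :=
  exists r, 0 < r /\
    (exists N, forall n y, (N <= n)%nat -> disc z r y -> fs n y <> None /\ Cdiff (fv (fs n)) y) /\
    (forall y, disc z r y -> F y <> None) /\
    forall eps, 0 < eps -> exists N, forall n y, (N <= n)%nat -> disc z r y -> Cmod (fv (fs n) y - fv F y) <= eps.

(** One of the two charts serves the whole tail of the sequence and the limit near z, so that
    Weierstrass's theorem on holomorphic functions applies to it. *)
Definition scv (fs : nat -> sphere_fun) (F : sphere_fun) (z : C) : Prop :=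
  rcv fs F z \/ rcv (fun n => sinv (fs n)) (sinv F) z.

Lemma rcv_lcv fs F z : rcv fs F z -> lcv (fun n => fv (fs n)) (fv F) z.
Proof.
move=> [r [r0 [[N hN] [_ hu]]]]; exists r; split=> //; split=> //; exists N => n hn y hy.
by case: (hN n y hn hy).
Qed.

Lemma rcv_reg fs F z : rcv fs F z -> reg F z.
Proof.
move=> h; have := lcv_hol _ _ _ (rcv_lcv _ _ _ h); case: h => r [r0 [_ [h _]]].
by move=> h2; apply: near2 (near_disc z r r0) h2 => y hy hd; split=> //; exact: h.
Qed.

Lemma rcv_eventually fs F z : rcv fs F z ->
  exists r N, 0 < r /\ forall n y, (N <= n)%nat -> disc z r y -> fs n y <> None /\ Cdiff (fv (fs n)) y.
Proof. by move=> [r [r0 [[N hN] _]]]; exists r, N. Qed.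

Lemma scv_mero fs F z : scv fs F z -> mero F z.
Proof. by case=> /rcv_reg; [left|right]. Qed.

Lemma scv_sinv fs F z : scv fs F z -> scv (fun n => sinv (fs n)) (sinv F) z.
Proof.
case=> h; [right|by left]. rewrite sinvK.
by have -> : (fun n => sinv (sinv (fs n))) = fs by apply: FunctionalExtensionality.functional_extensionality => n; rewrite sinvK.
Qed.

Lemma rcv_inv fs F z : rcv fs F z -> fv F z <> 0 -> rcv (fun n => sinv (fs n)) (sinv F) z.
Proof.
move=> h n0; have hl := rcv_lcv _ _ _ h; have li := lcv_inv _ _ _ hl n0.
have p0 := proj1 (Cmod_gt_0 _) n0; have p2 : 0 < Cmod (fv F z) / 2 by lra.
case: (lcv_eval _ _ _ _ hl p2) => d [N1 [d0 hd]]; case: (near_inv _ _ (rcv_reg _ _ _ h) n0) => a [a0 ha].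
case: h => r [r0 [[N hN] [hF _]]]; case: li => s [s0 [[N2 h2] hu]].
set t := Rmin (Rmin r s) (Rmin a d); have t0 : 0 < t by apply: Rmin_pos; apply: Rmin_pos.
have [m1 [m2 [m3 m4]]] : t <= r /\ t <= s /\ t <= a /\ t <= d.
  have := Rmin_l (Rmin r s) (Rmin a d); have := Rmin_r (Rmin r s) (Rmin a d); rewrite -/t.
  have := Rmin_l r s; have := Rmin_r r s; have := Rmin_l a d; have := Rmin_r a d; lra.
have dt y x : t <= x -> disc z t y -> disc z x y by rewrite /disc; lra.
have key n y : (Nat.max N N1 <= n)%nat -> disc z t y -> sinv (fs n) y <> None /\ fv (sinv (fs n)) y = (/ fv (fs n) y)%C.
  move=> hn hy; have [f1 _] := hN n y (ltac:(lia)) (dt _ _ m1 hy).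
  have nz : fv (fs n) y <> 0.
    move=> e; have := hd n y (ltac:(lia)) (dt _ _ m4 hy); rewrite e.
    have -> : (0 - fv F z = - fv F z)%C by ring. rewrite Cmod_opp; lra.
  have s1 := sinv_some _ _ f1 nz; split=> //; by case: (fv_sinv _ _ f1 s1).
exists t; split=> //; split; [|split].
- exists (Nat.max (Nat.max N N1) N2) => n y hn hy; have [k1 k2] := key n y (ltac:(lia)) hy; split=> //.
  apply: (Cdiff_ext (fun y => / fv (fs n) y)%C); last by apply: h2 (dt _ _ m2 hy); lia.
  by apply: near_mono (near_open _ _ _ hy) => w hw; case: (key n w (ltac:(lia)) hw) => _ ->.
- by move=> y hy; case: (ha y (dt _ _ m3 hy)) => _ [].
- move=> eps /hu [N3 h3]; exists (Nat.max (Nat.max N N1) N3) => n y hn hy.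
  case: (key n y (ltac:(lia)) hy) => _ ->; case: (ha y (dt _ _ m3 hy)) => _ [_ [_ ->]].
  by apply: h3 (dt _ _ m2 hy); lia.
Qed.

Lemma scv_finite fs F z : scv fs F z -> F z <> None -> rcv fs F z.
Proof.
case=> // h n; have e1 : (fun n => sinv (sinv (fs n))) = fs.
  by apply: FunctionalExtensionality.functional_extensionality => k; rewrite sinvK.
rewrite -(sinvK F) -e1; apply: rcv_inv => // e; apply: n; apply/sinv_zero => //.
by case: (near_self _ _ (rcv_reg _ _ _ h)).
Qed.

Lemma scv_pole fs F z : scv fs F z -> F z = None -> rcv (fun n => sinv (fs n)) (sinv F) z.
Proof. by move=> h e; apply: scv_finite (scv_sinv _ _ _ h) _; rewrite /sinv e. Qed.

Lemma rcv_subseq fs F z phi : incr phi -> rcv fs F z -> rcv (fun n => fs (phi n)) F z.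
Proof.
move=> hp [r [r0 [[N hN] [hF hu]]]]; have g := incr_ge _ hp; exists r; split=> //; split; [|split=> //].
- by exists N => n y hn; apply: hN; have := g n; lia.
- by move=> eps /hu [M hM]; exists M => n y hn; apply: hM; have := g n; lia.
Qed.

Lemma scv_subseq fs F z phi : incr phi -> scv fs F z -> scv (fun n => fs (phi n)) F z.
Proof.
move=> hp [h|h]; [left; exact: rcv_subseq hp h|right].
exact: (rcv_subseq (fun n => sinv (fs n)) (sinv F) z phi hp h).
Qed.

Lemma chordal_le x y : chordal (Some x) (Some y) <= Cmod (x - y).
Proof.
rewrite /chordal; have s1 w : 1 <= sqrt (1 + Cmod w ^ 2).
  rewrite -{1}sqrt_1; apply: sqrt_le_1_alt; have := pow2_ge_0 (Cmod w); lra.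
have := s1 x; have := s1 y => h1 h2; have h3 : 1 <= sqrt (1 + Cmod x ^ 2) * sqrt (1 + Cmod y ^ 2) by nra.
apply/Rle_div_l; first lra. rewrite -{1}(Rmult_1_r (Cmod _)); apply: Rmult_le_compat_l => //; exact: Cmod_ge_0.
Qed.

Lemma sqrt_inv_sq (x : C) : x <> 0 -> sqrt (1 + Cmod (/ x) ^ 2) = sqrt (1 + Cmod x ^ 2) / Cmod x.
Proof.
move=> n; have p := proj1 (Cmod_gt_0 _) n; rewrite Cmod_inv //.
have -> : 1 + (/ Cmod x) ^ 2 = (1 + Cmod x ^ 2) / (Cmod x ^ 2) by field; lra.
rewrite sqrt_div_alt; last by apply: pow_lt. by rewrite sqrt_pow2; lra.
Qed.

Lemma chordal_oinv a b : chordal (oinv a) (oinv b) = chordal a b.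
Proof.
have one w : sqrt (1 + Cmod w ^ 2) <> 0 by apply: Rgt_not_eq; apply: sqrt_lt_R0; exact: one_sq_pos.
have s1 : sqrt (1 + Cmod 0 ^ 2) = 1 by rewrite Cmod_0 (_ : 1 + 0 ^ 2 = 1) ?sqrt_1 //; ring.
case: a => [x|]; case: b => [y|] //.
- case: (excluded_middle_informative (x = 0)) => [->|nx]; case: (excluded_middle_informative (y = 0)) => [->|ny].
  + by rewrite oinv0 /= Cmod_sub_self /Rdiv Rmult_0_l.
  + rewrite oinv0 oinv_neq0 // /chordal sqrt_inv_sq // s1.
    have -> : (0 - y = - y)%C by ring. rewrite Cmod_opp; have := proj1 (Cmod_gt_0 _) ny; move=> p; field; repeat split; first [exact: one|lra].
  + rewrite oinv0 oinv_neq0 // /chordal sqrt_inv_sq // s1.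
    have -> : (x - 0 = x)%C by ring. have := proj1 (Cmod_gt_0 _) nx; move=> p; field; repeat split; first [exact: one|lra].
  + have px := proj1 (Cmod_gt_0 _) nx; have py := proj1 (Cmod_gt_0 _) ny.
    rewrite !oinv_neq0 // /chordal !sqrt_inv_sq //.
    have -> : (/ x - / y = (y - x) / (x * y))%C by field.
    rewrite Cmod_div ?Cmod_mult ?(Cmod_sym y x); last exact: Cmul_neq0.
    have o1 := one x; have o2 := one y; field; repeat split; first [exact: one|lra].
- case: (excluded_middle_informative (x = 0)) => [->|nx].
    by rewrite oinv0.
  rewrite oinv_neq0 // [oinv None]/= /chordal sqrt_inv_sq // s1; have -> : (/ x - 0 = / x)%C by ring.
  rewrite Cmod_inv //; have := proj1 (Cmod_gt_0 _) nx; move=> p; field; repeat split; first [exact: one|lra].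
- case: (excluded_middle_informative (y = 0)) => [->|ny].
    by rewrite oinv0.
  rewrite oinv_neq0 // [oinv None]/= /chordal sqrt_inv_sq // s1; have -> : (0 - / y = - / y)%C by ring.
  rewrite Cmod_opp Cmod_inv //; have := proj1 (Cmod_gt_0 _) ny; move=> p; field; repeat split; first [exact: one|lra].
- by rewrite /= Cmod_sub_self /Rdiv Rmult_0_l.
Qed.

Lemma rcv_chordal fs F z eps : rcv fs F z -> 0 < eps ->
  exists N, near z (fun y => forall n, (N <= n)%nat -> chordal (fs n y) (F y) < eps).
Proof.
move=> [r [r0 [[N hN] [hF hu]]]] e0; have e2 : 0 < eps / 2 by lra.
case: (hu _ e2) => N' h'; exists (Nat.max N N'); exists r; split=> // y hy n hn.
case: (hN n y (ltac:(lia)) hy) => n1 _; rewrite (some_fv _ _ n1) (some_fv _ _ (hF y hy)).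
apply: Rle_lt_trans (chordal_le _ _) _; have := h' n y (ltac:(lia)) hy; lra.
Qed.

Lemma scv_chordal fs F z eps : scv fs F z -> 0 < eps ->
  exists N, near z (fun y => forall n, (N <= n)%nat -> chordal (fs n y) (F y) < eps).
Proof.
case=> h e0; first exact: rcv_chordal h e0.
case: (rcv_chordal _ _ _ _ h e0) => N hN; exists N; apply: near_mono hN => y hy n hn.
by rewrite -chordal_oinv; apply: hy.
Qed.

Lemma lcv_eval_seq fn f z (y : nat -> C) : lcv fn f z -> Ccv y z -> Ccv (fun n => fn n (y n)) (f z).
Proof.
move=> h hy eps e0; case: (lcv_eval _ _ _ _ h e0) => d [N [d0 hd]]; have d2 : 0 < d / 2 by lra.
case: (hy _ d2) => N' h'; exists (Nat.max N N') => n hn; apply: hd; first lia.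
rewrite /disc; have := h' n (ltac:(lia)); lra.
Qed.

Lemma Ccv_is_lim_seq a l : Ccv a l -> is_lim_seq (fun n => Cmod (a n)) (Cmod l).
Proof.
move=> h; apply/is_lim_seq_Reals => eps e0; have e2 : 0 < eps / 2 by lra.
case: (h _ e2) => N hN; exists N => n hn; rewrite /R_dist; have := hN n hn.
have := Cmod_le_add (a n) l; have := Cmod_le_add l (a n); rewrite (Cmod_sym l) => h1 h2 h3.
apply: Rle_lt_trans (_ : eps / 2 < _); last lra. apply/Rabs_le_between; lra.
Qed.

Lemma rcv_sharp fs F z y : rcv fs F z -> Ccv y z -> is_lim_seq (fun n => sharp (fs n) (y n)) (sharp F z).
Proof.
move=> h hy; have hl := rcv_lcv _ _ _ h.
have l1 := Ccv_is_lim_seq _ _ (lcv_eval_seq _ _ _ _ hl hy).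
have l2 := Ccv_is_lim_seq _ _ (lcv_eval_seq _ _ _ _ (lcv_cder _ _ _ hl) hy).
case: h => r [r0 [[N hN] [hF _]]]; have r2 : 0 < r / 2 by lra.
case: (hy _ r2) => N' h'; rewrite sharp_fin; last by apply: hF; exact: disc_center.
apply: (is_lim_seq_ext_loc (fun n => Cmod (C_derive (fv (fs n)) (y n)) / (1 + Cmod (fv (fs n) (y n)) * Cmod (fv (fs n) (y n))))).
  exists (Nat.max N N') => n hn; rewrite sharp_fin /= ?Rmult_1_r //.
  case: (hN n (y n)); [lia|rewrite /disc; have := h' n (ltac:(lia)); lra|by []].
have -> : 1 + Cmod (fv F z) ^ 2 = 1 + Cmod (fv F z) * Cmod (fv F z) by ring.
apply: is_lim_seq_div'; [exact: l2| |have := Cmod_ge_0 (fv F z); nra].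
by apply: is_lim_seq_plus'; [exact: is_lim_seq_const|apply: is_lim_seq_mult'].
Qed.

Lemma scv_sharp fs F z y : scv fs F z -> Ccv y z ->
  (exists r N, 0 < r /\ forall n w, (N <= n)%nat -> disc z r w -> mero (fs n) w) ->
  is_lim_seq (fun n => sharp (fs n) (y n)) (sharp F z).
Proof.
move=> h hy hm; case: (h) => h1; first exact: rcv_sharp h1 hy.
have := rcv_sharp _ _ _ _ h1 hy; rewrite sharp_sinv; last exact: scv_mero h.
apply: is_lim_seq_ext_loc; case: hm => r [N [r0 hN]]; have r2 : 0 < r / 2 by lra.
case: (hy _ r2) => N' h'; exists (Nat.max N N') => n hn; apply: sharp_sinv; apply: hN; first lia.
rewrite /disc; have := h' n (ltac:(lia)); lra.
Qed.

Lemma Ccv_cst z : Ccv (fun _ => z) z.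
Proof. by move=> eps e0; exists O => n _; rewrite Cmod_sub_self; lra. Qed.

(* An enumeration of a dense subset of C. *)
Definition dpt (j : nat) : C :=
  let q s := (INR (fst (Cantor.of_nat (fst (Cantor.of_nat s)))) - INR (snd (Cantor.of_nat (fst (Cantor.of_nat s)))))
             / (INR (snd (Cantor.of_nat s)) + 1) in
  (q (fst (Cantor.of_nat j)), q (snd (Cantor.of_nat j))).

Lemma rational_dense x eps : 0 < eps -> exists a b c, Rabs ((INR a - INR b) / (INR c + 1) - x) < eps.
Proof.
move=> e0; case: (INR_unbounded (/ eps)) => c hc; have i0 := Rinv_0_lt_compat _ e0.
case: (archimed (x * (INR c + 1))) => u1 u2; set n := up (x * (INR c + 1)) in u1 u2.
have key a b : INR a - INR b = IZR n -> Rabs ((INR a - INR b) / (INR c + 1) - x) < eps.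
  move=> ->; have -> : IZR n / (INR c + 1) - x = (IZR n - x * (INR c + 1)) * / (INR c + 1) by field; lra.
  rewrite Rabs_mult (Rabs_pos_eq (/ _)); last by left; apply: Rinv_0_lt_compat; lra.
  apply: Rle_lt_trans (_ : 1 * / (INR c + 1) < _).
    apply: Rmult_le_compat_r; first by left; apply: Rinv_0_lt_compat; lra. by apply/Rabs_le_between; lra.
  rewrite Rmult_1_l -(Rinv_inv eps); apply: Rinv_lt_contravar; nra.
case: (Z_le_gt_dec 0 n) => hn.
- exists (Z.to_nat n), O, c; apply: key; rewrite INR_IZR_INZ Z2Nat.id //= Rminus_0_r //.
- exists O, (Z.to_nat (- n)), c; apply: key; rewrite (INR_IZR_INZ (Z.to_nat _)) Z2Nat.id; last lia.
  rewrite opp_IZR /=; lra.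
Qed.

Lemma dpt_dense z eps : 0 < eps -> exists j, Cmod (dpt j - z) < eps.
Proof.
move=> e0; have e2 : 0 < eps / 2 by lra.
case: (rational_dense (fst z) _ e2) => a [b [c h1]]; case: (rational_dense (snd z) _ e2) => a' [b' [c' h2]].
exists (Cantor.to_nat (Cantor.to_nat (Cantor.to_nat (a, b), c), Cantor.to_nat (Cantor.to_nat (a', b'), c'))).
rewrite /dpt; repeat (rewrite Cantor.cancel_of_to; cbn [fst snd]).
case: z h1 h2 => x y; cbn [fst snd]; rewrite /Cminus /Cplus /Copp; cbn [fst snd] => h1 h2.
apply: Rle_lt_trans (Cmod_pair_le _ _) _; apply: Rlt_le_trans (Rplus_lt_compat _ _ _ _ h1 h2) _; lra.
Qed.

(** Height at least 1/5 means modulus at most 2, and a value is recovered there from its coordinates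
    by dividing by the height, which is uniformly continuous. *)
Lemma sc_rcv (gs : nat -> sphere_fun) G z s N : 0 < s ->
  (forall n y, (N <= n)%nat -> disc z s y -> mero (gs n) y /\ / 5 <= sc 0 (gs n y)) ->
  (forall y, disc z s y -> / 5 <= sc 0 (G y)) ->
  (forall k eps, 0 < eps -> exists N', forall n y, (N' <= n)%nat -> disc z s y -> Rabs (sc k (gs n y) - sc k (G y)) <= eps) ->
  rcv gs G z.
Proof.
move=> s0 hg hG hu; have fin_of a : / 5 <= sc 0 a -> a <> None by case: a => //=; lra.
exists s; split=> //; split; [|split].
- exists N => n y hn hy; case: (hg n y hn hy) => hm /fin_of hf; split=> //.
  by case: (near_self _ _ (mero_finite _ _ hm hf)).
- by move=> y hy; apply: fin_of; apply: hG.
- move=> eps e0; have e1 : 0 < eps / 60 by lra.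
  case: (hu 0%nat _ e1) => N0 h0; case: (hu 1%nat _ e1) => N1 h1; case: (hu 2%nat _ e1) => N2 h2.
  exists (Nat.max N (Nat.max N0 (Nat.max N1 N2))) => n y hn hy.
  case: (hg n y (ltac:(lia)) hy) => _ k1; have k2 := hG y hy.
  have k3 := h0 n y (ltac:(lia)) hy; have k4 := h1 n y (ltac:(lia)) hy; have k5 := h2 n y (ltac:(lia)) hy.
  have n1 := fin_of _ k1; have n2 := fin_of _ k2; rewrite (some_fv _ _ n1) in k1 k3 k4 k5; rewrite (some_fv _ _ n2) in k2 k3 k4 k5.
  move: k1 k2 k3 k4 k5; move: (fv (gs n) y) (fv G y) => w v; rewrite /sc.
  have pw := one_sq_pos (Cmod w); have pv := one_sq_pos (Cmod v).
  set tw := / (1 + Cmod w ^ 2); set tv := / (1 + Cmod v ^ 2) => k1 k2 k3 k4 k5.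
  have v2 : Cmod v <= 2.
    have : 1 + Cmod v ^ 2 <= 5; last by nra.
    apply: Rnot_lt_le => hlt; have p5 : 0 < 5 * (1 + Cmod v ^ 2) by lra.
    have := Rinv_lt_contravar _ _ p5 hlt; rewrite -/tv; lra.
  have vx : Rabs (fst v) <= 2 by have := re_le_Cmod v; rewrite /Re; lra.
  have vy : Rabs (snd v) <= 2 by have := Rle_trans _ _ _ (Rmax_r _ _) (Rmax_Cmod v); lra.
  have one (a b : R) : Rabs b <= 2 -> Rabs (a / (1 + Cmod w ^ 2) - b / (1 + Cmod v ^ 2)) <= eps / 60 -> Rabs (a - b) <= eps / 2.
    rewrite /Rdiv -/tw -/tv => hb hab.
    have e : (a - b) * tw = (a * tw - b * tv) - b * (tw - tv) by ring.
    have : Rabs (a - b) * tw <= eps / 60 + 2 * (eps / 60).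
      rewrite -{1}(Rabs_pos_eq tw); last lra. rewrite -Rabs_mult e.
      apply: Rle_trans (Rabs_triang _ _) _; rewrite Rabs_Ropp Rabs_mult.
      have := Rmult_le_compat _ _ _ _ (Rabs_pos b) (Rabs_pos (tw - tv)) hb k3; rewrite /Rdiv in hab *; lra.
    have := Rabs_pos (a - b); nra.
  have -> : (w - v)%C = (fst w - fst v, snd w - snd v) by [].
  apply: Rle_trans (Cmod_pair_le _ _) _; have := one _ _ vx k4; have := one _ _ vy k5; lra.
Qed.

(** The half of the sphere containing G z selects the chart, and equicontinuity keeps the heights
    above 1/5 on a disc small enough that 3 M t <= 1/20. *)
Lemma sc_convergence_scv (gs : nat -> sphere_fun) G z s N M : 0 < s -> 0 <= M ->
  (forall n y, (N <= n)%nat -> disc z s y -> mero (gs n) y /\ sharp (gs n) y <= M) ->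
  (forall k eps, 0 < eps -> exists N', forall n y, (N' <= n)%nat -> disc z s y -> Rabs (sc k (gs n y) - sc k (G y)) <= eps) ->
  scv gs G z.
Proof.
move=> s0 M0 hg hu.
have core (g : nat -> sphere_fun) (H : sphere_fun) : / 2 <= sc 0 (H z) ->
  (forall n y, (N <= n)%nat -> disc z s y -> mero (g n) y /\ sharp (g n) y <= M) ->
  (forall k eps, 0 < eps -> exists N', forall n y, (N' <= n)%nat -> disc z s y -> Rabs (sc k (g n y) - sc k (H y)) <= eps) ->
  rcv g H z.
  move=> hz hg' hu'; set t := Rmin s (/ (60 * (M + 1))).
  have t0 : 0 < t by apply: Rmin_pos => //; apply: Rinv_0_lt_compat; lra.
  have m1 : t <= s by exact: Rmin_l. have m2 : t <= / (60 * (M + 1)) by exact: Rmin_r.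
  have dt y : disc z t y -> disc z s y by rewrite /disc; lra.
  have mt : 3 * M * t <= / 20.
    have e : (60 * (M + 1)) * / (60 * (M + 1)) = 1 by field; lra.
    have p60 : 0 <= 60 * (M + 1) by lra.
    have := Rmult_le_compat_l _ _ _ p60 m2; rewrite e; nra.
  have e20 : 0 < / 20 by lra. case: (hu' 0%nat _ e20) => N1 h1.
  have low n y : (Nat.max N N1 <= n)%nat -> disc z t y -> / 2 - / 10 <= sc 0 (g n y).
    move=> hn hy; have := h1 n z (ltac:(lia)) (disc_center _ _ s0) => /Rabs_le_between k1.
    have : Rabs (sc 0 (g n y) - sc 0 (g n z)) <= 3 * M * Cmod (y - z).
      apply: sc_lipschitz => u hu2; apply: hg'; first lia. apply: seg_disc => //; [exact: disc_center|exact: dt].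
    move/Rabs_le_between; rewrite /disc in hy => k2.
    have : 3 * M * Cmod (y - z) <= 3 * M * t by apply: Rmult_le_compat_l; lra. lra.
  apply: (sc_rcv g H z t (Nat.max N N1)) => //.
  - move=> n y hn hy; split; last by have := low n y hn hy; lra.
    by case: (hg' n y (ltac:(lia)) (dt _ hy)).
  - move=> y hy; have := h1 (Nat.max N N1) y (ltac:(lia)) (dt _ hy) => /Rabs_le_between k1.
    have := low (Nat.max N N1) y (ltac:(lia)) hy; lra.
  - by move=> k eps /(hu' k) [N' h']; exists N' => n y hn /dt; apply: h'.
case: (Rle_lt_dec (/ 2) (sc 0 (G z))) => hz; [left; exact: core|right].
apply: core.
- rewrite /sinv sc_oinv0; lra.
- move=> n y hn hy; case: (hg n y hn hy) => h1 h2; split; [exact: mero_sinv|by rewrite sharp_sinv].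
- move=> k eps e0; case: (hu k _ e0) => N' h'; exists N' => n y hn hy; have := h' n y hn hy; rewrite /sinv.
  case: k {h'} => [|[|k]].
  + rewrite !sc_oinv0; have -> : 1 - sc 0 (gs n y) - (1 - sc 0 (G y)) = - (sc 0 (gs n y) - sc 0 (G y)) by ring.
    by rewrite Rabs_Ropp.
  + by rewrite !sc_oinv1.
  + have e2 x : sc (S (S k)) x = sc 2 x by case: x.
    rewrite !e2 !sc_oinv2; have -> : - sc 2 (gs n y) - - sc 2 (G y) = - (sc 2 (gs n y) - sc 2 (G y)) by ring.
    by rewrite Rabs_Ropp.
Qed.

(** Ascoli's argument in sphere coordinates: a diagonal subsequence converges at all points [dpt],
    the Lipschitz bound spreads this to all points, locally uniformly, and the limiting coordinates
    again define a point of the sphere. *)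
Lemma marty (fs : nat -> sphere_fun) (Om : C -> Prop) :
  (forall z, Om z -> exists r N M, 0 < r /\ forall n y, (N <= n)%nat -> disc z r y -> mero (fs n) y /\ sharp (fs n) y <= M) ->
  exists phi F, incr phi /\ forall z, Om z -> scv (fun n => fs (phi n)) F z.
Proof.
(* The set where the local bound holds is open even if [Om] is not, so neighbours of a good point
   are good. *)
move=> h0; set Om' := fun z => exists r N M, 0 < r /\ forall n y, (N <= n)%nat -> disc z r y -> mero (fs n) y /\ sharp (fs n) y <= M.
have hOm z : Om' z -> near z Om'.
  move=> [r [N [M [r0 hr]]]]; exists r; split=> // y hy; exists (r - Cmod (y - z)), N, M; split.
    by rewrite /disc in hy; lra.
  move=> n w hn hw; apply: hr => //; apply: disc_sub hw _; lra.
suff [phi [F [h1 h2]]] : exists phi F, incr phi /\ forall z, Om' z -> scv (fun n => fs (phi n)) F z.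
  by exists phi, F; split=> // z /h0; exact: h2.
have h z : Om' z -> Om' z by [].
case: (diagonal (fun n j => sc (fst (Cantor.of_nat j)) (fs n (dpt (snd (Cantor.of_nat j)))))) => [n j|phi [hphi hC]].
  exact: sc_bound.
have hCp k i eps : 0 < eps -> exists N, forall n m, (N <= n)%nat -> (N <= m)%nat ->
    Rabs (sc k (fs (phi n) (dpt i)) - sc k (fs (phi m) (dpt i))) <= eps.
  by move=> e0; case: (hC (Cantor.to_nat (k, i)) _ e0) => N; rewrite Cantor.cancel_of_to /=; exists N.
have jointC z k eps : Om' z -> 0 < eps -> exists N, near z (fun y => forall n m, (N <= n)%nat -> (N <= m)%nat ->
    Rabs (sc k (fs (phi n) y) - sc k (fs (phi m) y)) <= eps).
  move=> /h [r [N [M [r0 hr]]]] e0; have M0 : 0 <= M.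
    by case: (hr N z (Nat.le_refl _) (disc_center z r r0)) => _; apply: Rle_trans; exact: sharp_ge0.
  set d := Rmin r (eps / (18 * (M + 1))); have d0 : 0 < d by apply: Rmin_pos => //; apply: Rdiv_lt_0_compat; lra.
  have m1 : d <= r by exact: Rmin_l. have m2 : d <= eps / (18 * (M + 1)) by exact: Rmin_r.
  case: (dpt_dense z d d0) => i hi; have e3 : 0 < eps / 3 by lra.
  case: (hCp k i _ e3) => N1 h1; exists (Nat.max N N1); exists d; split=> // y hy n m hn hm.
  have lip l : (Nat.max N N1 <= l)%nat -> Rabs (sc k (fs (phi l) y) - sc k (fs (phi l) (dpt i))) <= eps / 3.
    move=> hl; apply: Rle_trans (_ : 3 * M * Cmod (y - dpt i) <= _).
      apply: sc_lipschitz => t ht; apply: hr; first by have := incr_ge _ hphi l; lia.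
      by apply: seg_disc => //; rewrite /disc in hy *; lra.
    have : Cmod (y - dpt i) <= 2 * d by have := Cmod_tri y z (dpt i); rewrite (Cmod_sym z) /disc in hy *; lra.
    have e : eps / (18 * (M + 1)) * (18 * (M + 1)) = eps by field; lra.
    have p18 : 0 <= 18 * (M + 1) by lra.
    have := Rmult_le_compat_r _ _ _ p18 m2; rewrite e.
    have := Cmod_ge_0 (y - dpt i); nra.
  have := lip n hn; have := lip m hm; have := h1 n m (ltac:(lia)) (ltac:(lia)).
  move=> /Rabs_le_between a1 /Rabs_le_between a2 /Rabs_le_between a3; apply/Rabs_le_between; lra.
have chL z : exists a, Om' z -> forall k, Un_cv (fun n => sc k (fs (phi n) z)) (sc k a).
  case: (excluded_middle_informative (Om' z)) => [hz|n]; last by exists None => /n.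
  have lim k : exists l, Un_cv (fun n => sc k (fs (phi n) z)) l.
    have hCa : Cauchy_crit (fun n => sc k (fs (phi n) z)).
      move=> eps e0; have e2 : 0 < eps / 2 by lra.
      case: (jointC z k _ hz e2) => N /near_self hN; exists N => n m hn hm; rewrite /R_dist.
      have := hN n m hn hm; lra.
    by case: (Rcomplete.R_complete _ hCa) => l hl; exists l.
  case: (lim 0%nat) => t ht; case: (lim 1%nat) => x hx; case: (lim 2%nat) => y hy.
  (* The sphere is closed: its equation passes to the limits of the three coordinates, and [sc_surj]
     supplies the limit point. *)
  have e : x ^ 2 + y ^ 2 = t - t ^ 2.
    apply: (UL_sequence (fun n => sc 1 (fs (phi n) z) * sc 1 (fs (phi n) z) + sc 2 (fs (phi n) z) * sc 2 (fs (phi n) z))).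
      have := CV_plus _ _ _ _ (CV_mult _ _ _ _ hx hx) (CV_mult _ _ _ _ hy hy).
      by have -> : x * x + y * y = x ^ 2 + y ^ 2 by ring.
    have := CV_minus _ _ _ _ ht (CV_mult _ _ _ _ ht ht); have -> : t - t * t = t - t ^ 2 by ring.
    apply: Un_cv_ext => n; have := sc_sphere (fs (phi n) z); rewrite /=; lra.
  case: (sc_surj t x y e) => a [e1 [e2 e3]]; exists a => _ k.
  case: k => [|[|k]]; rewrite ?e1 ?e2 //.
  have e4 w : sc (S (S k)) w = sc 2 w by case: w.
  rewrite e4 e3; apply: Un_cv_ext hy => n; by rewrite e4.
pose F z := proj1_sig (constructive_indefinite_description _ (chL z)).
have hF z : Om' z -> forall k, Un_cv (fun n => sc k (fs (phi n) z)) (sc k (F z)).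
  by rewrite /F; case: constructive_indefinite_description.
exists phi, F; split=> // z hz; case: (hOm z hz) => q [q0 hq]; case: (hz) => r [N [M [r0 hr]]].
have M0 : 0 <= M.
  by case: (hr N z (Nat.le_refl _) (disc_center z r r0)) => _; apply: Rle_trans; exact: sharp_ge0.
set s := Rmin (q / 2) (r / 2); have s0 : 0 < s by apply: Rmin_pos; lra.
have m1 : s <= q / 2 by exact: Rmin_l. have m2 : s <= r / 2 by exact: Rmin_r.
apply: (sc_convergence_scv _ F z s N M) => //.
  move=> n y hn hy; apply: hr; first by have := incr_ge _ hphi n; lia. by rewrite /disc in hy *; lra.
move=> k eps e0; have e2 : 0 < eps / 2 by lra.
case: (compact_uniform (fun y => Cmod (y - z) <= s) (Cmod z + s) (fun N y => forall n m, (N <= n)%nat -> (N <= m)%nat ->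
    Rabs (sc k (fs (phi n) y) - sc k (fs (phi m) y)) <= eps / 2)).
- exact: cdisc_bounded.
- exact: cdisc_closed.
- by move=> N1 N2 y h12 hh n m hn hm; apply: hh; lia.
- move=> y hy; apply: jointC => //; apply: hq; rewrite /disc; lra.
move=> N' hN'; exists N' => n y hn hy; have hyq : Om' y by apply: hq; rewrite /disc in hy *; lra.
case: (hF y hyq k _ e2) => N2 h2; have := h2 (Nat.max N' N2) (ltac:(lia)).
have hys : Cmod (y - z) <= s by rewrite /disc in hy; lra.
have := hN' y hys n (Nat.max N' N2) hn (ltac:(lia)); rewrite /R_dist.
move=> /Rabs_le_between a1 /Rabs_lt_between a2; apply/Rabs_le_between; lra.
Qed.

(** * Connectedness *)

(** If U and V were disjoint on D, consider the last time up to which the segment from c stays in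
    the open set containing c: neither set can contain that point. *)
Lemma star_connected (D : C -> Prop) c : D c -> (forall z t, D z -> 0 <= t <= 1 -> D (seg c z t)) -> connected_set D.
Proof.
move=> Dc hs U V hU hV cov [a [Da Ua]] [b [Db Vb]]; apply: Classical_Prop.NNPP => hn.
have dis y : D y -> U y -> V y -> False by move=> *; apply: hn; exists y.
have main (A B : C -> Prop) : open_set A -> open_set B -> (forall y, D y -> A y \/ B y) ->
    (forall y, D y -> A y -> B y -> False) -> A c -> forall z, D z -> ~ B z.
  move=> hA hB hcov hdis Ac z Dz Bz.
  pose E t := 0 <= t <= 1 /\ forall s, 0 <= s <= t -> A (seg c z s).
  case: (completeness E); first by exists 1 => t [? _]; lra.
    exists 0; split; first lra. move=> s hs0; have -> : s = 0 by lra. by rewrite seg0.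
  move=> l [l1 l2]; have l0 : 0 <= l.
    by apply: l1; split=> [|s hs0]; [lra|rewrite (_ : s = 0) ?seg0 //; lra].
  have l3 : l <= 1 by apply: l2 => t [? _]; lra.
  have below s : 0 <= s < l -> A (seg c z s).
    move=> hsl; apply: Classical_Prop.NNPP => nA; have : l <= s; last lra.
    apply: l2 => t [_ ht]; apply: Rnot_lt_le => hst; apply: nA; apply: ht; lra.
  have Dl : D (seg c z l) by apply: hs => //; lra.
  have ball (W : C -> Prop) : open_set W -> W (seg c z l) -> exists d, 0 < d /\ forall s, Rabs (s - l) < d -> W (seg c z s).
    move=> hW /hW [r [r0 hr]]; case: (RD_pc _ _ _ (RD_seg c z l) r r0) => d [d0 hd].
    by exists d; split=> // s /hd; exact: hr.
  case: (hcov _ Dl) => hl.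
  - case: (ball A hA hl) => d [d0 hd]; case: (Req_dec l 1) => [e|ne].
      by apply: (hdis z Dz) => //; rewrite -(seg1 c z) -e.
    set t := Rmin 1 (l + d / 2); have t1 : t <= 1 by exact: Rmin_l. have t2 : t <= l + d / 2 by exact: Rmin_r.
    have t3 : l < t by apply: Rmin_glb_lt; lra.
    have : t <= l; last lra. apply: l1; split; first lra. move=> s hst.
    case: (Rlt_dec s l) => hsl; first by apply: below; lra. by apply: hd; apply/Rabs_lt_between; lra.
  - case: (ball B hB hl) => d [d0 hd]; case: (Req_dec l 0) => [e|ne].
      by apply: (hdis c Dc) => //; rewrite -(seg0 c z) -e.
    set s := Rmax 0 (l - d / 2); have s1 : 0 <= s by exact: Rmax_l. have s2 : l - d / 2 <= s by exact: Rmax_r.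
    have s3 : s < l by apply: Rmax_lub_lt; lra.
    apply: (hdis (seg c z s)); [apply: hs => //; lra|apply: below; lra|apply: hd; apply/Rabs_lt_between; lra].
case: (cov c Dc) => hc; first exact: (main U V hU hV cov dis hc b Db Vb).
apply: (main V U hV hU _ _ hc a Da Ua) => y Dy; first by case: (cov y Dy); tauto.
by move=> h1 h2; apply: (dis y).
Qed.

Lemma connected_all : connected_set (fun _ => True).
Proof. exact: (star_connected _ 0). Qed.

Lemma connected_union (D E : C -> Prop) c : connected_set D -> connected_set E -> D c -> E c ->
  connected_set (fun z => D z \/ E z).
Proof.
move=> hD hE Dc Ec U V hU hV cov hu hv; apply: Classical_Prop.NNPP => hn.
have covD z : D z -> U z \/ V z by move=> h; apply: cov; left.
have covE z : E z -> U z \/ V z by move=> h; apply: cov; right.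
have one (A B : C -> Prop) : open_set A -> open_set B -> (forall z, D z \/ E z -> A z \/ B z) -> A c ->
   (exists z, (D z \/ E z) /\ B z) -> exists z, (D z \/ E z) /\ A z /\ B z.
  move=> hA hB hc Ac [z [[h|h] Bz]].
  - case: (hD A B hA hB (fun z h => hc z (or_introl h))); [by exists c|by exists z|].
    by move=> w [? ?]; exists w; split=> //; left.
  - case: (hE A B hA hB (fun z h => hc z (or_intror h))); [by exists c|by exists z|].
    by move=> w [? ?]; exists w; split=> //; right.
case: (covD c Dc) => hc; first exact: hn (one U V hU hV cov hc hv).
case: (one V U hV hU _ hc hu) => [z hz|z [h1 [h2 h3]]]; first by case: (cov z hz); tauto.
by apply: hn; exists z.
Qed.

Definition Cstar (z : C) : Prop := z <> 0.

(** The union of two planes slit along a half-axis, star-shaped about 1 and -1 and both containing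
    i. *)
Lemma connected_Cstar : connected_set Cstar.
Proof.
have slit s : s = 1 \/ s = -1 -> connected_set (fun z => ~ (snd z = 0 /\ s * fst z <= 0)).
  move=> hs; apply: (star_connected _ (RtoC s)).
    rewrite /= => -[_]; case: hs => ->; lra.
  move=> [x y] t /= h ht [e1 e2]; case: (Req_dec t 0) => [t0|t0].
    rewrite t0 in e2; case: hs e2 => ->; lra.
  have y0 : y = 0 by nra. apply: h; split=> //; rewrite y0 in e2.
  apply: Rnot_lt_le => hp; case: hs e2 hp => ->; nra.
have h := connected_union _ _ Ci (slit 1 (or_introl erefl)) (slit (-1) (or_intror erefl)).
have sh : forall P : C -> Prop, (forall z, P z <-> Cstar z) -> connected_set P -> connected_set Cstar.
  move=> P e hP U V hU hV cov [a [ha1 ha2]] [b [hb1 hb2]].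
  case: (hP U V hU hV) => [z /e /cov|||z [/e h1 h2]] //; [by exists a; split=> //; apply/e|by exists b; split=> //; apply/e|by exists z].
apply: sh (h _ _); rewrite /=; try lra.
move=> [x y] /=; split.
- by move=> hz e; case: hz; case=> [] //; move/(f_equal fst): (e); move/(f_equal snd): e => /= -> ->; split; lra.
- move=> nz; apply: Classical_Prop.NNPP => hn; apply: nz; congr pair; apply: Classical_Prop.NNPP => h2; apply: hn.
    by case: (Req_dec y 0) => hy; [case: (Rlt_dec 0 x) => hx; [left|right]; lra|left; lra].
  left; lra.
Qed.

Lemma near_open_set (P : C -> Prop) : open_set (fun z => near z P).
Proof. by move=> z [r [r0 h]]; exists r; split=> // w hw; exists (r - Cmod (w - z)); split;
  [rewrite /disc in hw; lra|move=> y hy; apply: h; apply: disc_sub hy _; lra]. Qed.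

Lemma connected_trichotomy (Om A B G : C -> Prop) : connected_set Om ->
  (forall z, A z -> near z A) -> (forall z, B z -> near z B) -> (forall z, G z -> near z G) ->
  (forall z, Om z -> A z \/ B z \/ G z) -> (forall z, A z -> ~ B z) -> (forall z, A z -> ~ G z) -> (forall z, B z -> ~ G z) ->
  (forall z, Om z -> A z) \/ (forall z, Om z -> B z) \/ (forall z, Om z -> G z).
Proof.
move=> hc hA hB hG cov nAB nAG nBG.
have op (P Q : C -> Prop) : (forall z, P z -> near z P) -> (forall z, Q z -> near z Q) -> open_set (fun z => P z \/ Q z).
  by move=> hP hQ z [/hP [r [r0 h]]|/hQ [r [r0 h]]]; exists r; split=> // w /h; tauto.
have op1 (P : C -> Prop) : (forall z, P z -> near z P) -> open_set P by move=> hP z /hP.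
have main (P Q S : C -> Prop) : (forall z, P z -> near z P) -> (forall z, Q z -> near z Q) -> (forall z, S z -> near z S) ->
    (forall z, Om z -> P z \/ Q z \/ S z) -> (forall z, P z -> ~ Q z) -> (forall z, P z -> ~ S z) ->
    (exists z, Om z /\ P z) -> forall z, Om z -> P z.
  move=> hP hQ hS cv n1 n2 ex z hz; apply: Classical_Prop.NNPP => nP.
  case: (hc P (fun z => Q z \/ S z) (op1 P hP) (op Q S hQ hS) cv ex).
    by exists z; split=> //; case: (cv z hz).
  by move=> w [_ [Pw [/(n1 w Pw)|/(n2 w Pw)]]].
case: (excluded_middle_informative (exists z, Om z /\ A z)) => [e|nA]; first by left; apply: (main A B G).
case: (excluded_middle_informative (exists z, Om z /\ B z)) => [e|nB].
  right; left; apply: (main B A G) => // [z hz|z Bz Az]; [by case: (cov z hz); tauto|exact: nAB Az Bz].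
by right; right => z hz; case: (cov z hz) => [h|[h|//]]; [case: nA|case: nB]; exists z.
Qed.

(** * Derivatives of powers and their orders at zeros and poles *)

Fixpoint cdn (m : nat) (g : C -> C) : C -> C := if m is S m' then C_derive (cdn m' g) else g.

(* (g^l)^(m) = g^(l - m) Qop l m g, and (g^l)^(m) = Qop (- l) m u / u^(l + m) when u = 1 / g. *)
Fixpoint Qop (lam : C) (m : nat) (u : C -> C) : C -> C :=
  if m is S m' then (fun z => u z * C_derive (Qop lam m' u) z + (lam - RtoC (INR m')) * C_derive u z * Qop lam m' u z)%C
  else (fun _ => RtoC 1).

Definition hol (g : C -> C) (z : C) : Prop := near z (Cdiff g).

Lemma hol_near g z : hol g z -> near z (hol g).
Proof. exact: near_near. Qed.
Lemma hol_at g z : hol g z -> Cdiff g z.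
Proof. exact: near_self. Qed.
Lemma hol_cst c z : hol (fun _ => c) z.
Proof. apply: near_all => y; exact: Cdiff_const. Qed.
Lemma hol_id z : hol (fun y => y) z.
Proof. apply: near_all => y; exact: Cdiff_id. Qed.
Lemma hol_plus g h z : hol g z -> hol h z -> hol (fun y => g y + h y)%C z.
Proof. apply: near2 => y; exact: Cdiff_plus. Qed.
Lemma hol_minus g h z : hol g z -> hol h z -> hol (fun y => g y - h y)%C z.
Proof. apply: near2 => y; exact: Cdiff_minus. Qed.
Lemma hol_mult g h z : hol g z -> hol h z -> hol (fun y => g y * h y)%C z.
Proof. apply: near2 => y; exact: Cdiff_mult. Qed.
Lemma hol_opp g z : hol g z -> hol (fun y => - g y)%C z.
Proof. apply: near_mono => y; exact: Cdiff_opp. Qed.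
Lemma hol_pow g z n : hol g z -> hol (fun y => g y ^ n)%C z.
Proof. apply: near_mono => y; exact: Cdiff_pow. Qed.
Lemma hol_inv g z : hol g z -> g z <> 0 -> hol (fun y => / g y)%C z.
Proof. move=> h n; apply: near2 h (Cc_neq _ _ _ (Cdiff_Cc _ _ (hol_at _ _ h)) n) => y; exact: Cdiff_inv. Qed.
Lemma hol_cder g z : hol g z -> hol (C_derive g) z.
Proof. exact: cder_near. Qed.
Lemma hol_ext g h z : near z (fun y => g y = h y) -> hol g z -> hol h z.
Proof. move=> e; apply: near2 (near_near _ _ e) => y; exact: Cdiff_ext. Qed.
Lemma hol_cdn m g z : hol g z -> hol (cdn m g) z.
Proof. by move=> h; elim: m => // m; exact: hol_cder. Qed.

Ltac hl := repeat first
  [ eassumption | apply: hol_cst | apply: hol_id | apply: hol_plus | apply: hol_minus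
  | apply: hol_opp | apply: hol_mult | apply: hol_pow | apply: hol_cder ].

Lemma hol_Qop lam m u z : hol u z -> hol (Qop lam m u) z.
Proof. by move=> h; elim: m => [|m IH] /=; hl. Qed.

Lemma cdn_ext m g h z : near z (fun y => g y = h y) -> hol g z -> near z (fun y => cdn m g y = cdn m h y).
Proof.
move=> e hg; elim: m => // m IH /=.
apply: near2 (near_near _ _ IH) (hol_cdn m g z hg) => y hy d; symmetry; exact: cder_ext.
Qed.

Lemma cdn_pow l m g z : (m <= l)%nat -> hol g z ->
  near z (fun y => cdn m (fun w => g w ^ l)%C y = (g y ^ (l - m) * Qop (RtoC (INR l)) m g y)%C).
Proof.
move=> hml hg; elim: m hml => [|m IH] hml /=; first by apply: near_all => y; rewrite Nat.sub_0_r Cmult_1_r.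
have {}IH := IH (ltac:(lia)).
apply: near2 (near_near _ _ IH) (near_and _ _ _ hg (hol_Qop (RtoC (INR l)) m g z hg)) => y e [d1 d2].
apply: CD_unique; apply: CD_ext; first by apply: near_mono e => w ->.
apply: CD_eq (CD_mult _ _ _ _ _ (CD_pow _ _ _ (l - m) (CD_cder _ _ d1)) (CD_cder _ _ d2)) _.
have -> : (l - m)%nat = S (l - S m) by lia. rewrite [Nat.pred _]/= (_ : S (l - S m) = (l - m)%nat); last lia.
rewrite minus_INR; last lia. rewrite RtoC_minus (_ : (l - m)%nat = S (l - S m)) /=; last lia. ring.
Qed.

Lemma CD_inv_pow g z a n : CD g z a -> g z <> 0 -> CD (fun y => / g y ^ n)%C z (- RtoC (INR n) * a / g z ^ S n)%C.
Proof.
move=> h n0; have np := Cpow_nz _ n n0.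
apply: CD_eq (CD_invf _ _ _ (CD_pow _ _ _ n h) np) _; case: n np => [|n] np; first by rewrite /=; field.
rewrite [Nat.pred _]/= !Cpow_S; field; split=> //; exact: Cpow_nz.
Qed.

Lemma cdn_inv_pow l m g u z : hol u z -> u z <> 0 -> near z (fun y => g y = / u y)%C ->
  near z (fun y => cdn m (fun w => g w ^ l)%C y = (Qop (- RtoC (INR l)) m u y * / u y ^ (l + m))%C).
Proof.
move=> hu un e; have hn := Cc_neq _ _ _ (Cdiff_Cc _ _ (hol_at _ _ hu)) un.
elim: m => [|m IH].
  by apply: near2 e hn => y /= -> n; rewrite Nat.add_0_r Cpow_inv // Cmult_1_l.
have hd := near_and _ _ _ (near_and _ _ _ hu hn) (hol_Qop (- RtoC (INR l)) m u z hu).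
apply: near2 (near_near _ _ IH) hd => y ey [[d1 n] d2] /=.
apply: CD_unique; apply: CD_ext; first by apply: near_mono ey => w ->.
have np := Cpow_nz _ (l + m) n.
apply: CD_eq (CD_mult _ _ _ _ _ (CD_cder _ _ d2) (CD_inv_pow _ _ _ (l + m) (CD_cder _ _ d1) n)) _.
rewrite Nat.add_succ_r Cpow_S plus_INR RtoC_plus; by field.
Qed.

Lemma lcv_Qop lam m un u z : lcv un u z -> lcv (fun n => Qop lam m (un n)) (Qop lam m u) z.
Proof.
move=> h; elim: m => [|m IH] /=; first by apply: lcv_cst; exact: hol_cst.
have hd := lcv_cder _ _ _ h.
exact: lcv_plus _ _ _ _ _ (lcv_mult _ _ _ _ _ h (lcv_cder _ _ _ IH))
  (lcv_mult _ _ _ _ _ (lcv_scal (lam - RtoC (INR m)) _ _ _ hd) IH).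
Qed.

(** * The differential monomial *)

Definition pprod (T : Type) (F : T -> C) (s : list T) : C := fold_right Cmult (RtoC 1) (map F s).

Definition suml (s : list (nat * nat)) : nat := fold_right Nat.add O (map fst s).
Definition summ (s : list (nat * nat)) : nat := fold_right Nat.add O (map snd s).

Definition Qpr (lam : nat -> C) (s : list (nat * nat)) (u : C -> C) (z : C) : C :=
  pprod _ (fun p => Qop (lam (fst p)) (snd p) u z) s.

Lemma hol_Qpr lam s u z : hol u z -> hol (Qpr lam s u) z.
Proof.
move=> h; elim: s => [|p s IH]; first exact: hol_cst.
by apply: (hol_mult (Qop (lam (fst p)) (snd p) u)) => //; exact: hol_Qop.
Qed.

Lemma lcv_Qpr lam s un u z : lcv un u z -> lcv (fun n => Qpr lam s (un n)) (Qpr lam s u) z.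
Proof.
move=> h; elim: s => [|p s IH]; first by apply: lcv_cst; exact: hol_cst.
exact: (lcv_mult _ _ _ _ _ (lcv_Qop (lam (fst p)) (snd p) _ _ _ h) IH).
Qed.

Definition dprod (s : list (nat * nat)) (g : C -> C) (z : C) : C :=
  pprod _ (fun p => cdn (snd p) (fun y => g y ^ fst p)%C z) s.

Definition okl (s : list (nat * nat)) : Prop := forall p, In p s -> (snd p <= fst p)%nat.

Lemma okl_cons p s : okl (p :: s) -> (snd p <= fst p)%nat /\ okl s.
Proof. by move=> h; split; [apply: h; left|move=> q hq; apply: h; right]. Qed.

Lemma okl_summ s : okl s -> (summ s <= suml s)%nat.
Proof.
elim: s => [//|p s IH] /okl_cons [h /IH]; rewrite /summ /suml /=; lia.
Qed.

Lemma dprod_pow s g z : okl s -> hol g z ->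
  near z (fun y => dprod s g y = (g y ^ (suml s - summ s) * Qpr (fun l => RtoC (INR l)) s g y)%C).
Proof.
move=> hs hg; elim: s hs => [|p s IH] hs; first by apply: near_all => y; rewrite /dprod /Qpr /pprod /=; ring.
have [h1 h2] := okl_cons _ _ hs; have h3 := okl_summ _ h2.
apply: near2 (IH h2) (cdn_pow (fst p) (snd p) g z h1 hg) => y; rewrite /dprod /Qpr /pprod /= => -> ->.
have -> : (suml (p :: s) - summ (p :: s) = (fst p - snd p) + (suml s - summ s))%nat by rewrite /suml /summ /= in h3 *; lia.
rewrite Cpow_add_r; ring.
Qed.

Lemma dprod_inv s g u z : hol u z -> u z <> 0 -> near z (fun y => g y = / u y)%C ->
  near z (fun y => dprod s g y = (Qpr (fun l => - RtoC (INR l))%C s u y * / u y ^ (suml s + summ s))%C).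
Proof.
move=> hu un e; have hn := Cc_neq _ _ _ (Cdiff_Cc _ _ (hol_at _ _ hu)) un.
elim: s => [|p s IH].
  by apply: near_all => y; rewrite /dprod /Qpr /pprod /= Cmult_1_l; field; exact: C1_nz.
have h1 := near_and _ _ _ IH hn.
apply: near2 h1 (cdn_inv_pow (fst p) (snd p) g u z hu un e) => y [i n]; move: i; rewrite /dprod /Qpr /pprod /= => -> ->.
have -> : (suml (p :: s) + summ (p :: s) = (fst p + snd p) + (suml s + summ s))%nat by rewrite /suml /summ /=; lia.
have n1 := Cpow_nz _ (fst p + snd p) n; have n2 := Cpow_nz _ (suml s + summ s) n.
rewrite (Cpow_add_r _ (fst p + snd p)); by field.
Qed.

Lemma hol_dprod s g z : hol g z -> hol (dprod s g) z.
Proof.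
move=> h; elim: s => [|p s IH]; first exact: hol_cst.
apply: (hol_mult (cdn (snd p) (fun y => g y ^ fst p)%C)) => //; apply: hol_cdn; exact: hol_pow.
Qed.

Lemma dprod_ext s g k z : near z (fun y => g y = k y) -> hol g z -> near z (fun y => dprod s g y = dprod s k y).
Proof.
move=> e h; elim: s => [|p s IH]; first exact: near_all.
have e2 : near z (fun y => (g y ^ fst p)%C = (k y ^ fst p)%C) by apply: near_mono e => y ->.
by apply: near2 IH (cdn_ext (snd p) _ _ z e2 (hol_pow _ _ _ h)) => y; rewrite /dprod /pprod /= => -> ->.
Qed.

Lemma lcv_cdn m un u z : lcv un u z -> lcv (fun n => cdn m (un n)) (cdn m u) z.
Proof. by move=> h; elim: m => // m; exact: lcv_cder. Qed.

Lemma lcv_dprod s un u z : lcv un u z -> lcv (fun n => dprod s (un n)) (dprod s u) z.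
Proof.
move=> h; elim: s => [|p s IH]; first by apply: lcv_cst; exact: hol_cst.
exact: (lcv_mult _ _ _ _ _ (lcv_cdn (snd p) _ _ _ (lcv_pow _ _ _ (fst p) h)) IH).
Qed.

(** The falling factorial a (a - 1) ... (a - m + 1). *)
Fixpoint lamprod (a : C) (m : nat) : C := if m is S m' then (lamprod a m' * (a - RtoC (INR m')))%C else RtoC 1.

Lemma QopS lam m u z : Qop lam (S m) u z =
  (u z * C_derive (Qop lam m u) z + (lam - RtoC (INR m)) * C_derive u z * Qop lam m u z)%C.
Proof. by []. Qed.

Lemma lamprodS a m : lamprod a (S m) = (lamprod a m * (a - RtoC (INR m)))%C.
Proof. by []. Qed.

(** Formally [Qop lam m u] is u^(m - lam) times the m-th derivative of u^lam. For u of order s + 1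
    the derivative has leading coefficient the falling factorial of lam (s + 1), and the orders add
    up to m s. *)
Lemma Qop_order lam m u v p s : hol v p -> near p (fun y => u y = ((y - p) ^ S s * v y)%C) ->
  exists k, hol k p /\ k p = (lamprod (lam * RtoC (INR (S s))) m * v p ^ m)%C /\
    near p (fun y => Qop lam m u y = ((y - p) ^ (m * s) * k y)%C).
Proof.
move=> hv e; have hz : hol (fun y => y - p)%C p by hl.
have hu : hol u p.
  by apply: (hol_ext (fun y => (y - p) ^ S s * v y)%C); [apply: near_mono e => y ->|hl].
have du : near p (fun y => C_derive u y = (RtoC (INR (S s)) * (y - p) ^ s * v y + (y - p) ^ S s * C_derive v y)%C).
  apply: near2 (near_near _ _ e) hv => y ey dv; apply: CD_unique; apply: CD_ext; first by apply: near_mono ey => w ->.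
  have dz : CD (fun w => w - p)%C y 1 by apply: CD_eq (CD_minus _ _ _ _ _ (CD_id y) (CD_const p y)) _; ring.
  apply: CD_eq (CD_mult _ _ _ _ _ (CD_pow _ _ _ (S s) dz) (CD_cder _ _ dv)) _; rewrite [Nat.pred _]/=; ring.
elim: m => [|m [k [hk [kp ek]]]].
  exists (fun _ => RtoC 1); split; first exact: hol_cst. split; first by rewrite /=; ring.
  by apply: near_all => y /=; ring.
have dQ : near p (fun y => ((y - p) * C_derive (Qop lam m u) y = RtoC (INR (m * s)) * (y - p) ^ (m * s) * k y + (y - p) ^ S (m * s) * C_derive k y)%C).
  apply: near2 (near_near _ _ ek) hk => y ey dk.
  have dz : CD (fun w => w - p)%C y 1 by apply: CD_eq (CD_minus _ _ _ _ _ (CD_id y) (CD_const p y)) _; ring.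
  rewrite (CD_unique _ _ _ (CD_ext _ _ _ _ (near_mono _ _ _ (fun w e => esym e) ey) (CD_mult _ _ _ _ _ (CD_pow _ _ _ (m * s) dz) (CD_cder _ _ dk)))).
  by case: (m * s)%nat => [|j]; rewrite [Nat.pred _]/= ?Cpow_S /=; ring.
exists (fun y => v y * (RtoC (INR (m * s)) * k y + (y - p) * C_derive k y) +
   (lam - RtoC (INR m)) * (RtoC (INR (S s)) * v y + (y - p) * C_derive v y) * k y)%C; split; first by hl.
split.
  cbv beta; rewrite kp lamprodS Cpow_S mult_INR RtoC_mult S_INR RtoC_plus; ring.
apply: near2 (near_and _ _ _ e du) (near_and _ _ _ ek dQ) => y [eu edu] [eQ edQ]; rewrite QopS.
have -> : (u y * C_derive (Qop lam m u) y = (y - p) ^ s * v y * ((y - p) * C_derive (Qop lam m u) y))%C.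
  rewrite eu Cpow_S; ring.
rewrite edQ edu eQ (_ : (S m * s)%nat = (m * s + s)%nat); last lia.
rewrite Cpow_add_r !Cpow_S; ring.
Qed.

Lemma lamprod_neq0 a m : (forall j, (j < m)%nat -> a <> RtoC (INR j)) -> lamprod a m <> 0.
Proof.
elim: m => [|m IH] h /=; first exact: C1_nz.
by apply: Cmul_neq0; [apply: IH => j hj; apply: h; lia|apply: Csub_neq0; apply: h; lia].
Qed.

Lemma Qpr_order lam ps u v p s : hol v p -> v p <> 0 -> near p (fun y => u y = ((y - p) ^ S s * v y)%C) ->
  (forall q, In q ps -> forall j, (j < snd q)%nat -> (lam (fst q) * RtoC (INR (S s)))%C <> RtoC (INR j)) ->
  exists k, hol k p /\ k p <> 0 /\ near p (fun y => Qpr lam ps u y = ((y - p) ^ (summ ps * s) * k y)%C).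
Proof.
move=> hv v0 e; elim: ps => [|q ps IH] hps.
  by exists (fun _ => RtoC 1); split; [exact: hol_cst|split; [exact: C1_nz|apply: near_all => y; rewrite /Qpr /pprod /=; ring]].
case: IH => [r hr|k [hk [k0 ek]]]; first by apply: hps; right.
case: (Qop_order (lam (fst q)) (snd q) u v p s hv e) => k' [hk' [kp ek']].
exists (fun y => k' y * k y)%C; split; first by hl. split.
  rewrite kp; apply: Cmul_neq0 => //; apply: Cmul_neq0; last exact: Cpow_nz.
  by apply: lamprod_neq0; apply: hps; left.
apply: near2 ek ek' => y; rewrite /Qpr /pprod /= => -> ->.
have -> : (summ (q :: ps) * s = snd q * s + summ ps * s)%nat by rewrite /summ /=; lia.
rewrite Cpow_add_r; ring.
Qed.

Lemma INR_neq_neg a b : (0 < a)%nat -> (- RtoC (INR a))%C <> RtoC (INR b).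
Proof.
move=> a0; rewrite -RtoC_opp => /RtoC_inj; have := lt_INR _ _ a0; have := pos_INR b; rewrite /=; lra.
Qed.

Section DifferentialMonomial.
Context (l0 : nat) (ps : list (nat * nat)).
Context (hl0 : (0 < l0)%nat) (hok : okl ps) (hm0 : (0 < summ ps)%nat) (hml : (summ ps < suml ps)%nat).

(* ps lists the pairs (l_i, m_i), and dmon g is P[g] for a holomorphic g. *)
Definition dmon (g : C -> C) (z : C) : C := (g z ^ l0 * dprod ps g z)%C.
(* P[g] = g^eN Qg g, and P[g] = Sg u / u^pN for u = 1 / g. *)
Definition eN : nat := (l0 + (suml ps - summ ps))%nat.
Definition pN : nat := (l0 + (suml ps + summ ps))%nat.
Definition dL : nat := (l0 + suml ps)%nat.
Definition Qg := Qpr (fun l => RtoC (INR l)) ps.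
Definition Sg := Qpr (fun l => (- RtoC (INR l))%C) ps.

Lemma hol_dmon g z : hol g z -> hol (dmon g) z.
Proof. by move=> h; apply: hol_mult; [exact: hol_pow|exact: hol_dprod]. Qed.

Lemma dmon_ext g k z : near z (fun y => g y = k y) -> hol g z -> near z (fun y => dmon g y = dmon k y).
Proof. by move=> e h; apply: near2 e (dprod_ext ps g k z e h) => y; rewrite /dmon => -> ->. Qed.

Lemma lcv_dmon un u z : lcv un u z -> lcv (fun n => dmon (un n)) (dmon u) z.
Proof. move=> h; exact: lcv_mult (lcv_pow _ _ _ l0 h) (lcv_dprod ps _ _ _ h). Qed.

Lemma dmon_pow g z : hol g z -> near z (fun y => dmon g y = (g y ^ eN * Qg g y)%C).
Proof.
move=> h; apply: near_mono (dprod_pow ps g z hok h) => y; rewrite /dmon => ->; rewrite /eN /Qg Cpow_add_r; ring.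
Qed.

Lemma dmon_inv g u z : hol u z -> u z <> 0 -> near z (fun y => g y = / u y)%C ->
  near z (fun y => dmon g y = (Sg u y * / u y ^ pN)%C).
Proof.
move=> hu un e; have hn := Cc_neq _ _ _ (Cdiff_Cc _ _ (hol_at _ _ hu)) un.
apply: near2 (near_and _ _ _ e hn) (dprod_inv ps g u z hu un e) => y [ey n]; rewrite /dmon => ->.
rewrite ey /pN /Sg (Cpow_add_r _ l0) Cpow_inv //; field; split; exact: Cpow_nz.
Qed.

(* P[g] / g and P[g]' / g, which remain holomorphic at the zeros of g. *)
Definition dmon_quo (g : C -> C) (z : C) : C := (g z ^ (eN - 1) * Qg g z)%C.
Definition dmon_dquo (g : C -> C) (z : C) : C :=
  (RtoC (INR eN) * g z ^ (eN - 2) * C_derive g z * Qg g z + g z ^ (eN - 1) * C_derive (Qg g) z)%C.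

Lemma eN_ge : (l0 + 1 <= eN)%nat.
Proof. rewrite /eN; lia. Qed.

Lemma dmon_dmon_quo g z : hol g z -> dmon g z = (g z * dmon_quo g z)%C.
Proof.
move=> h; rewrite (near_self _ _ (dmon_pow g z h)) /dmon_quo; have := eN_ge; case: eN => [|k] h1; first lia.
rewrite (_ : S k - 1 = k)%nat; last lia. rewrite Cpow_S; ring.
Qed.

Lemma cder_dmon g z : hol g z -> C_derive (dmon g) z = (g z * dmon_dquo g z)%C.
Proof.
move=> h; apply: CD_unique; apply: CD_ext; first by apply: near_mono (dmon_pow g z h) => y ->.
have hQ := hol_Qpr (fun l => RtoC (INR l)) ps g z h.
apply: CD_eq (CD_mult _ _ _ _ _ (CD_pow _ _ _ eN (CD_cder _ _ (hol_at _ _ h))) (CD_cder _ _ (hol_at _ _ hQ))) _.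
rewrite /dmon_dquo -/Qg; have := eN_ge; case: eN => [|[|k]] h1; [lia|lia|].
rewrite [Nat.pred _]/= (_ : S (S k) - 1 = S k)%nat; last lia. rewrite (_ : S (S k) - 2 = k)%nat; last lia.
rewrite !Cpow_S; ring.
Qed.

Lemma hol_dmon_quo g z : hol g z -> hol (dmon_quo g) z.
Proof. by move=> h; apply: hol_mult; [exact: hol_pow|exact: hol_Qpr]. Qed.

Lemma hol_dmon_dquo g z : hol g z -> hol (dmon_dquo g) z.
Proof. by move=> h; have hQ := hol_Qpr (fun l => RtoC (INR l)) ps g z h; rewrite /dmon_dquo; hl. Qed.

Lemma lcv_dmon_quo un u z : lcv un u z -> lcv (fun n => dmon_quo (un n)) (dmon_quo u) z.
Proof. move=> h; exact: lcv_mult (lcv_pow _ _ _ _ h) (lcv_Qpr _ ps _ _ _ h). Qed.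

Lemma lcv_dmon_dquo un u z : lcv un u z -> lcv (fun n => dmon_dquo (un n)) (dmon_dquo u) z.
Proof.
move=> h; have hQ := lcv_Qpr (fun l => RtoC (INR l)) ps _ _ _ h.
apply: lcv_plus; last exact: lcv_mult (lcv_pow _ _ _ _ h) (lcv_cder _ _ _ hQ).
by apply: lcv_mult hQ; apply: lcv_mult (lcv_cder _ _ _ h); apply: lcv_scal; exact: lcv_pow.
Qed.

(** At a pole of F the falling factorials start from - l (s + 1), negative unless l = 0, and then m
    = 0 leaves an empty product: no cancellation of leading terms occurs. *)
Lemma Sg_order u v p s : hol v p -> v p <> 0 -> near p (fun y => u y = ((y - p) ^ S s * v y)%C) ->
  exists k, hol k p /\ k p <> 0 /\ near p (fun y => Sg u y = ((y - p) ^ (summ ps * s) * k y)%C).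
Proof.
move=> hv v0 e; apply: (Qpr_order _ ps u v p s hv v0 e) => q hq j hj.
have := hok q hq; have -> : (- RtoC (INR (fst q)) * RtoC (INR (S s)) = - RtoC (INR (fst q * S s)))%C by rewrite mult_INR RtoC_mult; ring.
move=> h; apply: INR_neq_neg; lia.
Qed.

(** Here l (s + 1) >= l >= m exceeds every j < m, so again no falling factorial vanishes and the
    order is exact. *)
Lemma dmon_zero_order g v p s : hol v p -> v p <> 0 -> near p (fun y => g y = ((y - p) ^ S s * v y)%C) ->
  exists k, hol k p /\ k p <> 0 /\ near p (fun y => dmon g y = ((y - p) ^ (S s * eN + summ ps * s) * k y)%C).
Proof.
move=> hv v0 e; have hg : hol g p.
  by apply: (hol_ext (fun y => (y - p) ^ S s * v y)%C); [apply: near_mono e => y ->|hl].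
case: (Qpr_order (fun l => RtoC (INR l)) ps g v p s hv v0 e) => [q hq j hj|k [hk [k0 ek]]].
  rewrite -RtoC_mult -mult_INR => /RtoC_inj /INR_eq; have := hok q hq; nia.
exists (fun y => v y ^ eN * k y)%C; split; first by hl. split; first by apply: Cmul_neq0 => //; exact: Cpow_nz.
apply: near2 (dmon_pow g p hg) (near_and _ _ _ e ek) => y -> [-> ]; rewrite -/Qg => ->.
rewrite (Cpow_add_r _ (S s * eN)) Cpow_mult_l (Cpow_mult_r _ (S s) eN); ring.
Qed.

(** * Three local behaviours of P[F] against a holomorphic function *)

Definition infinite_near (F : sphere_fun) (z : C) : Prop := near z (fun y => F y = None).
Definition dmon_agrees (h : C -> C) (F : sphere_fun) (z : C) : Prop := near z (fun y => F y <> None /\ dmon (fv F) y = h y).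
Definition dmon_differs (h : C -> C) (F : sphere_fun) (z : C) : Prop :=
  mero F z /\ hol h z /\ near z (fun y => y <> z -> F y <> None /\ dmon (fv F) y <> h y).

(** The H of the overview, for a general h. The value 0 at poles is the continuous one, since P[F]
    has a genuine pole there by [pole_form]. *)
Definition dmon_recip (h : C -> C) (F : sphere_fun) (z : C) : C :=
  if F z is Some _ then (/ (dmon (fv F) z - h z))%C else RtoC 0.

Lemma dmon_recip_fin h F z : F z <> None -> dmon_recip h F z = (/ (dmon (fv F) z - h z))%C.
Proof. by rewrite /dmon_recip; case: (F z). Qed.

(* The exponent pN (s+1) - m s is the order of the pole of P[F] at a pole of order s + 1 of F. *)
Lemma pole_form h F z : mero F z -> F z = None -> hol h z -> ~ infinite_near F z ->
  exists s v H1, hol v z /\ v z <> 0 /\ hol H1 z /\ H1 z <> 0 /\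
    near z (fun y => sinv F y <> None /\ fv (sinv F) y = ((y - z) ^ S s * v y)%C) /\
    near z (fun y => dmon_recip h F y = ((y - z) ^ (S s * pN - summ ps * s) * H1 y)%C) /\
    near z (fun y => y <> z -> F y <> None /\ dmon (fv F) y <> h y).
Proof.
move=> hm fz hh nB; have hr := mero_pole _ _ hm fz; have hu := reg_hol _ _ hr.
have u0 : fv (sinv F) z = 0 by rewrite /fv /sinv fz.
have hfin : near z (fun y => sinv F y <> None) by apply: near_mono hr => y [].
case: (near_dichotomy _ _ hu) => [e|[n [v [hv [v0 e]]]]].
  by case: nB; apply: near2 e hfin => y e1 e2; apply/sinv_zero.
case: n e => [|s] e; first by case: v0; move: (e z); rewrite u0 /= Cmult_1_l.
have vn := Cc_neq _ _ _ (Cdiff_Cc _ _ (hol_at _ _ hv)) v0.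
case: (Sg_order (fv (sinv F)) v z s hv v0 (near_all _ _ e)) => k [hk [k0 ek]].
set n := (S s * pN - summ ps * s)%nat.
have n0 : (0 < n)%nat by rewrite /n /pN; nia.
have nn : (S s * pN = n + summ ps * s)%nat by rewrite /n /pN; nia.
have zn : ((z - z) ^ n = 0)%C by case: n n0 {nn} => [|j] j0; [lia|rewrite Cpow_S; ring].
(* P[F] - h is D / ((y - z)^n v^pN) off z, and n > 0 makes D z = k z, which is not zero. *)
set D := fun y => (k y - h y * (y - z) ^ n * v y ^ pN)%C.
have hD : hol D z by rewrite /D; hl.
have D0 : D z <> 0.
  rewrite /D zn.
  by have -> : (k z - h z * 0 * v z ^ pN = k z)%C by ring.
have Dn := Cc_neq _ _ _ (Cdiff_Cc _ _ (hol_at _ _ hD)) D0.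
have key : near z (fun y => y <> z -> F y <> None /\ (dmon (fv F) y - h y)%C = (D y * / ((y - z) ^ n * v y ^ pN))%C).
  apply: near2 (near_and _ _ _ (near_near _ _ hfin) (near_near _ _ hu)) (near_and _ _ _ vn ek) => y [fy uy] [vy ey] ny.
  have uy0 : fv (sinv F) y <> 0 by rewrite e; apply: Cmul_neq0 => //; apply: Cpow_nz; exact: Csub_neq0.
  have fy1 := near_self _ _ fy; have Fy := sinv_fin _ _ fy1 uy0; split=> //.
  have einv : near y (fun w => fv F w = / fv (sinv F) w)%C.
    apply: near2 fy (Cc_neq _ _ _ (Cdiff_Cc _ _ (near_self _ _ uy)) uy0) => w fw uw.
    have Fw := sinv_fin _ _ fw uw; have [a1 ->] := fv_sinv _ _ Fw fw; by rewrite Cinv_inv.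
  rewrite (near_self _ _ (dmon_inv _ _ _ uy uy0 einv)) ey e Cpow_mult_l -Cpow_mult_r nn (Cpow_add_r _ n) /D.
  have a1 := Csub_neq0 _ _ ny; field; repeat split; exact: Cpow_nz.
exists s, v, (fun y => v y ^ pN * / D y)%C; split=> //; split=> //; split; first by apply: hol_mult; [exact: hol_pow|exact: hol_inv].
split; first by apply: Cmul_neq0; [exact: Cpow_nz|exact: Cinv_neq0].
split; first by apply: near_mono hfin => y hy; split.
split.
- apply: near2 key (near_and _ _ _ Dn vn) => y ky [dy vy]; case: (excluded_middle_informative (y = z)) => [->|ny].
    by rewrite /dmon_recip fz -/n zn Cmult_0_l.
  case: (ky ny) => Fy e2; rewrite dmon_recip_fin // e2 -/n; have a1 := Csub_neq0 _ _ ny; field; repeat split; try exact: Cpow_nz; exact: dy.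
- apply: near2 key (near_and _ _ _ Dn vn) => y ky [dy vy] ny; case: (ky ny) => Fy e2; split=> // e3.
  have : (D y * / ((y - z) ^ n * v y ^ pN))%C = 0 by rewrite -e2 e3; ring.
  have a1 := Csub_neq0 _ _ ny.
  by case/Cmul_eq0 => // /(Cinv_neq0 _ (Cmul_neq0 _ _ (Cpow_nz _ n a1) (Cpow_nz _ pN vy))).
Qed.

Lemma trichotomy_at h F z : mero F z -> hol h z -> infinite_near F z \/ dmon_agrees h F z \/ dmon_differs h F z.
Proof.
move=> hm hh; case: (excluded_middle_informative (F z = None)) => [e|n].
  case: (excluded_middle_informative (infinite_near F z)) => [|nB]; first by left.
  right; right; case: (pole_form h F z hm e hh nB) => s [v [H1 [_ [_ [_ [_ [_ [_ hp]]]]]]]]; by split.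
right; have hr := mero_finite _ _ hm n; have hg := reg_hol _ _ hr.
have hE : hol (fun y => dmon (fv F) y - h y)%C z by apply: hol_minus => //; exact: hol_dmon.
case: (near_dichotomy _ _ hE) => [e|[j [v [hv [v0 e]]]]].
- left; apply: near2 hr e => y [Fy _] ey; split=> //.
  have -> : dmon (fv F) y = (dmon (fv F) y - h y + h y)%C by ring. rewrite ey; ring.
- right; split=> //; split=> //; apply: near2 hr (near_punct_neq0 _ _ _ _ hv v0 e) => y [Fy _] ey ny; split=> // e2.
  by apply: (ey ny); rewrite e2; ring.
Qed.

(** The three behaviours are open and mutually exclusive, so only one occurs on a connected set. It
    is applied to limit functions, where the first two have to be excluded or are harmless. *)
Lemma trichotomy h F (Om : C -> Prop) : connected_set Om -> (forall z, Om z -> mero F z /\ hol h z) ->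
  (forall z, Om z -> infinite_near F z) \/ (forall z, Om z -> dmon_agrees h F z) \/ (forall z, Om z -> dmon_differs h F z).
Proof.
move=> hc hmh.
have excl (P Q : C -> Prop) z : near z P -> near z (fun y => y <> z -> Q y) -> exists y, P y /\ Q y.
  move=> hP hQ; case: (near_and _ _ _ hP hQ) => r [r0 hr]; case: (exists_punct z r r0) => y [/hr [h1 h2] h3].
  by exists y; split=> //; exact: h2.
apply: connected_trichotomy => //.
- by move=> z; exact: near_near.
- by move=> z; exact: near_near.
- move=> z [hm [hh hp]].
  apply: near2 (near_and _ _ _ (mero_near _ _ hm) (hol_near _ _ hh)) (near_near _ _ hp) => y [my hy] py; split=> //; split=> //.
  case: (excluded_middle_informative (y = z)) => [->|nyz].
    case: (excluded_middle_informative (y = z)) => [e|//]; by rewrite e in py.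
  have [Fy Py] := near_self _ _ py nyz; have hr := mero_finite _ _ my Fy.
  have hE : hol (fun y => dmon (fv F) y - h y)%C y by apply: hol_minus => //; apply: hol_dmon; exact: reg_hol.
  have En := Cc_neq _ _ 0 (Cdiff_Cc _ _ (hol_at _ _ hE)) (Csub_neq0 _ _ Py).
  apply: near2 hr En => w [Fw _] ew _; split=> // e; apply: ew; rewrite e; ring.
- move=> z /hmh [hm hh]; exact: trichotomy_at.
- move=> z b1 b2; case: (near_self _ _ b2) => n _; apply: n; exact: near_self b1.
- by move=> z b1 [_ [_ g]]; case: (excl _ _ _ b1 g) => y [e [n _]].
- by move=> z b2 [_ [_ g]]; case: (excl _ _ _ b2 g) => y [[_ e] [_ n]].
Qed.

Lemma dmon_differs_not_infinite_near h F z : dmon_differs h F z -> ~ infinite_near F z.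
Proof.
move=> [_ [_ g]] b; case: (near_and _ _ _ b g) => r [r0 hr]; case: (exists_punct z r r0) => y [/hr [h1 h2] h3].
by case: (h2 h3).
Qed.

(** * Zero-free functions with bounded spherical derivative *)

Lemma distance_to (P : C -> Prop) z : near z (fun y => ~ P y) -> (exists y, P y) ->
  exists d, 0 < d /\ (forall y, disc z d y -> ~ P y) /\ forall s, 0 < s -> exists y, Cmod (y - z) < d + s /\ P y.
Proof.
move=> [r [r0 hr]] [y0 Py0]; pose E t := 0 <= t /\ forall y, disc z t y -> ~ P y.
case: (completeness E).
- exists (Cmod (y0 - z)) => t [_ ht]; apply: Rnot_lt_le => hlt; exact: (ht y0 hlt Py0).
- by exists r; split=> //; lra.
move=> d [d1 d2]; have d0 : 0 < d by have := d1 r (conj (Rlt_le _ _ r0) hr); lra.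
exists d; split=> //; split.
- move=> y hy Py; have : d <= Cmod (y - z); last by rewrite /disc in hy; lra.
  apply: d2 => t [_ ht]; apply: Rnot_lt_le => hlt; exact: (ht y hlt Py).
- move=> s s0; apply: Classical_Prop.NNPP => hn; have : d + s <= d; last lra.
  apply: d1; split; first lra. move=> y hy Py; apply: hn; by exists y.
Qed.

Lemma entire_mero g : (forall z, Cdiff g z) -> forall z, mero (fun z => Some (g z)) z.
Proof. by move=> h z; left; apply: near_all => y; split=> //; exact: h. Qed.

Lemma segment_point (z y : C) t : 0 < t <= Cmod (y - z) -> exists w, Cmod (w - z) = t /\ Cmod (w - y) = Cmod (y - z) - t.
Proof.
move=> ht; exists (z + RtoC (t / Cmod (y - z)) * (y - z))%C; split.
- have -> : (z + RtoC (t / Cmod (y - z)) * (y - z) - z = RtoC (t / Cmod (y - z)) * (y - z))%C by ring.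
  rewrite Cmod_mult Cmod_R Rabs_pos_eq; first by field; lra. by apply: Rdiv_le_0_compat; lra.
- have -> : (z + RtoC (t / Cmod (y - z)) * (y - z) - y = - (RtoC (1 - t / Cmod (y - z)) * (y - z)))%C by rewrite RtoC_minus; ring.
  rewrite Cmod_opp Cmod_mult Cmod_R Rabs_pos_eq; first by field; lra.
  have : t / Cmod (y - z) <= 1 by apply/Rle_div_l; lra. lra.
Qed.

Lemma ln_le_sub x : 0 < x -> ln x <= x - 1.
Proof. move=> x0; have := exp_ineq1_le (ln x); rewrite exp_ln //; lra. Qed.

(* Minda's argument: compare with the nearest point where |g| = 1, where the spherical derivative controls log |g|. *)
Lemma zero_free_log_deriv g K : 0 < K -> (forall z, Cdiff g z) -> (forall z, g z <> 0) ->
  (forall z, sharp (fun z => Some (g z)) z <= K) -> forall z, 1 < Cmod (g z) -> Cmod (C_derive g z) <= 64 * K * Cmod (g z).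
Proof.
move=> K0 hg nz hs z hz; set P := fun y => Cmod (g y) <= 1.
case: (excluded_middle_informative (exists y, P y)) => [ex|nex]; last first.
  have hi y : Cdiff (fun y => / g y)%C y by apply: Cdiff_inv.
  have hb y : Cmod (/ g y) <= 1.
    rewrite Cmod_inv // -Rinv_1; apply: Rinv_le_contravar; first lra.
    apply: Rnot_lt_le => hlt; apply: nex; exists y; rewrite /P; lra.
  have hc := liouville _ _ hi hb; have e y : g y = g z.
    by rewrite -(Cinv_inv (g y)) // (hc y z) Cinv_inv.
  rewrite (CD_unique g z 0); last by apply: (CD_ext (fun _ => g z)); [apply: near_all => y; rewrite e|exact: CD_const].
  rewrite Cmod_0; apply: Rmult_le_pos; [lra|exact: Cmod_ge_0].
have hn : near z (fun y => ~ P y).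
  have e0 : 0 < Cmod (g z) - 1 by lra.
  apply: near_mono (Cdiff_Cc _ _ (hg z) _ e0) => y; rewrite /P Cmod_sym => hy; have := Cmod_le_add (g z) (g y); lra.
case: (distance_to P z hn ex) => d [d0 [hd hP]].
(* With K s <= 1/48 the height at w is within 1/8 of 1/2, so ln |g w| <= 16 K s. Harnack from w back
   to z costs a factor 2 d / s, in which s cancels, leaving ln |g z| <= 32 K d. *)
set s := Rmin (d / 2) (/ (48 * K)); have s0 : 0 < s by apply: Rmin_pos; [lra|apply: Rinv_0_lt_compat; lra].
have m1 : s <= d / 2 by exact: Rmin_l. have m2 : s <= / (48 * K) by exact: Rmin_r.
have Ks : 6 * K * s <= / 8.
  have := Rmult_le_compat_l (6 * K) _ _ ltac:(lra) m2; have -> : 6 * K * / (48 * K) = / 8 by field; lra.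
  by [].
case: (hP s s0) => y [hy Py].
have yd : d <= Cmod (y - z) by apply: Rnot_lt_le => hlt; exact: (hd y hlt Py).
case: (segment_point z y (d - s)) => [|w [w1 w2]]; first lra.
have hw : disc z d w by rewrite /disc; lra.
have g1 v : disc z d v -> 1 < Cmod (g v) by move=> hv; apply: Rnot_le_lt => hle; exact: (hd v hv hle).
have lip : Rabs (sc 0 (Some (g w)) - sc 0 (Some (g y))) <= 3 * K * Cmod (w - y).
  apply: (sc_lipschitz 0 (fun z => Some (g z)) y w K) => t _; split; [exact: entire_mero|exact: hs].
have lgw : ln (Cmod (g w)) <= 16 * K * s.
  move: lip => /Rabs_le_between [lip _]; rewrite /sc in lip.
  have gw := g1 w hw; have gy := Cmod_ge_0 (g y).
  have hy2 : / 2 <= / (1 + Cmod (g y) ^ 2) by apply: Rinv_le_contravar; [exact: one_sq_pos|rewrite /P in Py; nra].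
  have wy : Cmod (w - y) <= 2 * s by lra.
  have hw2 : / 2 - 6 * K * s <= / (1 + Cmod (g w) ^ 2) by nra.
  have p := one_sq_pos (Cmod (g w)).
  have hx : (/ 2 - 6 * K * s) * (1 + Cmod (g w) ^ 2) <= 1.
    have := Rmult_le_compat_r _ _ _ (Rlt_le _ _ p) hw2; rewrite Rinv_l; lra.
  have hx2 : Cmod (g w) ^ 2 - 1 <= 32 * K * s.
    move: Ks hx s0; set G := Cmod (g w) ^ 2; move=> Ks hx s0; have x0 : 0 < K * s by exact: Rmult_lt_0_compat.
    apply: Rnot_lt_le => hlt; have h1 : 0 < / 2 - 6 * K * s by lra.
    have h2 := Rmult_lt_compat_l _ _ _ h1 (Rplus_lt_compat_l 1 _ _ hlt); nra.
  have e : ln (Cmod (g w) ^ 2) = 2 * ln (Cmod (g w)) by rewrite /= Rmult_1_r ln_mult; lra.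
  have := ln_le_sub (Cmod (g w) ^ 2) ltac:(nra); lra.
case: (harnack g z d d0 (fun v _ => hg v) g1) => /(_ w hw) h1 h2; rewrite w1 in h1.
have hl : ln (Cmod (g z)) <= 32 * K * d.
  apply: (Rmult_le_reg_r s) => //; have : (d + (d - s)) * ln (Cmod (g w)) <= 2 * d * (16 * K * s).
    have := ln_pos _ (g1 w hw) => lw0; apply: Rmult_le_compat; lra.
  lra.
apply: (Rmult_le_reg_l d) => //; apply: Rle_trans h2 _.
have c0 := Cmod_ge_0 (g z); have := Rmult_le_compat_r _ _ _ c0 hl; nra.
Qed.

(** [zero_free_log_deriv] for g where |g| > 1, for 1 / g where |g| < 1, and the spherical derivative
    itself where |g| = 1 bound the entire function g' / g; Liouville makes it constant. *)
Lemma zero_free_exp g K : (forall z, Cdiff g z) -> (forall z, g z <> 0) ->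
  (forall z, sharp (fun z => Some (g z)) z <= K) -> exists eta : C, forall z, C_derive g z = (eta * g z)%C.
Proof.
move=> hg nz hs; set K' := Rabs K + 1; have K0 : 1 <= K' by rewrite /K'; have := Rabs_pos K; lra.
have K0' : 0 < K' by lra.
have hs' z : sharp (fun z => Some (g z)) z <= K' by have := hs z; have := Rle_abs K; rewrite /K'; lra.
have hi z : Cdiff (fun z => / g z)%C z by exact: Cdiff_inv.
have ei z : sinv (fun z => Some (g z)) z = Some (/ g z)%C by rewrite /sinv oinv_neq0.
have ei2 : sinv (fun z => Some (g z)) = (fun z => Some (/ g z)%C).
  by apply: FunctionalExtensionality.functional_extensionality.
have nz2 z : (/ g z)%C <> 0 by exact: Cinv_neq0.
have hs2 z : sharp (fun z => Some (/ g z)%C) z <= K' by rewrite -ei2 sharp_sinv //; exact: entire_mero.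
have hb z : Cmod (C_derive g z / g z) <= 64 * K'.
  have p := proj1 (Cmod_gt_0 _) (nz z); rewrite Cmod_div //; apply/Rle_div_l => //.
  case: (Rtotal_order (Cmod (g z)) 1) => [h|[h|h]].
  - have := zero_free_log_deriv _ K' K0' hi nz2 hs2 z.
    have -> : C_derive (fun y => / g y)%C z = (- C_derive g z / (g z * g z))%C by apply: CD_unique; apply: CD_invf => //; exact: CD_cder.
    rewrite Cmod_inv // Cmod_div ?Cmod_opp ?Cmod_mult; last exact: Cmul_neq0.
    have h1 : 1 < / Cmod (g z).
      by rewrite -[X in X < _]Rinv_1; apply: Rinv_lt_contravar; rewrite ?Rmult_1_r; lra.
    move/(_ h1)/(Rle_div_l _ _ _ (Rmult_lt_0_compat _ _ p p)).
    have -> : 64 * K' * / Cmod (g z) * (Cmod (g z) * Cmod (g z)) = 64 * K' * Cmod (g z) by field; lra. by [].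
  - have := hs' z; rewrite /sharp h; have -> : 1 + 1 ^ 2 = 2 by ring.
    move/(Rle_div_l _ _ _ Rlt_0_2); move=> h2; change (Cmod (C_derive g z) <= K' * 2) in h2; lra.
  - exact: (zero_free_log_deriv g K').
have hq z : Cdiff (fun z => C_derive g z / g z)%C z.
  by apply: Cdiff_div => //; apply: (cder_hol g z 1 (fun y _ => hg y)); apply: disc_center; lra.
have hc := liouville _ _ hq hb; exists (C_derive g 0 / g 0)%C => z; rewrite (hc 0 z); field; exact: nz.
Qed.

Lemma cdn_exp g eta l m : (forall z, Cdiff g z) -> (forall z, C_derive g z = (eta * g z)%C) ->
  forall z, cdn m (fun w => g w ^ l)%C z = ((RtoC (INR l) * eta) ^ m * g z ^ l)%C.
Proof.
move=> hg e; elim: m => [|m IH] z; first by rewrite /=; ring.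
rewrite [cdn _ _ _]/=; apply: CD_unique; apply: (CD_ext (fun w => (RtoC (INR l) * eta) ^ m * g w ^ l)%C); first by apply: near_all => y; rewrite IH.
apply: CD_eq (CD_scal _ _ _ _ (CD_pow _ _ _ l (CD_cder _ _ (hg z)))) _; rewrite e Cpow_S.
case: l {IH} => [|l]; first by rewrite /=; ring. rewrite [Nat.pred _]/= !Cpow_S; ring.
Qed.

Lemma dprod_exp g (eta : C) s : (forall z, Cdiff g z) -> (forall z, C_derive g z = (eta * g z)%C) -> okl s -> eta <> 0 ->
  exists c : C, c <> 0 /\ forall z, dprod s g z = (c * g z ^ suml s)%C.
Proof.
move=> hg e hs n0; elim: s hs => [|[l m] s IH] hs.
  by exists (RtoC 1); split; [exact: C1_nz|move=> z; rewrite /dprod /pprod /=; ring].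
have [/= h1 h2] := okl_cons _ _ hs; case: (IH h2) => c [c0 ec].
exists ((RtoC (INR l) * eta) ^ m * c)%C; split.
  apply: Cmul_neq0 => //; case: m h1 {hs} => [|m] h1; first exact: C1_nz.
  by apply: Cpow_nz; apply: Cmul_neq0 => //; move/RtoC_inj; apply: not_0_INR; lia.
move=> z; move: (ec z); rewrite /dprod /pprod /= (cdn_exp g eta l m hg e) => ->.
rewrite /suml /= Cpow_add_r; ring.
Qed.

(** A zero of finite order of F is a zero of P[F] of order at least [eN] > q, too many for b z^q.
    Without zeros, g' = eta g, and eta <> 0 would give P[g] = c g^dL with c <> 0: nowhere zero,
    against q > 0, and not constant, against q = 0. *)
Lemma dmon_monomial_trivial b q F K : (q < l0)%nat -> (forall z, mero F z) -> (forall z, sharp F z <= K) ->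
  (forall z, dmon_agrees (fun z => b * z ^ q)%C F z) -> forall z, sharp F z = 0.
Proof.
move=> hq hm hs hB; set g := fv F.
have hf z : F z <> None /\ dmon g z = (b * z ^ q)%C by exact: near_self (hB z).
have hg z : Cdiff g z by exact: hol_at _ _ (reg_hol _ _ (mero_finite _ _ (hm z) (proj1 (hf z)))).
have eF : F = (fun z => Some (g z)) by apply: FunctionalExtensionality.functional_extensionality => z; apply: some_fv; case: (hf z).
have fin0 : (forall z, C_derive g z = 0) -> forall z, sharp F z = 0.
  move=> h z; rewrite sharp_fin; last by case: (hf z). by rewrite -/g h Cmod_0 /Rdiv Rmult_0_l.
have he := eN_ge.
case: (excluded_middle_informative (exists p, g p = 0)) => [[p gp]|nz].
- apply: fin0; case: (near_dichotomy g p (near_all _ _ hg)) => [e|[n [v [hv [v0 e]]]]].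
    move=> z; apply: CD_unique; apply: (CD_ext (fun _ => RtoC 0)); last exact: CD_const.
    apply: near_all => y; symmetry; have R0 : 0 < Cmod (y - p) + 1 by have := Cmod_ge_0 (y - p); lra.
    by apply: (identity_disc g p _ R0 (fun y _ => hg y) e); rewrite /disc; lra.
  exfalso; case: n e => [|s] e; first by apply: v0; rewrite -gp e /=; ring.
  case: (dmon_zero_order g v p s hv v0 (near_all _ _ e)) => k [hk [k0 ek]].
  set n := (S s * eN + summ ps * s)%nat in ek; have hn : (q < n)%nat by rewrite /n; nia.
  have p0 : b <> 0 -> p = 0.
    move=> b0; apply: Classical_Prop.NNPP => np; have := near_self _ _ ek; rewrite (proj2 (hf p)).
    have -> : ((p - p) ^ n * k p = 0)%C by case: n hn {ek} => [|j] hj; [lia|rewrite Cpow_S; ring].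
    exact: Cmul_neq0 b0 (Cpow_nz _ q np).
  case: (excluded_middle_informative (b = 0)) => [b0|/[dup] b0 /p0 ep].
    have kn := Cc_neq _ _ _ (Cdiff_Cc _ _ (hol_at _ _ hk)) k0.
    case: (near_and _ _ _ ek kn) => r [r0 hr]; case: (exists_punct p r r0) => y [/hr [h1 h2] h3].
    move: h1; rewrite (proj2 (hf y)) b0 Cmult_0_l => h1; apply: (Cmul_neq0 ((y - p) ^ n)%C (k y)) => //.
    by apply: Cpow_nz; exact: Csub_neq0.
  apply: b0; rewrite ep in ek hk k0; rewrite (Cc_eq_at (fun _ => b) (fun z => z ^ (n - q) * k z)%C 0).
  + by rewrite (_ : (n - q)%nat = S (n - q - 1)); [rewrite Cpow_S; ring|lia].
  + exact: CD_Cc (CD_const b 0).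
  + apply: (Cdiff_Cc (fun z => z ^ (n - q) * k z)%C); have := hol_at _ _ hk; move=> hk'; hol.
  + apply: near_mono ek => y; rewrite (proj2 (hf y)) (_ : (y - 0 = y)%C); last by ring.
    move=> ey ny.
    have nq := Cpow_nz _ q ny; have -> : b = (b * y ^ q / y ^ q)%C by field.
    rewrite ey (_ : n = (n - q) + q)%nat; last lia. rewrite Cpow_add_r (_ : n - q + q - q = n - q)%nat; last lia. by field.
- have nz' z : g z <> 0 by move=> e; apply: nz; exists z.
  have hs' z : sharp (fun z => Some (g z)) z <= K by rewrite -eF.
  case: (zero_free_exp g K hg nz' hs') => eta e; apply: fin0 => z; rewrite e.
  case: (excluded_middle_informative (eta = 0)) => [->|n0]; first by ring.
  exfalso; case: (dprod_exp g eta ps hg e hok n0) => c [c0 ec].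
  have eP y : (c * g y ^ dL = b * y ^ q)%C by rewrite -(proj2 (hf y)) /dmon ec /dL Cpow_add_r; ring.
  case: q hq hB hf eP => [|q] hq hB hf eP.
  + have : (c * (RtoC (INR dL) * (eta * g 0) * g 0 ^ Nat.pred dL))%C = 0.
      rewrite -e -(CD_unique _ _ _ (CD_scal c _ _ _ (CD_pow _ _ _ dL (CD_cder _ _ (hg 0))))).
      apply: CD_unique; apply: (CD_ext (fun _ => b)); last exact: CD_const.
      by apply: near_all => y; rewrite eP /=; ring.
    have dL0 : RtoC (INR dL) <> 0 by move/RtoC_inj; apply: not_0_INR; rewrite /dL; lia.
    exact: Cmul_neq0 _ _ c0 (Cmul_neq0 _ _ (Cmul_neq0 _ _ dL0 (Cmul_neq0 _ _ n0 (nz' 0))) (Cpow_nz _ _ (nz' 0))).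
  + move: (eP 0); rewrite Cpow_S Cmult_0_l Cmult_0_r; apply: Cmul_neq0 => //; exact: Cpow_nz.
Qed.

(* When al h' = be h this is - (al H' + be H) / (F H) with H = 1 / (P[F] - h), extended holomorphically to the poles and zeros of F. *)
Definition dmon_log (al be h : C -> C) (F : sphere_fun) (z : C) : C :=
  if F z is Some _ then ((al z * dmon_dquo (fv F) z - be z * dmon_quo (fv F) z) * / (dmon (fv F) z - h z))%C
  else (- (al z * RtoC (INR pN) * C_derive (fv (sinv F)) z))%C.

Lemma dmon_log_fin al be h F z : F z <> None ->
  dmon_log al be h F z = ((al z * dmon_dquo (fv F) z - be z * dmon_quo (fv F) z) * / (dmon (fv F) z - h z))%C.
Proof. by rewrite /dmon_log; case: (F z). Qed.

Lemma dmon_recip_near h F z : reg F z -> near z (fun y => dmon_recip h F y = (/ (dmon (fv F) y - h y))%C).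
Proof. by apply: near_mono => y [n _]; exact: dmon_recip_fin. Qed.

Lemma dmon_recip_hol_fin h F z : reg F z -> hol h z -> dmon (fv F) z <> h z -> hol (dmon_recip h F) z.
Proof.
move=> hr hh n; apply: (hol_ext (fun y => / (dmon (fv F) y - h y))%C).
  by apply: near_mono (dmon_recip_near h F z hr) => y ->.
apply: (hol_inv (fun y => dmon (fv F) y - h y)%C); last exact: Csub_neq0.
by apply: hol_minus => //; apply: hol_dmon; exact: reg_hol.
Qed.

(** The relation between h' and h removes the h terms, which is why the logarithmic derivative of H
    alone suffices for a constant or a monomial h. *)
Lemma dmon_log_log al be h F z : reg F z -> hol h z -> dmon (fv F) z <> h z -> fv F z <> 0 ->
  (al z * C_derive h z = be z * h z)%C ->
  dmon_log al be h F z = (- (/ fv F z * (al z * (C_derive (dmon_recip h F) z / dmon_recip h F z) + be z)))%C.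
Proof.
move=> hr hh n n0 ea; have hg := reg_hol _ _ hr; have Fz := proj1 (near_self _ _ hr).
have nn := Csub_neq0 _ _ n; rewrite dmon_log_fin // dmon_recip_fin //.
have -> : C_derive (dmon_recip h F) z = (- (fv F z * dmon_dquo (fv F) z - C_derive h z) / ((dmon (fv F) z - h z) * (dmon (fv F) z - h z)))%C.
  apply: CD_unique; apply: CD_ext; first by apply: near_mono (dmon_recip_near h F z hr) => y ->.
  apply: CD_eq (CD_invf _ _ _ (CD_minus _ _ _ _ _ (CD_cder _ _ (hol_at _ _ (hol_dmon _ _ hg))) (CD_cder _ _ (hol_at _ _ hh))) nn) _.
  by rewrite cder_dmon.
have e0 := dmon_dmon_quo _ _ hg; rewrite e0 in nn *.
have -> : (al z * dmon_dquo (fv F) z - be z * dmon_quo (fv F) z = / fv F z * (al z * (fv F z * dmon_dquo (fv F) z - C_derive h z) - be z * (fv F z * dmon_quo (fv F) z - h z)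
   + (al z * C_derive h z - be z * h z)))%C by field.
rewrite ea; field; by split.
Qed.

Definition avoids (h : C -> C) (F : sphere_fun) (z : C) : Prop := near z (fun y => F y <> None -> dmon (fv F) y <> h y).

Lemma dmon_recip_hol h F z : mero F z -> hol h z -> ~ infinite_near F z -> avoids h F z -> hol (dmon_recip h F) z.
Proof.
move=> hm hh nB ha; case: (excluded_middle_informative (F z = None)) => [e|n].
  case: (pole_form h F z hm e hh nB) => s [v [H1 [hv [v0 [hH1 [H10 [eu [eH _]]]]]]]].
  by apply: (hol_ext (fun y => (y - z) ^ (S s * pN - summ ps * s) * H1 y)%C); [apply: near_mono eH => y ->|hl].
by apply: dmon_recip_hol_fin => //; [exact: mero_finite|exact: near_self ha n].
Qed.

Lemma dmon_log_hol al be h F z : mero F z -> hol h z -> hol al z -> hol be z ->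
  near z (fun y => (al y * C_derive h y = be y * h y)%C) -> ~ infinite_near F z -> avoids h F z -> hol (dmon_log al be h F) z.
Proof.
move=> hm hh hal hbe hab nB ha; case: (excluded_middle_informative (F z = None)) => [e|n]; last first.
  have hr := mero_finite _ _ hm n; have hg := reg_hol _ _ hr.
  apply: (hol_ext (fun y => (al y * dmon_dquo (fv F) y - be y * dmon_quo (fv F) y) * / (dmon (fv F) y - h y))%C).
    by apply: near_mono hr => y [Fy _]; rewrite dmon_log_fin.
  apply: hol_mult; first by apply: hol_minus; apply: hol_mult => //; [exact: hol_dmon_dquo|exact: hol_dmon_quo].
  apply: (hol_inv (fun y => dmon (fv F) y - h y)%C); last by apply: Csub_neq0; exact: near_self ha n.
  by apply: hol_minus => //; exact: hol_dmon.
case: (pole_form h F z hm e hh nB) => s [v [H1 [hv [v0 [hH1 [H10 [eu [eH ep]]]]]]]].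
set n := (S s * pN - summ ps * s)%nat in eH.
(* The formula of [dmon_log_log] with 1 / F = (y - z)^(s + 1) v and H = (y - z)^n H1: one factor y -
   z absorbs the pole n / (y - z) of H' / H. *)
set R := fun y => (- ((y - z) ^ s * v y * (al y * ((RtoC (INR n) * H1 y + (y - z) * C_derive H1 y) * / H1 y) + be y * (y - z))))%C.
apply: (hol_ext R); last by rewrite /R; hl; exact: hol_inv.
have vn := Cc_neq _ _ _ (Cdiff_Cc _ _ (hol_at _ _ hv)) v0; have Hn := Cc_neq _ _ _ (Cdiff_Cc _ _ (hol_at _ _ hH1)) H10.
have q1 := near_and _ _ _ (near_near _ _ eH) (near_and _ _ _ ep eu).
have q2 := near_and _ _ _ (near_and _ _ _ vn Hn) (near_and _ _ _ hH1 (near_and _ _ _ (hol_near _ _ hh) (near_and _ _ _ hab (mero_near _ _ hm)))).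
apply: near2 q1 q2 => y [eHy [py [sy uy]]] [[vy H1y] [dH1 [hhy [aby my]]]].
case: (excluded_middle_informative (y = z)) => [->|ny].
- rewrite /dmon_log e /R.
  have du : C_derive (fv (sinv F)) z = ((RtoC (INR (S s)) * (z - z) ^ s) * v z + (z - z) ^ S s * C_derive v z)%C.
    apply: CD_unique; apply: CD_ext; first by apply: near_mono eu => w [_ ->].
    have dz : CD (fun w => w - z)%C z 1 by apply: CD_eq (CD_minus _ _ _ _ _ (CD_id z) (CD_const z z)) _; ring.
    apply: CD_eq (CD_mult _ _ _ _ _ (CD_pow _ _ _ (S s) dz) (CD_cder _ _ (hol_at _ _ hv))) _; rewrite [Nat.pred _]/=; ring.
  (* For a simple pole n = [pN], matching the value chosen in [dmon_log]; for a multiple pole both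
     sides vanish. *)
  rewrite du; case: (s) @n eH R du eu eHy => [|j] n eH R du eu eHy.
    have -> : n = pN by rewrite /n; lia. rewrite /= ; field; exact: H10.
  rewrite !Cpow_S; ring.
- have [Fy Py] := py ny; have hr := mero_finite _ _ my Fy.
  have [g0 eg] := fv_sinv _ _ Fy sy; have a1 := Csub_neq0 _ _ ny.
  rewrite (dmon_log_log al be h F y hr hhy Py g0 aby) -eg uy (near_self _ _ eHy).
  have -> : C_derive (dmon_recip h F) y = ((RtoC (INR n) * (y - z) ^ (Nat.pred n)) * H1 y + (y - z) ^ n * C_derive H1 y)%C.
    apply: CD_unique; apply: CD_ext; first by apply: near_mono eHy => w ->.
    have dz : CD (fun w => w - z)%C y 1 by apply: CD_eq (CD_minus _ _ _ _ _ (CD_id y) (CD_const z y)) _; ring.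
    apply: CD_eq (CD_mult _ _ _ _ _ (CD_pow _ _ _ n dz) (CD_cder _ _ dH1)) _; ring.
  rewrite /R; have n0 : (0 < n)%nat by rewrite /n /pN; nia.
  case: (n) n0 => [|j] j0; first lia. rewrite [Nat.pred _]/= !Cpow_S; field; repeat split => //; exact: Cpow_nz.
Qed.

Lemma dmon_recip_lcv h (fs : nat -> sphere_fun) F z : scv fs F z -> F z <> None -> hol h z -> dmon (fv F) z <> h z ->
  lcv (fun n => dmon_recip h (fs n)) (dmon_recip h F) z.
Proof.
move=> hs n hh np; have hr := scv_finite _ _ _ hs n; have hl := rcv_lcv _ _ _ hr.
apply: lcv_ext (lcv_inv _ _ _ (lcv_minus _ _ _ _ _ (lcv_dmon _ _ _ hl) (lcv_cst _ _ hh)) (Csub_neq0 _ _ np)) _ _.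
- case: (rcv_eventually _ _ _ hr) => r [N [r0 hN]]; exists r, N; split=> // k y hk hy.
  by rewrite dmon_recip_fin //; case: (hN k y hk hy).
- by apply: near_mono (dmon_recip_near h F z (rcv_reg _ _ _ hr)) => y ->.
Qed.

Lemma dmon_log_lbd al be (hs : nat -> C -> C) h (fs : nat -> sphere_fun) F z : scv fs F z -> F z <> None -> lcv hs h z -> hol al z -> hol be z ->
  dmon (fv F) z <> h z -> lbd (fun n y => Cmod (dmon_log al be (hs n) (fs n) y)) z.
Proof.
move=> hF n hh hal hbe np; have hr := scv_finite _ _ _ hF n; have hl := rcv_lcv _ _ _ hr.
have h1 := lcv_minus _ _ _ _ _ (lcv_mult _ _ _ _ _ (lcv_cst _ _ hal) (lcv_dmon_dquo _ _ _ hl)) (lcv_mult _ _ _ _ _ (lcv_cst _ _ hbe) (lcv_dmon_quo _ _ _ hl)).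
have h2 := lcv_inv _ _ _ (lcv_minus _ _ _ _ _ (lcv_dmon _ _ _ hl) hh) (Csub_neq0 _ _ np).
case: (lbd_elim _ _ (lcv_lbd _ _ _ (lcv_mult _ _ _ _ _ h1 h2))) => d [N [M [d0 hd]]].
case: (rcv_eventually _ _ _ hr) => r [N' [r0 hN]].
apply: (lbd_intro _ _ (Rmin d r) (Nat.max N N') M); first exact: Rmin_pos.
move=> k y hk hy; have m1 := Rmin_l d r; have m2 := Rmin_r d r.
rewrite dmon_log_fin; first by apply: hd; [lia|rewrite /disc in hy *; lra].
by case: (hN k y); [lia|rewrite /disc in hy *; lra|].
Qed.

(** Off z the limit is finite and P[F] differs from h, so both sequences converge or stay bounded
    there; [lbd_fill] then covers z itself. *)
Lemma dmon_recip_dmon_log_lbd al be h (fs : nat -> sphere_fun) F z R N0 : 0 < R ->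
  (forall y, disc z R y -> scv fs F y /\ hol h y /\ hol al y /\ hol be y /\ (al y * C_derive h y = be y * h y)%C) -> dmon_differs h F z ->
  (forall n y, (N0 <= n)%nat -> disc z R y -> mero (fs n) y /\ ~ infinite_near (fs n) y /\ avoids h (fs n) y) ->
  lbd (fun n y => Cmod (dmon_recip h (fs n) y)) z /\ lbd (fun n y => Cmod (dmon_log al be h (fs n) y)) z.
Proof.
move=> R0 hy [_ [_ hG]] hn; have dR := near_disc z R R0.
have hab y : disc z R y -> near y (fun w => (al w * C_derive h w = be w * h w)%C).
  by move=> /near_open; apply: near_mono => w /hy; tauto.
split; apply: (lbd_fill _ z R N0 R0).
- move=> n n0 y hyd; case: (hy y hyd) => _ [hh _]; case: (hn n y n0 hyd) => a [b c]; exact: hol_at _ _ (dmon_recip_hol _ _ _ a hh b c).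
- apply: near2 hG dR => y hG hyd ny; case: (hG ny) => a b; case: (hy y hyd) => c [d _].
  exact: lcv_lbd _ _ _ (dmon_recip_lcv h fs F y c a d b).
- move=> n n0 y hyd; case: (hy y hyd) => _ [hh [hal [hbe _]]]; case: (hn n y n0 hyd) => a [b c].
  exact: hol_at _ _ (dmon_log_hol al be h (fs n) y a hh hal hbe (hab y hyd) b c).
- apply: near2 hG dR => y hG hyd ny; case: (hG ny) => a b; case: (hy y hyd) => c [d [hal [hbe _]]].
  exact: (dmon_log_lbd al be (fun _ => h) h fs F y c a (lcv_cst _ _ d) hal hbe b).
Qed.

(** * Rescaling *)

Lemma near_affine (w s z : C) Q : near (w + s * z)%C Q -> near z (fun y => Q (w + s * y)%C).
Proof.
move=> [r [r0 hr]]; have h : Cdiff (fun y => w + s * y)%C z by hol.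
by apply: near_mono (Cdiff_Cc _ _ h r r0) => y hy; apply: hr.
Qed.

Lemma hol_affine g (w s z : C) : hol g (w + s * z)%C -> hol (fun y => g (w + s * y)%C) z.
Proof. by move/near_affine; apply: near_mono => y hy; apply: CD_Cdiff (CD_affine _ _ _ _ _ (CD_cder _ _ hy)). Qed.

Lemma Qop_affine lam m g (c w s z : C) : hol g (w + s * z)%C ->
  near z (fun y => Qop lam m (fun y => c * g (w + s * y))%C y = ((c * s) ^ m * Qop lam m g (w + s * y))%C).
Proof.
move=> h; elim: m => [|m IH]; first by apply: near_all => y /=; ring.
apply: near2 (near_near _ _ IH) (near_affine _ _ _ _ (near_and _ _ _ h (hol_Qop lam m _ _ h))) => y e [dg dQ].
rewrite !QopS; have -> : C_derive (Qop lam m (fun y => c * g (w + s * y))%C) y = ((c * s) ^ m * (s * C_derive (Qop lam m g) (w + s * y)))%C.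
  apply: CD_unique; apply: (CD_ext (fun y => (c * s) ^ m * Qop lam m g (w + s * y))%C); first by apply: near_mono e => v ->.
  exact: CD_scal _ _ _ _ (CD_affine _ _ _ _ _ (CD_cder _ _ dQ)).
rewrite (CD_unique _ _ _ (CD_scal c _ _ _ (CD_affine _ _ _ _ _ (CD_cder _ _ dg)))) (near_self _ _ e) Cpow_S; ring.
Qed.

Lemma Qpr_affine lam s g (c w t z : C) : hol g (w + t * z)%C ->
  near z (fun y => Qpr lam s (fun y => c * g (w + t * y))%C y = ((c * t) ^ summ s * Qpr lam s g (w + t * y))%C).
Proof.
move=> h; elim: s => [|p s IH]; first by apply: near_all => y; rewrite /Qpr /pprod /=; ring.
apply: near2 IH (Qop_affine (lam (fst p)) (snd p) g c w t z h) => y; rewrite /Qpr /pprod /= => -> ->.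
rewrite /summ /= Cpow_add_r; ring.
Qed.

Definition resc (c w s : C) (F : sphere_fun) : sphere_fun :=
  fun y => if F (w + s * y)%C is Some v then Some (c * v)%C else None.

Lemma fv_resc c w s F : fv (resc c w s F) = (fun y => c * fv F (w + s * y))%C.
Proof.
apply: FunctionalExtensionality.functional_extensionality => y; rewrite /fv /resc; case: (F _) => [v|] //=; ring.
Qed.

Lemma resc_fin c w s F z : resc c w s F z <> None <-> F (w + s * z)%C <> None.
Proof. by rewrite /resc; case: (F _). Qed.

Lemma sinv_resc (c w s : C) F : c <> 0 -> sinv (resc c w s F) = resc (/ c) w s (sinv F).
Proof.
move=> c0; apply: FunctionalExtensionality.functional_extensionality => y; rewrite /sinv /resc; case: (F _) => [v|] /=; last by congr Some; ring.
destruct (excluded_middle_informative (v = 0)) as [->|v0].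
  by destruct (excluded_middle_informative (c * 0 = 0)%C) as [e0|n] => //; case: n; ring.
destruct (excluded_middle_informative (c * v = 0)%C) as [e|n]; first by case: (Cmul_neq0 _ _ c0 v0).
congr Some; by field.
Qed.

Lemma reg_resc c w s F z : reg F (w + s * z)%C -> reg (resc c w s F) z.
Proof.
move/near_affine; apply: near_mono => y [a b]; split; first exact/resc_fin.
rewrite fv_resc; exact: CD_Cdiff (CD_scal _ _ _ _ (CD_affine _ _ _ _ _ (CD_cder _ _ b))).
Qed.

Lemma mero_resc (c w s : C) F z : c <> 0 -> mero F (w + s * z)%C -> mero (resc c w s F) z.
Proof. by move=> c0 [h|h]; [left; exact: reg_resc|right; rewrite sinv_resc //; exact: reg_resc]. Qed.

Lemma cder_fv_resc c w s F z : reg F (w + s * z)%C ->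
  C_derive (fv (resc c w s F)) z = (c * s * C_derive (fv F) (w + s * z))%C.
Proof.
move=> h; rewrite fv_resc -Cmult_assoc; apply: CD_unique; apply: CD_scal; apply: CD_affine; apply: CD_cder.
exact: hol_at _ _ (reg_hol _ _ h).
Qed.

Lemma eN_summ : (eN + summ ps = dL)%nat.
Proof. rewrite /eN /dL; lia. Qed.

(** P is homogeneous of degree [dL] and each monomial carries [summ ps] derivatives; every rescaling
    below rests on this. *)
Lemma dmon_affine g (c w s z : C) : hol g (w + s * z)%C ->
  dmon (fun y => c * g (w + s * y))%C z = (c ^ dL * s ^ summ ps * dmon g (w + s * z))%C.
Proof.
move=> h; rewrite (near_self _ _ (dmon_pow g _ h)); have h' := hol_mult _ _ _ (hol_cst c z) (hol_affine _ _ _ _ h).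
rewrite (near_self _ _ (dmon_pow _ z h')) /Qg (near_self _ _ (Qpr_affine _ _ _ c _ _ _ h)) -eN_summ.
rewrite (Cpow_add_r _ eN) !Cpow_mult_l; ring.
Qed.

Lemma dmon_quo_affine g (c w s z : C) : hol g (w + s * z)%C ->
  dmon_quo (fun y => c * g (w + s * y))%C z = (c ^ (dL - 1) * s ^ summ ps * dmon_quo g (w + s * z))%C.
Proof.
move=> h; rewrite /dmon_quo /Qg (near_self _ _ (Qpr_affine _ _ _ c _ _ _ h)).
have := eN_ge => e1; have e2 := eN_summ; have -> : (dL - 1 = (eN - 1) + summ ps)%nat by lia.
rewrite (Cpow_add_r _ (eN - 1)) !Cpow_mult_l; ring.
Qed.

Lemma dmon_dquo_affine g (c w s z : C) : hol g (w + s * z)%C ->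
  dmon_dquo (fun y => c * g (w + s * y))%C z = (c ^ (dL - 1) * s ^ S (summ ps) * dmon_dquo g (w + s * z))%C.
Proof.
move=> h; have hQ := Qpr_affine (fun l => RtoC (INR l)) ps _ c _ _ _ h.
rewrite /dmon_dquo /Qg (CD_unique _ _ _ (CD_scal c _ _ _ (CD_affine _ _ _ _ _ (CD_cder _ _ (hol_at _ _ h))))).
have dQ := CD_cder _ _ (hol_at _ _ (hol_Qpr (fun l => RtoC (INR l)) ps _ _ h)).
rewrite (near_self _ _ hQ) (CD_unique _ _ _ (CD_ext _ _ _ _ (near_mono _ _ _ (fun w e => esym e) hQ) (CD_scal _ _ _ _ (CD_affine _ _ _ _ _ dQ)))).
have := eN_ge => e1; have e2 := eN_summ; have -> : (dL - 1 = S (eN - 2) + summ ps)%nat by lia.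
have -> : (eN - 1 = S (eN - 2))%nat by lia.
rewrite (Cpow_add_r _ (S (eN - 2))) !Cpow_mult_l !Cpow_S; ring.
Qed.

Lemma dmon_recip_resc (c w s : C) h h' F z : c <> 0 -> s <> 0 -> mero F (w + s * z)%C ->
  (F (w + s * z)%C <> None -> dmon (fv F) (w + s * z)%C <> h' (w + s * z)%C) ->
  h z = (c ^ dL * s ^ summ ps * h' (w + s * z))%C ->
  dmon_recip h (resc c w s F) z = (/ (c ^ dL * s ^ summ ps) * dmon_recip h' F (w + s * z))%C.
Proof.
move=> c0 s0 hm ha eh; case: (excluded_middle_informative (F (w + s * z)%C = None)) => [e|n].
  rewrite /dmon_recip /resc e; ring.
rewrite !dmon_recip_fin //; last exact/resc_fin. have hg := reg_hol _ _ (mero_finite _ _ hm n).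
rewrite fv_resc dmon_affine // eh; have n1 := Csub_neq0 _ _ (ha n).
have -> : (c ^ dL * s ^ summ ps * dmon (fv F) (w + s * z) - c ^ dL * s ^ summ ps * h' (w + s * z) =
  c ^ dL * s ^ summ ps * (dmon (fv F) (w + s * z) - h' (w + s * z)))%C by ring.
field; repeat split => //; exact: Cpow_nz.
Qed.

(** The factor s of the chain rule is absorbed by al. For al the identity and w = 0 nothing of s
    remains, and a rescaling about 0 changes the function only by 1 / c. *)
Lemma dmon_log_resc (c w s : C) al al' be be' h h' F z : c <> 0 -> s <> 0 -> mero F (w + s * z)%C ->
  (F (w + s * z)%C <> None -> dmon (fv F) (w + s * z)%C <> h' (w + s * z)%C) ->
  h z = (c ^ dL * s ^ summ ps * h' (w + s * z))%C -> (al z * s = al' (w + s * z))%C -> be z = be' (w + s * z)%C ->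
  dmon_log al be h (resc c w s F) z = (/ c * dmon_log al' be' h' F (w + s * z))%C.
Proof.
move=> c0 s0 hm ha eh ea eb; case: (excluded_middle_informative (F (w + s * z)%C = None)) => [e|n].
  rewrite /dmon_log {1}/resc e sinv_resc // cder_fv_resc; last exact: mero_pole.
  rewrite -ea; ring.
rewrite !dmon_log_fin //; last exact/resc_fin. have hg := reg_hol _ _ (mero_finite _ _ hm n).
rewrite fv_resc dmon_affine // dmon_quo_affine // dmon_dquo_affine // eh -ea eb; have n1 := Csub_neq0 _ _ (ha n).
have -> : (c ^ dL * s ^ summ ps * dmon (fv F) (w + s * z) - c ^ dL * s ^ summ ps * h' (w + s * z) =
  c ^ dL * s ^ summ ps * (dmon (fv F) (w + s * z) - h' (w + s * z)))%C by ring.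
have [j ->] : exists j, dL = S j by exists (dL - 1)%nat; rewrite /dL; lia.
rewrite (_ : S j - 1 = j)%nat; last lia.
rewrite !Cpow_S; field; repeat split => //; exact: Cpow_nz.
Qed.

Lemma scv_bounded fs G p (x : nat -> C) M : scv fs G p -> Ccv x p -> 0 < M ->
  (forall n, fs n (x n) <> None /\ Cmod (fv (fs n) (x n)) <= M) -> G p <> None.
Proof.
move=> hs hx M0 hb e; have hr := scv_pole _ _ _ hs e.
have h1 := lcv_eval_seq _ _ _ _ (rcv_lcv _ _ _ hr) hx.
have e0 : fv (sinv G) p = 0 by rewrite /fv /sinv e.
case: (rcv_eventually _ _ _ hr) => r [N [r0 hN]].
have iM : 0 < / M by exact: Rinv_0_lt_compat.
have r2 : 0 < r / 2 by lra. have iM2 : 0 < / M / 2 by lra.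
case: (hx _ r2) => N1 h2; case: (h1 _ iM2) => N2 h3; set n := (N + N1 + N2)%nat.
have [s1 _] : sinv (fs n) (x n) <> None /\ Cdiff (fv (sinv (fs n))) (x n).
  apply: hN; first by rewrite /n; lia. have := h2 n; rewrite /disc => /(_ ltac:(rewrite /n; lia)); lra.
have [f1 f2] := hb n; have [v0 ev] := fv_sinv _ _ f1 s1.
have := h3 n ltac:(rewrite /n; lia); rewrite e0 ev.
have -> : (/ fv (fs n) (x n) - 0 = / fv (fs n) (x n))%C by ring.
rewrite Cmod_inv //; have p0 := proj1 (Cmod_gt_0 _) v0.
have := Rinv_le_contravar _ _ p0 f2; lra.
Qed.

Lemma dprod_cst (c : C) s z : (0 < summ s)%nat -> dprod s (fun _ => c) z = 0.
Proof.
have hc m (a : C) y : cdn (S m) (fun _ => a) y = 0.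
  elim: m y => [|m IH] y; first exact: CD_unique (CD_const a y).
  apply: CD_unique; apply: (CD_ext (fun _ => RtoC 0)); last exact: CD_const.
  by apply: near_all => v; exact: esym (IH v).
elim: s => [|[l [|m]] s IH] h; [by move: h; rewrite /summ /=; lia| |].
  have -> : dprod ((l, O) :: s) (fun _ => c) z = (c ^ l * dprod s (fun _ => c) z)%C by [].
  by rewrite IH; [ring|move: h; rewrite /summ /=].
have -> : dprod ((l, S m) :: s) (fun _ => c) z = (cdn (S m) (fun _ => c ^ l)%C z * dprod s (fun _ => c) z)%C by [].
rewrite hc; ring.
Qed.

Lemma cder_zero_disc g z r : (forall y, disc z r y -> Cdiff g y /\ C_derive g y = 0) -> forall w, disc z r w -> g w = g z.
Proof.
move=> hg w hw; have := mean_value_ineq g (C_derive g) z w 0; rewrite Rmult_0_l => H.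
have hs t : 0 <= t <= 1 -> CD g (seg z w t) (C_derive g (seg z w t)) /\ Cmod (C_derive g (seg z w t)) <= 0.
  move=> ht; case: (hg (seg z w t)) => [|h1 h2]; last by split; [exact: CD_cder|rewrite h2 Cmod_0; lra].
  rewrite /disc /seg in hw *; have -> : (z + RtoC t * (w - z) - z = RtoC t * (w - z))%C by ring.
  rewrite Cmod_mult Cmod_R Rabs_pos_eq; [have := Cmod_ge_0 (w - z); nra|lra].
have {}H := H hs; have := Cmod_ge_0 (g w - g z) => h1; have e : (g w - g z)%C = 0 by apply: Cmod_eq_0; lra.
have -> : g w = (g w - g z + g z)%C by ring. rewrite e; ring.
Qed.

Lemma cder_zero_const g : (forall z, Cdiff g z) -> (forall z, C_derive g z = 0) -> forall z w, g z = g w.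
Proof.
move=> hg h z w; apply: (cder_zero_disc g w (Cmod (z - w) + 1)) => [y _|]; first by split.
rewrite /disc; lra.
Qed.

(** F would be constant by [dmon_monomial_trivial], and P of a constant is 0 because at least one
    derivative is taken. *)
Lemma monomial_not_dmon_agrees (a : C) q F K : a <> 0 -> (q < l0)%nat -> (forall z, mero F z) -> (forall z, sharp F z <= K) ->
  ~ (forall z, dmon_agrees (fun z => a * z ^ q)%C F z).
Proof.
move=> a0 hq hm hs hB; have hz := dmon_monomial_trivial a q F K hq hm hs hB.
have hf z : F z <> None /\ dmon (fv F) z = (a * z ^ q)%C by exact: near_self (hB z).
have hg z : Cdiff (fv F) z by exact: hol_at _ _ (reg_hol _ _ (mero_finite _ _ (hm z) (proj1 (hf z)))).
have d0 z : C_derive (fv F) z = 0.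
  apply: Cmod_eq_0; move: (hz z); rewrite sharp_fin; last by case: (hf z).
  move/Rmult_integral => [//|h]; have := Rinv_0_lt_compat _ (one_sq_pos (Cmod (fv F z))); lra.
have hc := cder_zero_const _ hg d0.
have e : fv F = fun _ => fv F 0 by apply: FunctionalExtensionality.functional_extensionality => z; exact: hc.
have [_] := hf 1; rewrite e /dmon dprod_cst // Cmult_0_r => /esym; apply: Cmul_neq0 => //.
by apply: Cpow_nz; exact: C1_nz.
Qed.

(** Multiplication of the values by c distorts the spherical metric by at most the larger of |c| and
    1 / |c|. *)
Lemma sharp_resc (c w s : C) F z M : 1 <= M -> / M <= Cmod c <= M -> mero F (w + s * z)%C ->
  Cmod s * / M * sharp F (w + s * z)%C <= sharp (resc c w s F) z <= Cmod s * M * sharp F (w + s * z)%C.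
Proof.
move=> M1 hc hm; have iM : 0 < / M by apply: Rinv_0_lt_compat; lra.
have c0 : c <> 0 by apply/Cmod_gt_0; lra. have s0 := Cmod_ge_0 s.
have M2 : 1 <= M * Cmod c by rewrite -(Rinv_r M); [apply: Rmult_le_compat_l; lra|lra].
have hc2 : / M <= / Cmod c <= M.
  split; first by apply: Rinv_le_contravar; lra.
  by apply: (Rmult_le_reg_r (Cmod c)); [lra|rewrite Rinv_l; lra].
case: (excluded_middle_informative (F (w + s * z)%C = None)) => [e|n].
  rewrite !sharp_pole //; last by rewrite /resc e.
  rewrite sinv_resc // cder_fv_resc; last exact: mero_pole.
  rewrite !Cmod_mult Cmod_inv //; set x := Cmod (C_derive _ _); have x0 : 0 <= x by exact: Cmod_ge_0.
  have : / M * (Cmod s * x) <= / Cmod c * (Cmod s * x) <= M * (Cmod s * x); last by lra.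
  by have sx := Rmult_le_pos _ _ s0 x0; split; apply: Rmult_le_compat_r => //; case: hc2.
rewrite !sharp_fin //; last exact/resc_fin.
rewrite cder_fv_resc; last exact: mero_finite. rewrite fv_resc !Cmod_mult.
set x := Cmod (C_derive _ _); set v := Cmod (fv F _); set k := Cmod c in hc M2 *.
have x0 : 0 <= x by exact: Cmod_ge_0. have sx := Rmult_le_pos _ _ s0 x0.
have p := one_sq_pos v; have p2 := one_sq_pos (k * v); have v2 := pow2_ge_0 v.
have e1 : Cmod s * / M * (x / (1 + v ^ 2)) = (Cmod s * x) * (/ M / (1 + v ^ 2)) by rewrite /Rdiv; ring.
have e2 : Cmod s * M * (x / (1 + v ^ 2)) = (Cmod s * x) * (M / (1 + v ^ 2)) by rewrite /Rdiv; ring.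
have e3 : k * Cmod s * x / (1 + (k * v) ^ 2) = (Cmod s * x) * (k / (1 + (k * v) ^ 2)) by rewrite /Rdiv; ring.
rewrite e1 e2 e3; have k0 : 0 < k by lra.
have q1 : / M * (k * v) ^ 2 <= k * v ^ 2.
  have -> : / M * (k * v) ^ 2 = (/ M * k) * (k * v ^ 2) by ring.
  have : / M * k <= 1 by rewrite -(Rinv_l M); [apply: Rmult_le_compat_l; lra|lra].
  have := Rmult_le_pos _ _ (Rlt_le _ _ k0) v2; nra.
have q2 : k * v ^ 2 <= M * (k * v) ^ 2.
  have -> : M * (k * v) ^ 2 = (M * k) * (k * v ^ 2) by ring.
  have := Rmult_le_pos _ _ (Rlt_le _ _ k0) v2; nra.
split; apply: Rmult_le_compat_l => //.
  apply/Rle_div_l => //; have -> : k / (1 + (k * v) ^ 2) * (1 + v ^ 2) = k * (1 + v ^ 2) / (1 + (k * v) ^ 2) by rewrite /Rdiv; ring.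
  apply/Rle_div_r => //; lra.
apply/Rle_div_l => //; have -> : M / (1 + v ^ 2) * (1 + (k * v) ^ 2) = M * (1 + (k * v) ^ 2) / (1 + v ^ 2) by rewrite /Rdiv; ring.
apply/Rle_div_r => //; lra.
Qed.

Lemma scv_sharp_le fs F z K : scv fs F z -> (exists r N, 0 < r /\ forall n w, (N <= n)%nat -> disc z r w -> mero (fs n) w) ->
  (exists N, forall n, (N <= n)%nat -> sharp (fs n) z <= K) -> sharp F z <= K.
Proof.
move=> hs hm [N hN]; have h := scv_sharp _ _ _ _ hs (Ccv_cst z) hm.
have : Rbar_le (sharp F z) K; last by [].
apply: (is_lim_seq_le_loc (fun n => sharp (fs n) z) (fun _ => K) (sharp F z) K _ h (is_lim_seq_const K)).
by exists N.
Qed.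

(** * An omitted nonzero value *)

(** Cauchy estimates, halving the radius once for each derivative. *)
Lemma Qop_bound lam m r : 0 < r -> exists M, 0 <= M /\ forall u y, holD y r u -> (forall v, disc y r v -> Cmod (u v) <= 1) ->
  Cmod (Qop lam m u y) <= M.
Proof.
elim: m r => [|m IH] r r0; first by exists 1; split; [lra|move=> u y _ _; rewrite /= Cmod_1; lra].
have r2 : 0 < r / 2 by lra.
case: (IH _ r2) => M [M0 hM]; exists (M / (r / 2) + Cmod (lam - RtoC (INR m)) * / r * M); split.
  have := Rinv_0_lt_compat _ r0 => i0; apply: Rplus_le_le_0_compat; first by apply: Rdiv_le_0_compat.
  by apply: Rmult_le_pos => //; apply: Rmult_le_pos; [exact: Cmod_ge_0|lra].
move=> u y hu hb; rewrite QopS.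
have hb2 w : disc y (r / 2) w -> Cmod (Qop lam m u w) <= M.
  move=> hw; have hsub v : disc w (r / 2) v -> disc y r v.
    move=> hv; rewrite /disc in hw hv *; have := Cmod_triangle (v - w) (w - y).
    have -> : (v - w + (w - y) = v - y)%C by ring. lra.
  by apply: hM => v /hsub; [apply: hu|apply: hb].
have hyy : disc y r y by exact: disc_center.
have hQ : holD y (r / 2) (Qop lam m u).
  move=> w hw; apply: hol_at; apply: hol_Qop; apply: (holD_near_at y r) => //; rewrite /disc in hw *; lra.
have c1 := cauchy_estimate _ _ _ _ r2 hQ hb2.
have c2 := cauchy_estimate _ _ _ _ r0 hu hb.
have h1 := hb2 y (disc_center y _ r2).
apply: Rle_trans (Cmod_triangle _ _) _; rewrite !Cmod_mult; apply: Rplus_le_compat.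
  have d1 : Cmod (C_derive (Qop lam m u) y) <= M / (r / 2) by apply/Rle_div_r => //; lra.
  have := hb y hyy; have := Cmod_ge_0 (u y); have := Cmod_ge_0 (C_derive (Qop lam m u) y); nra.
have d2 : Cmod (C_derive u y) <= / r.
  by apply: (Rmult_le_reg_l r) => //; rewrite Rinv_r; lra.
apply: Rmult_le_compat => //; try exact: Cmod_ge_0; first by apply: Rmult_le_pos; exact: Cmod_ge_0.
by apply: Rmult_le_compat_l => //; exact: Cmod_ge_0.
Qed.

Lemma Qpr_bound lam s r : 0 < r -> exists M, 0 <= M /\ forall u y, holD y r u -> (forall v, disc y r v -> Cmod (u v) <= 1) ->
  Cmod (Qpr lam s u y) <= M.
Proof.
move=> r0; elim: s => [|p s [M [M0 IH]]]; first by exists 1; split; [lra|move=> u y _ _; rewrite /Qpr /pprod /= Cmod_1; lra].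
case: (Qop_bound (lam (fst p)) (snd p) r r0) => M' [M0' h]; exists (M' * M); split; first exact: Rmult_le_pos.
move=> u y hu hb; have -> : Qpr lam (p :: s) u y = (Qop (lam (fst p)) (snd p) u y * Qpr lam s u y)%C by [].
by rewrite Cmod_mult; apply: Rmult_le_compat; try exact: Cmod_ge_0; [exact: h|exact: IH].
Qed.

(** Absorbs the term |u| log (1 / |u|) that appears in [W_clear_bound]. *)
Lemma x_ln_inv x : 0 < x -> x * - ln x <= 1.
Proof.
move=> x0; have i := Rinv_0_lt_compat _ x0; have := ln_le_sub _ i; rewrite ln_Rinv // => h.
have := Rmult_le_compat_l _ _ _ (Rlt_le _ _ x0) h; have -> : x * (/ x - 1) = 1 - x by field; lra.
lra.
Qed.

Section OmittedValue.
Context (a : C) (F : sphere_fun) (K : R) (a0 : a <> 0) (hm : forall z, mero F z) (hs : forall z, sharp F z <= K)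
  (ha : forall z, F z <> None -> dmon (fv F) z <> a) (nb : forall z, ~ infinite_near F z).

Local Notation H := (dmon_recip (fun _ => a) F).
Local Notation W := (dmon_log (fun _ => RtoC 1) (fun _ => RtoC 0) (fun _ => a) F).
Local Notation u := (fv (sinv F)).
(** The gap between 2 here and 1 in [clear_inv] is what allows control of 1 / F a fixed distance
    beyond a disc free of such points. *)
Definition moderate (y : C) : Prop := F y <> None /\ Cmod (fv F y) <= 2.
Definition clear (z : C) (d : R) : Prop := forall y, disc z d y -> ~ moderate y.

(** Translates share the bound K, so Marty gives a limit G. It cannot satisfy P[G] = a, by
    [monomial_not_dmon_agrees]; unless it is identically infinite, H and W are bounded at the
    centres. *)
Lemma translates_limit (zs : nat -> C) : exists phi G, incr phi /\
  (forall y, scv (fun n => resc 1 (zs (phi n)) 1 F) G y) /\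
  ((forall y, infinite_near G y) \/ exists M N, forall n, (N <= n)%nat -> Cmod (H (zs (phi n))) <= M /\ Cmod (W (zs (phi n))) <= M).
Proof.
set fs := fun n => resc 1 (zs n) 1 F.
have nz1 := C1_nz.
have fm n y : mero (fs n) y by apply: mero_resc.
have fsh n y : sharp (fs n) y <= K.
  case: (sharp_resc 1 (zs n) 1 F y 1 (Rle_refl 1)) => //; first by rewrite Cmod_1; lra.
  move=> _; rewrite Cmod_1 !Rmult_1_l => h; exact: Rle_trans h (hs _).
case: (marty fs (fun _ => True)) => [z _|phi [G [hphi hG]]].
  by exists 1, O, K; split; [lra|move=> n y _ _; split].
have {hG}hG y : scv (fun n => fs (phi n)) G y by exact: hG.
exists phi, G; split=> //; split=> //.
have gm y : mero G y by exact: scv_mero (hG y).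
have gs y : sharp G y <= K.
  by apply: (scv_sharp_le _ _ _ _ (hG y)); [exists 1, O; split; [lra|move=> n w _ _; exact: fm]|exists O => n _; exact: fsh].
case: (trichotomy (fun _ => a) G (fun _ => True) connected_all) => [z _|h|[h|h]].
- by split; [exact: gm|exact: hol_cst].
- by left=> y; exact: h.
- exfalso; apply: (monomial_not_dmon_agrees a 0 G K a0 hl0 gm gs) => z.
  have -> : (fun z : C => a * z ^ 0)%C = fun _ => a; last exact: h.
  by apply: FunctionalExtensionality.functional_extensionality => y /=; ring.
- right; case: (dmon_recip_dmon_log_lbd (fun _ => RtoC 1) (fun _ => RtoC 0) (fun _ => a) (fun n => fs (phi n)) G 0 1 0 Rlt_0_1 _ (h _ I)).
  + move=> y _; split; first exact: hG. do 3 (split; first exact: hol_cst).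
    rewrite (CD_unique _ _ _ (CD_const a y)); ring.
  + move=> n y _ _; split; first exact: fm. split.
      move=> hB; apply: (nb (zs (phi n) + y)%C).
      have : near (zs (phi n) + y)%C (fun v => fs (phi n) (v - zs (phi n))%C = None).
        have hB' : near (- zs (phi n) + 1 * (zs (phi n) + y))%C (fun v => fs (phi n) v = None).
          by have -> : (- zs (phi n) + 1 * (zs (phi n) + y) = y)%C by ring.
        apply: near_mono (near_affine _ _ _ _ hB') => v.
        by have -> : (- zs (phi n) + 1 * v = v - zs (phi n))%C by ring.
      apply: near_mono => v; rewrite /fs /resc.
      have -> : (zs (phi n) + 1 * (v - zs (phi n)) = v)%C by ring. by case: (F v).
    apply: near_all => v hv; have hv' := proj1 (resc_fin _ _ _ _ _) hv.
    rewrite fv_resc dmon_affine; last by apply: reg_hol; exact: mero_finite.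
    rewrite !Cpow_1_l !Cmult_1_l; have := ha _ hv'; by rewrite Cmult_1_l.
  move=> /lbd_elim [d1 [N1 [M1 [d10 hd1]]]] /lbd_elim [d2 [N2 [M2 [d20 hd2]]]].
  exists (Rmax M1 M2), (N1 + N2)%nat => n hn.
  have e0 : (zs (phi n) + 1 * 0 = zs (phi n))%C by ring.
  have m1 := Rmax_l M1 M2; have m2 := Rmax_r M1 M2.
  split.
  * have := hd1 n 0 ltac:(lia) (disc_center _ _ d10).
    rewrite (dmon_recip_resc 1 _ 1 (fun _ => a) (fun _ => a)) //; first 1 last.
    - by rewrite e0; exact: ha.
    - rewrite !Cpow_1_l; ring.
    rewrite e0 !Cpow_1_l (_ : (/ (1 * 1) * H (zs (phi n)) = H (zs (phi n)))%C); first lra. field; exact: C1_nz.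
  * have := hd2 n 0 ltac:(lia) (disc_center _ _ d20).
    rewrite (dmon_log_resc 1 _ 1 _ (fun _ => RtoC 1) _ (fun _ => RtoC 0) (fun _ => a) (fun _ => a)) //; first 1 last.
    - by rewrite e0; exact: ha.
    - rewrite !Cpow_1_l; ring.
    - ring.
    rewrite e0 (_ : (/ 1 * W (zs (phi n)) = W (zs (phi n)))%C); first lra. field; exact: C1_nz.
Qed.

(** A sequence of counterexamples has translates tending to infinity everywhere, yet bounded by 2 at
    points that subconverge within distance R0: impossible. *)
Lemma bounded_near_moderate R0 : exists M, 1 <= M /\ forall z w, Cmod (w - z) <= R0 -> moderate w -> Cmod (H z) <= M /\ Cmod (W z) <= M.
Proof.
apply: Classical_Prop.NNPP => hn.
have ex n : exists p : C * C, Cmod (snd p - fst p) <= R0 /\ moderate (snd p) /\ ~ (Cmod (H (fst p)) <= INR n + 1 /\ Cmod (W (fst p)) <= INR n + 1).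
  apply: Classical_Prop.NNPP => hn2; apply: hn; exists (INR n + 1); split; first by have := pos_INR n; lra.
  move=> z w h1 h2; apply: Classical_Prop.NNPP => h3; apply: hn2; by exists (z, w).
set p := fun n => proj1_sig (constructive_indefinite_description _ (ex n)).
have hp n : Cmod (snd (p n) - fst (p n)) <= R0 /\ moderate (snd (p n)) /\ ~ (Cmod (H (fst (p n))) <= INR n + 1 /\ Cmod (W (fst (p n))) <= INR n + 1).
  exact: proj2_sig (constructive_indefinite_description _ (ex n)).
case: (translates_limit (fun n => fst (p n))) => phi [G [hphi [hG [hB|[M [N hM]]]]]].
- case: (bolzano_weierstrass (fun n => snd (p (phi n)) - fst (p (phi n)))%C R0) => [n|psi [l [hpsi hl]]]; first by case: (hp (phi n)).
  have hb := near_self _ _ (hB l).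
  apply: (scv_bounded _ _ _ _ 2 (scv_subseq _ _ _ _ hpsi (hG l)) hl) => //; first lra.
  move=> n; case: (hp (phi (psi n))) => _ [[h1 h2] _].
  have e : (fst (p (phi (psi n))) + 1 * (snd (p (phi (psi n))) - fst (p (phi (psi n)))) = snd (p (phi (psi n))))%C by ring.
  split; first by apply/resc_fin; rewrite e.
  by rewrite fv_resc e Cmult_1_l.
- case: (INR_unbounded M) => n0 hn0; set n := (N + n0)%nat.
  case: (hM n) => [|h1 h2]; first by rewrite /n; lia.
  case: (hp (phi n)) => _ [_]; apply; have := le_INR _ _ (incr_ge _ hphi n).
  have : INR n0 <= INR n by apply: le_INR; rewrite /n; lia. lra.
Qed.

(** Since 3 K [rho] <= 1/4, a height at most 1/5, that is |F| >= 2, stays below 1/2 within distance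
    [rho]. *)
Definition rho : R := / (12 * (K + 1)).

Lemma K_ge0 : 0 <= K.
Proof. exact: Rle_trans (sharp_ge0 F 0) (hs 0). Qed.

Lemma rho_pos : 0 < rho.
Proof. have := K_ge0; rewrite /rho => h; apply: Rinv_0_lt_compat; lra. Qed.

(* A point within rho of a clear disc has spherical height below 1/2, that is |F| > 1. *)
Lemma clear_inv z d y : 0 < d -> clear z d -> disc z (d + rho) y -> sinv F y <> None /\ Cmod (u y) < 1.
Proof.
move=> d0 hc hy; have K0 := K_ge0; have r0 := rho_pos.
have [v [hv hvy]] : exists v, disc z d v /\ Cmod (y - v) <= rho.
  case: (Rle_lt_dec (Cmod (y - z)) rho) => h; first by exists z; split=> //; exact: disc_center.
  rewrite /disc in hy; case: (segment_point z y (Cmod (y - z) - rho)) => [|v [h1 h2]]; first lra.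
  by exists v; rewrite /disc; split; [lra|rewrite Cmod_sym; lra].
have sv : sc 0 (F v) <= / 5.
  case: (excluded_middle_informative (F v = None)) => [->|n]; first by rewrite /=; lra.
  rewrite (some_fv _ _ n) [sc _ _]/=; apply: Rinv_le_contravar; first lra.
  have : 2 < Cmod (fv F v); last by move=> h; rewrite /= in h *; nra.
  apply: Rnot_le_lt => hle; exact: hc v hv (conj n hle).
have lip : Rabs (sc 0 (F y) - sc 0 (F v)) <= 3 * K * Cmod (y - v).
  by apply: (sc_lipschitz 0 F v y K) => t _; split; [exact: hm|exact: hs].
have lip2 : 3 * K * Cmod (y - v) <= / 4.
  apply: (Rle_trans _ (3 * K * rho)); first by apply: Rmult_le_compat_l; lra.
  have -> : 3 * K * rho = / 4 * (K / (K + 1)) by rewrite /rho; field; lra.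
  have : K / (K + 1) <= 1 by apply/Rle_div_l; lra. lra.
have hsc : sc 0 (F y) < / 2 by move/Rabs_le_between: lip; lra.
case: (excluded_middle_informative (F y = None)) => [e|n].
  by rewrite /fv /sinv e /= Cmod_0; split=> //; lra.
have h1 : 1 < Cmod (fv F y).
  apply: Rnot_le_lt => hle; move: hsc; rewrite (some_fv _ _ n) [sc _ _]/=; apply: Rle_not_lt.
  have p := one_sq_pos (Cmod (fv F y)); apply: Rinv_le_contravar => //; have := Cmod_ge_0 (fv F y); rewrite /= in p *; nra.
have n0 : fv F y <> 0 by apply/Cmod_gt_0; lra.
have hsn := sinv_some _ _ n n0; split=> //; have [_ ->] := fv_sinv _ _ n hsn.
by rewrite Cmod_inv // -[X in _ < X]Rinv_1; apply: Rinv_lt_contravar; lra.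
Qed.

Lemma u_hol y : sinv F y <> None -> hol u y.
Proof. move=> h; apply: reg_hol; apply: mero_finite => //; exact: mero_sinv. Qed.

(** The A of the overview: P[F] - a = [den] / u^pN, so [den] times H is u^pN. *)
Definition den (z : C) : C := (Sg u z - a * u z ^ pN)%C.

Lemma hol_den y : sinv F y <> None -> hol den y.
Proof. by move/u_hol => h; have := hol_Qpr (fun l => (- RtoC (INR l))%C) ps u y h; rewrite /den => h2; hl. Qed.

Lemma den_bound : exists M, 1 <= M /\ forall z d y, 0 < d -> clear z d -> disc z (d + rho / 2) y -> Cmod (den y) <= M.
Proof.
have r0 := rho_pos; have r2 : 0 < rho / 2 by lra.
case: (Qpr_bound (fun l => (- RtoC (INR l))%C) ps _ r2) => M [M0 hM].
exists (M + Cmod a + 1); split; first by have := Cmod_ge_0 a; lra.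
move=> z d y d0 hc hy; have hsub v : disc y (rho / 2) v -> disc z (d + rho) v.
  move=> hv; rewrite /disc in hv hy *; have := Cmod_triangle (v - y) (y - z).
  have -> : (v - y + (y - z) = v - z)%C by ring. lra.
have h1 : Cmod (Sg u y) <= M.
  by apply: hM => v /hsub hv; case: (clear_inv z d v d0 hc hv) => [/u_hol /hol_at ? ?] //; lra.
have h2 := proj2 (clear_inv z d y d0 hc (hsub _ (disc_center _ _ r2))).
apply: Rle_trans (Cmod_triangle _ _) _; rewrite Cmod_opp Cmod_mult Cmod_pow.
have : Cmod (u y) ^ pN <= 1 by rewrite -(pow1 pN); apply: pow_incr; split; [exact: Cmod_ge_0|lra].
have := Cmod_ge_0 a; nra.
Qed.

Lemma pN_pos : exists j, pN = S j.
Proof. exists (pN - 1)%nat; rewrite /pN; lia. Qed.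

Lemma den_dmon_recip y : sinv F y <> None -> (den y * H y = u y ^ pN)%C.
Proof.
move=> hy; case: (excluded_middle_informative (F y = None)) => [e|n].
  rewrite /dmon_recip e (proj2 (sinv_zero _ _ hy) e); case: pN_pos => j ->; rewrite Cpow_S; ring.
have [g0 eu] := fv_sinv _ _ n hy; have u0 : u y <> 0 by rewrite eu; exact: Cinv_neq0.
have hr := mero_finite _ _ (hm y) n.
have e : near y (fun v => fv F v = / u v)%C.
  by apply: near_mono (near_inv F y hr g0) => v [_ [_ [v0 ->]]]; rewrite Cinv_inv.
rewrite dmon_recip_fin // (near_self _ _ (dmon_inv _ _ _ (u_hol _ hy) u0 e)) /den.
have up := Cpow_nz _ pN u0; have := ha y n; rewrite (near_self _ _ (dmon_inv _ _ _ (u_hol _ hy) u0 e)) => hne.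
have ne : (Sg u y - a * u y ^ pN)%C <> 0.
  move=> e0; apply: hne; have -> : Sg u y = (Sg u y - a * u y ^ pN + a * u y ^ pN)%C by ring.
  rewrite e0; field; exact: up.
by field.
Qed.

Lemma H_hol y : hol H y.
Proof.
apply: dmon_recip_hol; [exact: hm|exact: hol_cst|exact: nb|apply: near_all => v; exact: ha].
Qed.

Lemma W_hol y : hol W y.
Proof.
apply: dmon_log_hol; [exact: hm|exact: hol_cst|exact: hol_cst|exact: hol_cst| |exact: nb|apply: near_all => v; exact: ha].
apply: near_all => v; rewrite (CD_unique _ _ _ (CD_const a v)); ring.
Qed.

(** [quotient_bound] with base point w, a moderate point just outside the clear disc: there |u w| >=
    1/2 and H is bounded, so [den] is bounded below. The Harnack constant between z and w is of
    order (1 + d) / [rho], hence the exponential bound. *)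
Lemma dmon_recip_exp_bound : exists C1, 0 <= C1 /\ forall z d, 0 < d -> clear z d ->
  (forall s, 0 < s -> exists y, Cmod (y - z) < d + s /\ moderate y) -> Cmod (H z) <= exp (C1 * (1 + d)).
Proof.
have r0 := rho_pos; case: den_bound => M0 [M01 hM0]; case: (bounded_near_moderate 0) => M [M1 hM].
set B := (2 * M0 * M * 2 ^ pN); have p2 : 1 <= 2 ^ pN by apply: pow_R1_Rle; lra.
have B1' : 1 <= B.
  have h1 : 1 <= 2 * M0 by lra. have h2 : 1 <= 2 * M0 * M by nra. rewrite /B; nra.
have lB : 0 <= ln B by rewrite -ln_1; apply: ln_le; lra.
exists (32 * (1 + / rho) * ln B); have ir := Rinv_0_lt_compat _ r0; split; first by apply: Rmult_le_pos => //; lra.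
move=> z d d0 hc hP; case: (hP (rho / 16)) => [|w [hw Pw]]; first lra.
have iM : 0 < / M0 by apply: Rinv_0_lt_compat; lra.
have hd y : disc z (d + rho / 2) y -> disc z (d + rho) y by rewrite /disc; lra.
have hi y (hy : disc z (d + rho / 2) y) := clear_inv z d y d0 hc (hd y hy).
have circ x r : d <= r < d + rho / 2 -> disc z (d + rho / 2) (z + RtoC r * cis x)%C.
  by move=> hr; apply: circ_disc; [lra|rewrite (_ : (z - z)%C = 0); [rewrite Cmod_0; lra|ring]].
have hwd : disc z (d + rho / 2) w by rewrite /disc; lra.
have [Fw Fw2] := Pw; have [sw uw] := hi w hwd; have [g0 eu] := fv_sinv _ _ Fw sw.
have u2 : / 2 <= Cmod (u w).
  by rewrite eu Cmod_inv //; apply: Rinv_le_contravar => //; exact/Cmod_gt_0.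
have cw0 : Cmod (w - w) <= 0 by rewrite (_ : (w - w)%C = 0); [rewrite Cmod_0; lra|ring].
have [Hw _] := hM w w cw0 Pw.
have eA := den_dmon_recip w sw; have up : / 2 ^ pN <= Cmod (u w) ^ pN by rewrite -pow_inv; apply: pow_incr; lra.
have hA : / (M * 2 ^ pN) <= Cmod (den w).
  have := f_equal Cmod eA; rewrite Cmod_mult Cmod_pow => e.
  apply: (Rmult_le_reg_r M); first lra.
  have -> : / (M * 2 ^ pN) * M = / 2 ^ pN by field; lra.
  apply: Rle_trans up _; rewrite -e; apply: Rmult_le_compat_l => //; exact: Cmod_ge_0.
have iMp : 0 < / (M * 2 ^ pN) by apply: Rinv_0_lt_compat; nra.
have A0 : den w <> 0 by apply/Cmod_gt_0; lra.
have MC : RtoC M0 <> 0 by move/RtoC_inj; lra.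
(* The radii leave room in steps: w lies within d + rho/16, Harnack is used on d + rho/8, the
   boundary bounds on d + rho/4, holomorphy holds on d + rho/2. *)
have := quotient_bound z (d + rho / 2) (d + rho / 4) (d + rho / 8) w (fun y => RtoC (/ M0) * den y)%C (fun y => RtoC (/ M0) * u y ^ pN)%C H.
have cm : Cmod (RtoC (/ M0)) = / M0 by rewrite Cmod_R Rabs_pos_eq //; lra.
have iM1 : / M0 <= 1 by rewrite -Rinv_1; apply: Rinv_le_contravar; lra.
have q1 : holD z (d + rho / 2) (fun y => RtoC (/ M0) * den y)%C.
  by move=> y hy; have := hol_at _ _ (hol_den _ (proj1 (hi y hy))) => h; hol.
have q2 : holD z (d + rho / 2) (fun y => RtoC (/ M0) * u y ^ pN)%C.
  by move=> y hy; have := hol_at _ _ (u_hol _ (proj1 (hi y hy))) => h; hol.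
have q3 : holD z (d + rho / 2) H by move=> y _; exact: hol_at _ _ (H_hol y).
have q4 y : disc z (d + rho / 2) y -> (RtoC (/ M0) * u y ^ pN = RtoC (/ M0) * den y * H y)%C.
  by move=> hy; rewrite -(den_dmon_recip y (proj1 (hi y hy))); ring.
move=> /(_ q1 q2 q3 q4) q; have {}q := q ltac:(lra) ltac:(lra) ltac:(rewrite /disc; lra).
apply: Rle_trans (q _ _ _) _.
- move=> x hx; rewrite Cmod_mult cm -[X in _ <= X](Rinv_l M0); last lra.
  apply: Rmult_le_compat_l; first lra. by apply: (hM0 z d) => //; apply: circ; lra.
- move=> x hx; rewrite Cmod_mult cm Cmod_pow; have hy := circ x (d + rho / 4) ltac:(lra).
  have : Cmod (u (z + RtoC (d + rho / 4) * cis x)%C) ^ pN <= 1.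
    by rewrite -(pow1 pN); apply: pow_incr; split; [exact: Cmod_ge_0|case: (hi _ hy); lra].
  have := pow_le _ pN (Cmod_ge_0 (u (z + RtoC (d + rho / 4) * cis x)%C)); nra.
- by apply: Cmul_neq0 => //; move/RtoC_inj; lra.
have mono x y : x <= y -> exp x <= exp y by case=> [/exp_increasing|->]; lra.
apply: mono; rewrite Cmod_mult cm.
have l1 : ln (2 / (/ M0 * Cmod (den w))) <= ln B.
  have pp : 0 < / M0 * Cmod (den w) by apply: Rmult_lt_0_compat => //; exact/Cmod_gt_0.
  apply: ln_le; first by apply: Rdiv_lt_0_compat; lra.
  apply/Rle_div_l => //; have -> : B * (/ M0 * Cmod (den w)) = 2 * (M * 2 ^ pN * Cmod (den w)) by rewrite /B; field; lra.
  have := Rmult_le_compat_l (M * 2 ^ pN) _ _ ltac:(nra) hA; rewrite Rinv_r; [lra|nra].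
have wd : Cmod (w - z) < d + rho / 16 by [].
have l2 : (d + rho / 8 + Cmod (w - z)) / (d + rho / 8 - Cmod (w - z)) <= 32 * (1 + / rho) * (1 + d).
  apply/Rle_div_l; first lra.
  apply: (Rle_trans _ (32 * (1 + / rho) * (1 + d) * (rho / 16))); last first.
    apply: Rmult_le_compat_l; last lra. by apply: Rmult_le_pos; lra.
  have -> : 32 * (1 + / rho) * (1 + d) * (rho / 16) = 2 * (1 + rho) * (1 + d) by field; lra. nra.
have l3 : 0 <= 32 * (1 + / rho) * (1 + d) by apply: Rmult_le_pos; lra.
have l4 : 0 <= (d + rho / 8 + Cmod (w - z)) / (d + rho / 8 - Cmod (w - z)).
  by apply: Rdiv_le_0_compat; have := Cmod_ge_0 (w - z); lra.
nra.
Qed.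


Lemma u_neq0 y : F y <> None -> sinv F y <> None -> u y <> 0.
Proof. by move=> a1 a2; have [v0 ->] := fv_sinv _ _ a1 a2; exact: Cinv_neq0. Qed.

Lemma cder_u_bound y : sinv F y <> None -> Cmod (u y) < 1 -> Cmod (C_derive u y) <= 2 * K.
Proof.
move=> h1 h2; have := hs y; rewrite -(sharp_sinv F y (hm y)) sharp_fin //.
have p := one_sq_pos (Cmod (u y)); move/(Rle_div_l _ _ _ p) => h; have := Cmod_ge_0 (u y) => h3.
have K0 := K_ge0; have h4 : Cmod (u y) ^ 2 <= 1 by rewrite /=; nra.
have := Rmult_le_compat_l _ _ _ K0 h4; lra.
Qed.

(** Taking logarithmic derivatives in [den] H = u^pN gives W = - (pN u' - u den' / den). Harnack for
    2 M0 / [den] bounds den' / den by (2 / r) log |2 M0 / den|; rewriting |den| as |u|^pN / |H|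
    leaves log |H| and a term |u| log (1 / |u|) <= 1. *)
Lemma W_clear_bound M0 x r L : 1 <= M0 ->
  (forall z d y, 0 < d -> clear z d -> disc z (d + rho / 2) y -> Cmod (den y) <= M0) ->
  0 < r -> clear x r -> (forall y, disc x r y -> den y <> 0) -> F x <> None -> Cmod (H x) <= exp L ->
  r * Cmod (W x) <= r * (INR pN * Cmod (C_derive u x)) + 2 * Cmod (u x) * (ln (2 * M0) + L) + 2 * INR pN.
Proof.
move=> M01 hM0 r0 hc hd Fx hH; have rp := rho_pos; have xx := disc_center x r r0.
have hi y : disc x r y -> sinv F y <> None /\ Cmod (u y) < 1 by move=> hy; apply: (clear_inv x r) => //; rewrite /disc in hy *; lra.
have [sx ux] := hi x xx; have u0 := u_neq0 x Fx sx; have d0 := hd x xx.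
have c2 : RtoC (2 * M0) <> 0 by move/RtoC_inj; lra.
have cm : Cmod (RtoC (2 * M0)) = 2 * M0 by rewrite Cmod_R Rabs_pos_eq //; lra.
pose T y := (RtoC (2 * M0) * / den y)%C.
have dT y : disc x r y -> CD T y (RtoC (2 * M0) * (- C_derive den y / (den y * den y)))%C.
  move=> hy; apply: CD_scal; apply: CD_invf; last exact: hd.
  by apply: CD_cder; apply: hol_at; apply: hol_den; case: (hi y hy).
have T1 y : disc x r y -> 1 < Cmod (T y).
  move=> hy; have p := proj1 (Cmod_gt_0 _) (hd y hy); rewrite /T Cmod_mult cm Cmod_inv //; last exact: hd.
  apply/Rlt_div_r => //; have := hM0 x r y r0 hc; rewrite /disc in hy *; move/(_ ltac:(lra)); lra.
case: (harnack T x r r0 (fun y hy => CD_Cdiff _ _ _ (dT y hy)) T1) => _.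
set q := (C_derive den x / den x)%C.
have -> : C_derive T x = (- (q * T x))%C by rewrite (CD_unique _ _ _ (dT x xx)) /T /q; field.
rewrite Cmod_opp Cmod_mult => hq; have Tx := T1 x xx.
have {}hq : r * Cmod q <= 2 * ln (Cmod (T x)) by apply: (Rmult_le_reg_r (Cmod (T x))); lra.
have eA := den_dmon_recip x sx; have up := Cpow_nz _ pN u0.
have H0 : H x <> 0 by move=> e; apply: up; rewrite -eA e; ring.
have hpos := proj1 (Cmod_gt_0 _) H0; have upos := proj1 (Cmod_gt_0 _) u0.
have lT : ln (Cmod (T x)) <= ln (2 * M0) + L - INR pN * ln (Cmod (u x)).
  have -> : Cmod (T x) = (2 * M0) * (Cmod (H x) * / Cmod (u x) ^ pN).
    rewrite /T Cmod_mult cm -Cmod_pow -eA Cmod_mult Cmod_inv //; field; split; apply: Rgt_not_eq; [exact: hpos|exact/Cmod_gt_0].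
  have pp : 0 < / Cmod (u x) ^ pN by apply: Rinv_0_lt_compat; exact: pow_lt.
  rewrite ln_mult; [|lra|exact: Rmult_lt_0_compat]. rewrite (ln_mult (Cmod (H x))) // ln_Rinv; last exact: pow_lt.
  rewrite ln_pow //; have : ln (Cmod (H x)) <= L by rewrite -(ln_exp L); exact: ln_le. lra.
have eW : W x = (- (RtoC (INR pN) * C_derive u x - u x * q))%C.
  have [g0 eu] := fv_sinv _ _ Fx sx.
  have := dmon_log_log (fun _ => RtoC 1) (fun _ => RtoC 0) (fun _ => a) F x (mero_finite _ _ (hm x) Fx) (hol_cst a x) (ha x Fx) g0.
  rewrite (CD_unique _ _ _ (CD_const a x)) Cmult_0_r Cmult_0_l => /(_ erefl) ->; rewrite -eu.
  have dH := CD_cder _ _ (hol_at _ _ (H_hol x)); have dd := CD_cder _ _ (hol_at _ _ (hol_den x sx)).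
  have du := CD_cder _ _ (hol_at _ _ (u_hol x sx)).
  have e1 := CD_unique _ _ _ (CD_mult _ _ _ _ _ dd dH).
  have e2 : C_derive (fun y => den y * H y)%C x = (RtoC (INR pN) * C_derive u x * u x ^ Nat.pred pN)%C.
    apply: CD_unique; apply: CD_ext (CD_pow _ _ _ pN du).
    have hn : near x (fun y => sinv F y <> None).
      by apply: near_mono (mero_finite _ _ (mero_sinv _ _ (hm x)) sx) => y [].
    by apply: near_mono hn => y hy; rewrite den_dmon_recip.
  have e3 : C_derive H x = ((RtoC (INR pN) * C_derive u x * u x ^ Nat.pred pN - C_derive den x * H x) / den x)%C.
    rewrite -e2 e1; field; exact: d0.
  rewrite e3; have eH : H x = (u x ^ pN / den x)%C by rewrite -eA; field.
  rewrite eH /q; case: pN_pos => j ej; rewrite ej [Nat.pred _]/= Cpow_S; rewrite ej Cpow_S in up.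
  have uj := Cpow_nz _ j u0; field; by repeat split.
rewrite eW Cmod_opp; apply: (Rle_trans _ (r * (INR pN * Cmod (C_derive u x) + Cmod (u x) * Cmod q))).
  apply: Rmult_le_compat_l; first lra. apply: Rle_trans (Cmod_triangle _ _) _.
  rewrite Cmod_opp !Cmod_mult Cmod_R Rabs_pos_eq; [lra|exact: pos_INR].
have h1 := Rmult_le_compat_l _ _ _ (Rlt_le _ _ upos) hq.
have h2 := Rmult_le_compat_l _ _ _ (Rlt_le _ _ upos) lT.
have h3 := Rmult_le_compat_l _ _ _ (pos_INR pN) (x_ln_inv _ upos).
lra.
Qed.

Lemma W_pole y : F y = None -> Cmod (W y) <= INR pN * K.
Proof.
move=> e; rewrite /dmon_log e Cmod_opp !Cmod_mult Cmod_1 Cmod_R Rabs_pos_eq; last exact: pos_INR.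
have := hs y; rewrite sharp_pole // => h; have := Rmult_le_compat_l _ _ _ (pos_INR pN) h; lra.
Qed.

Lemma cont_disc_bounded (f : C -> C) z r : (forall y, Cdiff f y) -> exists M, forall y, Cmod (y - z) <= r -> Cmod (f y) <= M.
Proof.
move=> hf; case: (compact_uniform (fun y => Cmod (y - z) <= r) (Cmod z + r) (fun N y => Cmod (f y) <= INR N)).
- exact: cdisc_bounded.
- exact: cdisc_closed.
- move=> N N' y /le_INR; lra.
- move=> y _; case: (INR_unbounded (Cmod (f y) + 1)) => N hN; exists N.
  apply: near_mono (Cdiff_Cc _ _ (hf y) 1 Rlt_0_1) => v hv; have := Cmod_le_add (f v) (f y); lra.
- by move=> N hN; exists (INR N).
Qed.

(* Landau's device: maximise (d/2 - |x - z|)|W x|; near an almost maximal point W varies little, so it has no poles there. *)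
Lemma W_bounded : (exists y, moderate y) -> exists M, forall z, Cmod (W z) <= M.
Proof.
move=> ex; case: den_bound => M0 [M01 hM0]; case: dmon_recip_exp_bound => C1 [C10 hC1].
case: (bounded_near_moderate 2) => M [M1 hM]; have K0 := K_ge0; have rp := rho_pos.
have N0 := pos_INR pN; have NK := Rmult_le_pos _ _ N0 K0.
have lM : 0 <= ln (2 * M0) by rewrite -ln_1; apply: ln_le; lra.
(* For d >= 1 the contribution of [W_clear_bound] is at most d Q when log |H| <= C1 (1 + 2 d); 512
   is 2 (from d / 2 on the left) times 2 (from S / 2) times 128 (from the radius de / 64). *)
set Q := 2 * ln (2 * M0) + 6 * C1 + 2 * INR pN.
exists (M + 8 * (INR pN * K) + 512 * Q) => z.
case: (excluded_middle_informative (exists w, Cmod (w - z) <= 2 /\ moderate w)) => [[w [h1 h2]]|nex].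
  case: (hM z w h1 h2) => _; rewrite /Q; lra.
have hn : near z (fun y => ~ moderate y).
  by exists 2; split; [lra|move=> y hy hP; apply: nex; exists y; split=> //; rewrite /disc in hy; lra].
case: (distance_to _ z hn ex) => d [d0 [hc hP]].
have d2 : 2 <= d.
  apply: Rnot_lt_le => hlt; case: (hP (2 - d)) => [|y [h1 h2]]; first lra.
  by apply: nex; exists y; split=> //; lra.
have hW y : Cdiff W y := hol_at _ _ (W_hol y).
pose phi x := (d / 2 - Cmod (x - z)) * Cmod (W x).
pose E t := exists x, Cmod (x - z) <= d / 2 /\ t = phi x.
have zz : Cmod (z - z) = 0 by rewrite (_ : (z - z)%C = 0); [exact: Cmod_0|ring].
have phz : phi z = d / 2 * Cmod (W z) by rewrite /phi zz; ring.
case: (cont_disc_bounded W z (d / 2) hW) => B hB.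
case: (completeness E).
- exists (d / 2 * B) => t [x [hx ->]]; rewrite /phi; have := Cmod_ge_0 (x - z); have := Cmod_ge_0 (W x); have := hB x hx.
  move=> ? ? ?; apply: Rmult_le_compat; lra.
- by exists (phi z), z; split=> //; rewrite zz; lra.
move=> S [S1 S2].
have Sz : d / 2 * Cmod (W z) <= S by rewrite -phz; apply: S1; exists z; split=> //; rewrite zz; lra.
have Wz := Cmod_ge_0 (W z).
case: (Rle_lt_dec S 0) => S0.
  have : Cmod (W z) <= 0 by nra. rewrite /Q; lra.
have [x0 [hx0 px0]] : exists x, Cmod (x - z) <= d / 2 /\ S / 2 < phi x.
  apply: Classical_Prop.NNPP => hne; have : S <= S / 2; last lra.
  by apply: S2 => t [x [hx ->]]; apply: Rnot_lt_le => hlt; apply: hne; exists x.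
set de := d / 2 - Cmod (x0 - z); set M' := Cmod (W x0).
have M'0 : 0 <= M' by exact: Cmod_ge_0.
have pd : S / 2 < de * M' by exact: px0.
have de0 : 0 < de.
  have : 0 <= de by rewrite /de; lra. case=> // e; rewrite -e in pd; lra.
have ded : de <= d / 2 by rewrite /de; have := Cmod_ge_0 (x0 - z); lra.
have tri x y : Cmod (x - z) <= Cmod (x - y) + Cmod (y - z).
  have := Cmod_triangle (x - y) (y - z); by have -> : (x - y + (y - z) = x - z)%C by ring.
(* On this disc the weight is at least de / 2, while phi <= S < 2 de M'. *)
have W4 x : disc x0 (de / 2) x -> Cmod (W x) <= 4 * M'.
  move=> hx; rewrite /disc in hx; have t1 := tri x x0.
  have hr : de / 2 <= d / 2 - Cmod (x - z) by rewrite /de in hx *; lra.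
  have : phi x <= S by apply: S1; exists x; split=> //; lra.
  rewrite /phi => h; have := Cmod_ge_0 (W x) => Wx.
  apply: (Rmult_le_reg_l (de / 2)); first lra. nra.
(* A small maximum already gives the bound. Otherwise |W| exceeds its largest possible value at a
   pole, [INR pN * K], wherever it stays above 3/4 M', so F is finite there. *)
case: (Rle_lt_dec M' (4 * (INR pN * K))) => hM'.
  have : d / 2 * Cmod (W z) <= d * M' by nra. move=> h; have : Cmod (W z) <= 2 * M' by nra. rewrite /Q; lra.
(* Cauchy's estimate gives |W'| <= 16 M' / de on this disc, so W moves by at most M' / 4. *)
have near0 x : disc x0 (de / 64) x -> 3 / 4 * M' <= Cmod (W x).
  move=> hx; rewrite /disc in hx; have := mean_value_ineq W (C_derive W) x0 x (16 * M' / de).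
  have hseg t : 0 <= t <= 1 -> CD W (seg x0 x t) (C_derive W (seg x0 x t)) /\ Cmod (C_derive W (seg x0 x t)) <= 16 * M' / de.
    move=> ht; split; first exact: CD_cder.
    have hd : Cmod (seg x0 x t - x0) <= de / 64.
      rewrite /seg; have -> : (x0 + RtoC t * (x - x0) - x0 = RtoC t * (x - x0))%C by ring.
      rewrite Cmod_mult Cmod_R Rabs_pos_eq; [have := Cmod_ge_0 (x - x0); nra|lra].
    have hb y : disc (seg x0 x t) (de / 4) y -> Cmod (W y) <= 4 * M'.
      move=> hy; apply: W4; rewrite /disc in hy *; have := Cmod_triangle (y - seg x0 x t) (seg x0 x t - x0).
      have -> : (y - seg x0 x t + (seg x0 x t - x0) = y - x0)%C by ring. lra.
    have d4 : 0 < de / 4 by lra. have := cauchy_estimate W _ _ _ d4 (fun y _ => hW y) hb => h.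
    apply/Rle_div_r => //; lra.
  move/(_ hseg) => h; have h2 : 16 * M' / de * Cmod (x - x0) <= M' / 4.
    have -> : 16 * M' / de * Cmod (x - x0) = 16 * M' * (Cmod (x - x0) / de) by rewrite /Rdiv; ring.
    have : Cmod (x - x0) / de <= / 64 by apply/Rle_div_l => //; lra. nra.
  have := Cmod_triangle (W x) (- (W x - W x0)); rewrite Cmod_opp.
  have -> : (W x + - (W x - W x0) = W x0)%C by ring. rewrite -/M'; lra.
have hcs y : disc x0 (de / 64) y -> disc z d y.
  by rewrite /disc => hy; have := tri y x0; rewrite /de in hy ded de0; lra.
have hcl : clear x0 (de / 64) by move=> y /hcs; exact: hc.
have fin y : disc x0 (de / 64) y -> F y <> None by move=> hy e; have := near0 y hy; have := W_pole y e; lra.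
have d64 : 0 < de / 64 by lra.
have hi y : disc x0 (de / 64) y -> sinv F y <> None /\ Cmod (u y) < 1.
  by move=> /hcs hy; apply: (clear_inv z d) => //; rewrite /disc in hy *; lra.
have hden y : disc x0 (de / 64) y -> den y <> 0.
  move=> hy e; have [sy _] := hi y hy; have := den_dmon_recip y sy; rewrite e Cmult_0_l => /esym.
  by apply: Cpow_nz; apply: u_neq0 => //; exact: fin.
have xx := disc_center x0 _ d64; have [sx ux] := hi x0 xx.
have hn0 : near x0 (fun y => ~ moderate y) by apply: near_mono hc _; exact: near_open (hcs _ xx).
case: (distance_to _ x0 hn0 ex) => d' [d'0 [hc' hP']].
have d'2 : d' <= 2 * d.
  case: (hP (d / 2)) => [|y [h1 h2]]; first lra.
  apply: Rnot_lt_le => hlt; apply: (hc' y _ h2); rewrite /disc.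
  have := Cmod_triangle (y - z) (z - x0); have -> : (y - z + (z - x0) = y - x0)%C by ring.
  rewrite (Cmod_sym z); lra.
have hH : Cmod (H x0) <= exp (C1 * (1 + 2 * d)).
  apply: Rle_trans (hC1 x0 d' d'0 hc' hP') _; have : C1 * (1 + d') <= C1 * (1 + 2 * d) by apply: Rmult_le_compat_l; lra.
  by case=> [/exp_increasing|->]; lra.
have := W_clear_bound M0 x0 _ _ M01 hM0 d64 hcl hden (fin _ xx) hH.
have du := cder_u_bound x0 sx ux; rewrite -/M' => hfin.
have k1 : INR pN * Cmod (C_derive u x0) <= M' / 2 by have := Rmult_le_compat_l _ _ _ N0 du; lra.
have L0 : 0 <= ln (2 * M0) + C1 * (1 + 2 * d) by have := Rmult_le_pos C1 (1 + 2 * d); lra.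
have k2 : 2 * Cmod (u x0) * (ln (2 * M0) + C1 * (1 + 2 * d)) <= 2 * (ln (2 * M0) + C1 * (1 + 2 * d)) by nra.
have k3 : de / 64 * (INR pN * Cmod (C_derive u x0)) <= de / 64 * (M' / 2) by apply: Rmult_le_compat_l; lra.
have k4 : de * M' <= 128 * (2 * (ln (2 * M0) + C1 * (1 + 2 * d)) + 2 * INR pN) by lra.
have k5 : 2 * (ln (2 * M0) + C1 * (1 + 2 * d)) + 2 * INR pN <= d * Q.
  have := Rmult_le_pos (d - 1) (2 * ln (2 * M0) + 2 * INR pN) ltac:(lra) ltac:(lra).
  have := Rmult_le_pos C1 (d - 1) C10 ltac:(lra); rewrite /Q; lra.
have k6 : d / 2 * Cmod (W z) <= d / 2 * (512 * Q) by lra.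
have := Rmult_le_reg_l (d / 2) _ _ ltac:(lra) k6; lra.
Qed.


(** A nonzero derivative of u means a simple pole of F, where Sg u has order m' 0 = 0 and u^pN
    vanishes. *)
Lemma den_pole y : F y = None -> C_derive u y <> 0 -> den y <> 0.
Proof.
move=> e du; have sy : sinv F y <> None by rewrite /sinv e.
have uy := proj2 (sinv_zero _ _ sy) e; have hu := u_hol y sy.
case: (near_dichotomy _ _ hu) => [z|[[|[|s]] [v [hv [v0 ev]]]]].
- case: du; apply: CD_unique; apply: CD_ext (CD_const 0 y); by apply: near_mono z => w ->.
- by case: v0; move: (ev y); rewrite uy /= Cmult_1_l.
- case: (Sg_order u v y 0 hv v0 (near_all _ _ ev)) => k [_ [k0 ek]].
  rewrite /den (near_self _ _ ek) uy Nat.mul_0_r; case: pN_pos => j ->; rewrite Cpow_S.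
  by have -> : ((y - y) ^ 0 * k y - a * (0 * 0 ^ j) = k y)%C by rewrite /=; ring.
- case: du; apply: CD_unique; apply: (CD_ext (fun w => (w - y) ^ S (S s) * v w)%C); first by apply: near_all => w; rewrite ev.
  have dz : CD (fun w => w - y)%C y 1 by apply: CD_eq (CD_minus _ _ _ _ _ (CD_id y) (CD_const y y)) _; ring.
  apply: CD_eq (CD_mult _ _ _ _ _ (CD_pow _ _ _ (S (S s)) dz) (CD_cder _ _ (hol_at _ _ hv))) _.
  rewrite [Nat.pred _]/= !Cpow_S; ring.
Qed.

(** Where H becomes large, the translates must tend to infinity identically, by [translates_limit];
    so u and u' tend to 0 there and moderate points are far. [W_clear_bound] on the largest clear
    disc then forces |W| < |c|. *)
Lemma H_bounded (c : C) : c <> 0 -> (forall z, W z = c) -> (exists y, moderate y) -> exists M, forall z, Cmod (H z) <= M.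
Proof.
move=> c0 eW ex; apply: Classical_Prop.NNPP => hn.
have ub n : exists z, INR n < Cmod (H z).
  apply: Classical_Prop.NNPP => hn2; apply: hn; exists (INR n) => z; apply: Rnot_lt_le => h; apply: hn2; by exists z.
set zs := fun n => proj1_sig (constructive_indefinite_description _ (ub n)).
have hz n : INR n < Cmod (H (zs n)) by exact: proj2_sig (constructive_indefinite_description _ (ub n)).
case: (translates_limit zs) => phi [G [hphi [hG [hB|[M [N hM]]]]]]; last first.
  case: (INR_unbounded M) => n0 h0; case: (hM (N + n0)%nat) => [|h1 _]; first lia.
  have h2 := hz (phi (N + n0)%nat); have := le_INR _ _ (incr_ge _ hphi (N + n0)%nat).
  have : INR n0 <= INR (N + n0) by apply: le_INR; lia. lra.
case: den_bound => M0 [M01 hM0]; case: dmon_recip_exp_bound => C1 [C10 hC1].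
have K0 := K_ge0; have rp := rho_pos; have cp := proj1 (Cmod_gt_0 _) c0; have N0 := pos_INR pN.
have lM : 0 <= ln (2 * M0) by rewrite -ln_1; apply: ln_le; lra.
(* [R0], [e1] and [e2] make each of the three terms of [W_clear_bound] at most d |c| / 8. *)
set R0 := 1 + 16 * INR pN / Cmod c.
have R01 : 0 <= 16 * INR pN / Cmod c by apply: Rdiv_le_0_compat => //; lra.
case: (bounded_near_moderate R0) => M [M1 hM].
set e1 := Cmod c / (8 * (INR pN + 1)); set e2 := Cmod c / (16 * (ln (2 * M0) + 2 * C1 + 1)).
have e10 : 0 < e1 by apply: Rdiv_lt_0_compat; lra.
have e20 : 0 < e2 by apply: Rdiv_lt_0_compat; lra.
have G0 : G 0 = None by exact: near_self (hB 0).
have hl := rcv_lcv _ _ _ (scv_pole _ _ _ (hG 0) G0).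
have u0 : fv (sinv G) 0 = 0 by rewrite /fv /sinv G0.
have du0 : C_derive (fv (sinv G)) 0 = 0.
  apply: CD_unique; apply: CD_ext (CD_const 0 0); apply: near_mono (hB 0) => y e; by rewrite /fv /sinv e.
case: (lcv_eval _ _ _ _ (lcv_cder _ _ _ hl) e10) => d1 [N1 [d10 h1]].
case: (lcv_eval _ _ _ _ hl e20) => d2 [N2 [d20 h2]].
case: (INR_unbounded M) => n0 hn0; set n := (N1 + N2 + n0)%nat; set z := zs (phi n).
have z0 : (z + 1 * 0 = z)%C by ring.
have Hz : M < Cmod (H z).
  have := hz (phi n); have := le_INR _ _ (incr_ge _ hphi n); have : INR n0 <= INR n by apply: le_INR; rewrite /n; lia.
  rewrite /z; lra.
have clR : forall y, disc z R0 y -> ~ moderate y.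
  move=> y hy Py; rewrite /disc in hy; case: (hM z y) => //; lra.
have hnz : near z (fun y => ~ moderate y) by exists R0; split; [rewrite /R0; lra|].
case: (distance_to _ z hnz ex) => d [d0 [hc hP]].
have dR : R0 <= d.
  apply: Rnot_lt_le => hlt; case: (hP (R0 - d)) => [|y [k1 k2]]; first lra.
  apply: (clR y) => //; rewrite /disc; lra.
have hi y : disc z d y -> sinv F y <> None /\ Cmod (u y) < 1.
  by move=> hy; apply: (clear_inv z d) => //; rewrite /disc in hy *; lra.
have hden y : disc z d y -> den y <> 0.
  move=> hy; have [sy _] := hi y hy; case: (excluded_middle_informative (F y = None)) => [e|Fy].
    apply: den_pole => // e'; apply: c0; rewrite -(eW y) /dmon_log e e'; ring.
  move=> e; have := den_dmon_recip y sy; rewrite e Cmult_0_l => /esym; apply: Cpow_nz; exact: u_neq0.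
have zz := disc_center z d d0; have [sz uz] := hi z zz.
have Fz : F z <> None by move=> e; move: Hz; rewrite /dmon_recip e Cmod_0; lra.
have := W_clear_bound M0 z d _ M01 hM0 d0 hc hden Fz (hC1 z d d0 hc hP).
have q1 : Cmod (C_derive u z) <= e1.
  have := h1 n 0 ltac:(rewrite /n; lia) (disc_center _ _ d10); rewrite du0 sinv_resc; last exact: C1_nz.
  rewrite cder_fv_resc -/z z0; last by apply: mero_finite => //; exact: mero_sinv.
  have -> : (/ 1 * 1 * C_derive u z - 0 = C_derive u z)%C by field; exact: C1_nz. by [].
have q2 : Cmod (u z) <= e2.
  have := h2 n 0 ltac:(rewrite /n; lia) (disc_center _ _ d20); rewrite u0 sinv_resc; last exact: C1_nz.
  rewrite fv_resc -/z z0.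
  have -> : (/ 1 * u z - 0 = u z)%C by field; exact: C1_nz. by [].
have d1' : 1 <= d by rewrite /R0 in dR; lra.
have k1 : INR pN * Cmod (C_derive u z) <= Cmod c / 8.
  apply: (Rle_trans _ (INR pN * e1)); first exact: Rmult_le_compat_l.
  have -> : INR pN * e1 = Cmod c / 8 * (INR pN / (INR pN + 1)) by rewrite /e1; field; lra.
  have : INR pN / (INR pN + 1) <= 1 by apply/Rle_div_l; lra. nra.
have k2 : 2 * Cmod (u z) * (ln (2 * M0) + C1 * (1 + d)) <= d * (Cmod c / 8).
  have k : ln (2 * M0) + C1 * (1 + d) <= d * (ln (2 * M0) + 2 * C1 + 1).
    have := Rmult_le_pos _ _ lM (_ : 0 <= d - 1); have := Rmult_le_pos _ _ C10 (_ : 0 <= d - 1); lra.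
  apply: (Rle_trans _ (2 * e2 * (d * (ln (2 * M0) + 2 * C1 + 1)))).
    apply: Rmult_le_compat => //; [|have := Rmult_le_pos C1 (1 + d); lra|lra].
    have := Cmod_ge_0 (u z); lra.
  right; rewrite /e2; field; lra.
have k3 : 2 * INR pN <= d * (Cmod c / 8).
  apply: (Rle_trans _ (16 * INR pN / Cmod c * (Cmod c / 8))); first by right; field; lra.
  apply: Rmult_le_compat_r; first lra. rewrite /R0 in dR; lra.
have k4 : d * (INR pN * Cmod (C_derive u z)) <= d * (Cmod c / 8) by apply: Rmult_le_compat_l; lra.
rewrite eW; nra.
Qed.

(** Liouville makes W a constant c. If c = 0 then H' = - F H W = 0 where F is finite, and at poles
    by continuity; otherwise H is bounded and Liouville applies again. *)
Lemma H_constant : (exists y, moderate y) -> forall z w, H z = H w.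
Proof.
move=> ex; case: (W_bounded ex) => M hM.
have hc := liouville _ _ (fun z => hol_at _ _ (W_hol z)) hM; set c := W 0.
have eW z : W z = c by exact: hc.
have hH z : Cdiff H z := hol_at _ _ (H_hol z).
case: (excluded_middle_informative (c = 0)) => [c0|c0]; last first.
  case: (H_bounded c c0 eW ex) => M' hM'; exact: liouville hH hM'.
have fin z : F z <> None -> C_derive H z = 0.
  move=> n; have hr := mero_finite _ _ (hm z) n; have hg := reg_hol _ _ hr; have nn := Csub_neq0 _ _ (ha z n).
  rewrite (CD_unique _ _ _ (CD_ext _ _ _ _ (near_mono _ _ _ (fun w e => esym e) (dmon_recip_near _ _ _ hr))
    (CD_invf _ _ _ (CD_minus _ _ _ _ _ (CD_cder _ _ (hol_at _ _ (hol_dmon _ _ hg))) (CD_const a z)) nn))).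
  have := eW z; rewrite dmon_log_fin // cder_dmon // c0 => e.
  have -> : (- (fv F z * dmon_dquo (fv F) z - 0) / ((dmon (fv F) z - a) * (dmon (fv F) z - a)) =
     - fv F z * ((1 * dmon_dquo (fv F) z - 0 * dmon_quo (fv F) z) * / (dmon (fv F) z - a)) / (dmon (fv F) z - a))%C by field.
  rewrite e; by field.
have dH z : C_derive H z = 0.
  case: (excluded_middle_informative (F z = None)) => [e|]; last exact: fin.
  case: (pole_form (fun _ => a) F z (hm z) e (hol_cst a z) (nb z)) => s [v [H1 [_ [_ [_ [_ [_ [_ hp]]]]]]]].
  apply: (Cc_eq_at _ (fun _ => RtoC 0) z (Cdiff_Cc _ _ (hol_at _ _ (hol_cder _ _ (H_hol z)))) (CD_Cc _ _ _ (CD_const 0 z))).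
  by apply: near_mono hp => y hy /hy [hf _]; exact: fin.
exact: cder_zero_const hH dH.
Qed.

(** H is nonzero at a moderate point, so as a constant it has no zeros and F no poles; P[F] is the
    constant a + 1 / H, the case q = 0 of [dmon_monomial_trivial]. *)
Lemma omitted_moderate : (exists y, moderate y) -> forall z, sharp F z = 0.
Proof.
move=> ex; have hc := H_constant ex; case: ex => y [Fy _].
have k0 : H y <> 0 by rewrite dmon_recip_fin //; apply: Cinv_neq0; apply: Csub_neq0; exact: ha.
have fz z : F z <> None by move=> e; apply: k0; rewrite (hc y z) /dmon_recip e.
apply: (dmon_monomial_trivial (a + / H y) 0 F K hl0 hm hs) => z; apply: near_all => w; split=> //.
rewrite (hc y w) dmon_recip_fin // Cinv_inv; last by apply: Csub_neq0; exact: ha.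
rewrite /=; ring.
Qed.

End OmittedValue.

Lemma infinite_near_sharp F z : infinite_near F z -> sharp F z = 0.
Proof.
move=> h; rewrite sharp_pole; last exact: near_self h.
rewrite (CD_unique _ _ 0) ?Cmod_0 //; apply: CD_ext (CD_const 0 z).
by apply: near_mono h => y e; rewrite /fv /sinv e.
Qed.

(** What remains is a function without moderate points, whose inverse is entire and bounded. *)
Lemma omitted_value_trivial (a : C) F K : a <> 0 -> (forall z, mero F z) -> (forall z, sharp F z <= K) ->
  (forall z, F z <> None -> dmon (fv F) z <> a) -> forall z, sharp F z = 0.
Proof.
move=> a0 hm hs ha.
case: (trichotomy (fun _ => a) F (fun _ => True) connected_all) => [z _|h|h].
- by split; [exact: hm|exact: hol_cst].
- by move=> z; apply: infinite_near_sharp; exact: h.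
have nb z : ~ infinite_near F z.
  case: h => h; last by apply: (dmon_differs_not_infinite_near (fun _ => a)); exact: h.
  by move=> /near_self e; have [] := near_self _ _ (h z I).
case: (excluded_middle_informative (exists y, moderate F y)) => [ex|nex].
  exact: (omitted_moderate a F K a0 hm hs ha nb ex).
have hi z : sinv F z <> None /\ Cmod (fv (sinv F) z) <= 1.
  case: (excluded_middle_informative (F z = None)) => [e|n].
    by rewrite /fv /sinv e /= Cmod_0; split=> //; lra.
  have h1 : 2 < Cmod (fv F z) by apply: Rnot_le_lt => hle; apply: nex; exists z.
  have n0 : fv F z <> 0 by apply/Cmod_gt_0; lra.
  have sn := sinv_some _ _ n n0; split=> //; have [_ ->] := fv_sinv _ _ n sn.
  by rewrite Cmod_inv // -Rinv_1; apply: Rinv_le_contravar; lra.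
have hd z : Cdiff (fv (sinv F)) z.
  by apply: hol_at; apply: reg_hol; apply: mero_finite; [exact: mero_sinv|case: (hi z)].
have hc := liouville _ _ hd (fun z => proj2 (hi z)) => z.
rewrite -(sharp_sinv F z (hm z)) sharp_fin; last by case: (hi z).
rewrite (CD_unique _ _ 0); first by rewrite Cmod_0; rewrite /Rdiv Rmult_0_l.
apply: (CD_ext (fun _ => fv (sinv F) z)); last exact: CD_const. by apply: near_all => y; exact: hc.
Qed.

(** * Zalcman's lemma *)

Lemma sharp_locally_bounded F z : mero F z -> exists M, near z (fun y => sharp F y <= M).
Proof.
have reg_case G : reg G z -> exists M, near z (fun y => sharp G y <= M).
  move=> hr; exists (Cmod (C_derive (fv G) z) + 1).
  have hc := Cdiff_Cc _ _ (hol_at _ _ (hol_cder _ _ (reg_hol _ _ hr))) 1 Rlt_0_1.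
  apply: near2 hr hc => y [n _] h; rewrite sharp_fin //; apply/Rle_div_l; first exact: one_sq_pos.
  have := Cmod_le_add (C_derive (fv G) y) (C_derive (fv G) z); have := Cmod_ge_0 (C_derive (fv G) z).
  have := pow2_ge_0 (Cmod (fv G y)); nra.
move=> hm; case: (hm) => h; first exact: reg_case.
case: (reg_case _ h) => M hM; exists M; apply: near2 hM (mero_near _ _ hm) => y; by move=> h1 h2; rewrite -sharp_sinv.
Qed.

(* The function t^(- be) F (w + t^L y) with t = 2^(- j): integer exponents avoid real powers. *)
Definition zoom (be L j : nat) (w : C) (F : sphere_fun) : sphere_fun :=
  resc (RtoC (2 ^ (j * be))) w (RtoC (/ 2 ^ (j * L))) F.

Lemma two_pow_pos j : 0 < 2 ^ j.
Proof. apply: pow_lt; lra. Qed.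

Lemma two_pow_ge1 j : 1 <= 2 ^ j.
Proof. apply: pow_R1_Rle; lra. Qed.

Lemma Cmod_pos x : 0 <= x -> Cmod (RtoC x) = x.
Proof. by move=> h; rewrite Cmod_R Rabs_pos_eq. Qed.

Lemma two_pow_neq0 j : RtoC (2 ^ j) <> 0.
Proof. move/RtoC_inj; have := two_pow_pos j; lra. Qed.

Lemma resc_resc c w s c' w' s' F : resc c' w' s' (resc c w s F) = resc (c' * c) (w + s * w') (s * s') F.
Proof.
apply: FunctionalExtensionality.functional_extensionality => y; rewrite /resc.
have -> : (w + s * (w' + s' * y) = w + s * w' + s * s' * y)%C by ring.
by case: (F _) => [v|] //; rewrite Cmult_assoc.
Qed.

(** Recentring at the point represented by y and zooming once more is a rescaling by 2^be in the
    values and 2^-L in the variable, so [sharp_resc] applies with M = 2^be. *)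
Lemma zoom_succ be L j w F (y : C) : mero F (w + RtoC (/ 2 ^ (j * L)) * y)%C ->
  / 2 ^ (L + be) * sharp (zoom be L j w F) y <= sharp (zoom be L (S j) (w + RtoC (/ 2 ^ (j * L)) * y) F) 0 /\
  sharp (zoom be L (S j) (w + RtoC (/ 2 ^ (j * L)) * y) F) 0 <= 2 ^ be / 2 ^ L * sharp (zoom be L j w F) y.
Proof.
move=> hm; set s := RtoC (/ 2 ^ (j * L)).
have -> : zoom be L (S j) (w + s * y)%C F = resc (RtoC (2 ^ be)) y (RtoC (/ 2 ^ L)) (zoom be L j w F).
  rewrite /zoom resc_resc -RtoC_mult -pow_add -/s.
  by have -> : (s * RtoC (/ 2 ^ L))%C = RtoC (/ 2 ^ (S j * L)) by rewrite /s -RtoC_mult -Rinv_mult -pow_add Nat.add_comm.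
have := two_pow_pos be => pb; have := two_pow_pos L => pL; have b1 := two_pow_ge1 be.
have iL := Rinv_0_lt_compat _ pL.
have e0 : (y + RtoC (/ 2 ^ L) * 0 = y)%C by ring.
case: (sharp_resc (RtoC (2 ^ be)) y (RtoC (/ 2 ^ L)) (zoom be L j w F) 0 (2 ^ be) b1).
- rewrite Cmod_pos; last lra. split; last lra.
  have : / 2 ^ be <= / 1 by apply: Rinv_le_contravar; lra. rewrite Rinv_1; lra.
- rewrite e0; apply: mero_resc => //; exact: two_pow_neq0.
rewrite e0 Cmod_pos; last lra. rewrite pow_add Rinv_mult => h1 h2; split; first by [].
by have -> : 2 ^ be / 2 ^ L = / 2 ^ L * 2 ^ be by rewrite /Rdiv; ring.
Qed.

Lemma zoom0 be L w F : mero F w -> sharp (zoom be L 0 w F) 0 = sharp F w.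
Proof.
move=> hm; have e0 : (w + RtoC (/ 2 ^ (0 * L)) * 0 = w)%C by ring.
case: (sharp_resc (RtoC (2 ^ (0 * be))) w (RtoC (/ 2 ^ (0 * L))) F 0 1 (Rle_refl 1)).
- by rewrite /= Cmod_1; lra.
- by rewrite e0.
rewrite e0 Cmod_pos; last by rewrite /=; lra. rewrite /zoom /=; lra.
Qed.

Lemma zoom_decay be L j d w F : (be < L)%nat -> mero F w ->
  sharp (zoom be L (d + j) w F) 0 <= / 2 ^ d * sharp (zoom be L j w F) 0.
Proof.
move=> hb hm; elim: d => [|d IH]; first by rewrite /= Rinv_1; lra.
have e0 : (w + RtoC (/ 2 ^ ((d + j) * L)) * 0 = w)%C by ring.
have := zoom_succ be L (d + j) w F 0; rewrite e0 => /(_ hm) [_ h2].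
have h0 := sharp_ge0 (zoom be L (d + j) w F) 0.
have q : 2 ^ be / 2 ^ L <= / 2.
  apply/Rle_div_l; first exact: two_pow_pos.
  have -> : L = (be + 1 + (L - be - 1))%nat by lia. rewrite !pow_add.
  have := two_pow_ge1 (L - be - 1); have := two_pow_pos be; nra.
have -> : / 2 ^ S d = / 2 * / 2 ^ d by rewrite /= Rinv_mult. rewrite Nat.add_succ_l; nra.
Qed.

Lemma zoom_bounds be L j w F : (be < L)%nat -> mero F w ->
  / 2 ^ (j * (L + be)) * sharp F w <= sharp (zoom be L j w F) 0 <= / 2 ^ j * sharp F w.
Proof.
move=> hb hm; split; last by have := zoom_decay be L 0 j w F hb hm; rewrite Nat.add_0_r zoom0.
elim: j => [|j IH]; first by rewrite zoom0 //= Rinv_1; lra.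
have e0 : (w + RtoC (/ 2 ^ (j * L)) * 0 = w)%C by ring.
have := zoom_succ be L j w F 0; rewrite e0 => /(_ hm) [h1 _].
have p1 := Rinv_0_lt_compat _ (two_pow_pos (L + be)).
have -> : (S j * (L + be) = (L + be) + j * (L + be))%nat by lia. rewrite pow_add Rinv_mult.
apply: Rle_trans h1; rewrite Rmult_assoc; apply: Rmult_le_compat_l; lra.
Qed.

(** If the conclusion fails, each zoom with derivative at least 1 at its centre has a point with
    derivative above 2^(L + be), which is still at least 1 after one more zoom recentred there. The
    centres converge, and along them the spherical derivative of F itself is at least 2^j:
    impossible at a point where F is meromorphic. *)
Lemma zoom_point be L F z j0 A : (be < L)%nat -> 0 <= A ->
  (forall y, Cmod (y - z) <= 4 * (A / 2 ^ (j0 * L)) -> mero F y) -> 2 ^ (j0 * (L + be)) <= sharp F z ->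
  exists j w, (j0 <= j)%nat /\ Cmod (w - z) <= 2 * (A / 2 ^ (j0 * L)) /\ 1 <= sharp (zoom be L j w F) 0 /\
    forall y, Cmod y <= A -> sharp (zoom be L j w F) y <= 2 ^ (L + be).
Proof.
move=> hb A0 hm hz; set c := A / 2 ^ (j0 * L).
have c0 : 0 <= c by apply: Rdiv_le_0_compat => //; exact: two_pow_pos.
have zz : Cmod (z - z) = 0 by rewrite (_ : (z - z)%C = 0); [exact: Cmod_0|ring].
apply: Classical_Prop.NNPP => hne.
(* 2 c - 2 c / 2^j is the sum of the displacements c / 2^i for i < j. *)
pose Bad j w := Cmod (w - z) <= 2 * c - 2 * c / 2 ^ j /\ 1 <= sharp (zoom be L (j0 + j) w F) 0.
case: (nested_limit Bad c z c0) => [j w [h1 h2]||l [hl1 hl2]].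
- have pj := two_pow_pos j; have cj : 0 <= 2 * c / 2 ^ j by apply: Rdiv_le_0_compat; lra.
  have [y [hy1 hy2]] : exists y, Cmod y <= A /\ 2 ^ (L + be) < sharp (zoom be L (j0 + j) w F) y.
    apply: Classical_Prop.NNPP => hn2; apply: hne; exists (j0 + j)%nat, w; split; first lia.
    split; first lra. split=> // y hy; apply: Rnot_lt_le => hlt; apply: hn2; by exists y.
  set s := RtoC (/ 2 ^ ((j0 + j) * L)); set w' := (w + s * y)%C.
  have hd : Cmod (w' - w) <= c / 2 ^ j.
    rewrite /w'; have -> : (w + s * y - w = s * y)%C by ring. rewrite Cmod_mult /s Cmod_pos; last by left; apply: Rinv_0_lt_compat; exact: two_pow_pos.
    apply: (Rle_trans _ (/ 2 ^ ((j0 + j) * L) * A)).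
      by apply: Rmult_le_compat_l => //; left; apply: Rinv_0_lt_compat; exact: two_pow_pos.
    rewrite Nat.mul_add_distr_r pow_add Rinv_mult /c /Rdiv.
    have -> : / 2 ^ (j0 * L) * / 2 ^ (j * L) * A = A * / 2 ^ (j0 * L) * / 2 ^ (j * L) by ring.
    apply: Rmult_le_compat_l; first exact: c0. apply: Rinv_le_contravar => //; apply: Rle_pow; [lra|nia].
  have e : 2 * c / 2 ^ S j = c / 2 ^ j by rewrite /=; field; lra.
  have hw' : Cmod (w' - z) <= 2 * c - 2 * c / 2 ^ S j.
    have := Cmod_triangle (w' - w) (w - z); have -> : (w' - w + (w - z) = w' - z)%C by ring. rewrite e.
    have e2 : 2 * c / 2 ^ j = 2 * (c / 2 ^ j) by rewrite /Rdiv; ring.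
    rewrite e2 in h1; lra.
  exists w'; split=> //; split=> //.
  have hmw : mero F w'.
    by apply: hm; have : 0 <= 2 * c / 2 ^ S j by [rewrite e; apply: Rdiv_le_0_compat]; rewrite -/c; lra.
  case: (zoom_succ be L (j0 + j) w F y hmw) => g1 _; rewrite Nat.add_succ_r.
  apply: Rle_trans g1; have p := two_pow_pos (L + be).
  have := Rmult_le_compat_l _ _ _ (Rlt_le _ _ (Rinv_0_lt_compat _ p)) (Rlt_le _ _ hy2); rewrite Rinv_l; lra.
- split; first by rewrite zz /=; lra. rewrite Nat.add_0_r.
  case: (zoom_bounds be L j0 z F hb) => [|h1 _]; first by apply: hm; rewrite zz -/c; lra.
  apply: Rle_trans h1; have p := two_pow_pos (j0 * (L + be)).
  have := Rmult_le_compat_l _ _ _ (Rlt_le _ _ (Rinv_0_lt_compat _ p)) hz; rewrite Rinv_l; lra.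
- case: (sharp_locally_bounded F l (hm l hl1)) => M [d [d0 hd]].
  have hj : exists j, 4 * c / 2 ^ j < d /\ M < 2 ^ j.
    case: (INR_unbounded (4 * c / d + Rabs M)) => j hj; exists j.
    have : INR j <= 2 ^ j.
      elim: j {hj} => [|j IH]; first by rewrite /=; lra.
      by rewrite S_INR /=; have := two_pow_ge1 j; lra.
    have := Rabs_pos M; have := Rle_abs M; have q : 0 <= 4 * c / d by apply: Rdiv_le_0_compat; lra.
    move=> ? ? ?; split; last lra. have pj := two_pow_pos j; apply/Rlt_div_l => //.
    have : 4 * c / d < 2 ^ j by lra. move/(Rlt_div_l _ _ _ d0); lra.
  case: hj => j [hj1 hj2]; case: (hl2 j) => w [[hw1 hw2] hw3].
  have pj := two_pow_pos j; have cj : 0 <= 2 * c / 2 ^ j by apply: Rdiv_le_0_compat; lra.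
  have hmw : mero F w by apply: hm; rewrite -/c; lra.
  case: (zoom_bounds be L (j0 + j) w F hb hmw) => _ h2.
  have h3 := hd w (_ : disc l d w); have {}h3 : sharp F w <= M by apply: h3; rewrite /disc Cmod_sym; lra.
  have : 2 ^ j <= M; last lra.
  have p2 := two_pow_pos (j0 + j); apply: Rle_trans h3.
  have : 2 ^ (j0 + j) <= sharp F w.
    have := Rmult_le_compat_l _ _ _ (Rlt_le _ _ p2) (Rle_trans _ _ _ hw2 h2); rewrite -Rmult_assoc Rinv_r; lra.
  apply: Rle_trans; apply: Rle_pow; [lra|lia].
Qed.

Lemma INR_pow2_small eps : 0 < eps -> exists N, forall n, (N <= n)%nat -> INR n / 2 ^ n <= eps.
Proof.
move=> e0; have lin n : INR n + 1 <= 2 ^ n.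
  by elim: n => [|n IH]; [rewrite /=; lra|rewrite S_INR [2 ^ _]/=; have := two_pow_ge1 n; lra].
have sq n : INR n * INR n <= 4 * 2 ^ n.
  by elim: n => [|n IH]; [rewrite /=; lra|rewrite S_INR [2 ^ _]/=; have := lin n; have := pos_INR n; lra].
case: (INR_unbounded (4 / eps)) => N hN; exists (S N) => n hn.
have := le_INR _ _ hn; rewrite S_INR => hn'; have p := two_pow_pos n.
have q : 0 < 4 / eps by apply: Rdiv_lt_0_compat; lra.
have n0 : 0 < INR n by lra. have h : 4 < INR n * eps by apply/Rlt_div_l => //; lra.
apply/Rle_div_l => //; have := sq n; nra.
Qed.

(** Stage k applies [zoom_point] with window radius k and starting level k, at a point near p with
    derivative at least 2^(k (L + be)). The windows exhaust C and carry a uniform bound, so Marty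
    yields the limit; the lower bound at 0 survives. *)
Lemma zalcman be L (fs : nat -> sphere_fun) p r n0 : (be < L)%nat -> 0 < r ->
  (forall n y, (n0 <= n)%nat -> disc p r y -> mero (fs n) y) ->
  (forall M eps N, 0 < eps -> exists n z, (N <= n)%nat /\ Cmod (z - p) < eps /\ M <= sharp (fs n) z) ->
  exists (i j : nat -> nat) (w : nat -> C) G, (forall k, (k + n0 <= i k)%nat) /\ (forall k, (k <= j k)%nat) /\ Ccv w p /\
    (forall k, 1 <= sharp (zoom be L (j k) (w k) (fs (i k))) 0) /\
    (forall y, scv (fun k => zoom be L (j k) (w k) (fs (i k))) G y) /\ (forall y, sharp G y <= 2 ^ (L + be)) /\ 1 <= sharp G 0.
Proof.
move=> hb r0 hm hbad; have r8 : 0 < r / 8 by lra.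
case: (INR_pow2_small (r / 8) r8) => N0 hN0.
have small k : (N0 <= k)%nat -> INR k / 2 ^ (k * L) <= INR k / 2 ^ k.
  move=> _; apply: Rmult_le_compat_l; first exact: pos_INR.
  apply: Rinv_le_contravar; first exact: two_pow_pos. apply: Rle_pow; [lra|nia].
pose good k (x : nat * nat * C) := (k + n0 <= fst (fst x))%nat /\ (k <= snd (fst x))%nat /\
  Cmod (snd x - p) < 2 * (INR k / 2 ^ k) + Rmin (r / 8) (/ (INR k + 1)) /\ 1 <= sharp (zoom be L (snd (fst x)) (snd x) (fs (fst (fst x)))) 0 /\
  forall y, Cmod y <= INR k -> sharp (zoom be L (snd (fst x)) (snd x) (fs (fst (fst x)))) y <= 2 ^ (L + be).
have ex k : exists x, (N0 <= k)%nat -> good k x.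
  case: (Compare_dec.le_lt_dec N0 k) => hk; last by exists (O, O, RtoC 0); lia.
  have ik : 0 < / (INR k + 1) by apply: Rinv_0_lt_compat; have := pos_INR k; lra.
  case: (hbad (2 ^ (k * (L + be))) (Rmin (r / 8) (/ (INR k + 1))) (k + n0)%nat) => [|n [z [hn [hz hsh]]]]; first exact: Rmin_pos.
  have s1 := small k hk; have s2 := hN0 k hk; have m1 := Rmin_l (r / 8) (/ (INR k + 1)).
  case: (zoom_point be L (fs n) z k (INR k) hb (pos_INR k)) => // [y hy|j [w [h1 [h2 [h3 h4]]]]].
    apply: hm; first lia. rewrite /disc; have := Cmod_triangle (y - z) (z - p).
    have -> : (y - z + (z - p) = y - p)%C by ring. lra.
  exists (n, j, w) => _; split=> //; split=> //; split; last by split.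
  have := Cmod_triangle (w - z) (z - p); have -> : (w - z + (z - p) = w - p)%C by ring. rewrite [snd _]/=; lra.
set x := fun k => proj1_sig (constructive_indefinite_description _ (ex (N0 + k)%nat)).
have hx k : good (N0 + k)%nat (x k).
  by apply: (proj2_sig (constructive_indefinite_description _ (ex (N0 + k)%nat))); lia.
set i := fun k => fst (fst (x k)); set j := fun k => snd (fst (x k)); set w := fun k => snd (x k).
have hw : Ccv w p.
  move=> eps e0; have e3 : 0 < eps / 3 by lra.
  case: (INR_pow2_small _ e3) => N1 h1; case: (INR_unbounded (/ (eps / 3))) => N2 h2.
  exists (N1 + N2)%nat => n hn; case: (hx n) => _ [_ [h _]].
  have a1 := h1 (N0 + n)%nat ltac:(lia); have a2 := Rmin_r (r / 8) (/ (INR (N0 + n) + 1)).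
  have : / (INR (N0 + n) + 1) <= eps / 3.
    rewrite -[X in _ <= X]Rinv_inv; apply: Rinv_le_contravar; first exact: Rinv_0_lt_compat.
    have : INR N2 <= INR (N0 + n) by apply: le_INR; lia. lra.
  rewrite /w; lra.
have hwr k : Cmod (w k - p) < r / 2.
  case: (hx k) => _ [_ [h _]]; have := hN0 (N0 + k)%nat ltac:(lia); have := Rmin_l (r / 8) (/ (INR (N0 + k) + 1)); rewrite /w; lra.
have zm k y : Cmod y <= INR k -> mero (zoom be L (j k) (w k) (fs (i k))) y.
  move=> hy; apply: mero_resc; first exact: two_pow_neq0.
  apply: hm; first by case: (hx k); rewrite /i; lia.
  rewrite /disc; have -> : (w k + RtoC (/ 2 ^ (j k * L)) * y - p = (w k - p) + RtoC (/ 2 ^ (j k * L)) * y)%C by ring.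
  apply: Rle_lt_trans (Cmod_triangle _ _) _; rewrite Cmod_mult Cmod_pos; last by left; apply: Rinv_0_lt_compat; exact: two_pow_pos.
  case: (hx k) => _ [hj _]; have s1 := small (N0 + k)%nat ltac:(lia); have s2 := hN0 (N0 + k)%nat ltac:(lia).
  have : / 2 ^ (j k * L) * Cmod y <= INR (N0 + k) / 2 ^ ((N0 + k) * L).
    rewrite /Rdiv Rmult_comm; apply: Rmult_le_compat; [exact: Cmod_ge_0|left; apply: Rinv_0_lt_compat; exact: two_pow_pos| |].
      by apply: Rle_trans hy _; apply: le_INR; lia.
    apply: Rinv_le_contravar; first exact: two_pow_pos. apply: Rle_pow; [lra|rewrite /j; nia].
  have := hwr k; lra.
have zs k y : Cmod y <= INR k -> sharp (zoom be L (j k) (w k) (fs (i k))) y <= 2 ^ (L + be).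
  move=> hy; case: (hx k) => _ [_ [_ [_]]]; apply; apply: Rle_trans hy _; apply: le_INR; lia.
have loc z : exists r N, 0 < r /\ forall n y, (N <= n)%nat -> disc z r y -> Cmod y <= INR n.
  case: (INR_unbounded (Cmod z + 1)) => N hN; exists 1, N; split; first lra.
  move=> n y /le_INR hn hy; rewrite /disc in hy; have := Cmod_le_add z y; rewrite Cmod_sym in hy; have := Cmod_triangle z (y - z).
  have -> : (z + (y - z) = y)%C by ring. rewrite (Cmod_sym y) ; lra.
case: (marty (fun k => zoom be L (j k) (w k) (fs (i k))) (fun _ => True)) => [z _|phi [G [hphi hG]]].
  case: (loc z) => s [N [s0 hs]]; exists s, N, (2 ^ (L + be)); split=> // n y hn hy; split; [apply: zm|apply: zs]; exact: hs n y hn hy.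
have gi := incr_ge _ hphi.
have ev z : exists r N, 0 < r /\ forall n y, (N <= n)%nat -> disc z r y -> mero (zoom be L (j (phi n)) (w (phi n)) (fs (i (phi n)))) y.
  case: (loc z) => s [N [s0 hs]]; exists s, N; split=> // n y hn hy; apply: zm; apply: (hs (phi n)) => //; have := gi n; lia.
exists (fun k => i (phi k)), (fun k => j (phi k)), (fun k => w (phi k)), G.
split; first by move=> k; case: (hx (phi k)); have := gi k; rewrite /i; lia.
split; first by move=> k; case: (hx (phi k)) => _ []; have := gi k; rewrite /j; lia.
split.
  move=> eps e0; case: (hw eps e0) => N hN; exists N => n hn; apply: hN; have := gi n; lia.
split; first by move=> k; case: (hx (phi k)) => _ [_ [_ [h1 _]]].
split; first by move=> y; exact: hG.
split.
  move=> y; apply: (scv_sharp_le _ _ _ _ (hG y I) (ev y)).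
  case: (loc y) => s [N [s0 hs]]; exists N => n hn; apply: zs; apply: (hs (phi n)); [have := gi n; lia|exact: disc_center].
have h := scv_sharp _ _ _ _ (hG 0 I) (Ccv_cst 0) (ev 0).
have : Rbar_le 1 (sharp G 0); last by [].
apply: (is_lim_seq_le_loc (fun _ => 1) _ 1 (sharp G 0) _ (is_lim_seq_const 1) h).
by exists O => n _; case: (hx (phi n)) => _ [_ [_ [h1 _]]].
Qed.

(** The reciprocals of P[fs n] - ks n are holomorphic near z and bounded off z, hence bounded at z
    by [lbd_fill]; so the limit of the differences cannot vanish at z. *)
Lemma hurwitz_omit (fs : nat -> sphere_fun) (ks : nat -> C -> C) G k z R N : 0 < R ->
  (forall y, disc z R y -> scv fs G y /\ lcv ks k y) ->
  (forall n y, (N <= n)%nat -> disc z R y -> fs n y <> None -> dmon (fv (fs n)) y <> ks n y) ->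
  dmon_differs k G z -> G z <> None -> dmon (fv G) z <> k z.
Proof.
move=> R0 hc ha [_ [_ hG]] Gz e; have zz := disc_center z R R0.
have [hs hk] := hc z zz; have hr := scv_finite _ _ _ hs Gz.
case: (rcv_eventually _ _ _ hr) => r [N1 [r0 h1]]; case: (hk) => r' [r'0 [[N2 h2] _]].
set s := Rmin R (Rmin r r'); have s0 : 0 < s by apply: Rmin_pos => //; exact: Rmin_pos.
have m1 : s <= R by exact: Rmin_l. have m2 : s <= r by exact: Rle_trans (Rmin_r _ _) (Rmin_l _ _).
have m3 : s <= r' by exact: Rle_trans (Rmin_r _ _) (Rmin_r _ _).
have hD (y : C) : scv fs G y -> lcv ks k y -> G y <> None -> lcv (fun n v => dmon (fv (fs n)) v - ks n v)%C (fun v => dmon (fv G) v - k v)%C y.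
  by move=> a1 a2 a3; exact: lcv_minus _ _ _ _ _ (lcv_dmon _ _ _ (rcv_lcv _ _ _ (scv_finite _ _ _ a1 a3))) a2.
have : lbd (fun n y => Cmod (/ (dmon (fv (fs n)) y - ks n y))) z.
  apply: (lbd_fill (fun n y => / (dmon (fv (fs n)) y - ks n y))%C z s (N + N1 + N2) s0).
  - move=> n hn y hy; rewrite /disc in hy.
    have hy1 : disc z r y by rewrite /disc; lra. have hy2 : disc z r' y by rewrite /disc; lra.
    have hf : hol (fv (fs n)) y.
      by apply: near_mono (near_open _ _ _ hy1) => v hv; case: (h1 n v ltac:(lia) hv).
    apply: Cdiff_inv; last by apply: Csub_neq0; apply: ha; [lia|rewrite /disc; lra|case: (h1 n y ltac:(lia) hy1)].
    apply: Cdiff_minus; [exact: hol_at _ _ (hol_dmon _ _ hf)|apply: h2 => //; lia].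
  - apply: near2 hG (near_disc z R R0) => y hy1 hyd ny; case: (hy1 ny) => Gy Py; case: (hc y hyd) => a1 a2.
    exact: lcv_lbd _ _ _ (lcv_inv _ _ _ (hD y a1 a2 Gy) (Csub_neq0 _ _ Py)).
case/lbd_elim => d [N3 [M [d0 hM]]].
have hz := lcv_eval_seq _ _ _ _ (hD z hs hk Gz) (Ccv_cst z).
have M0 : 0 < Rabs M + 1 by have := Rabs_pos M; lra.
have i0 : 0 < / (2 * (Rabs M + 1)) by apply: Rinv_0_lt_compat; lra.
case: (hz _ i0) => N4 h4; set n := (N + N1 + N2 + N3 + N4)%nat.
have := h4 n ltac:(rewrite /n; lia); rewrite e; have -> : (k z - k z)%C = 0 by ring.
set D := (dmon (fv (fs n)) z - ks n z)%C; have -> : (D - 0 = D)%C by ring. move=> hDn.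
have D0 : D <> 0.
  apply: Csub_neq0; apply: ha => //; first by rewrite /n; lia. by case: (h1 n z ltac:(rewrite /n; lia) (disc_center _ _ r0)).
have := hM n z ltac:(rewrite /n; lia) (disc_center _ _ d0); rewrite -/D Cmod_inv // => hi.
have Dp := proj1 (Cmod_gt_0 _) D0.
have : 2 * (Rabs M + 1) <= / Cmod D.
  by rewrite -[X in X <= _]Rinv_inv; exact: Rinv_le_contravar.
have := Rle_abs M; lra.
Qed.

Lemma zoom_arg_disc L p (j : nat -> nat) w y d : (0 < L)%nat -> (forall k, (k <= j k)%nat) -> Ccv w p -> 0 < d ->
  exists N, forall k z, (N <= k)%nat -> disc y 1 z -> disc p d (w k + RtoC (/ 2 ^ (j k * L)) * z)%C.
Proof.
move=> L0 hj hw d0.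
case: (hw _ (_ : 0 < d / 4)) => [|N1 h1]; first lra.
case: (INR_pow2_small (d / 4)) => [|N2 h2]; first lra. case: (INR_unbounded (Cmod y + 1)) => N3 h3.
exists (N1 + N2 + N3)%nat => k z hk hz; rewrite /disc.
have -> : (w k + RtoC (/ 2 ^ (j k * L)) * z - p = (w k - p) + RtoC (/ 2 ^ (j k * L)) * z)%C by ring.
apply: Rle_lt_trans (Cmod_triangle _ _) _; rewrite Cmod_mult Cmod_pos; last by left; apply: Rinv_0_lt_compat; exact: two_pow_pos.
have a1 := h1 k ltac:(lia); have a2 := h2 k ltac:(lia).
have : / 2 ^ (j k * L) * Cmod z <= INR k / 2 ^ k; last lra.
rewrite /Rdiv Rmult_comm; apply: Rmult_le_compat; [exact: Cmod_ge_0|left; apply: Rinv_0_lt_compat; exact: two_pow_pos| |].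
  have : INR N3 <= INR k by apply: le_INR; lia. rewrite /disc in hz; have := Cmod_triangle y (z - y).
  have -> : (y + (z - y) = z)%C by ring. lra.
apply: Rinv_le_contravar; first exact: two_pow_pos. apply: Rle_pow; [lra|have := hj k; nia].
Qed.

Lemma lcv_zoom_arg be L hs h p (i j : nat -> nat) w y : (be < L)%nat -> lcv hs h p -> (forall k, (k <= i k)%nat) -> (forall k, (k <= j k)%nat) -> Ccv w p ->
  lcv (fun k z => hs (i k) (w k + RtoC (/ 2 ^ (j k * L)) * z)%C) (fun _ => h p) y.
Proof.
move=> hb hl hi hj hw; have [r [r0 [[N hN] _]]] := hl.
have loc := fun d => zoom_arg_disc L p j w y d (Nat.le_lt_trans _ _ _ (Nat.le_0_l be) hb) hj hw.
exists 1; split; first lra. split.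
  case: (loc r r0) => N' h'; exists (N + N')%nat => k hk z hz.
  have := hN (i k) ltac:(have := hi k; lia) _ (h' k z ltac:(lia) hz) => hd.
  exact: CD_Cdiff (CD_affine _ _ _ _ _ (CD_cder _ _ hd)).
move=> eps e0; case: (lcv_eval _ _ _ _ hl e0) => d [N1 [d0 h1]]; case: (loc d d0) => N' h'.
exists (N1 + N')%nat => k z hk hz; apply: h1; [have := hi k; lia|apply: h' => //; lia].
Qed.

(** The exponent [summ ps] in [be] cancels the derivatives; what remains is s^-be' for the scale s =
    2^-(j dL). *)
Lemma zoom_factor be' j : (RtoC (2 ^ (j * (summ ps + be'))) ^ dL * RtoC (/ 2 ^ (j * dL)) ^ summ ps = RtoC (2 ^ (j * dL * be')))%C.
Proof.
rewrite -!RtoC_pow -RtoC_mult; congr RtoC.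
rewrite pow_inv -!pow_mult; apply: (Rmult_eq_reg_r (2 ^ (j * dL * summ ps))); last by have := two_pow_pos (j * dL * summ ps); lra.
rewrite Rmult_assoc Rinv_l; last by have := two_pow_pos (j * dL * summ ps); lra.
rewrite -pow_add Rmult_1_r; congr pow; ring.
Qed.

(** With be = [summ ps] zooming leaves P unchanged, so a Zalcman limit omits the nonzero constant h0
    p and is trivial by [omitted_value_trivial], against [sharp] at least 1 at 0. *)
Lemma omit_limit_bounded (fs : nat -> sphere_fun) (hs : nat -> C -> C) (h0 : C -> C) p r n0 : 0 < r -> h0 p <> 0 -> lcv hs h0 p ->
  (forall n y, (n0 <= n)%nat -> disc p r y -> mero (fs n) y /\ (fs n y <> None -> dmon (fv (fs n)) y <> hs n y)) ->
  exists M eps N, 0 < eps /\ forall n z, (N <= n)%nat -> Cmod (z - p) < eps -> sharp (fs n) z < M.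
Proof.
move=> r0; set a := h0 p => a0 hl hf; apply: Classical_Prop.NNPP => hn.
have hb : (summ ps < dL)%nat by rewrite /dL; lia.
case: (zalcman (summ ps) dL fs p r n0 hb r0) => [n y hn0 hy|M eps N e0|i [j [w [G [hi0 [hj [hw [_ [hG [hK h1]]]]]]]]]].
- by case: (hf n y hn0 hy).
- apply: Classical_Prop.NNPP => hn2; apply: hn; exists M, eps, N; split=> // n z h1 h2.
  by apply: Rnot_le_lt => hle; apply: hn2; exists n, z.
have gm y : mero G y by exact: scv_mero (hG y).
have hi k : (k <= i k)%nat by have := hi0 k; lia.
have hlk y := lcv_zoom_arg (summ ps) dL hs h0 p i j w y hb hl hi hj hw.
have loc y : exists N, forall k z, (N <= k)%nat -> disc y 1 z -> disc p r (w k + RtoC (/ 2 ^ (j k * dL)) * z)%C.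
  by apply: zoom_arg_disc => //; rewrite /dL; lia.
have om y : dmon_differs (fun _ => a) G y -> G y <> None -> dmon (fv G) y <> a.
  case: (loc y) => N hN; apply: (hurwitz_omit _ _ G (fun _ => a) y 1 N Rlt_0_1 (fun z _ => conj (hG z) (hlk z))).
  move=> n z hn' hz fz; have hd := hN n z hn' hz; have [hm ho] := hf (i n) _ ltac:(have := hi0 n; lia) hd.
  have fz' := proj1 (resc_fin _ _ _ _ _) fz; rewrite fv_resc dmon_affine; last by apply: reg_hol; exact: mero_finite.
  have := zoom_factor 0 (j n); rewrite !Nat.add_0_r Nat.mul_0_r => ->; rewrite Cmult_1_l; exact: ho.
case: (trichotomy (fun _ => a) G (fun _ => True) connected_all) => [z _|h|[h|h]].
- by split; [exact: gm|exact: hol_cst].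
- have := infinite_near_sharp _ _ (h 0 I); lra.
- apply: (monomial_not_dmon_agrees a 0 G _ a0 hl0 gm hK) => z.
  have -> : (fun z : C => a * z ^ 0)%C = fun _ => a; last exact: h.
  by apply: FunctionalExtensionality.functional_extensionality => y /=; ring.
- have := omitted_value_trivial a G _ a0 gm hK (fun z => om z (h z I)) 0; lra.
Qed.

(** * An omitted monomial *)

Lemma pow_bracket b x : 2 <= b -> 1 <= x -> exists j, b ^ j <= x < b ^ S j.
Proof.
move=> hb hx; have [n hn] : exists n, x < b ^ n.
  case: (INR_unbounded x) => n hn; exists n; apply: Rlt_le_trans hn _.
  elim: n => [|n IH]; first by rewrite /=; lra.
  rewrite S_INR [b ^ _]/=; have : 1 <= b ^ n by apply: pow_R1_Rle; lra. nra.
elim: n hn => [|n IH] hn; first by rewrite /= in hn; lra.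
case: (Rlt_le_dec x (b ^ n)) => h; [exact: IH|by exists n].
Qed.

Lemma RtoC_inv_pos x : 0 < x -> RtoC (/ x) = (/ RtoC x)%C.
Proof. by move=> h; apply: RtoC_inv; apply: Rgt_not_eq. Qed.

Section OmittedMonomial.
Context (a : C) (q : nat) (F : sphere_fun) (K : R) (a0 : a <> 0) (hq : (q < l0)%nat) (hm : forall z, mero F z)
  (hs : forall z, sharp F z <= K).

Definition mono (z : C) : C := (a * z ^ q)%C.
Local Notation U := (dmon_log (fun z => z) (fun _ => RtoC (INR q)) mono F).

Context (ha : forall z : C, z <> 0 -> F z <> None -> dmon (fv F) z <> mono z) (nb : forall z, ~ infinite_near F z).

Lemma hol_mono z : hol mono z.
Proof. rewrite /mono; hl. Qed.

Lemma mono_neq0 (z : C) : z <> 0 -> mono z <> 0.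
Proof. by move=> z0; apply: Cmul_neq0 => //; exact: Cpow_nz. Qed.

Lemma CD_mono z : CD mono z (a * (RtoC (INR q) * z ^ Nat.pred q)).
Proof. by apply: CD_eq (CD_scal a _ _ _ (CD_pow _ _ _ q (CD_id z))) _; ring. Qed.

Lemma mono_euler z : (z * C_derive mono z = RtoC (INR q) * mono z)%C.
Proof.
rewrite (CD_unique _ _ _ (CD_mono z)) /mono; case: (q) => [|j]; first by rewrite /=; ring.
rewrite [Nat.pred _]/= Cpow_S; ring.
Qed.

Lemma avoids_off z : F z = None \/ z <> 0 -> avoids mono F z.
Proof.
move=> hz; case: (excluded_middle_informative (z = 0)) => [e|n]; last by apply: near_mono (near_neq z 0 n) => y ny; exact: ha.
case: hz => // e2; case: (pole_form mono F z (hm z) e2 (hol_mono z) (nb z)) => s [v [H1 [_ [_ [_ [_ [_ [_ hp]]]]]]]].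
apply: near_mono hp => y hy Fy; case: (excluded_middle_informative (y = z)) => [ey|/hy [] //].
by case: Fy; rewrite ey.
Qed.

Lemma U_hol_off z : F z = None \/ z <> 0 -> hol U z.
Proof.
move=> hz; apply: dmon_log_hol; [exact: hm|exact: hol_mono|exact: hol_id|exact: hol_cst| |exact: nb|exact: avoids_off].
by apply: near_all => y; exact: mono_euler.
Qed.

(** Only 0 can be singular, and only if F 0 is finite. If F 0 = 0, P[F] vanishes to order at least
    [eN] > q and y^q cancels between numerator and denominator. If not, with P[F] - mono = y^m v,
    the function is (m - q + y v' / v) / F. *)
Lemma U_extends : exists V, hol V 0 /\ near 0 (fun y => y <> 0 -> U y = V y).
Proof.
case: (excluded_middle_informative (F 0 = None)) => [e|n].
  by exists U; split; [apply: U_hol_off; left|apply: near_all].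
have hr := mero_finite _ _ (hm 0) n; have hg := reg_hol _ _ hr; set g := fv F in hg *.
have hF : near 0 (fun y => F y <> None) by apply: near_mono hr => y [].
case: (excluded_middle_informative (g 0 = 0)) => [g0|g0].
- pose g1 := dquot g 0; have hg1 : hol g1 0 by apply: near_mono hg => y hy; exact: (dquot_hol g 0 (reg_hol _ _ hr)).
  have eg y : g y = (y * g1 y)%C by rewrite (dquot_eq g 0 y) g0 -/g1; ring.
  have hQ := hol_Qpr (fun l => RtoC (INR l)) ps g 0 hg; rewrite -/Qg in hQ.
  have e1 := eN_ge; have [e ee] : exists e, eN = S (S e) by exists (eN - 2)%nat; lia.
  pose B y := (RtoC (INR eN) * g1 y ^ e * C_derive g y * Qg g y + y * g1 y ^ S e * C_derive (Qg g) y - RtoC (INR q) * g1 y ^ S e * Qg g y)%C.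
  pose D y := (y ^ (eN - q) * g1 y ^ eN * Qg g y - a)%C.
  have hB : hol B 0 by rewrite /B; hl. have hD : hol D 0 by rewrite /D; hl.
  have D0 : D 0 <> 0.
    rewrite /D (_ : (eN - q)%nat = S (eN - q - 1)); last lia. rewrite Cpow_S.
    have -> : (0 * 0 ^ (eN - q - 1) * g1 0 ^ eN * Qg g 0 - a = - a)%C by ring.
    by move=> e2; apply: a0; rewrite (_ : a = (- (- a))%C); [rewrite e2; ring|ring].
  exists (fun y => y ^ (eN - 1 - q) * B y * / D y)%C; split; first by hl; exact: hol_inv.
  have Dn := Cc_neq _ _ _ (Cdiff_Cc _ _ (hol_at _ _ hD)) D0.
  apply: near2 (near_and _ _ _ hF Dn) (near_and _ _ _ (hol_near _ _ hg) (dmon_pow g 0 hg)) => y [Fy Dy] [hy Py] ny.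
  have yq := Cpow_nz _ q ny; rewrite dmon_log_fin // -/g Py.
  have eD : (g y ^ eN * Qg g y - mono y = y ^ q * D y)%C.
    rewrite /D /mono eg Cpow_mult_l {1}(_ : eN = q + (eN - q))%nat; last lia. rewrite Cpow_add_r; ring.
  have eB : (y * dmon_dquo g y - RtoC (INR q) * dmon_quo g y = y ^ (eN - 1) * B y)%C.
    rewrite /dmon_dquo /dmon_quo /B ee (_ : S (S e) - 2 = e)%nat; last lia. rewrite (_ : S (S e) - 1 = S e)%nat; last lia.
    move: (C_derive g y) (Qg g y) (C_derive (Qg g) y) (eg y); move: (g y) (g1 y) => b b1 d Qy Qd ->.
    rewrite !Cpow_mult_l !Cpow_S; ring.
  rewrite eD eB {1}(_ : (eN - 1 = q + (eN - 1 - q))%nat); last lia. rewrite Cpow_add_r; field; by split.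
- have hE : hol (fun y => dmon g y - mono y)%C 0 by apply: hol_minus; [exact: hol_dmon|exact: hol_mono].
  case: (near_dichotomy _ _ hE) => [z|[m [v [hv [v0 ev]]]]].
    exfalso; case: (near_and _ _ _ z hF) => r [r0 h]; case: (exists_punct 0 r r0) => y [/h [h1 h2] ny].
    apply: (ha y ny h2); have -> : dmon (fv F) y = (dmon g y - mono y + mono y)%C by rewrite -/g; ring. rewrite h1; ring.
  have vn := Cc_neq _ _ _ (Cdiff_Cc _ _ (hol_at _ _ hv)) v0; have gn := Cc_neq _ _ _ (Cdiff_Cc _ _ (hol_at _ _ hg)) g0.
  exists (fun y => / g y * (RtoC (INR m) - RtoC (INR q) + y * C_derive v y * / v y))%C; split.
    by apply: hol_mult; [exact: hol_inv|hl; exact: hol_inv].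
  apply: near2 (near_and _ _ _ hF vn) (near_and _ _ _ gn (near_and _ _ _ (hol_near _ _ hg) hv)) => y [Fy vy] [gy [hy dv]] ny.
  rewrite dmon_log_fin // -/g ev.
  have dE : C_derive (fun y => dmon g y - mono y)%C y = (g y * dmon_dquo g y - C_derive mono y)%C.
    rewrite -cder_dmon //; apply: CD_unique; apply: CD_minus; apply: CD_cder; first exact: hol_at _ _ (hol_dmon _ _ hy).
    exact: CD_Cdiff (CD_mono y).
  have dE2 : (y * C_derive (fun y => dmon g y - mono y)%C y = RtoC (INR m) * y ^ m * v y + y * (y ^ m * C_derive v y))%C.
    have -> : C_derive (fun y => dmon g y - mono y)%C y = (RtoC (INR m) * y ^ Nat.pred m * v y + y ^ m * C_derive v y)%C.
      apply: CD_unique; apply: (CD_ext (fun y => y ^ m * v y)%C).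
        by apply: near_all => w; rewrite ev (_ : (w - 0)%C = w) //; ring.
      by apply: CD_eq (CD_mult _ _ _ _ _ (CD_pow _ _ _ m (CD_id y)) (CD_cder _ _ dv)) _; ring.
    case: (m) => [|j]; first by rewrite /=; ring. rewrite [Nat.pred _]/= !Cpow_S; ring.
  have y0 : (y - 0 = y)%C by ring. have ym := Cpow_nz _ m ny.
  have e1 : (g y * (y * dmon_dquo g y - RtoC (INR q) * dmon_quo g y) = y ^ m * (RtoC (INR m) * v y + y * C_derive v y - RtoC (INR q) * v y))%C.
    have -> : (g y * (y * dmon_dquo g y - RtoC (INR q) * dmon_quo g y) = y * (g y * dmon_dquo g y - C_derive mono y) + y * C_derive mono y - RtoC (INR q) * (g y * dmon_quo g y))%C by ring.
    rewrite -dE dE2 mono_euler -dmon_dmon_quo // (_ : dmon g y = dmon g y - mono y + mono y)%C; last by ring.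
    rewrite ev y0; ring.
  rewrite y0 (_ : (y * dmon_dquo g y - RtoC (INR q) * dmon_quo g y)%C = (/ g y * (g y * (y * dmon_dquo g y - RtoC (INR q) * dmon_quo g y)))%C); last by field.
  rewrite e1; field; by repeat split.
Qed.

Definition small_on_circles : Prop := forall eps R0, 0 < eps -> exists r, R0 < r /\ forall x, 0 <= x <= 2 * PI -> Cmod (U (RtoC r * cis x)) <= eps.

Lemma U_vanishes : small_on_circles -> forall z : C, z <> 0 -> U z = 0.
Proof.
move=> hsm; case: U_extends => V [hV eV].
pose U1 (z : C) := if excluded_middle_informative (z = 0) then V 0 else U z.
have eU (z : C) : z <> 0 -> U1 z = U z by rewrite /U1; destruct (excluded_middle_informative (z = 0)).
have hU z : Cdiff U1 z.
  apply: hol_at; case: (excluded_middle_informative (z = 0)) => [->|n].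
    apply: hol_ext hV; apply: near_mono eV => y hy; rewrite /U1.
    destruct (excluded_middle_informative (y = 0)) as [->|ny] => //; by rewrite hy.
  apply: (hol_ext U); last by apply: U_hol_off; right.
  by apply: near_mono (near_neq z 0 n) => y ny; rewrite eU.
move=> z z0; rewrite -eU //; apply: Cmod_eq_0; apply: Rle_antisym; last exact: Cmod_ge_0.
apply: Rnot_lt_le => hlt; have e2 : 0 < Cmod (U1 z) / 2 by lra.
case: (hsm _ (Cmod z) e2) => r [hr hx]; have zp := Cmod_ge_0 z.
have := max_principle U1 0 (r + 1) r (Cmod (U1 z) / 2) z (fun y _ => hU y) ltac:(lra).
have h1 x : 0 <= x <= 2 * PI -> Cmod (U1 (0 + RtoC r * cis x)%C) <= Cmod (U1 z) / 2.
  move=> hx01; rewrite Cplus_0_l eU; first exact: hx.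
  by apply: Cmul_neq0; [move/RtoC_inj; lra|exact: cis_neq0].
move/(_ h1); have h2 : disc 0 r z by rewrite /disc (_ : (z - 0)%C = z); [|ring].
move/(_ h2); lra.
Qed.

(** By [dmon_log_resc] a bound M on the unit circle for the rescaled function means |U| <= c M on
    the circle of radius s; here s grows and c tends to 0. *)
Lemma resc_circles (s c : nat -> R) (hh : nat -> C -> C) :
  (forall n, 0 < s n) -> (forall n, 0 < c n) ->
  (forall n z, hh n z = (RtoC (c n) ^ dL * RtoC (s n) ^ summ ps * mono (0 + RtoC (s n) * z))%C) ->
  (forall R0, exists N, forall n, (N <= n)%nat -> R0 < s n) -> (forall eps, 0 < eps -> exists N, forall n, (N <= n)%nat -> c n <= eps) ->
  (forall z : C, z <> 0 -> lbd (fun n y => Cmod (dmon_log (fun z => z) (fun _ => RtoC (INR q)) (hh n) (resc (RtoC (c n)) 0 (RtoC (s n)) F) y)) z) ->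
  small_on_circles.
Proof.
move=> s0 c0 eh hsi hc hb eps R0 e0.
case: (circle_uniform (fun n y => Cmod (dmon_log (fun z => z) (fun _ => RtoC (INR q)) (hh n) (resc (RtoC (c n)) 0 (RtoC (s n)) F) y)) 0 1) => [x _|M hM].
  by case: (hb (0 + RtoC 1 * cis x)%C) => [|d [d0 hd]]; [rewrite Cplus_0_l Cmult_1_l; exact: cis_neq0|exists d].
have M1 : 0 < Rabs M + 1 by have := Rabs_pos M; lra.
case: (hsi R0) => N1 h1; case: (hc (eps / (Rabs M + 1))) => [|N2 h2]; first exact: Rdiv_lt_0_compat.
case: (INR_unbounded M) => N3 h3; set n := (N1 + N2 + N3)%nat.
exists (s n); split; first by apply: h1; rewrite /n; lia.
have c1 := c0 n; have s1 := s0 n; have cn : RtoC (c n) <> 0 by move/RtoC_inj; lra.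
have sn : RtoC (s n) <> 0 by move/RtoC_inj; lra.
move=> x hx; have n3 : M <= INR n by have : INR N3 <= INR n by [apply: le_INR; rewrite /n; lia]; lra.
have := hM n x n3 hx; rewrite Cplus_0_l Cmult_1_l.
have zn : (0 + RtoC (s n) * cis x)%C <> 0 by rewrite Cplus_0_l; apply: Cmul_neq0 => //; exact: cis_neq0.
rewrite (dmon_log_resc _ 0 _ _ (fun z => z) _ (fun _ => RtoC (INR q)) _ mono) //; [|exact: ha|ring].
rewrite Cplus_0_l Cmod_mult Cmod_inv // Cmod_pos; last lra. move=> h.
have h4 : Cmod (U (RtoC (s n) * cis x)) <= c n * M.
  have := Rmult_le_compat_l _ _ _ (Rlt_le _ _ c1) h; rewrite -Rmult_assoc Rinv_r; lra.
have := h2 n ltac:(rewrite /n; lia) => /(Rle_div_r _ _ _ M1) h5.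
have := Rle_abs M => h6; have := Rmult_le_compat_l _ _ _ (Rlt_le _ _ c1) h6; lra.
Qed.

(* Case F bounded along a sequence tending to infinity: the rescaled functions subconverge off 0 to a function with a zero. *)
Lemma circles_bounded M : 0 < M -> (forall R0, exists z, R0 <= Cmod z /\ F z <> None /\ Cmod (fv F z) <= M) -> small_on_circles.
Proof.
move=> M0 hz; have L0 : (0 < dL)%nat by rewrite /dL; lia.
have b2 : 2 <= 2 ^ dL by rewrite -{1}(pow_1 2); apply: Rle_pow; [lra|lia].
have ch n : exists x : C * nat, (2 ^ dL) ^ n <= Cmod (fst x) /\ (F (fst x) <> None /\ Cmod (fv F (fst x)) <= M) /\
    (2 ^ dL) ^ (snd x) <= Cmod (fst x) < (2 ^ dL) ^ S (snd x).
  case: (hz ((2 ^ dL) ^ n)) => z [h1 h2]; case: (pow_bracket (2 ^ dL) (Cmod z)) => //.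
    by apply: Rle_trans h1; apply: pow_R1_Rle; lra.
  by move=> j hj; exists (z, j).
set x := fun n => proj1_sig (constructive_indefinite_description _ (ch n)).
set z := fun n => fst (x n); set j := fun n => snd (x n).
have hx n : (2 ^ dL) ^ n <= Cmod (z n) /\ (F (z n) <> None /\ Cmod (fv F (z n)) <= M) /\ (2 ^ dL) ^ (j n) <= Cmod (z n) < (2 ^ dL) ^ S (j n).
  exact: proj2_sig (constructive_indefinite_description _ (ch n)).
have hj n : (n <= j n)%nat.
  case: (hx n) => h1 [_ [_ h2]]; have h3 := Rle_lt_trans _ _ _ h1 h2.
  case: (Compare_dec.le_lt_dec n (j n)) => // hle; have := Rle_pow (2 ^ dL) _ _ ltac:(lra) hle; lra.
(* The condition is c^dL s^(m' + q) = 1, which makes the rescaled function omit the same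
   monomial. *)
pose s n := 2 ^ (j n * dL); pose c n := / 2 ^ (j n * (summ ps + q)).
have s0 n : 0 < s n by exact: two_pow_pos.
have c0 n : 0 < c n by apply: Rinv_0_lt_compat; exact: two_pow_pos.
have es n : (2 ^ dL) ^ (j n) = s n by rewrite -pow_mult Nat.mul_comm.
have fac n y : mono y = (RtoC (c n) ^ dL * RtoC (s n) ^ summ ps * mono (0 + RtoC (s n) * y))%C.
  rewrite Cplus_0_l /mono Cpow_mult_l -!RtoC_pow.
  have e : c n ^ dL * s n ^ summ ps * s n ^ q = 1.
    rewrite Rmult_assoc -pow_add /c /s pow_inv -!pow_mult.
    rewrite (_ : (j n * (summ ps + q) * dL = j n * dL * (summ ps + q))%nat); last ring.
    apply: Rinv_l; have := two_pow_pos (j n * dL * (summ ps + q)); lra.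
  have -> : (RtoC (c n ^ dL) * RtoC (s n ^ summ ps) * (a * (RtoC (s n ^ q) * y ^ q)) = RtoC (c n ^ dL * s n ^ summ ps * s n ^ q) * (a * y ^ q))%C by rewrite !RtoC_mult; ring.
  rewrite e; ring.
have cn n : RtoC (c n) <> 0 by move/RtoC_inj; have := c0 n; lra.
have sn n : RtoC (s n) <> 0 by move/RtoC_inj; have := s0 n; lra.
have cle n : c n <= / 2 ^ n.
  by apply: Rinv_le_contravar; [exact: two_pow_pos|apply: Rle_pow; [lra|have := hj n; nia]].
pose fs n := resc (RtoC (c n)) 0 (RtoC (s n)) F.
have fm n y : mero (fs n) y by exact: mero_resc.
have fo n (y : C) : y <> 0 -> fs n y <> None -> dmon (fv (fs n)) y <> mono y.
  move=> y0 fy; have fy' := proj1 (resc_fin _ _ _ _ _) fy; rewrite fv_resc dmon_affine; last by apply: reg_hol; exact: mero_finite.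
  have ny : (0 + RtoC (s n) * y)%C <> 0 by rewrite Cplus_0_l; exact: Cmul_neq0.
  rewrite (fac n y) => e; apply: (ha _ ny fy'); move: e; set k := (RtoC (c n) ^ dL * RtoC (s n) ^ summ ps)%C.
  have k0 : k <> 0 by apply: Cmul_neq0; exact: Cpow_nz.
  move=> e; have -> : dmon (fv F) (0 + RtoC (s n) * y) = (k * dmon (fv F) (0 + RtoC (s n) * y) / k)%C by field.
  rewrite e; by field.
have off (p : C) : p <> 0 -> 0 < Cmod p /\ forall y, disc p (Cmod p) y -> y <> 0.
  move=> p0; split; first exact/Cmod_gt_0. move=> y hy e; move: hy; rewrite /disc e Cmod_sym (_ : (p - 0)%C = p); [lra|ring].
case: (marty fs Cstar) => [p p0|phi [G [hphi hG]]].
  have [pp hp] := off p p0; case: (omit_limit_bounded fs (fun _ => mono) mono p (Cmod p) 0 pp (mono_neq0 p p0) (lcv_cst _ _ (hol_mono p))) => [n y _ /hp y0|M' [eps [N [e0 hN]]]].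
    by split; [exact: fm|exact: fo].
  by exists eps, N, M'; split=> // n y hn hy; split=> //; left; exact: hN.
have gi := incr_ge _ hphi.
pose p n := (z (phi n) / RtoC (s (phi n)))%C.
have ep n : (0 + RtoC (s (phi n)) * p n = z (phi n))%C by rewrite /p; field.
have hp n : 1 <= Cmod (p n) <= 2 ^ dL.
  case: (hx (phi n)) => _ [_ [h1 h2]]; rewrite /p Cmod_div // Cmod_pos; last by left.
  rewrite es in h1; have -> : 2 ^ dL = (2 ^ dL) ^ S (j (phi n)) / s (phi n) by rewrite [_ ^ S _]/= es; field; apply: Rgt_not_eq; exact: s0.
  by have s1 := s0 (phi n); split; [apply/Rle_div_r; lra|apply: Rmult_le_compat_r; [left; exact: Rinv_0_lt_compat|lra]].
case: (bolzano_weierstrass p (2 ^ dL)) => [n|psi [l [hpsi hl]]]; first by case: (hp n).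
have l0' : l <> 0.
  move=> e; case: (hl (/ 2)) => [|N hN]; first lra.
  have := hN N (Nat.le_refl N); rewrite e (_ : (p (psi N) - 0)%C = p (psi N)); last ring. case: (hp (psi N)); lra.
have hGl := scv_subseq _ _ _ _ hpsi (hG l l0').
have val n : fs (phi (psi n)) (p (psi n)) <> None /\ Cmod (fv (fs (phi (psi n))) (p (psi n))) <= M / 2 ^ n.
  case: (hx (phi (psi n))) => _ [[h1 h2] _]; split; first by apply/resc_fin; rewrite ep.
  rewrite fv_resc ep Cmod_mult Cmod_pos; last by left.
  have h3 := cle (phi (psi n)); have h4 : / 2 ^ (phi (psi n)) <= / 2 ^ n.
    apply: Rinv_le_contravar; first exact: two_pow_pos. apply: Rle_pow; first lra.
    have := gi (psi n); have := incr_ge _ hpsi n; lia.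
  rewrite /Rdiv Rmult_comm; apply: Rmult_le_compat => //; [exact: Cmod_ge_0|left; exact: c0|lra].
have Gl : G l <> None.
  apply: (scv_bounded _ _ _ _ M hGl hl M0) => n; case: (val n) => h1 h2; split=> //; apply: Rle_trans h2 _.
  apply/Rle_div_l; first exact: two_pow_pos. have := two_pow_ge1 n; nra.
(* |F| <= M at the chosen points and c tends to 0. This zero excludes both an infinite limit and
   P[G] = mono, since mono l is not 0. *)
have g0 : fv G l = 0.
  apply: Cmod_eq_0; apply: Rle_antisym; last exact: Cmod_ge_0.
  apply: Rnot_lt_le => hlt; have : Cmod (fv G l) <= Cmod (fv G l) / 2; last lra.
  apply: (Ccv_Cmod _ _ _ (lcv_eval_seq _ _ _ _ (rcv_lcv _ _ _ (scv_finite _ _ _ hGl Gl)) hl)).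
  case: (INR_unbounded (M / (Cmod (fv G l) / 2))) => N hN; exists N => n hn; case: (val n) => _ h; apply: Rle_trans h _.
  have e2 : 0 < Cmod (fv G l) / 2 by lra. have := le_INR _ _ hn => hn'.
  apply/Rle_div_l; first exact: two_pow_pos. have : M / (Cmod (fv G l) / 2) < 2 ^ n.
    apply: Rlt_le_trans hN _; apply: Rle_trans hn' _; elim: (n) => [|i IH]; first by rewrite /=; lra.
    rewrite S_INR [2 ^ _]/=; have := two_pow_ge1 i; lra.
  move/(Rlt_div_l _ _ _ e2); lra.
have hGG : forall y, Cstar y -> dmon_differs mono G y.
  case: (trichotomy mono G Cstar connected_Cstar) => [y y0|h|[h|//]].
  - by split; [exact: scv_mero (hG y y0)|exact: hol_mono].
  - by case: Gl; exact: near_self (h l l0').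
  - case: (near_self _ _ (h l l0')) => _; rewrite dmon_dmon_quo; last by apply: reg_hol; apply: mero_finite => //; exact: scv_mero (hG l l0').
    by rewrite g0 Cmult_0_l => /esym /(mono_neq0 l l0').
apply: (resc_circles (fun n => s (phi n)) (fun n => c (phi n)) (fun _ => mono)) => //.
- move=> R0; case: (INR_unbounded R0) => N hN; exists N => n hn; apply: Rlt_le_trans hN _.
  apply: (Rle_trans _ (INR n)); first exact: le_INR. apply: (Rle_trans _ (2 ^ n)).
    elim: (n) => [|i IH]; first by rewrite /=; lra.
    rewrite S_INR [2 ^ _]/=; have := two_pow_ge1 i; lra.
  by apply: Rle_pow; [lra|have := hj (phi n); have := gi n; nia].
- move=> eps e0; case: (INR_pow2_small eps e0) => N hN; exists (S N) => n hn.
  have h1 := cle (phi n); have h2 := hN n ltac:(lia); have : / 2 ^ phi n <= / 2 ^ n.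
    by apply: Rinv_le_contravar; [exact: two_pow_pos|apply: Rle_pow; [lra|exact: gi]].
  have : 1 * / 2 ^ n <= INR n / 2 ^ n; last lra.
  apply: Rmult_le_compat_r; first by left; apply: Rinv_0_lt_compat; exact: two_pow_pos.
  have := le_INR 1 n ltac:(lia); rewrite /=; lra.
- move=> y y0; have [yp hy] := off y y0.
  case: (dmon_recip_dmon_log_lbd (fun z => z) (fun _ => RtoC (INR q)) mono (fun n => fs (phi n)) G y (Cmod y) 0 yp _ (hGG y y0)) => [w /hy w0|n w _ /hy w0|_ //].
    split; first exact: hG. split; first exact: hol_mono. split; first exact: hol_id. split; first exact: hol_cst.
    exact: mono_euler.
  split; first exact: fm. split; last by apply: near_mono (near_neq w 0 w0) => v v0; exact: fo.
  move=> hB; apply: (nb (RtoC (s (phi n)) * w)%C); have e : (0 + RtoC (/ s (phi n)) * (RtoC (s (phi n)) * w) = w)%C.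
    rewrite RtoC_inv_pos //; by field.
  rewrite -e in hB; apply: near_mono (near_affine _ _ _ _ hB) => v; rewrite /fs /resc.
  rewrite RtoC_inv_pos // (_ : (0 + RtoC (s (phi n)) * (0 + / RtoC (s (phi n)) * v) = v)%C); last by field.
 
  by case: (F v).
Qed.


Lemma rcv_of_lcv fs G z : lcv (fun n => fv (fs n)) (fv G) z -> (forall y, G y <> None) ->
  (exists r N, 0 < r /\ forall n y, (N <= n)%nat -> disc z r y -> fs n y <> None) -> rcv fs G z.
Proof.
move=> [r1 [r10 [[N1 h1] h2]]] hG [r [N [r0 h]]]; exists (Rmin r1 r); split; first exact: Rmin_pos.
have m1 := Rmin_l r1 r; have m2 := Rmin_r r1 r.
split; first by exists (N + N1)%nat => n y hn hy; split; [apply: h; [lia|rewrite /disc in hy *; lra]|apply: h1; [lia|rewrite /disc in hy *; lra]].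
split; first by move=> y _; exact: hG.
move=> eps e0; case: (h2 eps e0) => N2 h3; exists N2 => n y hn hy; apply: h3 => //; rewrite /disc in hy *; lra.
Qed.

Lemma lcv_constants (b : nat -> C) l z : Ccv b l -> lcv (fun n _ => b n) (fun _ => l) z.
Proof.
move=> hb; exists 1; split; first lra. split; first by exists O => n _ y _; exact: CD_Cdiff (CD_const (b n) y).
by move=> eps e0; case: (hb eps e0) => N hN; exists N => n y hn _; exact: hN.
Qed.

(** Close to 0 this is the exact order statement [dmon_zero_order]; homogeneity of a power carries
    it to every nonzero z. *)
Lemma dmon_power_neq0 (b : C) m (z : C) : b <> 0 -> z <> 0 -> dmon (fun y => b * y ^ S m)%C z <> 0.
Proof.
move=> b0 z0; set g := fun y => _.
case: (dmon_zero_order g (fun _ => b) 0 m (hol_cst b 0) b0) => [|k [hk [k0 ek]]].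
  by apply: near_all => y; rewrite /g (_ : (y - 0)%C = y); ring.
have kn := Cc_neq _ _ _ (Cdiff_Cc _ _ (hol_at _ _ hk)) k0.
case: (near_and _ _ _ ek kn) => r [r0 hr]; have zp := proj1 (Cmod_gt_0 _) z0.
set t := r / (2 * Cmod z); have t0 : 0 < t by apply: Rdiv_lt_0_compat; lra.
have tn : RtoC t <> 0 by move/RtoC_inj; lra.
have eg : g = (fun y => RtoC (/ t) ^ S m * g (0 + RtoC t * y))%C.
  apply: FunctionalExtensionality.functional_extensionality => y; rewrite /g Cplus_0_l Cpow_mult_l RtoC_inv_pos // Cpow_inv //.
  have := Cpow_nz _ (S m) tn => h; by field.
have hg : hol g (0 + RtoC t * z)%C by rewrite /g; hl.
rewrite eg dmon_affine //; have tz : (0 + RtoC t * z)%C <> 0 by rewrite Cplus_0_l; exact: Cmul_neq0.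
case: (hr (0 + RtoC t * z)%C) => [|-> kz].
  rewrite /disc (_ : (0 + RtoC t * z - 0 = RtoC t * z)%C); last ring.
  rewrite Cmod_mult Cmod_pos; last lra. have -> : t * Cmod z = r / 2 by rewrite /t; field; lra. lra.
apply: Cmul_neq0; first by apply: Cmul_neq0; apply: Cpow_nz => //; apply: Cpow_nz; rewrite RtoC_inv_pos //; exact: Cinv_neq0.
by apply: Cmul_neq0 => //; apply: Cpow_nz; exact: Csub_neq0.
Qed.

(* Case F -> infinity at infinity: then F has a pole of some order there and the rescaled functions converge to b z^n. *)
Lemma circles_unbounded : (forall M, 0 < M -> exists R0, forall z, R0 <= Cmod z -> F z = None \/ M < Cmod (fv F z)) -> small_on_circles.
Proof.
move=> hinf; set u := fv (sinv F).
have hu M : 0 < M -> exists R0, 0 < R0 /\ forall z, R0 <= Cmod z -> sinv F z <> None /\ Cmod (u z) <= / M.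
  move=> M0; have iM := Rinv_0_lt_compat _ M0; case: (hinf M M0) => R0 h; exists (Rabs R0 + 1); split; first by have := Rabs_pos R0; lra.
  move=> z hz; have := Rle_abs R0 => h1; case: (h z ltac:(lra)) => [e|h2].
    by rewrite /u /fv /sinv e /= Cmod_0; split=> //; lra.
  case: (excluded_middle_informative (F z = None)) => [e|n]; first by rewrite /u /fv /sinv e /= Cmod_0; split=> //; lra.
  have n0 : fv F z <> 0 by apply/Cmod_gt_0; lra.
  have sn := sinv_some _ _ n n0; split=> //; rewrite /u; have [_ ->] := fv_sinv _ _ n sn.
  by rewrite Cmod_inv //; apply: Rinv_le_contravar; lra.
case: (hu 1 Rlt_0_1) => R1 [R10 hR1]; have iR := Rinv_0_lt_compat _ R10.
have hinv (w : C) Q : 0 < Q -> disc 0 (/ Q) w -> w <> 0 -> Q <= Cmod (/ w).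
  move=> Q0 hw w0; have wp := proj1 (Cmod_gt_0 _) w0; rewrite Cmod_inv //; rewrite /disc (_ : (w - 0)%C = w) in hw; last ring.
  rewrite -(Rinv_inv Q); apply: Rinv_le_contravar => //; lra.
(* The inverse of F, read in the coordinate w = 1 / z at infinity. *)
case: (removable (fun w => u (/ w)%C) 0 (/ R1) (/ 1) iR) => [w hw w0|g1 [hg1 eg1]].
  case: (hR1 (/ w)%C (hinv w R1 R10 hw w0)) => h1 h2; split=> //.
  have hd : Cdiff u (/ w)%C by apply: hol_at; apply: reg_hol; apply: mero_finite => //; exact: mero_sinv.
  exact: CD_Cdiff (CD_comp _ _ _ _ _ (CD_cder _ _ hd) (CD_inv w w0)).
have hol1 : hol g1 0 by exact: (holD_near_at 0 (/ R1) g1 0 hg1 (disc_center _ _ iR)).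
have g10 : g1 0 = 0.
  apply: Cmod_eq_0; apply: Rle_antisym; last exact: Cmod_ge_0. apply: Rnot_lt_le => hlt.
  have e2 : 0 < Cmod (g1 0) / 2 by lra. have ie := Rinv_0_lt_compat _ e2.
  case: (hu _ ie) => Q [Q0 hQ]; have iQ := Rinv_0_lt_compat _ Q0.
  case: (near_and _ _ _ (Cdiff_Cc _ _ (hol_at _ _ hol1) _ e2) (near_disc 0 (/ Q) iQ)) => r [r0 hr].
  case: (exists_punct 0 r r0) => w [/hr [h1 h2] w0]; case: (hQ (/ w)%C (hinv w Q Q0 h2 w0)) => _; rewrite -eg1 // Rinv_inv => h3.
  have := Cmod_le_add (g1 0) (g1 w); rewrite Cmod_sym; lra.
have fin1 (w : C) : disc 0 (/ R1) w -> w <> 0 -> g1 w <> 0 -> F (/ w)%C <> None /\ fv F (/ w)%C = (/ g1 w)%C.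
  move=> hw w0; case: (hR1 (/ w)%C (hinv w R1 R10 hw w0)) => h1 _; rewrite (eg1 w w0) => h2.
  have h3 := sinv_fin _ _ h1 h2; split=> //; have [a1 ea] := fv_sinv _ _ h3 h1; by rewrite /u ea Cinv_inv.
case: (near_dichotomy g1 0 hol1) => [z|[[|m] [v [hv [v0 ev]]]]].
- exfalso; case: (near_and _ _ _ z (near_disc 0 (/ R1) iR)) => r [r0 hr]; have ir := Rinv_0_lt_compat _ r0.
  apply: (nb (RtoC (2 / r))); have c2 : 0 < 2 / r by apply: Rdiv_lt_0_compat; lra.
  have e0 : 0 < / r by []. exists (/ r); split=> // y; rewrite /disc => hy.
  have hy2 : / r < Cmod y.
    have := Cmod_le_add (RtoC (2 / r)) y; rewrite Cmod_pos; last lra.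
    rewrite Cmod_sym in hy; have -> : 2 / r = 2 * / r by []. lra.
  have y0 : y <> 0 by apply/Cmod_gt_0; lra.
  have yi : disc 0 r (/ y)%C.
    rewrite /disc (_ : (/ y - 0)%C = (/ y)%C); last ring.
    by rewrite Cmod_inv // -(Rinv_inv r); apply: Rinv_lt_contravar => //; apply: Rmult_lt_0_compat; lra.
  case: (hr _ yi) => h1 h2; have ny := Cinv_neq0 _ y0; have := hinv _ R1 R10 h2 ny; rewrite Cinv_inv // => /hR1 [h3 _].
  by apply/sinv_zero => //; move: h1; rewrite eg1 // Cinv_inv.
- by case: v0; move: (ev 0); rewrite g10 /= Cmult_1_l.
have vn := Cc_neq _ _ _ (Cdiff_Cc _ _ (hol_at _ _ hv)) v0.
case: (near_and _ _ _ (near_and _ _ _ hv vn) (near_disc 0 (/ R1) iR)) => r [r0 hr].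
pose s k := INR k + 1; pose c k := / s k ^ S m.
have s1 k : 1 <= s k by rewrite /s; have := pos_INR k; lra.
have s0 k : 0 < s k by have := s1 k; lra.
have c0 k : 0 < c k by apply: Rinv_0_lt_compat; exact: pow_lt.
have sn k : RtoC (s k) <> 0 by move/RtoC_inj; have := s0 k; lra.
have cis_ k : c k <= / s k.
  apply: Rinv_le_contravar => //; rewrite -[X in X <= _]pow_1; apply: Rle_pow; [exact: s1|lia].
have big R0 : exists N, forall n, (N <= n)%nat -> R0 < s n.
  case: (INR_unbounded R0) => N hN; exists N => n /le_INR; rewrite /s; lra.
have small eps : 0 < eps -> exists N, forall n, (N <= n)%nat -> / s n <= eps.
  move=> e0; case: (big (/ eps)) => N hN; exists N => n hn; rewrite -(Rinv_inv eps); apply: Rinv_le_contravar; first exact: Rinv_0_lt_compat.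
  by left; exact: hN.
(* With c = s^-(m + 1) this tends to 0: its size is s^(m' + q - (m + 1) dL) and m' + q < dL. In the
   limit it suffices that P[b z^(m + 1)] does not vanish. *)
pose hh k z := (RtoC (c k) ^ dL * RtoC (s k) ^ summ ps * mono (0 + RtoC (s k) * z))%C.
apply: (resc_circles s c hh) => //.
  by move=> eps e0; case: (small eps e0) => N hN; exists N => n hn; exact: Rle_trans (cis_ n) (hN n hn).
move=> z z0; have zp := proj1 (Cmod_gt_0 _) z0.
have far (y : C) : disc z (Cmod z / 2) y -> y <> 0 /\ Cmod z / 2 < Cmod y.
  move=> hy; rewrite /disc Cmod_sym in hy; have := Cmod_le_add z y => h; split; last lra. apply/Cmod_gt_0; lra.
have arg d : 0 < d -> exists N, forall n y, (N <= n)%nat -> disc z (Cmod z / 2) y -> disc 0 d (/ (RtoC (s n) * y))%C.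
  move=> d0; case: (big (2 / (d * Cmod z))) => N hN; exists N => n y hn /far [y0 hy]; rewrite /disc.
  have -> : (/ (RtoC (s n) * y) - 0 = / (RtoC (s n) * y))%C by ring.
  rewrite Cmod_inv; last exact: Cmul_neq0. rewrite Cmod_mult Cmod_pos; last by left.
  have dz : 0 < d * Cmod z by exact: Rmult_lt_0_compat.
  have h1 : 2 < s n * (d * Cmod z) by apply/Rlt_div_l => //; exact: hN.
  have sy : 0 < s n * Cmod y by apply: Rmult_lt_0_compat; [exact: s0|lra].
  apply: (Rmult_lt_reg_r (s n * Cmod y)) => //; rewrite Rinv_l; last lra.
  have := Rmult_lt_compat_l (s n * d) _ _ ltac:(apply: Rmult_lt_0_compat => //; exact: s0) hy; lra.
have lv : lcv (fun n y => v (/ (RtoC (s n) * y)))%C (fun _ => v 0) z.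
  exists (Cmod z / 2); split; first lra. split.
    case: (arg r r0) => N hN; exists N => n hn y hy; case: (hr _ (hN n y hn hy)) => [[hd _] _].
    have [y0 _] := far y hy; have sy : (RtoC (s n) * y)%C <> 0 by exact: Cmul_neq0.
    exact: CD_Cdiff (CD_comp (fun y => / (RtoC (s n) * y))%C v y _ _ (CD_cder _ _ hd) (CD_invf (fun y => RtoC (s n) * y)%C y _ (CD_scal (RtoC (s n)) _ _ _ (CD_id y)) sy)).
  move=> eps e0; case: (Cdiff_Cc _ _ (hol_at _ _ hv) eps e0) => d [d0 hd]; case: (arg d d0) => N hN.
  by exists N => n y hn hy; left; exact: hd _ (hN n y hn hy).
set b := (/ v 0)%C; have b0 : b <> 0 by exact: Cinv_neq0.
pose fs k := resc (RtoC (c k)) 0 (RtoC (s k)) F.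
have [N0 hN0] := arg r r0.
have fform n y : (N0 <= n)%nat -> disc z (Cmod z / 2) y -> fs n y <> None /\ fv (fs n) y = (/ v (/ (RtoC (s n) * y)) * y ^ S m)%C.
  move=> hn hy; have [y0 _] := far y hy; case: (hr _ (hN0 n y hn hy)) => [[_ vn'] hw].
  have sy : (RtoC (s n) * y)%C <> 0 by exact: Cmul_neq0. have w0 := Cinv_neq0 _ sy.
  have gn : g1 (/ (RtoC (s n) * y))%C <> 0 by rewrite ev; apply: Cmul_neq0 => //; apply: Cpow_nz; exact: Csub_neq0.
  case: (fin1 _ hw w0 gn); rewrite Cinv_inv // => h1 h2; split; first by apply/resc_fin; rewrite Cplus_0_l.
  rewrite fv_resc Cplus_0_l h2 ev (_ : (/ (RtoC (s n) * y) - 0 = / (RtoC (s n) * y))%C); last ring.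
  rewrite Cpow_inv // Cpow_mult_l /c RtoC_inv_pos ?RtoC_pow; last exact: pow_lt.
  have k1 := Cpow_nz _ (S m) (sn n); have k2 := Cpow_nz _ (S m) y0; field; by repeat split.
pose G : sphere_fun := fun y => Some (b * y ^ S m)%C.
have lf : lcv (fun n => fv (fs n)) (fv G) z.
  have hp : hol (fun y => y ^ S m)%C z by apply: hol_pow; exact: hol_id.
  apply: lcv_ext (lcv_mult _ _ _ _ _ (lcv_inv _ _ _ lv v0) (lcv_cst _ _ hp)) _ _; last by apply: near_all.
  by exists (Cmod z / 2), N0; split; [lra|move=> n y hn hy; case: (fform n y hn hy) => _ ->].
have hG : scv fs G z.
  left; apply: rcv_of_lcv => //; exists (Cmod z / 2), N0; split; first lra. by move=> n y hn hy; case: (fform n y hn hy).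
have lh : lcv hh (fun _ => RtoC 0) z.
  have hb : Ccv (fun n => RtoC (c n) ^ dL * RtoC (s n) ^ summ ps * RtoC (s n) ^ q)%C 0.
    move=> eps e0; case: (small eps e0) => N hN; exists N => n hn; apply: Rle_trans (hN n hn).
    rewrite (_ : (RtoC (c n) ^ dL * RtoC (s n) ^ summ ps * RtoC (s n) ^ q - 0 = RtoC (c n ^ dL * s n ^ summ ps * s n ^ q))%C); last first.
      by rewrite !RtoC_mult !RtoC_pow; ring.
    have p1 := pow_lt _ dL (c0 n); have p2 := pow_lt _ (summ ps) (s0 n); have p3 := pow_lt _ q (s0 n).
    rewrite Cmod_pos; last by left; apply: Rmult_lt_0_compat => //; exact: Rmult_lt_0_compat.
    rewrite Rmult_assoc -pow_add /c pow_inv -pow_mult.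
    apply: (Rmult_le_reg_l (s n ^ (S m * dL))); first exact: pow_lt.
    rewrite -Rmult_assoc Rinv_r; last by apply: pow_nonzero; have := s0 n; lra.
    rewrite Rmult_1_l (_ : (S m * dL = S (S m * dL - 1))%nat); last by rewrite /dL; lia.
    rewrite [_ ^ S _]/= (_ : s n * s n ^ (S m * dL - 1) * / s n = s n ^ (S m * dL - 1)); last by field; have := s0 n; lra.
    apply: Rle_pow; [exact: s1|rewrite /dL; nia].
  apply: lcv_ext (lcv_mult _ _ _ _ _ (lcv_constants _ _ z hb) (lcv_cst _ _ (hol_mono z))) _ _.
    exists 1, O; split; first lra. by move=> n y _ _; rewrite /hh /mono Cplus_0_l Cpow_mult_l; ring.
  by apply: near_all => y; ring.
have n0 : dmon (fv G) z <> 0 by exact: dmon_power_neq0.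
exact: (dmon_log_lbd _ _ hh (fun _ => RtoC 0) fs G z hG (fun e => ltac:(discriminate e)) lh (hol_id z) (hol_cst _ z) n0).
Qed.

Lemma small_circles : small_on_circles.
Proof.
case: (excluded_middle_informative (exists M, 0 < M /\ forall R0, exists z, R0 <= Cmod z /\ F z <> None /\ Cmod (fv F z) <= M)) => [[M [M0 h]]|h].
  exact: circles_bounded M0 h.
apply: circles_unbounded => M M0; apply: Classical_Prop.NNPP => h2; apply: h; exists M; split=> // R0.
apply: Classical_Prop.NNPP => h3; apply: h2; exists R0 => z hz.
case: (excluded_middle_informative (F z = None)) => [|n]; [by left|right; apply: Rnot_le_lt => hle; apply: h3].
by exists z.
Qed.

(** U = 0 says that T = z^q H has derivative 0 off the origin, so T is a constant k on the connected
    punctured plane. It is not 0, hence F has no poles and P[F] = (a + 1 / k) z^q. *)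
Lemma omitted_monomial_aux z : sharp F z = 0.
Proof.
have hU := U_vanishes small_circles.
pose T z := (z ^ q * dmon_recip mono F z)%C.
have hH y : F y = None \/ y <> 0 -> hol T y.
  move=> hy; have h := dmon_recip_hol mono F y (hm y) (hol_mono y) (nb y) (avoids_off y hy); rewrite /T.
  apply: hol_mult => //; apply: hol_pow; exact: hol_id.
have dfin (y : C) : y <> 0 -> F y <> None -> C_derive T y = 0.
  move=> y0 n; have hr := mero_finite _ _ (hm y) n; have hg := reg_hol _ _ hr; have nn := Csub_neq0 _ _ (ha y y0 n).
  have dH : CD (dmon_recip mono F) y (- (fv F y * dmon_dquo (fv F) y - C_derive mono y) / ((dmon (fv F) y - mono y) * (dmon (fv F) y - mono y))).
    apply: (CD_ext _ _ _ _ (near_mono _ _ _ (fun w e => esym e) (dmon_recip_near _ _ _ hr))).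
    rewrite -cder_dmon //; apply: (CD_invf (fun y => dmon (fv F) y - mono y)%C) => //.
    by apply: CD_minus; apply: CD_cder; apply: hol_at; [exact: hol_dmon|exact: hol_mono].
  have e1 : (y * dmon_dquo (fv F) y = RtoC (INR q) * dmon_quo (fv F) y)%C.
    have := hU y y0; rewrite dmon_log_fin // => e.
    have : (y * dmon_dquo (fv F) y - RtoC (INR q) * dmon_quo (fv F) y)%C = 0.
      apply: Classical_Prop.NNPP => h; exact: (Cmul_neq0 _ _ h (Cinv_neq0 _ nn)).
    move=> h; have -> : (y * dmon_dquo (fv F) y)%C = (y * dmon_dquo (fv F) y - RtoC (INR q) * dmon_quo (fv F) y + RtoC (INR q) * dmon_quo (fv F) y)%C by ring.
    rewrite h; ring.
  have eP := dmon_dmon_quo _ _ hg; have em := mono_euler y.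
  have yq : (y * (RtoC (INR q) * y ^ Nat.pred q) = RtoC (INR q) * y ^ q)%C by case: (q) => [|j]; [rewrite /=; ring|rewrite [Nat.pred _]/= Cpow_S; ring].
  have eT := CD_unique _ _ _ (CD_mult _ _ _ _ _ (CD_pow _ _ _ q (CD_id y)) dH).
  have ez : (y * C_derive T y)%C = 0.
    rewrite /T eT dmon_recip_fin //.
    have -> : (y * (RtoC (INR q) * 1 * y ^ Nat.pred q * / (dmon (fv F) y - mono y) +
       y ^ q * (- (fv F y * dmon_dquo (fv F) y - C_derive mono y) / ((dmon (fv F) y - mono y) * (dmon (fv F) y - mono y)))) =
       (y * (RtoC (INR q) * y ^ Nat.pred q)) * / (dmon (fv F) y - mono y) - y ^ q * (fv F y * (y * dmon_dquo (fv F) y) - y * C_derive mono y) / ((dmon (fv F) y - mono y) * (dmon (fv F) y - mono y)))%C by field.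
    rewrite yq e1 em (_ : (fv F y * (RtoC (INR q) * dmon_quo (fv F) y) = RtoC (INR q) * dmon (fv F) y)%C); last by rewrite eP; ring.
    by field.
  apply: Classical_Prop.NNPP => h; exact: Cmul_neq0 y0 h ez.
have dT (y : C) : y <> 0 -> C_derive T y = 0.
  move=> y0; case: (excluded_middle_informative (F y = None)) => [e|]; last exact: dfin.
  case: (pole_form mono F y (hm y) e (hol_mono y) (nb y)) => s [v [H1 [_ [_ [_ [_ [_ [_ hp]]]]]]]].
  apply: (Cc_eq_at _ (fun _ => RtoC 0) y (Cdiff_Cc _ _ (hol_at _ _ (hol_cder _ _ (hH y (or_intror y0))))) (CD_Cc _ _ _ (CD_const 0 y))).
  by apply: near2 hp (near_neq y 0 y0) => w hw w0 /hw [hf _]; exact: dfin.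
have loc (y : C) : y <> 0 -> near y (fun w => T w = T y).
  move=> y0; have yp := proj1 (Cmod_gt_0 _) y0; exists (Cmod y); split=> // w; apply: cder_zero_disc => x hx.
  have x0 : x <> 0 by move=> e; move: hx; rewrite /disc e Cmod_sym (_ : (y - 0)%C = y); [lra|ring].
  by split; [exact: hol_at _ _ (hH x (or_intror x0))|exact: dT].
have hT (y : C) : y <> 0 -> T y = T 1.
  move=> y0; apply: Classical_Prop.NNPP => ne.
  case: (connected_Cstar (fun w => near w (fun x => T x = T 1)) (fun w => near w (fun x => T x <> T 1)) (near_open_set _) (near_open_set _)).
  - move=> w w0; case: (excluded_middle_informative (T w = T 1)) => [e|n]; [left|right].
      by apply: near_mono (loc w w0) => x ->.
    by apply: near_mono (loc w w0) => x ->.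
  - by exists (RtoC 1); split; [exact: C1_nz|exact: loc _ C1_nz].
  - by exists y; split=> //; apply: near_mono (loc y y0) => x ->.
  - by move=> w [_ [/near_self e /near_self n]].
set k := T 1 in hT; have fin0 (y : C) : y <> 0 -> F y <> None -> T y <> 0.
  by move=> y0 n; rewrite /T dmon_recip_fin //; apply: Cmul_neq0; [exact: Cpow_nz|apply: Cinv_neq0; apply: Csub_neq0; exact: ha].
have k0 : k <> 0.
  move=> e; apply: (nb 1); apply: near_mono (near_neq 1 0 C1_nz) => y y0.
  by apply: Classical_Prop.NNPP => n; apply: (fin0 y y0 n); rewrite hT.
have fin (y : C) : y <> 0 -> F y <> None by move=> y0 e; apply: k0; rewrite -(hT y y0) /T /dmon_recip e; ring.
have eP (y : C) : y <> 0 -> dmon (fv F) y = ((a + / k) * y ^ q)%C.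
  move=> y0; have := hT y y0; rewrite /T dmon_recip_fin; last exact: fin.
  have nn := Csub_neq0 _ _ (ha y y0 (fin y y0)) => e; have -> : dmon (fv F) y = (dmon (fv F) y - mono y + mono y)%C by ring.
  have yq := Cpow_nz _ q y0; have -> : (dmon (fv F) y - mono y = y ^ q / k)%C by rewrite -e; field; split.
  by rewrite /mono; field.
have F0 : F 0 <> None.
  move=> e; apply: k0; have h := hol_at _ _ (hH 0 (or_introl e)).
  have := Cc_eq_at T (fun _ => k) 0 (Cdiff_Cc _ _ h) (CD_Cc _ _ _ (CD_const k 0)) (near_all _ _ hT) => <-.
  by rewrite /T /dmon_recip e; ring.
apply: (dmon_monomial_trivial (a + / k) q F K hq hm hs) => y; apply: near_all => w.
case: (excluded_middle_informative (w = 0)) => [->|w0]; last by split; [exact: fin|exact: eP].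
split=> //; apply: (Cc_eq_at (dmon (fv F)) (fun w => (a + / k) * w ^ q)%C 0).
- exact: Cdiff_Cc _ _ (hol_at _ _ (hol_dmon _ _ (reg_hol _ _ (mero_finite _ _ (hm 0) F0)))).
- by apply: Cdiff_Cc; apply: hol_at; hl.
- by apply: near_all => x; exact: eP.
Qed.

End OmittedMonomial.

Lemma omitted_monomial_trivial (a : C) q F K : a <> 0 -> (q < l0)%nat -> (forall z, mero F z) -> (forall z, sharp F z <= K) ->
  (forall z : C, z <> 0 -> F z <> None -> dmon (fv F) z <> mono a q z) -> forall z, sharp F z = 0.
Proof.
move=> a0 hq hm hs ha.
case: (trichotomy (mono a q) F (fun _ => True) connected_all) => [z _|h|h].
- by split; [exact: hm|exact: hol_mono].
- by move=> z; apply: infinite_near_sharp; exact: h.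
have nb z : ~ infinite_near F z.
  case: h => h; last by apply: (dmon_differs_not_infinite_near (mono a q)); exact: h.
  by move=> /near_self e; have [] := near_self _ _ (h z I).
exact: (omitted_monomial_aux a q F K a0 hq hm hs ha nb).
Qed.

(** * Normality *)

Lemma resc_at_zero (c w s : C) F y : mero (resc c w s F) y -> sharp (resc c (w + s * y) s F) 0 = sharp (resc c w s F) y.
Proof.
move=> hm; have e0 : (y + 1 * 0 = y)%C by ring.
have e : resc c (w + s * y) s F = resc 1 y 1 (resc c w s F) by rewrite resc_resc !Cmult_1_l Cmult_1_r.
case: (sharp_resc 1 y 1 (resc c w s F) 0 1 (Rle_refl 1)); rewrite ?e0 //; first by rewrite Cmod_1; lra.
rewrite e Cmod_1; lra.
Qed.

Lemma zoom_omit q (c : C) h v z0 r F j w y : (forall z, disc z0 r z -> h z = ((z - z0) ^ q * v z)%C) ->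
  (forall z, disc z0 r z -> mero F z) -> (forall z, disc z0 r z -> z <> z0 -> F z <> None -> dmon (fv F) z <> (c * h z)%C) ->
  disc z0 r (w + RtoC (/ 2 ^ (j * dL)) * y)%C -> (w + RtoC (/ 2 ^ (j * dL)) * y)%C <> z0 ->
  zoom (summ ps + q) dL j w F y <> None ->
  dmon (fv (zoom (summ ps + q) dL j w F)) y <>
    (c * (RtoC (2 ^ (j * dL)) * (w - z0) + y) ^ q * v (w + RtoC (/ 2 ^ (j * dL)) * y))%C.
Proof.
move=> hh hm ho hd hn fz; have fz' := proj1 (resc_fin _ _ _ _ _) fz.
rewrite fv_resc dmon_affine; last by apply: reg_hol; apply: mero_finite => //; exact: hm.
rewrite zoom_factor => e; apply: (ho _ hd hn fz'); rewrite hh //.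
set t := RtoC (2 ^ (j * dL)) in e; have tn : t <> 0 by exact: two_pow_neq0.
have es : RtoC (/ 2 ^ (j * dL)) = (/ t)%C by rewrite RtoC_inv_pos //; exact: two_pow_pos.
rewrite es in e *; set x := (w + / t * y)%C in e *.
have ex : (t * (w - z0) + y = t * (x - z0))%C by rewrite /x; field.
have tq := Cpow_nz _ q tn; have e2 : RtoC (2 ^ (j * dL * q)) = (t ^ q)%C by rewrite /t -RtoC_pow pow_mult.
rewrite ex Cpow_mult_l e2 in e; have -> : dmon (fv F) x = (t ^ q * dmon (fv F) x / t ^ q)%C by field.
rewrite e; by field.
Qed.

(** The point z0, where the omission may fail, sits at - bs n in the zoomed picture; translating the
    limit by b moves it to 0, the exceptional point of [omitted_monomial_trivial]. Elsewhere
    [hurwitz_omit] passes the omission to the limit. *)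
Lemma zoom_limit_trivial q (a b : C) (fs : nat -> sphere_fun) (ks : nat -> C -> C) (bs : nat -> C) G K :
  a <> 0 -> (q < l0)%nat -> Ccv bs b -> (forall y, scv fs G y) -> (forall y, sharp G y <= K) ->
  (forall y, lcv ks (fun y => a * (b + y) ^ q)%C y) ->
  (forall y, exists N, forall n z, (N <= n)%nat -> disc y 1 z -> (bs n + z)%C <> 0 -> fs n z <> None -> dmon (fv (fs n)) z <> ks n z) ->
  forall y, sharp G y = 0.
Proof.
move=> a0 hq hb hG hK hk ho; set k := fun y => _ in hk; have gm y : mero G y by exact: scv_mero (hG y).
have hk' y : hol k y by exact: lcv_hol (hk y).
pose F := resc 1 (- b) 1 G; have e1 y : (- b + 1 * y = y - b)%C by ring.
have fm y : mero F y by apply: mero_resc => //; exact: C1_nz.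
have fs_ y : sharp F y <= K.
  case: (sharp_resc 1 (- b) 1 G y 1 (Rle_refl 1)) => //; first by rewrite Cmod_1; lra.
  move=> _; rewrite Cmod_1 !Rmult_1_l => h; exact: Rle_trans h (hK _).
have kF y : k (y - b)%C = mono a q y by rewrite /k /mono (_ : (b + (y - b))%C = y); last ring.
have PF y : F y <> None -> dmon (fv F) y = dmon (fv G) (y - b)%C.
  move=> n; rewrite fv_resc dmon_affine; first by rewrite e1 !Cpow_1_l !Cmult_1_l.
  by apply: reg_hol; apply: mero_finite => //; move: n; exact: (proj1 (resc_fin _ _ _ _ _)).
case: (trichotomy k G (fun _ => True) connected_all) => [y _|h|[h|h]] //.
- by move=> y; apply: infinite_near_sharp; exact: h.
- exfalso; apply: (monomial_not_dmon_agrees a q F K a0 hq fm fs_) => y.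
  have h' : dmon_agrees k G (- b + 1 * y)%C by exact: h.
  apply: near_mono (near_affine _ _ _ _ h') => w; rewrite e1 => [[h1 h2]].
  have fw : F w <> None by apply/resc_fin; rewrite e1.
  by split=> //; rewrite PF // h2 kF.
have hF y : sharp F y = 0.
  apply: (omitted_monomial_trivial a q F K a0 hq fm fs_) => {y} y y0 n; rewrite PF // -kF.
  have nG : G (y - b)%C <> None by have := proj1 (resc_fin _ _ _ _ _) n; rewrite e1.
  have yp := proj1 (Cmod_gt_0 _) y0; have y2 : 0 < Cmod y / 2 by lra.
  case: (hb _ y2) => N1 h1; case: (ho (y - b)%C) => N2 h2.
  have m1 : 0 < Rmin 1 (Cmod y / 2) by apply: Rmin_pos; lra.
  apply: (hurwitz_omit fs ks G k (y - b) _ (N1 + N2) m1) => //; last exact: h.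
  move=> n' z hn' hz; have ml := Rmin_l 1 (Cmod y / 2); have mr := Rmin_r 1 (Cmod y / 2).
  apply: h2; [lia|rewrite /disc in hz *; lra|].
  move=> e; have := h1 n' ltac:(lia); rewrite /disc in hz.
  have := Cmod_triangle (z - (y - b)) (bs n' - b); have -> : (z - (y - b) + (bs n' - b) = bs n' + z - y)%C by ring.
  rewrite e (_ : (0 - y = - y)%C); last ring. rewrite Cmod_opp; lra.
move=> y; have := hF (y + b)%C; rewrite /F.
case: (sharp_resc 1 (- b) 1 G (y + b) 1 (Rle_refl 1)) => //; first by rewrite Cmod_1; lra.
rewrite Cmod_1 (_ : (- b + 1 * (y + b))%C = y); last ring. have := sharp_ge0 G y; lra.
Qed.

(* Zalcman at z0; the ratio (w_k - z0) / s_k is bounded or not, and the second case is excluded by rescaling about z0 instead. *)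
Lemma local_bound_sequence q (c : C) h v z0 r (fs : nat -> sphere_fun) : c <> 0 -> (q < l0)%nat -> 0 < r -> holD z0 r v -> v z0 <> 0 ->
  (forall z, disc z0 r z -> h z = ((z - z0) ^ q * v z)%C) ->
  (forall n z, disc z0 r z -> mero (fs n) z) ->
  (forall n z, disc z0 r z -> z <> z0 -> fs n z <> None -> dmon (fv (fs n)) z <> (c * h z)%C) ->
  ~ (forall M eps N, 0 < eps -> exists n z, (N <= n)%nat /\ Cmod (z - z0) < eps /\ M <= sharp (fs n) z).
Proof.
move=> c0 hq r0 hv v0 hh hm ho hbad.
set be := (summ ps + q)%nat; have hb : (be < dL)%nat by rewrite /be /dL; lia.
have L0 : (0 < dL)%nat by lia.
case: (zalcman be dL fs z0 r 0 hb r0) => [n y _|//|i [j [w [G [_ [hj [hw [hw1 [hG [hK h1]]]]]]]]]]; first exact: hm.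
have a0 : (c * v z0)%C <> 0 by exact: Cmul_neq0.
pose bs k := (RtoC (2 ^ (j k * dL)) * (w k - z0))%C.
have hvl : lcv (fun _ => v) v z0 by apply: lcv_cst; exact: (holD_near_at z0 r v z0 hv (disc_center _ _ r0)).
case: (excluded_middle_informative (exists B, forall N, exists k, (N <= k)%nat /\ Cmod (bs k) <= B)) => [[B hB]|hB].
- have hB' N : exists k, (N < k)%nat /\ Cmod (bs k) <= B by case: (hB (S N)) => k [h2 h3]; exists k.
  pose nx N := proj1_sig (constructive_indefinite_description _ (hB' N)).
  have hnx N : (N < nx N)%nat /\ Cmod (bs (nx N)) <= B by exact: proj2_sig (constructive_indefinite_description _ (hB' N)).
  pose al := fix al n := match n with O => nx O | S n' => nx (al n') end.
  have hal : incr al by move=> n /=; case: (hnx (al n)).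
  have hbl n : Cmod (bs (al n)) <= B by case: n => [|n]; [exact: proj2 (hnx O)|exact: proj2 (hnx (al n))].
  case: (bolzano_weierstrass (fun n => bs (al n)) B hbl) => psi [b [hpsi hbs]].
  set ph := fun n => al (psi n) in hbs; have hph : incr ph by exact: (incr_comp al psi hal hpsi).
  have gp := incr_ge _ hph.
  have hj' n : (n <= j (ph n))%nat by have := hj (ph n); have := gp n; lia.
  have hw' : Ccv (fun n => w (ph n)) z0.
    by move=> eps e0; case: (hw eps e0) => N hN; exists N => n hn; apply: hN; have := gp n; lia.
  have lk y : lcv (fun n y => c * (bs (ph n) + y) ^ q * v (w (ph n) + RtoC (/ 2 ^ (j (ph n) * dL)) * y))%C (fun y => (c * v z0) * (b + y) ^ q)%C y.
    have l1 := lcv_zoom_arg be dL (fun _ => v) v z0 (fun k => k) (fun n => j (ph n)) (fun n => w (ph n)) y hb hvl (fun k => Nat.le_refl k) hj' hw'.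
    have l2 := lcv_pow _ _ _ q (lcv_plus _ _ _ _ _ (lcv_constants _ _ y hbs) (lcv_cst _ y (hol_id y))).
    apply: lcv_ext (lcv_mult _ _ _ _ _ (lcv_scal c _ _ _ l2) l1) _ _; last by apply: near_all => x; ring.
    by exists 1, O; split; [lra|].
  have := zoom_limit_trivial q (c * v z0) b (fun n => zoom be dL (j (ph n)) (w (ph n)) (fs (i (ph n))))
    (fun n y => c * (bs (ph n) + y) ^ q * v (w (ph n) + RtoC (/ 2 ^ (j (ph n) * dL)) * y))%C (fun n => bs (ph n)) G _ a0 hq hbs
    (fun y => scv_subseq _ _ _ ph hph (hG y)) hK lk.
  move=> H; suff /H /(_ 0) : forall y, exists N, forall n z, (N <= n)%nat -> disc y 1 z -> (bs (ph n) + z)%C <> 0 ->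
     zoom be dL (j (ph n)) (w (ph n)) (fs (i (ph n))) z <> None -> dmon (fv (zoom be dL (j (ph n)) (w (ph n)) (fs (i (ph n))))) z <>
     (c * (bs (ph n) + z) ^ q * v (w (ph n) + RtoC (/ 2 ^ (j (ph n) * dL)) * z))%C by lra.
  move=> y; case: (zoom_arg_disc dL z0 (fun n => j (ph n)) (fun n => w (ph n)) y r L0 hj' hw' r0) => N hN.
  exists N => n z hn hz nz fz; apply: (zoom_omit q c h v z0 r) => //; [exact: hm|exact: ho|exact: hN|].
  move=> e; apply: nz; rewrite /bs -e RtoC_inv_pos; last exact: two_pow_pos.
  have := two_pow_neq0 (j (ph n) * dL) => tn; by field.
- have hinf B : exists N, forall k, (N <= k)%nat -> B < Cmod (bs k).
    apply: Classical_Prop.NNPP => h2; apply: hB; exists B => N; apply: Classical_Prop.NNPP => h3; apply: h2; exists N => k hk.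
    by apply: Rnot_le_lt => hle; apply: h3; exists k.
  have b2 : 2 <= 2 ^ dL by rewrite -{1}(pow_1 2); apply: Rle_pow; [lra|lia].
  have dp := two_pow_pos dL.
  have [N1 hN1] := hinf 0; case: (hw (/ 2)) => [|N2 hN2]; first lra.
  set N3 := (N1 + N2)%nat.
  have wz k : (N3 <= k)%nat -> 0 < Cmod (w k - z0) <= / 2.
    move=> hk; split; last by apply: hN2; rewrite /N3 in hk; lia.
    have := hN1 k ltac:(rewrite /N3 in hk; lia); rewrite /bs Cmod_mult; have := Cmod_ge_0 (w k - z0).
    case=> // <-; rewrite Rmult_0_r; lra.
  (* A coarser level j' is chosen so that w_k, seen from z0 at scale 2^-(j' dL), lies at distance
     between 2^-dL and 1; these positions subconverge to some l <> 0, where the omitted function c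
     y^q v z0 is not zero. *)
  have ex k : exists m, (N3 <= k)%nat -> (2 ^ dL) ^ m <= / Cmod (w k - z0) < (2 ^ dL) ^ S m.
    case: (Compare_dec.le_lt_dec N3 k) => hk; last by exists O; lia.
    case: (wz k hk) => p1 p2; case: (pow_bracket (2 ^ dL) (/ Cmod (w k - z0)) b2) => [|m hm']; last by exists m.
    by rewrite -Rinv_1; apply: Rinv_le_contravar; lra.
  pose j' k := proj1_sig (constructive_indefinite_description _ (ex k)).
  have hj' k : (N3 <= k)%nat -> (2 ^ dL) ^ j' k <= / Cmod (w k - z0) < (2 ^ dL) ^ S (j' k).
    exact: (proj2_sig (constructive_indefinite_description _ (ex k))).
  have ej m : (2 ^ dL) ^ m = 2 ^ (m * dL) by rewrite -pow_mult Nat.mul_comm.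
  pose p k := (RtoC (2 ^ (j' k * dL)) * (w k - z0))%C.
  have pw k : (z0 + RtoC (/ 2 ^ (j' k * dL)) * p k = w k)%C.
    rewrite /p RtoC_inv_pos; last exact: two_pow_pos. have := two_pow_neq0 (j' k * dL) => tn; by field.
  have hp k : (N3 <= k)%nat -> / 2 ^ dL <= Cmod (p k) <= 1.
    move=> hk; case: (wz k hk) => p1 _; case: (hj' k hk) => q1 q2; rewrite /p Cmod_mult Cmod_pos; last by left; exact: two_pow_pos.
    rewrite ej in q1; rewrite [_ ^ S _]/= ej in q2; split.
      apply: (Rmult_le_reg_l (2 ^ dL)) => //; rewrite Rinv_r; last lra.
      have := Rmult_lt_compat_r _ _ _ p1 q2; rewrite Rinv_l; lra.
    have := Rmult_le_compat_r _ _ _ (Rlt_le _ _ p1) q1; rewrite Rinv_l; lra.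
  case: (bolzano_weierstrass (fun k => p (N3 + k)%nat) 1) => [k|psi [l [hpsi hl]]]; first by case: (hp (N3 + k)%nat ltac:(lia)).
  have lp : / 2 ^ dL / 2 <= Cmod l.
    have i1 : 0 < / 2 ^ dL / 2 by have := Rinv_0_lt_compat _ dp; lra.
    case: (hl _ i1) => N hN; have := hN N (Nat.le_refl N); case: (hp (N3 + psi N)%nat ltac:(lia)) => q1 _.
    have := Cmod_le_add (p (N3 + psi N)%nat) l; lra.
  have l0' : 0 < Cmod l by have := Rinv_0_lt_compat _ dp; lra.
  have ln0 : l <> 0 by apply/Cmod_gt_0.
  pose ph n := (N3 + psi n)%nat; have gp n : (n <= ph n)%nat by have := incr_ge _ hpsi n; rewrite /ph; lia.
  have sinf (R0 : R) : exists N, forall n, (N <= n)%nat -> R0 < 2 ^ (j' (ph n) * dL).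
    case: (hw (/ (2 ^ dL * (Rabs R0 + 1)))) => [|N hN].
      by apply: Rinv_0_lt_compat; apply: Rmult_lt_0_compat => //; have := Rabs_pos R0; lra.
    exists N => n hn; have hn' : (N3 <= ph n)%nat by rewrite /ph; lia. case: (wz (ph n) hn') => p1 _.
    have := hN (ph n) ltac:(have := gp n; lia) => q1; case: (hj' (ph n) hn') => _; rewrite [_ ^ S _]/= ej => q2.
    have q3 : 2 ^ dL * (Rabs R0 + 1) <= / Cmod (w (ph n) - z0).
      by rewrite -(Rinv_inv (2 ^ dL * (Rabs R0 + 1))); apply: Rinv_le_contravar.
    have := Rle_abs R0; nra.
  pose gs n := zoom be dL (j' (ph n)) z0 (fs (i (ph n))).
  have argd d : 0 < d -> exists N, forall n y, (N <= n)%nat -> disc l (Cmod l) y -> disc z0 d (z0 + RtoC (/ 2 ^ (j' (ph n) * dL)) * y)%C.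
    move=> d0; case: (sinf (2 * Cmod l / d)) => N hN; exists N => n y hn hy; rewrite /disc.
    have -> : (z0 + RtoC (/ 2 ^ (j' (ph n) * dL)) * y - z0 = RtoC (/ 2 ^ (j' (ph n) * dL)) * y)%C by ring.
    have tp := two_pow_pos (j' (ph n) * dL); rewrite Cmod_mult Cmod_pos; last by left; exact: Rinv_0_lt_compat.
    have := hN n hn => /(Rlt_div_l _ _ _ d0) h2; rewrite /disc in hy; have := Cmod_triangle l (y - l).
    have -> : (l + (y - l) = y)%C by ring. move=> h3.
    apply: (Rmult_lt_reg_l (2 ^ (j' (ph n) * dL))) => //; rewrite -Rmult_assoc Rinv_r; lra.
  case: (argd r r0) => N4 hN4.
  have lks : lcv (fun n y => c * y ^ q * v (z0 + RtoC (/ 2 ^ (j' (ph n) * dL)) * y))%C (fun y => c * y ^ q * v z0)%C l.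
    apply: lcv_mult; first by apply: lcv_cst; hl.
    exists (Cmod l); split=> //; split.
      exists N4 => n hn y hy; exact: CD_Cdiff (CD_affine _ _ _ _ _ (CD_cder _ _ (hv _ (hN4 n y hn hy)))).
    move=> eps e0; case: (lcv_eval _ _ _ _ hvl e0) => d [N5 [d0 h5]]; case: (argd d d0) => N6 h6.
    by exists (N5 + N6)%nat => n y hn hy; apply: (h5 n); [lia|apply: h6 => //; lia].
  have ln1 : (c * l ^ q * v z0)%C <> 0 by apply: Cmul_neq0 => //; apply: Cmul_neq0 => //; exact: Cpow_nz.
  case: (omit_limit_bounded gs _ (fun y => c * y ^ q * v z0)%C l (Cmod l) N4 l0' ln1 lks) => [n y hn hy|M [eps [N5 [e0 h5]]]].
    have hd := hN4 n y hn hy; split; first by apply: mero_resc; [exact: two_pow_neq0|exact: hm].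
    move=> fy; have := zoom_omit q c h v z0 r (fs (i (ph n))) (j' (ph n)) z0 y hh (hm _) (ho _) hd.
    have -> : (RtoC (2 ^ (j' (ph n) * dL)) * (z0 - z0) + y = y)%C by ring. apply=> // e.
    have y0 : y <> 0 by move=> e2; move: hy; rewrite e2 /disc Cmod_sym (_ : (l - 0)%C = l); [lra|ring].
    have tn : RtoC (/ 2 ^ (j' (ph n) * dL)) <> 0 by move/RtoC_inj; have := Rinv_0_lt_compat _ (two_pow_pos (j' (ph n) * dL)); lra.
    apply: (Cmul_neq0 _ _ tn y0); have -> : (RtoC (/ 2 ^ (j' (ph n) * dL)) * y = z0 + RtoC (/ 2 ^ (j' (ph n) * dL)) * y - z0)%C by ring.
    rewrite e; ring.
  set M' := Rmax 1 M; have M1 : 1 <= M' by exact: Rmax_l. have M2 : M <= M' by exact: Rmax_r.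
  have e2 : 0 < eps / 2 by lra.
  (* Near l the zooms at level j' have derivative below M, at level j it is at least 1, and each
     level halves it: so 2^(j - j') <= M' and |bs| <= M'^dL, whereas |bs| tends to infinity. *)
  case: (hinf (M' ^ dL)) => N6 h6; case: (hl _ e2) => N7 h7; case: (hw (r / 2)) => [|N8 h8]; first lra.
  set n := (N5 + N6 + N7 + N8)%nat; have gn := gp n.
  have hwr : disc z0 r (w (ph n)) by have := h8 (ph n) ltac:(rewrite /n in gn *; lia); rewrite /disc; lra.
  have := h6 (ph n) ltac:(rewrite /n in gn *; lia); have [q1 q2] := hp (ph n) ltac:(rewrite /ph; lia).
  have hsh : sharp (zoom be dL (j' (ph n)) (w (ph n)) (fs (i (ph n)))) 0 < M.
    rewrite -{1}(pw (ph n)) /zoom resc_at_zero; first by apply: (h5 n); [rewrite /n; lia|have := h7 n ltac:(rewrite /n; lia); rewrite /ph; lra].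
    apply: mero_resc; first exact: two_pow_neq0. rewrite pw; exact: hm.
  have md : mero (fs (i (ph n))) (w (ph n)) by apply: hm; exact: hwr.
  have eb k : (k <= j (ph n))%nat -> Cmod (bs (ph n)) = 2 ^ ((j (ph n) - k) * dL) * (2 ^ (k * dL) * Cmod (w (ph n) - z0)).
    move=> hk; rewrite /bs Cmod_mult Cmod_pos; last by left; exact: two_pow_pos.
    rewrite -Rmult_assoc -pow_add; congr (2 ^ _ * _); nia.
  have Md : 1 <= M' ^ dL by exact: pow_R1_Rle.
  have ep : Cmod (p (ph n)) = 2 ^ (j' (ph n) * dL) * Cmod (w (ph n) - z0) by rewrite /p Cmod_mult Cmod_pos //; left; exact: two_pow_pos.
  case: (Compare_dec.le_lt_dec (j' (ph n)) (j (ph n))) => hjj hB6; last first.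
    have h9 : Cmod (bs (ph n)) <= Cmod (p (ph n)).
      rewrite ep /bs Cmod_mult Cmod_pos; last by left; exact: two_pow_pos.
      apply: Rmult_le_compat_r; first exact: Cmod_ge_0. apply: Rle_pow; [lra|nia].
    lra.
  rewrite (eb _ hjj) -ep in hB6; set d := (j (ph n) - j' (ph n))%nat in hB6.
  have := zoom_decay be dL (j' (ph n)) d _ _ hb md; rewrite (_ : (d + j' (ph n) = j (ph n))%nat); last by rewrite /d; lia.
  have := hw1 (ph n) => h9 h10; have pd := two_pow_pos d; have d1 : 2 ^ d <= M'.
    have := Rmult_le_compat_l _ _ _ (Rlt_le _ _ pd) (Rle_trans _ _ _ h9 h10); rewrite -Rmult_assoc Rinv_r; lra.
  have : 2 ^ (d * dL) <= M' ^ dL by rewrite pow_mult; apply: pow_incr; lra.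
  have := two_pow_pos (d * dL); nra.
Qed.

Lemma family_local_bound q h v z0 r (Fam : sphere_fun -> Prop) (c : C) : c <> 0 -> (q < l0)%nat -> 0 < r -> holD z0 r v -> v z0 <> 0 ->
  (forall z, disc z0 r z -> h z = ((z - z0) ^ q * v z)%C) ->
  (forall f z, Fam f -> disc z0 r z -> mero f z) ->
  (forall f z, Fam f -> disc z0 r z -> z <> z0 -> f z <> None -> dmon (fv f) z <> (c * h z)%C) ->
  exists M eps, 0 < eps /\ forall f z, Fam f -> disc z0 eps z -> mero f z /\ sharp f z <= M.
Proof.
move=> c0 hq r0 hv v0 hh hm ho; apply: Classical_Prop.NNPP => hn.
have ex n : exists x : sphere_fun * C, Fam (fst x) /\ Cmod (snd x - z0) < Rmin r (/ (INR n + 1)) /\ INR n <= sharp (fst x) (snd x).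
  apply: Classical_Prop.NNPP => h2; apply: hn; exists (INR n), (Rmin r (/ (INR n + 1))); split.
    by apply: Rmin_pos => //; apply: Rinv_0_lt_compat; have := pos_INR n; lra.
  have m1 := Rmin_l r (/ (INR n + 1)); move=> f z hf hz; split; first by apply: hm => //; rewrite /disc in hz *; lra.
  by apply: Rnot_lt_le => hlt; apply: h2; exists (f, z); split=> //; split=> //=; lra.
pose x n := proj1_sig (constructive_indefinite_description _ (ex n)).
have hx n : Fam (fst (x n)) /\ Cmod (snd (x n) - z0) < Rmin r (/ (INR n + 1)) /\ INR n <= sharp (fst (x n)) (snd (x n)).
  exact: proj2_sig (constructive_indefinite_description _ (ex n)).
apply: (local_bound_sequence q c h v z0 r (fun n => fst (x n))) => //.
- by move=> n z hz; apply: hm => //; case: (hx n).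
- by move=> n z hz; apply: ho => //; case: (hx n).
move=> M eps N e0; case: (INR_unbounded (Rabs M + / eps)) => n1 h1; exists (N + n1)%nat, (snd (x (N + n1)%nat)).
case: (hx (N + n1)%nat) => _ [h2 h3]; split; first lia.
have h4 : INR n1 <= INR (N + n1) by apply: le_INR; lia.
have ie := Rinv_0_lt_compat _ e0; have := Rle_abs M; have := Rabs_pos M => a1 a2; split; last lra.
apply: Rlt_le_trans h2 _; apply: Rle_trans (Rmin_r _ _) _; rewrite -(Rinv_inv eps); apply: Rinv_le_contravar; lra.
Qed.

(* If P[f] = h accumulates at z0 for one f, then for all, and P[f] = h <> 2 h off z0; otherwise P[f] <> h off z0. *)
Lemma family_omits q h v z0 r (Fam : sphere_fun -> Prop) : 0 < r -> holD z0 r v -> v z0 <> 0 ->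
  (forall z, disc z0 r z -> h z = ((z - z0) ^ q * v z)%C) ->
  (forall f, Fam f -> mero f z0) ->
  (forall f g z, Fam f -> Fam g -> disc z0 r z -> f z <> None /\ dmon (fv f) z = h z -> g z <> None /\ dmon (fv g) z = h z) ->
  exists (c : C) r', c <> 0 /\ 0 < r' <= r /\
    forall f z, Fam f -> disc z0 r' z -> z <> z0 -> f z <> None -> dmon (fv f) z <> (c * h z)%C.
Proof.
move=> r0 hv v0 hh hm hE; case: (excluded_middle_informative (exists f, Fam f)) => [[f hf]|nf]; last first.
  exists (RtoC 1), r; split; first exact: C1_nz. split; first lra. by move=> f z hf; case: nf; exists f.
have hh0 : hol h z0.
  apply: (hol_ext (fun z => (z - z0) ^ q * v z)%C); first by apply: near_mono (near_disc z0 r r0) => z hz; rewrite hh.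
  have hvh := holD_near_at z0 r v z0 hv (disc_center _ _ r0); by apply: hol_mult => //; hl.
have from1 : near z0 (fun z => z <> z0 -> ~ (f z <> None /\ dmon (fv f) z = h z)) ->
  exists (c : C) r', c <> 0 /\ 0 < r' <= r /\
    forall f z, Fam f -> disc z0 r' z -> z <> z0 -> f z <> None -> dmon (fv f) z <> (c * h z)%C.
  move=> [d [d0 hd]]; exists (RtoC 1), (Rmin r d); have m1 := Rmin_l r d; have m2 := Rmin_r r d.
  split; first exact: C1_nz. split; first by split=> //; exact: Rmin_pos.
  move=> g z hg hz nz gz; rewrite Cmult_1_l => e; apply: (hd z _ nz); first by rewrite /disc in hz *; lra.
  by apply: (hE g f z hg hf) => //; rewrite /disc in hz *; lra.
case: (trichotomy_at h f z0 (hm f hf) hh0) => [hB|[hB|[_ [_ hG]]]].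
- by apply: from1; apply: near_mono hB => z e _ [].
- have vn := Cc_neq _ _ _ (Cdiff_Cc _ _ (hv z0 (disc_center _ _ r0))) v0.
  case: (near_and _ _ _ hB vn) => d [d0 hd]; exists (RtoC 2), (Rmin r d); have m1 := Rmin_l r d; have m2 := Rmin_r r d.
  split; first by move/RtoC_inj; lra. split; first by split=> //; exact: Rmin_pos.
  move=> g z hg hz nz gz; have hzr : disc z0 r z by rewrite /disc in hz *; lra.
  case: (hd z) => [|hz1 vz]; first by rewrite /disc in hz *; lra.
  case: (hE f g z hf hg hzr hz1) => _ -> e; have hz0 : h z <> 0.
    by rewrite hh //; apply: Cmul_neq0 => //; apply: Cpow_nz; exact: Csub_neq0.
  apply: hz0; have -> : h z = (2 * h z - h z)%C by ring. rewrite -e; ring.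
- by apply: from1; apply: near_mono hG => z h1 nz [fz e]; case: (h1 nz).
Qed.

End DifferentialMonomial.

(** * From the definitions of the statement to germs *)

Lemma deriv_tower_cdn (D : C -> Prop) g d : open_set D -> deriv_tower D g d -> forall n z, D z -> d n z = cdn n g z.
Proof.
move=> hD [h0 hS]; elim=> [|n IH] z Dz; first exact: h0.
case: (hD z Dz) => r [r0 hr]; symmetry; apply: CD_unique; apply: (CD_ext (d n)); last exact: hS.
by exists r; split=> // w /hr; exact: IH.
Qed.

Lemma disc_open z r : open_set (disc z r).
Proof. move=> w hw; exact: near_open hw. Qed.

Definition pairs (k : nat) (l m : nat -> nat) : list (nat * nat) := map (fun i => (l i, m i)) (seq 1 k).

Lemma dprod_pairs k l m g z : dprod (pairs k l m) g z = Cprod1 k (fun i => cdn (m i) (fun y => g y ^ l i)%C z).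
Proof. by rewrite /dprod /pprod /Cprod1 /pairs map_map. Qed.

(** A tower of derivatives is determined by its function on an open set, so any witness agrees with
    [cdn]; conversely [cdn] of the powers provides a witness. *)
Lemma P_value_dmon l0 k l m f z w : mero f z ->
  P_value l0 k l m f z w <-> f z <> None /\ w = dmon l0 (pairs k l m) (fv f) z.
Proof.
move=> hm; split.
- move=> [r [g [d [r0 [hg [ef [hd ->]]]]]]]; have zz := disc_center z r r0; rewrite ef //; split=> //.
  have e : near z (fun y => g y = fv f y) by exists r; split=> // y hy; rewrite /fv ef.
  have hgz : hol g z by exists r; split.
  rewrite -(near_self _ _ (dmon_ext l0 (pairs k l m) g (fv f) z e hgz)) /dmon dprod_pairs; congr (_ * _)%C.
  congr Cprod1; apply: FunctionalExtensionality.functional_extensionality => i.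
  exact: deriv_tower_cdn (disc_open z r) (hd i) _ _ zz.
- move=> [n ->]; case: (mero_finite _ _ hm n) => r [r0 hr].
  exists r, (fv f), (fun i n => cdn n (fun y => fv f y ^ l i)%C); split=> //.
  split; first by move=> y /hr [].
  split; first by move=> y /hr [h _]; exact: some_fv.
  split; last by rewrite /dmon dprod_pairs.
  move=> i; split=> // n' y hy; have h : hol (fv f) y by apply: near_mono (near_open _ _ _ hy) => v /hr [].
  exact: CD_cder (hol_at _ _ (hol_cdn n' _ _ (hol_pow _ _ (l i) h))).
Qed.

Lemma suml_pairs k l m : suml (pairs k l m) = sum1 k l.
Proof. by rewrite /suml /sum1 /pairs map_map. Qed.

Lemma summ_pairs k l m : summ (pairs k l m) = sum1 k m.
Proof. by rewrite /summ /sum1 /pairs map_map. Qed.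

Lemma okl_pairs k l m : (forall i, (1 <= i <= k)%nat -> (m i <= l i)%nat) -> okl (pairs k l m).
Proof. by move=> h p /in_map_iff [i [<- /in_seq hi]]; apply: h; lia. Qed.

(** Marty gives a subsequence converging in one chart near each point; chordal closeness near points
    becomes uniform on compact sets by [compact_uniform]. *)
Lemma local_bound_normal (D : C -> Prop) (Fam : sphere_fun -> Prop) :
  (forall z0, D z0 -> exists M eps, 0 < eps /\ forall f z, Fam f -> disc z0 eps z -> mero f z /\ sharp f z <= M) -> normal_family D Fam.
Proof.
move=> hb fs hfs; case: (marty fs D) => [z Dz|phi [F [hphi hF]]].
  case: (hb z Dz) => M [eps [e0 h]]; exists eps, O, M; split=> // n y _ hy; exact: h.
exists phi, F; split=> // K [KD [[M hM] hcl]] eps e0.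
case: (compact_uniform K M (fun N y => forall n, (N <= n)%nat -> chordal (fs (phi n) y) (F y) < eps) hM hcl) => [N N' y hN h n hn|y Ky|N hN].
- by apply: h; lia.
- exact: scv_chordal _ _ _ _ (hF y (KD y Ky)) e0.
- by exists N => n z hn Kz; exact: hN.
Qed.

Theorem theorem1p3 (k l0 : nat) (l m : nat -> nat)
    (D : C -> Prop) (Fam : sphere_fun -> Prop) (h : C -> C) :
  (1 <= k)%nat ->
  (0 < l0)%nat ->
  (forall i, (1 <= i <= k)%nat -> (m i <= l i)%nat) ->
  (0 < sum1 k m)%nat ->
  (sum1 k m < sum1 k l)%nat ->
  is_domain D ->
  (forall f, Fam f -> meromorphic_on D f /\ nonconstant_on D f) ->
  (forall f z0, Fam f -> D z0 -> f z0 = None -> pole_mult_ge f z0 l0) ->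
  holomorphic_on D h ->
  (exists z, D z /\ h z <> 0%C) ->
  (forall z0, D z0 -> h z0 = 0%C -> zero_mult_le h z0 (l0 - 1)) ->
  (forall f g, Fam f -> Fam g -> share_IM_P l0 k l m D f g h) ->
  normal_family D Fam.
Proof.
move=> _ hl0 hlm hm0 hml [hD _] hF _ hh _ hz hshare.
have hmero f z (Ff : Fam f) : D z -> mero f z by apply: meromorphic_mero; case: (hF f Ff).
apply: local_bound_normal => z0 D0; set ps := pairs k l m.
have hok : okl ps by exact: okl_pairs.
have hm0' : (0 < summ ps)%nat by rewrite /ps summ_pairs.
have hml' : (summ ps < suml ps)%nat by rewrite /ps summ_pairs suml_pairs.
case: (hD z0 D0) => r1 [r10 hr1].
(* At a zero of h the multiplicity hypothesis gives q <= l0 - 1; elsewhere q = 0 with v = h. *)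
have [q [r [v [hq [r0 [rD [hv [v0 ehv]]]]]]]] : exists q r v, (q < l0)%nat /\ 0 < r /\ (forall z, disc z0 r z -> D z) /\
  holD z0 r v /\ v z0 <> 0 /\ forall z, disc z0 r z -> h z = ((z - z0) ^ q * v z)%C.
  case: (excluded_middle_informative (h z0 = 0)) => [e|n].
    case: (hz z0 D0 e) => q [r [v [hq [r0 [hv [v0 ev]]]]]]; exists q, (Rmin r r1), v.
    have m1 := Rmin_l r r1; have m2 := Rmin_r r r1; split; first lia. split; first exact: Rmin_pos.
    split; first by move=> z hz'; apply: hr1; rewrite /disc in hz' *; lra.
    split; first by move=> z hz'; apply: hv; rewrite /disc in hz' *; lra.
    by split=> // z hz'; apply: ev; rewrite /disc in hz' *; lra.
  exists O, r1, h; split=> //; split=> //; split=> //; split; first by move=> z /hr1; exact: hh.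
  by split=> // z _ /=; ring.
have hE f g z : Fam f -> Fam g -> disc z0 r z -> f z <> None /\ dmon l0 ps (fv f) z = h z -> g z <> None /\ dmon l0 ps (fv g) z = h z.
  move=> Ff Fg hz' [fz e]; have Dz := rD z hz'; have [s1 _] := hshare f g Ff Fg z Dz.
  by case: (proj1 (P_value_dmon l0 k l m g z (h z) (hmero g z Fg Dz)) (s1 (proj2 (P_value_dmon l0 k l m f z (h z) (hmero f z Ff Dz)) (conj fz (esym e))))).
case: (family_omits l0 ps hl0 hok hm0' hml' q h v z0 r Fam r0 hv v0 ehv) => // [f Ff|c [r' [c0 [[r'0 r'r] ho]]]]; first exact: hmero.
have sub z : disc z0 r' z -> disc z0 r z by rewrite /disc; lra.
apply: (family_local_bound l0 ps hl0 hok hm0' hml' q h v z0 r' Fam c) => //.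
- by move=> z /sub; exact: hv.
- by move=> z /sub; exact: ehv.
- by move=> f z Ff /sub /rD; exact: hmero.
Qed.
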